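(* Let $M=\Gamma\backslash G$ be the three-dimensional Heisenberg manifold with parameters $A,r,w_2>0$, $m_v\in\mathbb{Z}_{>0}$, $m_w\in\mathbb{Z}$, with spin structure determined by $\varepsilon=(\varepsilon_1,\varepsilon_2,\varepsilon_3)\in\{\pm1\}^3$ (where $\varepsilon_3=1$ if $m_v$ is odd). The spectrum of the spin Dirac operator $D$, with multiplicities, is the union of the following two families. (i) If $\varepsilon_3=1$: for each $(j_1,j_2)\in\mathbb{Z}^2$, put $$\alpha_1=\frac{w_2}{rm_v}\left(j_1+\frac{1-\varepsilon_1}{4}\right),\qquad \alpha_2=\frac1{w_2}\left[\left(j_2+\frac{1-\varepsilon_2}{4}\right)-\frac{m_w}{m_v}\left(j_1+\frac{1-\varepsilon_1}{4}\right)\right];$$ the pair contributes the two eigenvalues $-\frac1{4A}\pm2\pi\sqrt{\frac{\alpha_1^2+\alpha_2^2}{A}}$, each with multiplicity one (so if $\alpha_1=\alpha_2=0$ it contributes $-\frac1{4A}$ with multiplicity two). If $\varepsilon_3=-1$ this family is empty. (ii) For each $\kappa\in\mathbb{Z}$ with $\mu=\kappa+\frac{1-\varepsilon_3}{4}\neq0$: the eigenvalues $$-\frac1{4A}-\frac{2\pi}{r}|\mu|\quad\text{and}\quad-\frac1{4A}\pm2\sqrt{\frac{\pi p}{rA}|\mu|+\frac{\pi^2}{r^2}\mu^2}\quad(p\in\mathbb{Z}_{>0}),$$ each occurring with multiplicity $m_v|\mu|$.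
   Context: $G$ is the three-dimensional Heisenberg group, i.e. $\mathbb{R}^3$ with product $(x,y,z)(x',y',z')=(x+x',y+y',z+z'+xy')$, with left-invariant fields $X,Y,Z$ satisfying $[X,Y]=Z$ (and $\exp(xX+yY+zZ)=(x,y,z+\tfrac12xy)$). The left-invariant metric is the one for which $\{\frac1{\sqrt A}X,\frac1{\sqrt A}Y,Z\}$ is orthonormal. The lattice is $\Gamma=\{(h_1v+h_2w,\,hr):h_1,h_2,h\in\mathbb{Z}\}$ with $v=\left(\frac{rm_v}{w_2},0\right)$, $w=\left(\frac{rm_w}{w_2},w_2\right)$. Spin structures correspond to homomorphisms $\varepsilon:\Gamma\to\{\pm1\}$, recorded by $\varepsilon_1=\varepsilon(v,0)$, $\varepsilon_2=\varepsilon(w,0)$, $\varepsilon_3=\varepsilon(0,0,r)$; the only constraint is $\varepsilon_3^{m_v}=1$. Spinors are functions $f:G\to\mathbb{C}^2$ with $f(\gamma x)=\varepsilon(\gamma)f(x)$, and with $E_1=\frac{X}{\sqrt A},E_2=\frac Y{\sqrt A},E_3=Z$ the Dirac operator is $D=\sum_{i=1}^3(E_i\diamond)\partial_{E_i}-\frac1{4A}$, where Clifford multiplication satisfies $v\diamond v\diamond=-|v|^2$ and $(E_3\diamond E_1\diamond E_2\diamond)=-\mathbf1$. *)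

(* Defs.v *)
(* Stdlib reals, with Coquelicot for derivatives, integrals and complex numbers. *)
From Stdlib Require Import Reals ZArith List.
From Coquelicot Require Import Coquelicot.
Open Scope R_scope.

(** * The Heisenberg group *)

Definition G : Type := (R * R * R)%type.

Definition gmul (g h : G) : G :=
  let '(x, y, z) := g in
  let '(x', y', z') := h in
  (x + x', y + y', z + z' + x * y').

(* [(a, b, c) : lie] stands for the Lie algebra element aX + bY + cZ. *)
Definition lie : Type := (R * R * R)%type.

Definition lie_add (u v : lie) : lie :=
  let '(a, b, c) := u in
  let '(a', b', c') := v in
  (a + a', b + b', c + c').

Definition lie_scal (t : R) (u : lie) : lie :=
  let '(a, b, c) := u in (t * a, t * b, t * c).

Definition gexp (u : lie) : G :=
  let '(a, b, c) := u in (a, b, c + a * b / 2).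

(* |u|^2 for the metric in which X/sqrt A, Y/sqrt A, Z are orthonormal. *)
Definition metric_sq (A : R) (u : lie) : R :=
  let '(a, b, c) := u in A * a ^ 2 + A * b ^ 2 + c ^ 2.

Definition E1 (A : R) : lie := (1 / sqrt A, 0, 0).
Definition E2 (A : R) : lie := (0, 1 / sqrt A, 0).
Definition E3 : lie := (0, 0, 1).

(** * The lattice and its characters *)

Definition vec_v (r w2 : R) (mv : Z) : R * R := (r * IZR mv / w2, 0).
Definition vec_w (r w2 : R) (mw : Z) : R * R := (r * IZR mw / w2, w2).

Definition in_Gamma (r w2 : R) (mv mw : Z) (g : G) : Prop :=
  exists h1 h2 h : Z,
    g = (IZR h1 * fst (vec_v r w2 mv) + IZR h2 * fst (vec_w r w2 mw),
         IZR h1 * snd (vec_v r w2 mv) + IZR h2 * snd (vec_w r w2 mw),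
         IZR h * r).

(* Homomorphisms Gamma -> {1, -1}; the values of [eps] outside Gamma are
   irrelevant. *)
Definition is_character (r w2 : R) (mv mw : Z) (eps : G -> R) : Prop :=
  (forall g, in_Gamma r w2 mv mw g -> eps g = 1 \/ eps g = -1) /\
  (forall g h, in_Gamma r w2 mv mw g -> in_Gamma r w2 mv mw h ->
     eps (gmul g h) = eps g * eps h).

(** * Spinors *)

Definition C2 : Type := (C * C)%type.
Definition c2zero : C2 := (RtoC 0, RtoC 0).
Definition c2add (s t : C2) : C2 :=
  (Cplus (fst s) (fst t), Cplus (snd s) (snd t)).
Definition c2scal (c : C) (s : C2) : C2 :=
  (Cmult c (fst s), Cmult c (snd s)).
Definition c2sub (s t : C2) : C2 := c2add s (c2scal (RtoC (-1)) t).

Definition c2fun : Type := G -> C2.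

Definition part_x (u : G -> R) : G -> R :=
  fun g => let '(x, y, z) := g in Derive (fun t => u (t, y, z)) x.
Definition part_y (u : G -> R) : G -> R :=
  fun g => let '(x, y, z) := g in Derive (fun t => u (x, t, z)) y.
Definition part_z (u : G -> R) : G -> R :=
  fun g => let '(x, y, z) := g in Derive (fun t => u (x, y, t)) z.

Definition has_partials (u : G -> R) : Prop :=
  forall x y z : R,
    ex_derive (fun t => u (t, y, z)) x /\
    ex_derive (fun t => u (x, t, z)) y /\
    ex_derive (fun t => u (x, y, t)) z.

(* [Ck n u]: all partial derivatives of u of order <= n exist and are (jointly)
   continuous. *)
Fixpoint Ck (n : nat) (u : G -> R) : Prop :=
  (forall g : R * R * R, continuous (u : R * R * R -> R) g) /\
  match n with
  | O => True
  | S m => has_partials u /\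
           Ck m (part_x u) /\ Ck m (part_y u) /\ Ck m (part_z u)
  end.

Definition smooth (f : c2fun) : Prop :=
  forall n : nat,
    Ck n (fun g => Re (fst (f g))) /\ Ck n (fun g => Im (fst (f g))) /\
    Ck n (fun g => Re (snd (f g))) /\ Ck n (fun g => Im (snd (f g))).

Definition is_spinor (r w2 : R) (mv mw : Z) (eps : G -> R) (f : c2fun) : Prop :=
  smooth f /\
  forall gamma g, in_Gamma r w2 mv mw gamma ->
    f (gmul gamma g) = c2scal (RtoC (eps gamma)) (f g).

(** * The Dirac operator *)

(* Clifford multiplication [cl u s] of the spinor s by u.  The orientation
   condition is E3 . E1 . E2 . = -1. *)
Definition is_clifford (A : R) (cl : lie -> C2 -> C2) : Prop :=
  (forall u v s, cl (lie_add u v) s = c2add (cl u s) (cl v s)) /\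
  (forall a u s, cl (lie_scal a u) s = c2scal (RtoC a) (cl u s)) /\
  (forall u s t, cl u (c2add s t) = c2add (cl u s) (cl u t)) /\
  (forall u c s, cl u (c2scal c s) = c2scal c (cl u s)) /\
  (forall u s, cl u (cl u s) = c2scal (RtoC (- metric_sq A u)) s) /\
  (forall s, cl E3 (cl (E1 A) (cl (E2 A) s)) = c2scal (RtoC (-1)) s).

Definition Cderive (c : R -> C) (t : R) : C :=
  (Derive (fun s => Re (c s)) t, Derive (fun s => Im (c s)) t).

(* The derivative of f along the left-invariant vector field u. *)
Definition lderive (u : lie) (f : c2fun) : c2fun :=
  fun g =>
    (Cderive (fun t => fst (f (gmul g (gexp (lie_scal t u))))) 0,
     Cderive (fun t => snd (f (gmul g (gexp (lie_scal t u))))) 0).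

Definition dirac (A : R) (cl : lie -> C2 -> C2) (f : c2fun) : c2fun :=
  fun g =>
    c2add (c2add (c2add (cl (E1 A) (lderive (E1 A) f g))
                        (cl (E2 A) (lderive (E2 A) f g)))
                 (cl E3 (lderive E3 f g)))
          (c2scal (RtoC (- (1 / (4 * A)))) (f g)).

Definition dirac_minus (A : R) (cl : lie -> C2 -> C2) (lambda : C) (f : c2fun)
  : c2fun := fun g => c2sub (dirac A cl f g) (c2scal lambda (f g)).

(** * The spectrum *)

(* The L^2 norm over M = Gamma\G.  The box
   [0, r mv / w2] x [0, w2] x [0, r] is a fundamental domain of Gamma, and the
   Riemannian volume is A dx dy dz. *)
Definition l2norm (A r w2 : R) (mv : Z) (f : c2fun) : R :=
  sqrt (A * RInt (fun x => RInt (fun y => RInt (fun z =>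
          Cmod (fst (f (x, y, z))) ^ 2 + Cmod (snd (f (x, y, z))) ^ 2)
        0 r) 0 w2) 0 (r * IZR mv / w2)).

(* D is regarded as a densely defined operator of L^2 with domain the smooth
   spinors, and lambda is in its resolvent set when D - lambda has a bounded
   inverse defined on a dense subspace; this is unchanged on passing to the
   closure of D.  Smooth spinors being dense in L^2, the range is dense in L^2
   iff every smooth spinor is an L^2-limit of elements of the range. *)
Definition resolvent_set (A r w2 : R) (mv mw : Z) (eps : G -> R)
  (cl : lie -> C2 -> C2) (lambda : C) : Prop :=
  (exists c : R, 0 < c /\
     forall f, is_spinor r w2 mv mw eps f ->
       c * l2norm A r w2 mv f <= l2norm A r w2 mv (dirac_minus A cl lambda f)) /\
  (forall h, is_spinor r w2 mv mw eps h -> forall e : R, 0 < e ->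
     exists f, is_spinor r w2 mv mw eps f /\
       l2norm A r w2 mv (fun g => c2sub (dirac_minus A cl lambda f g) (h g)) < e).

Definition spectrum (A r w2 : R) (mv mw : Z) (eps : G -> R)
  (cl : lie -> C2 -> C2) (lambda : C) : Prop :=
  ~ resolvent_set A r w2 mv mw eps cl lambda.

Definition eigenspace (A r w2 : R) (mv mw : Z) (eps : G -> R)
  (cl : lie -> C2 -> C2) (lambda : C) (f : c2fun) : Prop :=
  is_spinor r w2 mv mw eps f /\
  forall g, dirac A cl f g = c2scal lambda (f g).

(* [lincomb n c b] = c_0 b_0 + ... + c_(n-1) b_(n-1). *)
Fixpoint lincomb (n : nat) (c : nat -> C) (b : nat -> c2fun) : c2fun :=
  match n with
  | O => fun _ => c2zero
  | S k => fun g => c2add (lincomb k c b g) (c2scal (c k) (b k g))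
  end.

Definition has_dim (V : c2fun -> Prop) (n : nat) : Prop :=
  exists b : nat -> c2fun,
    (forall k, (k < n)%nat -> V (b k)) /\
    (forall c, (forall g, lincomb n c b g = c2zero) ->
       forall k, (k < n)%nat -> c k = RtoC 0) /\
    (forall f, V f -> exists c, forall g, f g = lincomb n c b g).

Definition has_card {T : Type} (P : T -> Prop) (n : nat) : Prop :=
  exists l : list T, NoDup l /\ length l = n /\ forall x, In x l <-> P x.

(** * The two families of eigenvalues *)

(* [plus = true] selects the sign +.  The last argument of [Ground] and [Level]
   numbers the copies of an eigenvalue that is to be counted several times. *)
Inductive label : Type :=
| Torus (j1 j2 : Z) (plus : bool)
| Ground (kappa : Z) (copy : nat)
| Level (kappa : Z) (p : nat) (plus : bool) (copy : nat).

Definition sgn (plus : bool) : R := if plus then 1 else -1.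

Definition alpha1 (r w2 : R) (mv : Z) (eps1 : R) (j1 : Z) : R :=
  w2 / (r * IZR mv) * (IZR j1 + (1 - eps1) / 4).

Definition alpha2 (w2 : R) (mv mw : Z) (eps1 eps2 : R) (j1 j2 : Z) : R :=
  1 / w2 * ((IZR j2 + (1 - eps2) / 4)
            - IZR mw / IZR mv * (IZR j1 + (1 - eps1) / 4)).

Definition mu (eps3 : R) (kappa : Z) : R := IZR kappa + (1 - eps3) / 4.

(* eps3 = -1 forces mv to be even, so mv |mu| is an integer, and it is the
   number of naturals below mv |mu|. *)
Definition is_label (mv : Z) (eps3 : R) (i : label) : Prop :=
  match i with
  | Torus _ _ _ => eps3 = 1
  | Ground kappa copy =>
      mu eps3 kappa <> 0 /\ INR copy < IZR mv * Rabs (mu eps3 kappa)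
  | Level kappa p _ copy =>
      mu eps3 kappa <> 0 /\ (0 < p)%nat /\
      INR copy < IZR mv * Rabs (mu eps3 kappa)
  end.

Definition label_value (A r w2 : R) (mv mw : Z) (eps1 eps2 eps3 : R)
  (i : label) : R :=
  match i with
  | Torus j1 j2 plus =>
      - (1 / (4 * A)) + sgn plus * (2 * PI *
        sqrt ((alpha1 r w2 mv eps1 j1 ^ 2
               + alpha2 w2 mv mw eps1 eps2 j1 j2 ^ 2) / A))
  | Ground kappa _ =>
      - (1 / (4 * A)) - 2 * PI / r * Rabs (mu eps3 kappa)
  | Level kappa p plus _ =>
      - (1 / (4 * A)) + sgn plus * (2 *
        sqrt (PI * INR p / (r * A) * Rabs (mu eps3 kappa)
              + PI ^ 2 / r ^ 2 * mu eps3 kappa ^ 2))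
  end.

(* Main.v *)
Require Import Defs.
From Stdlib Require Import Reals ZArith List Lra Lia Psatz Classical FunctionalExtensionality ClassicalEpsilon ssreflect.
From Coquelicot Require Import Coquelicot.
Open Scope R_scope.

(* In a basis s+, s- = E1 s+ of C^2 with E3 s+ = i s+, the operator D + 1/(4A) becomes
   (p, q) |-> (i Z p + L* q, L p - i Z q) on pairs of equivariant functions, where L = (X - iY)/sqrt A, L* = -(X + iY)/sqrt A
   and [L, L*] = -(2i/A) Z.  Fejer means along the center split functions into central frequencies k = 2 pi mu / r.
   For mu = 0 two further Fejer projections leave only characters of the torus, giving family (i).
   For mu > 0 the operator L* is a creation operator.  The Weil-Brezin transform turns L into a first order
   operator on d = mv mu Schwartz functions of one variable, so the kernel of L is spanned by d theta functions theta_j and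
   every u is a combination of the theta_j plus some L* u'.  Iterating, the remainder L*^n u' is small because
   ||L R||^2 >= n sigma ||R||^2 for R = L*^n u', so the L*^n theta_j are complete; D acts on the pairs
   (L*^n theta_j, L*^(n-1) theta_j) by 2x2 matrices, giving family (ii).
   The quaternionic structure (p, q) |-> (- conj q, conj p) commutes with D and reduces mu < 0 to mu > 0.
   A symmetric operator with a complete orthogonal family of eigenvectors and discrete eigenvalues has no other spectrum. *)

(** * Complex-valued functions of a real variable *)

(** No Hilbert space is completed: all functions stay smooth and equivariant, and completeness
    enters only as density of finite combinations of eigenspinors in the L^2 norm. This fits a
    resolvent set defined through smooth spinors, and it explains the Fejer means: they keep
    smoothness and equivariance, and their error is uniform as soon as one derivative is bounded.
    The obstacle is density at nonzero central frequency. On the line, [L* g = f] has a rapidly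
    decreasing solution only if one linear functional of [f] vanishes. Subtracting a multiple of the
    Gaussian killed by [L] meets this condition, so one theta function per residue class modulo [d]
    complements the range of [L*]. The number [d] counts flux quanta: [k a w2 = 2 pi d] with
    [k = 2 pi |mu| / r] and [a = r m_v / w2] gives [d = m_v |mu|]. The square root in (ii) comes
    from a 2x2 matrix of trace 0 and determinant [-(k^2 + 2 k p / A)]. At the bottom of the ladder
    the theta function has no partner in the second component, so only the value [-k] occurs there,
    with no sign choice. *)

Ltac funring := apply: functional_extensionality => ?; ring.

Lemma C_ext (z w : C) : Re z = Re w -> Im z = Im w -> z = w.
Proof. by case: z => a b; case: w => c d /= -> ->. Qed.
Ltac Cring := apply: C_ext => /=; ring.

Lemma is_derive_eq (f : R -> R) (x l l' : R) : is_derive f x l -> l = l' -> is_derive f x l'.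
Proof. by move=> H <-. Qed.

Lemma is_derive_Rplus (f g : R -> R) x a b :
  is_derive f x a -> is_derive g x b -> is_derive (fun t => f t + g t) x (a + b).
Proof. move=> Hf Hg; exact: (is_derive_plus f g x a b Hf Hg). Qed.

Lemma is_derive_Rminus (f g : R -> R) x a b :
  is_derive f x a -> is_derive g x b -> is_derive (fun t => f t - g t) x (a - b).
Proof. move=> Hf Hg; exact: (is_derive_minus f g x a b Hf Hg). Qed.

Lemma is_derive_Rmult (f g : R -> R) x a b :
  is_derive f x a -> is_derive g x b -> is_derive (fun t => f t * g t) x (a * g x + f x * b).
Proof. move=> Hf Hg; exact: (is_derive_mult f g x a b Hf Hg Rmult_comm). Qed.

Lemma is_derive_Rcomp (f g : R -> R) x a b :
  is_derive f (g x) a -> is_derive g x b -> is_derive (fun t => f (g t)) x (a * b).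
Proof.
  move=> Hf Hg. apply: is_derive_eq. exact: (is_derive_comp f g x a b Hf Hg).
  by rewrite /scal /= /mult /= Rmult_comm.
Qed.

Definition CD (f : R -> C) (t : R) (l : C) : Prop :=
  is_derive (fun s => Re (f s)) t (Re l) /\ is_derive (fun s => Im (f s)) t (Im l).

Lemma CD_Cderive f t l : CD f t l -> Cderive f t = l.
Proof.
  move=> [H1 H2]. rewrite /Cderive. apply: C_ext => /=; exact: is_derive_unique.
Qed.

Lemma CD_ext f g t l : (forall s, f s = g s) -> CD f t l -> CD g t l.
Proof.
  move=> E. have -> : g = f by apply: functional_extensionality => s; rewrite E. by [].
Qed.

Lemma CD_eq f t l l' : CD f t l -> l = l' -> CD f t l'.
Proof. by move=> H <-. Qed.

Lemma CD_const (c : C) t : CD (fun _ => c) t 0%C.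
Proof. split; apply: is_derive_const. Qed.

Lemma CD_plus f g t a b : CD f t a -> CD g t b -> CD (fun s => f s + g s)%C t (a + b)%C.
Proof. move=> [H1 H2] [H3 H4]; split => /=; exact: is_derive_Rplus. Qed.

Lemma CD_mult f g t a b :
  CD f t a -> CD g t b -> CD (fun s => f s * g s)%C t (a * g t + f t * b)%C.
Proof.
  move=> [H1 H2] [H3 H4]; split => /=.
  - apply: is_derive_eq. apply: is_derive_Rminus; apply: is_derive_Rmult; eassumption. rewrite /=.
    rewrite /Re /Im; lra.
  - apply: is_derive_eq. apply: is_derive_Rplus; apply: is_derive_Rmult; eassumption. rewrite /=.
    rewrite /Re /Im; lra.
Qed.

Lemma CD_scal (c : C) f t a : CD f t a -> CD (fun s => c * f s)%C t (c * a)%C.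
Proof.
  move=> H. apply: CD_eq. apply: CD_mult (CD_const c t) H. cbv beta; ring.
Qed.

Lemma CD_conj f t a : CD f t a -> CD (fun s => Cconj (f s)) t (Cconj a).
Proof. move=> [H1 H2]; split => //=. exact: (is_derive_opp (fun s => Im (f s))). Qed.

Lemma CD_comp f (g : R -> R) t a b :
  CD f (g t) a -> is_derive g t b -> CD (fun s => f (g s)) t (a * RtoC b)%C.
Proof.
  move=> [H1 H2] H3; split => /=; apply: is_derive_eq.
  - exact: (is_derive_Rcomp (fun s => Re (f s)) g t _ _ H1 H3).
  - rewrite /Re /Im /=; ring.
  - exact: (is_derive_Rcomp (fun s => Im (f s)) g t _ _ H2 H3).
  - rewrite /Re /Im /=; ring.
Qed.

Lemma CD_RtoC f t a : is_derive f t a -> CD (fun s => RtoC (f s)) t (RtoC a).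
Proof. move=> H; split => //=. apply: is_derive_const. Qed.

Definition cis (x : R) : C := (cos x, sin x).

Lemma cis_plus x y : cis (x + y) = (cis x * cis y)%C.
Proof. apply: C_ext => /=. apply: cos_plus. rewrite sin_plus; ring. Qed.

Lemma cis_0 : cis 0 = 1%C.
Proof. by rewrite /cis cos_0 sin_0. Qed.

Lemma cis_opp x : cis (- x) = Cconj (cis x).
Proof. by rewrite /cis cos_neg sin_neg. Qed.

Lemma cis_conj_mult x : (cis x * Cconj (cis x))%C = 1%C.
Proof. by rewrite -cis_opp -cis_plus Rplus_opp_r cis_0. Qed.

Lemma Cmod_sq (z : C) : Cmod z ^ 2 = Re z ^ 2 + Im z ^ 2.
Proof.
  rewrite /Cmod pow2_sqrt //. have := pow2_ge_0 (fst z); have := pow2_ge_0 (snd z). lra.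
Qed.

Lemma Cmod_cis x : Cmod (cis x) = 1.
Proof.
  have H := Cmod_sq (cis x). have H2 := sin2_cos2 x. rewrite /Rsqr in H2.
  have H0 := Cmod_ge_0 (cis x). rewrite /cis /= in H H0 *. nra.
Qed.

Lemma cis_period x (n : Z) : cis (x + 2 * PI * IZR n) = cis x.
Proof.
  have P : forall (m : nat) y, cis (y + 2 * PI * INR m) = cis y.
  { move=> m y. rewrite /cis.
    have -> : y + 2 * PI * INR m = y + 2 * INR m * PI by ring.
    by rewrite cos_period sin_period. }
  case: (Z_le_gt_dec 0 n) => H.
  - rewrite -(Z2Nat.id n) // -INR_IZR_INZ. exact: P.
  - rewrite -(P (Z.to_nat (- n)) (x + _)). f_equal.
    rewrite INR_IZR_INZ Z2Nat.id; last lia. rewrite opp_IZR; ring.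
Qed.

Lemma cis_2PI (n : Z) : cis (2 * PI * IZR n) = 1%C.
Proof. by rewrite -(Rplus_0_l (2 * PI * IZR n)) cis_period cis_0. Qed.

Lemma CD_cis x : CD cis x (Ci * cis x)%C.
Proof.
  split => /=; apply: is_derive_eq.
  - apply: is_derive_cos.
  - ring.
  - apply: is_derive_sin.
  - ring.
Qed.

Lemma CD_cis_comp (g : R -> R) t b :
  is_derive g t b -> CD (fun s => cis (g s)) t (Ci * RtoC b * cis (g t))%C.
Proof.
  move=> H. apply: CD_eq. apply: (CD_comp cis g). apply: CD_cis. eassumption. ring.
Qed.

Lemma RInt_Rplus (f g : R -> R) a b : ex_RInt f a b -> ex_RInt g a b ->
  RInt (fun t => f t + g t) a b = RInt f a b + RInt g a b.
Proof. move=> Hf Hg; exact: (@RInt_plus R_CompleteNormedModule). Qed.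

Lemma RInt_Rminus (f g : R -> R) a b : ex_RInt f a b -> ex_RInt g a b ->
  RInt (fun t => f t - g t) a b = RInt f a b - RInt g a b.
Proof. move=> Hf Hg; exact: (@RInt_minus R_CompleteNormedModule). Qed.

Lemma RInt_Rscal (f : R -> R) c a b : ex_RInt f a b ->
  RInt (fun t => c * f t) a b = c * RInt f a b.
Proof. move=> Hf; exact: (@RInt_scal R_CompleteNormedModule). Qed.

Ltac rring := match goal with |- @eq _ ?x ?y => change (@eq R x y) end; ring.
Ltac rfield := match goal with |- @eq _ ?x ?y => change (@eq R x y) end; field.

(** * Compactness *)

(** Compactness of an interval by a supremum: the points reached from [a] have a least upper bound,
    and the local hypothesis there carries the reached segment past it unless it is [b]. Additivity
    of [Q] under concatenation replaces the choice of a finite subcover. *)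
Lemma interval_cover (Q : R -> R -> Prop) (a b : R) :
  (forall u v w, u <= v <= w -> Q u v -> Q v w -> Q u w) ->
  (forall x, a <= x <= b -> exists d : posreal, forall u v, x - d < u -> u <= v -> v < x + d -> Q u v) ->
  a <= b -> Q a b.
Proof.
  move=> Hadd Hloc Hab.
  set (E := fun x => a <= x <= b /\ Q a x).
  have HaE : E a.
  { split; first lra. case: (Hloc a ltac:(lra)) => d Hd. have := cond_pos d => Hp. apply: Hd; lra. }
  have [m [Hub Hlub]] : {m | is_lub E m}.
  { apply: completeness. - exists b => x [Hx _]; lra. - by exists a. }
  have Ham : a <= m by apply: Hub.
  have Hmb : m <= b by apply: Hlub => x [Hx _]; lra.
  case: (Hloc m ltac:(lra)) => d Hd. have Hp := cond_pos d.
  have [x [[Hx1 Qx] Hx2]] : exists x, E x /\ m - d < x.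
  { apply: NNPP => Hn. have : m <= m - d; last lra. apply: Hlub => x Ex.
    case: (Rle_lt_dec x (m - d)) => // Hlt. exfalso; apply: Hn. by exists x. }
  have Hxm : x <= m by apply: Hub.
  (* Half of [d] keeps [y] strictly inside the neighbourhood of [m], yet beyond [m] unless [b] stops
     it. *)
  set (y := Rmin b (m + d / 2)).
  have Hy : m <= y /\ y <= b /\ y < m + d.
  { rewrite /y /Rmin; case: Rle_dec => ?; lra. }
  have Qy : Q a y.
  { apply: (Hadd a x y) => //; first lra. apply: Hd; lra. }
  have Hym : y <= m by apply: Hub; split; [lra|].
  have <- : y = b. { move: Hym; rewrite /y /Rmin; case: Rle_dec => ?; lra. }
  done.
Qed.

Section Tube.
Context {U : UniformSpace}.

Definition jcont (F : U -> R -> R) : Prop :=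
  forall p t, continuous (fun q : U * R => F (fst q) (snd q)) (p, t).

Lemma jcont_eps F p t (e : posreal) : jcont F ->
  exists d : posreal, forall q s, ball p d q -> Rabs (s - t) < d -> Rabs (F q s - F p t) < e.
Proof.
  move=> H. have := H p t. move/filterlim_locally => /(_ e) [d Hd].
  exists d => q s Hq Hs. exact: (Hd (q, s)).
Qed.

(** On a short piece around [x] both [F q t] and [F p t] are within [e / 2] of [F p x]; the covering
    argument glues the pieces by taking the smaller radius. *)
Lemma tube F p (a b : R) (e : posreal) : a <= b -> jcont F ->
  exists d : posreal, forall q t, ball p d q -> a <= t <= b -> Rabs (F q t - F p t) < e.
Proof.
  move=> Hab H.
  apply: (interval_cover (fun a b => exists d : posreal, forall q t, ball p d q -> a <= t <= b -> Rabs (F q t - F p t) < e)) => //.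
  - move=> u v w Huv [d1 H1] [d2 H2].
    have Hm : 0 < Rmin d1 d2 by apply: Rmin_pos; apply: cond_pos.
    exists (mkposreal _ Hm) => q t /= Hq Ht.
    case: (Rle_lt_dec t v) => Htv.
    + apply: H1; last lra. apply: ball_le Hq. apply: Rmin_l.
    + apply: H2; last lra. apply: ball_le Hq. apply: Rmin_r.
  - move=> x Hx. case: (jcont_eps F p x (pos_div_2 e) H) => d Hd.
    exists d => u v Hu Huv Hv. exists d => q t Hq Ht.
    have H1 := Hd q t Hq ltac:(apply: Rabs_def1; lra).
    have H2 := Hd p t (ball_center p d) ltac:(apply: Rabs_def1; lra).
    rewrite /= in H1 H2.
    have -> : F q t - F p t = (F q t - F p x) - (F p t - F p x) by ring.
    apply: Rle_lt_trans (Rabs_triang _ _) _. rewrite Rabs_Ropp. lra.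
Qed.

Lemma jcont_slice F p : jcont F -> forall t, continuous (F p) t.
Proof.
  move=> H t. apply/filterlim_locally => e. case: (jcont_eps F p t e H) => d Hd.
  exists d => s Hs. apply: Hd => //. apply: ball_center.
Qed.

Lemma ex_RInt_jcont F p a b : jcont F -> ex_RInt (F p) a b.
Proof.
  move=> H. apply: (@ex_RInt_continuous R_CompleteNormedModule) => t _. exact: jcont_slice.
Qed.

Lemma continuous_RInt_param F (a b : R) : a <= b -> jcont F ->
  forall p, continuous (fun p => RInt (F p) a b) p.
Proof.
  move=> Hab H p. apply/filterlim_locally => e.
  have He : 0 < e / (b - a + 1). { apply: Rdiv_lt_0_compat; [apply: cond_pos | lra]. }
  case: (tube F p a b (mkposreal _ He) Hab H) => d Hd.
  exists d => q Hq.
  change (Rabs (RInt (F q) a b - RInt (F p) a b) < e).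
  rewrite -RInt_Rminus; [|exact: ex_RInt_jcont|exact: ex_RInt_jcont].
  apply: Rle_lt_trans (_ : (b - a) * (e / (b - a + 1)) < e).
  - apply: abs_RInt_le_const => //.
    + apply: (@ex_RInt_minus R_NormedModule); exact: ex_RInt_jcont.
    + move=> t Ht. apply: Rlt_le. exact: (Hd q t).
  - have Hp := cond_pos e. have -> : (b - a) * (e / (b - a + 1)) = e - e / (b - a + 1) by field; lra.
    lra.
Qed.

Lemma loc_bounded_RInt F p (a b : R) : a <= b -> jcont F ->
  exists (d : posreal) (M : R), forall q t, ball p d q -> a <= t <= b -> Rabs (F q t) <= M.
Proof.
  move=> Hab H.
  apply: (interval_cover (fun a b => exists (d : posreal) M, forall q t, ball p d q -> a <= t <= b -> Rabs (F q t) <= M)) => //.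
  - move=> u v w Huv [d1 [M1 H1]] [d2 [M2 H2]].
    have Hm : 0 < Rmin d1 d2 by apply: Rmin_pos; apply: cond_pos.
    exists (mkposreal _ Hm), (Rmax M1 M2) => q t /= Hq Ht.
    case: (Rle_lt_dec t v) => Htv.
    + apply: Rle_trans (Rmax_l _ _). apply: H1; last lra. apply: ball_le Hq. apply: Rmin_l.
    + apply: Rle_trans (Rmax_r _ _). apply: H2; last lra. apply: ball_le Hq. apply: Rmin_r.
  - move=> x Hx. case: (jcont_eps F p x (mkposreal 1 Rlt_0_1) H) => d Hd.
    exists d => u v Hu Huv Hv. exists d, (Rabs (F p x) + 1) => q t Hq Ht.
    have H1 := Hd q t Hq ltac:(apply: Rabs_def1; lra). rewrite /= in H1.
    have -> : F q t = F p x + (F q t - F p x) by ring.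
    apply: Rle_trans (Rabs_triang _ _) _. lra.
Qed.
End Tube.

Lemma jcont_2d (F : R -> R -> R) x y : jcont F -> continuity_2d_pt F x y.
Proof.
  move=> H e. case: (jcont_eps F x y e H) => d Hd. exists d => u v Hu Hv. exact: Hd.
Qed.

Lemma is_derive_RInt_jcont (F F1 : R -> R -> R) a b x : a <= b ->
  (forall x t, is_derive (fun x => F x t) x (F1 x t)) -> jcont F -> jcont F1 ->
  is_derive (fun x => RInt (F x) a b) x (RInt (F1 x) a b).
Proof.
  move=> Hab HF HcF HcF1.
  have E : (fun u v => Derive (fun z => F z v) u) = F1.
  { apply: functional_extensionality => u; apply: functional_extensionality => v. exact: is_derive_unique. }
  have E' : forall x, (fun t => Derive (fun u => F u t) x) = F1 x.
  { move=> u; apply: functional_extensionality => v. exact: is_derive_unique. }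
  rewrite -E'. apply: (is_derive_RInt_param F).
  - apply: filter_forall => z t _. eexists. exact: HF.
  - move=> t _. rewrite E. exact: jcont_2d.
  - apply: filter_forall => z. exact: ex_RInt_jcont.
Qed.

Lemma is_derive_RInt_upper (f : R -> R) a x : (forall t, continuous f t) ->
  is_derive (fun x => RInt f a x) x (f x).
Proof.
  move=> H. apply: (is_derive_RInt f _ a x).
  - apply: filter_forall => z. apply: RInt_correct. apply: (@ex_RInt_continuous R_CompleteNormedModule) => t _. exact: H.
  - exact: H.
Qed.

Lemma derive_zero_const (f : R -> R) a b : (forall x, is_derive f x 0) -> f a = f b.
Proof.
  move=> H. case: (MVT_gen f a b (fun _ => 0)).
  - move=> x _; exact: H.
  - move=> x _. apply: derivable_continuous_pt. exists 0. apply/is_derive_Reals. exact: H.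
  - move=> c [_ E]. lra.
Qed.

Lemma RInt_Derive_eq (f f' : R -> R) a b : (forall x, is_derive f x (f' x)) ->
  (forall x, continuous f' x) -> RInt f' a b = f b - f a.
Proof.
  move=> H Hc. apply: is_RInt_unique. apply: (is_RInt_derive f f'); move=> x _; [exact: H|exact: Hc].
Qed.

Lemma RInt_Rpoint (f : R -> R) a : RInt f a a = 0.
Proof. exact: (@RInt_point R_CompleteNormedModule). Qed.

Lemma RInt_RChasles (f : R -> R) a b c : (forall t, continuous f t) ->
  RInt f a b + RInt f b c = RInt f a c.
Proof.
  move=> H. apply: (@RInt_Chasles R_CompleteNormedModule); apply: (@ex_RInt_continuous R_CompleteNormedModule) => t _; exact: H.
Qed.

Lemma RInt_shift (f : R -> R) a b c : (forall t, continuous f t) ->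
  RInt (fun t => f (t + c)) a b = RInt f (a + c) (b + c).
Proof.
  move=> H.
  rewrite -(RInt_RChasles f (a + c) 0 (b + c)) //.
  have Hd : forall x, is_derive (fun x => RInt f 0 (x + c)) x (f (x + c)).
  { move=> x. apply: is_derive_eq. apply: (is_derive_Rcomp (fun x => RInt f 0 x)). exact: is_derive_RInt_upper.
    apply: is_derive_Rplus. apply: is_derive_id. apply: is_derive_const. rewrite /one /zero /=. ring. }
  rewrite (RInt_Derive_eq _ _ a b Hd).
  - have := RInt_RChasles f 0 (a + c) 0 H. rewrite RInt_Rpoint. lra.
  - move=> x. apply: (continuous_comp (fun x => x + c) f) => //.
    apply: (continuous_plus (fun x => x) (fun _ => c)). apply: continuous_id. apply: continuous_const.
Qed.

Lemma RInt_period (f : R -> R) T c : (forall t, continuous f t) -> (forall t, f (t + T) = f t) ->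
  RInt (fun t => f (t + c)) 0 T = RInt f 0 T.
Proof.
  move=> Hc Hp. rewrite RInt_shift // Rplus_0_l.
  have E : RInt f T (T + c) = RInt f 0 c.
  { have -> : RInt f 0 c = RInt (fun t => f (t + T)) 0 c by apply: RInt_ext => t _.
    rewrite RInt_shift //. by rewrite Rplus_0_l (Rplus_comm c). }
  have H1 := RInt_RChasles f 0 c (T + c) Hc. have H2 := RInt_RChasles f 0 T (T + c) Hc. lra.
Qed.

Lemma continuous_pair {U V W : UniformSpace} (f : U -> V) (g : U -> W) p :
  continuous f p -> continuous g p -> continuous (fun q => (f q, g q)) p.
Proof.
  move=> Hf Hg. apply/filterlim_locally => e.
  move/filterlim_locally: Hf => /(_ e) Hf. move/filterlim_locally: Hg => /(_ e) Hg.
  apply: filter_imp (filter_and _ _ Hf Hg) => q [H1 H2]. by split.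
Qed.

Lemma continuous_fst_comp {U V W : UniformSpace} (f : U -> V * W) p :
  continuous f p -> continuous (fun q => fst (f q)) p.
Proof. move=> H. apply: (continuous_comp f fst) => //. apply: continuous_fst. Qed.

Lemma continuous_snd_comp {U V W : UniformSpace} (f : U -> V * W) p :
  continuous f p -> continuous (fun q => snd (f q)) p.
Proof. move=> H. apply: (continuous_comp f snd) => //. apply: continuous_snd. Qed.

Lemma continuous_Rplus {U : UniformSpace} (f g : U -> R) p :
  continuous f p -> continuous g p -> continuous (fun q => f q + g q) p.
Proof. exact: (@continuous_plus U R_AbsRing R_NormedModule). Qed.

Lemma continuous_Rminus {U : UniformSpace} (f g : U -> R) p :
  continuous f p -> continuous g p -> continuous (fun q => f q - g q) p.
Proof. exact: (@continuous_minus U R_AbsRing R_NormedModule). Qed.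

Lemma continuous_Rmult {U : UniformSpace} (f g : U -> R) p :
  continuous f p -> continuous g p -> continuous (fun q => f q * g q) p.
Proof. exact: (@continuous_mult U R_AbsRing). Qed.

Lemma continuous_scomp {U V W : UniformSpace} (f : V -> W) (g : U -> V) p :
  (forall v, continuous f v) -> continuous g p -> continuous (fun q => f (g q)) p.
Proof. move=> H1 H2. exact: (continuous_comp g f). Qed.

Lemma continuous_of_derive (f : R -> R) x l : is_derive f x l -> continuous f x.
Proof. move=> H. apply: (ex_derive_continuous f). by exists l. Qed.

Ltac cont :=
  repeat first
    [ assumption | apply: continuous_const | apply: continuous_id
    | apply: continuous_pair | apply: continuous_Rplus | apply: continuous_Rminus | apply: continuous_Rmult
    | apply: continuous_fst_comp | apply: continuous_snd_comp ].

(** Both sides, as functions of the upper limit of the [x] integral, have the same derivative and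
    vanish when the limit is [a]. *)
Lemma RInt_fubini (F : R -> R -> R) a b c d : a <= b -> c <= d -> jcont F ->
  RInt (fun x => RInt (fun y => F x y) c d) a b = RInt (fun y => RInt (fun x => F x y) a b) c d.
Proof.
  move=> Hab Hcd HF.
  have HF' : jcont (fun y x => F x y).
  { move=> y x. apply: (continuous_comp (fun q : R * R => (snd q, fst q)) (fun q : R * R => F (fst q) (snd q))); last exact: HF.
    cont. }
  (* Differentiating the right-hand side under the integral needs joint continuity of an integral
     with moving endpoint. Rescaling to the fixed interval from 0 to 1 makes it a parametric
     integral. *)
  have HI : jcont (fun x y => RInt (fun x => F x y) a x).
  { move=> x y.
    have E : forall q : R * R, RInt (fun x => F x (snd q)) a (fst q) = RInt (fun s => (fst q - a) * F (a + s * (fst q - a)) (snd q)) 0 1.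
    { case=> u v /=. rewrite (RInt_Derive_eq (fun s => RInt (fun x => F x v) a (a + s * (u - a))) _ 0 1).
      - have -> : a + 1 * (u - a) = u by ring. have -> : a + 0 * (u - a) = a by ring. rewrite RInt_Rpoint; by rewrite Rminus_0_r.
      - move=> s. apply: is_derive_eq. apply: (is_derive_Rcomp (fun x => RInt (fun x => F x v) a x)).
        apply: is_derive_RInt_upper. exact: (jcont_slice _ v HF').
        apply: is_derive_Rplus. apply: is_derive_const. apply: is_derive_Rmult. apply: is_derive_id. apply: is_derive_const.
        rewrite /one /zero /=. ring.
      - move=> s. apply: (continuous_mult (fun _ => u - a)). apply: continuous_const.
        apply: (continuous_comp (fun s => a + s * (u - a)) (fun x => F x v)); last exact: (jcont_slice _ v HF').
        apply: (continuous_plus (fun _ => a)). apply: continuous_const.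
        apply: (continuous_mult (fun s => s)). apply: continuous_id. apply: continuous_const. }
    apply: (continuous_ext (fun q : R * R => RInt (fun s => (fst q - a) * F (a + s * (fst q - a)) (snd q)) 0 1)).
    { move=> q. by rewrite E. }
    apply: (continuous_RInt_param (U := prod_UniformSpace R_UniformSpace R_UniformSpace) (fun (q : R * R) s => (fst q - a) * F (a + s * (fst q - a)) (snd q))); first lra.
    move=> p t.
    apply: continuous_Rmult; first by cont.
    apply: (continuous_comp (fun q : R * R * R => (a + snd q * (fst (fst q) - a), snd (fst q))) (fun q => F (fst q) (snd q))); last exact: HF.
    cont. }
  have H : forall x, is_derive (fun x => RInt (fun x => RInt (fun y => F x y) c d) a x - RInt (fun y => RInt (fun x => F x y) a x) c d) x 0.
  { move=> x. apply: is_derive_eq. apply: is_derive_Rminus.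
    - apply: is_derive_RInt_upper. exact: (continuous_RInt_param F).
    - apply: (is_derive_RInt_jcont (fun x y => RInt (fun x => F x y) a x) F) => //.
      move=> z t. apply: is_derive_RInt_upper. exact: (jcont_slice _ t HF').
    - exact: Rminus_diag_eq. }
  have := derive_zero_const _ a b H. rewrite RInt_Rpoint.
  have -> : RInt (fun y => RInt (fun x => F x y) a a) c d = 0.
  { rewrite (RInt_ext _ (fun _ => 0)); last by (move=> *; rewrite RInt_Rpoint). rewrite RInt_const /scal /= /mult /=. ring. }
  lra.
Qed.

(** * Smooth functions on the group *)

Definition contG (u : G -> R) : Prop := forall g : R * R * R, continuous (u : R * R * R -> R) g.

Definition partials (u ux uy uz : G -> R) : Prop := forall x y z,
  is_derive (fun t => u (t, y, z)) x (ux (x, y, z)) /\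
  is_derive (fun t => u (x, t, z)) y (uy (x, y, z)) /\
  is_derive (fun t => u (x, y, t)) z (uz (x, y, z)).

Lemma Ck_contG n u : Ck n u -> contG u.
Proof. by case: n => [|n] []. Qed.

Lemma Ck_partials n u : Ck (S n) u -> partials u (part_x u) (part_y u) (part_z u).
Proof.
  move=> [_ [H _]] x y z. case: (H x y z) => [H1 [H2 H3]].
  by split; [|split]; apply: Derive_correct.
Qed.

Lemma partials_part u ux uy uz : partials u ux uy uz -> part_x u = ux /\ part_y u = uy /\ part_z u = uz.
Proof.
  move=> H; split; [|split]; apply: functional_extensionality; move=> [[x y] z] /=;
  case: (H x y z) => [H1 [H2 H3]]; exact: is_derive_unique.
Qed.

Lemma Ck_intro n u ux uy uz : contG u -> partials u ux uy uz -> Ck n ux -> Ck n uy -> Ck n uz -> Ck (S n) u.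
Proof.
  move=> Hc H Hx Hy Hz. case: (partials_part _ _ _ _ H) => [Ex [Ey Ez]].
  split => //. rewrite Ex Ey Ez. split => // x y z.
  case: (H x y z) => [H1 [H2 H3]]. by split; [|split]; eexists; eassumption.
Qed.

Lemma Ck_lower n u : Ck (S n) u -> Ck n u.
Proof.
  elim: n u => [|n IH] u [Hc [Hp [Hx [Hy Hz]]]]; split => //. split => //. by split; [|split]; apply: IH.
Qed.

Lemma Ck_const n (c : R) : Ck n (fun _ => c).
Proof.
  elim: n c => [|n IH] c; first by split => // g; apply: continuous_const.
  apply: (Ck_intro n _ (fun _ => 0) (fun _ => 0) (fun _ => 0)) => //.
  - move=> g. apply: continuous_const.
  - by move=> x y z; split; [|split]; apply: is_derive_const.
Qed.

Lemma Ck_coord n : Ck n (fun g => fst (fst g)) /\ Ck n (fun g => snd (fst g)) /\ Ck n (fun g => snd g).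
Proof.
  have Hc : contG (fun g => fst (fst g)) /\ contG (fun g => snd (fst g)) /\ contG (fun g => snd g).
  { split; [|split] => g; cont. }
  case: Hc => [H1 [H2 H3]].
  case: n => [|n]; first by split; [|split].
  split; [|split].
  - apply: (Ck_intro n _ (fun _ => 1) (fun _ => 0) (fun _ => 0)) => //; try apply: Ck_const.
    move=> x y z; split; [|split]; [apply: is_derive_id|apply: is_derive_const|apply: is_derive_const].
  - apply: (Ck_intro n _ (fun _ => 0) (fun _ => 1) (fun _ => 0)) => //; try apply: Ck_const.
    move=> x y z; split; [|split]; [apply: is_derive_const|apply: is_derive_id|apply: is_derive_const].
  - apply: (Ck_intro n _ (fun _ => 0) (fun _ => 0) (fun _ => 1)) => //; try apply: Ck_const.
    move=> x y z; split; [|split]; [apply: is_derive_const|apply: is_derive_const|apply: is_derive_id].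
Qed.

Lemma Ck_plus n u v : Ck n u -> Ck n v -> Ck n (fun g => u g + v g).
Proof.
  elim: n u v => [|n IH] u v Hu Hv.
  - split => // g. apply: continuous_Rplus. exact: (Ck_contG _ _ Hu). exact: (Ck_contG _ _ Hv).
  - have Pu := Ck_partials _ _ Hu. have Pv := Ck_partials _ _ Hv.
    apply: (Ck_intro n _ (fun g => part_x u g + part_x v g) (fun g => part_y u g + part_y v g) (fun g => part_z u g + part_z v g)).
    + move=> g. apply: continuous_Rplus. exact: (Ck_contG _ _ Hu). exact: (Ck_contG _ _ Hv).
    + move=> x y z. case: (Pu x y z) => [? [? ?]]. case: (Pv x y z) => [? [? ?]].
      by split; [|split]; apply: is_derive_Rplus.
    + apply: IH; [apply Hu|apply Hv].
    + apply: IH; [apply Hu|apply Hv].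
    + apply: IH; [apply Hu|apply Hv].
Qed.

Lemma Ck_mult n u v : Ck n u -> Ck n v -> Ck n (fun g => u g * v g).
Proof.
  elim: n u v => [|n IH] u v Hu Hv.
  - split => // g. apply: continuous_Rmult. exact: (Ck_contG _ _ Hu). exact: (Ck_contG _ _ Hv).
  - have Pu := Ck_partials _ _ Hu. have Pv := Ck_partials _ _ Hv.
    have Lu := Ck_lower _ _ Hu. have Lv := Ck_lower _ _ Hv.
    apply: (Ck_intro n _ (fun g => part_x u g * v g + u g * part_x v g) (fun g => part_y u g * v g + u g * part_y v g)
       (fun g => part_z u g * v g + u g * part_z v g)).
    + move=> g. apply: continuous_Rmult. exact: (Ck_contG _ _ Hu). exact: (Ck_contG _ _ Hv).
    + move=> x y z. case: (Pu x y z) => [? [? ?]]. case: (Pv x y z) => [? [? ?]].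
      by split; [|split]; apply: is_derive_Rmult.
    + apply: Ck_plus; apply: IH => //; [apply Hu|apply Hv].
    + apply: Ck_plus; apply: IH => //; [apply Hu|apply Hv].
    + apply: Ck_plus; apply: IH => //; [apply Hu|apply Hv].
Qed.

(** The outer function comes as its whole sequence of derivatives, so that the induction on [n] may
    pass from index [k] to [S k]. *)
Lemma Ck_comp n (phi : nat -> R -> R) u : (forall k x, is_derive (phi k) x (phi (S k) x)) ->
  Ck n u -> forall k, Ck n (fun g => phi k (u g)).
Proof.
  move=> Hphi. elim: n u => [|n IH] u Hu k.
  - split => // g. apply: (continuous_scomp (phi k) u). move=> v. exact: (continuous_of_derive _ _ _ (Hphi k v)).
    exact: (Ck_contG _ _ Hu).
  - have Pu := Ck_partials _ _ Hu. have Lu := Ck_lower _ _ Hu.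
    apply: (Ck_intro n _ (fun g => phi (S k) (u g) * part_x u g) (fun g => phi (S k) (u g) * part_y u g)
       (fun g => phi (S k) (u g) * part_z u g)).
    + move=> g. apply: (continuous_scomp (phi k) u). move=> v. exact: (continuous_of_derive _ _ _ (Hphi k v)).
      exact: (Ck_contG _ _ Hu).
    + move=> x y z. case: (Pu x y z) => [? [? ?]].
      split; [|split].
      * exact: (is_derive_Rcomp (phi k) (fun t => u (t, y, z))).
      * exact: (is_derive_Rcomp (phi k) (fun t => u (x, t, z))).
      * exact: (is_derive_Rcomp (phi k) (fun t => u (x, y, t))).
    + apply: Ck_mult; [exact: IH|apply Hu].
    + apply: Ck_mult; [exact: IH|apply Hu].
    + apply: Ck_mult; [exact: IH|apply Hu].
Qed.

Definition CK (n : nat) (u : G -> C) : Prop := Ck n (fun g => Re (u g)) /\ Ck n (fun g => Im (u g)).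
Definition Sm (u : G -> C) : Prop := forall n, CK n u.

Definition PX (u : G -> C) : G -> C := fun g => (part_x (fun h => Re (u h)) g, part_x (fun h => Im (u h)) g).
Definition PY (u : G -> C) : G -> C := fun g => (part_y (fun h => Re (u h)) g, part_y (fun h => Im (u h)) g).
Definition PZ (u : G -> C) : G -> C := fun g => (part_z (fun h => Re (u h)) g, part_z (fun h => Im (u h)) g).

Definition Cpartials (u ux uy uz : G -> C) : Prop := forall x y z,
  CD (fun t => u (t, y, z)) x (ux (x, y, z)) /\
  CD (fun t => u (x, t, z)) y (uy (x, y, z)) /\
  CD (fun t => u (x, y, t)) z (uz (x, y, z)).

Definition CcontG (u : G -> C) : Prop := contG (fun g => Re (u g)) /\ contG (fun g => Im (u g)).

Lemma CK_cont n u : CK n u -> CcontG u.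
Proof. move=> [H1 H2]; split; apply: Ck_contG; eassumption. Qed.

Lemma CK_partials n u : CK (S n) u -> Cpartials u (PX u) (PY u) (PZ u).
Proof.
  move=> [H1 H2] x y z. case: (Ck_partials _ _ H1 x y z) => [? [? ?]]. case: (Ck_partials _ _ H2 x y z) => [? [? ?]].
  by split; [|split]; split.
Qed.

Lemma Cpartials_P u ux uy uz : Cpartials u ux uy uz -> PX u = ux /\ PY u = uy /\ PZ u = uz.
Proof.
  move=> H.
  have H1 : partials (fun g => Re (u g)) (fun g => Re (ux g)) (fun g => Re (uy g)) (fun g => Re (uz g)).
  { move=> x y z. case: (H x y z) => [[? ?] [[? ?] [? ?]]]. by split; [|split]. }
  have H2 : partials (fun g => Im (u g)) (fun g => Im (ux g)) (fun g => Im (uy g)) (fun g => Im (uz g)).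
  { move=> x y z. case: (H x y z) => [[? ?] [[? ?] [? ?]]]. by split; [|split]. }
  case: (partials_part _ _ _ _ H1) => [E1 [E2 E3]]. case: (partials_part _ _ _ _ H2) => [E4 [E5 E6]].
  split; [|split]; apply: functional_extensionality => g; apply: C_ext => /=;
  by rewrite ?E1 ?E2 ?E3 ?E4 ?E5 ?E6.
Qed.

Lemma CK_intro n u ux uy uz : CcontG u -> Cpartials u ux uy uz -> CK n ux -> CK n uy -> CK n uz -> CK (S n) u.
Proof.
  move=> [Hc1 Hc2] H [? ?] [? ?] [? ?]. split.
  - apply: (Ck_intro n _ (fun g => Re (ux g)) (fun g => Re (uy g)) (fun g => Re (uz g))) => //.
    move=> x y z. case: (H x y z) => [[? ?] [[? ?] [? ?]]]. by split; [|split].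
  - apply: (Ck_intro n _ (fun g => Im (ux g)) (fun g => Im (uy g)) (fun g => Im (uz g))) => //.
    move=> x y z. case: (H x y z) => [[? ?] [[? ?] [? ?]]]. by split; [|split].
Qed.

Lemma CK_S n u : CK (S n) u -> CK n u /\ CK n (PX u) /\ CK n (PY u) /\ CK n (PZ u).
Proof.
  move=> [H1 H2]. have L1 := Ck_lower _ _ H1. have L2 := Ck_lower _ _ H2.
  split; first by split. case: H1 => [_ [_ [? [? ?]]]]. case: H2 => [_ [_ [? [? ?]]]]. by split; [|split].
Qed.

Lemma CK_plus n u v : CK n u -> CK n v -> CK n (fun g => u g + v g)%C.
Proof. move=> [? ?] [? ?]; split; exact: Ck_plus. Qed.

Lemma CK_mult n u v : CK n u -> CK n v -> CK n (fun g => u g * v g)%C.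
Proof.
  move=> [H1 H2] [H3 H4]; split => /=.
  - have -> : (fun g : G => fst (u g) * fst (v g) - snd (u g) * snd (v g)) = (fun g => Re (u g) * Re (v g) + (-1) * (Im (u g) * Im (v g))).
    { apply: functional_extensionality => g; rewrite /Re /Im; ring. }
    apply: Ck_plus. exact: Ck_mult. apply: Ck_mult. exact: Ck_const. exact: Ck_mult.
  - apply: Ck_plus; exact: Ck_mult.
Qed.

Lemma CK_const n c : CK n (fun _ => c).
Proof. split; exact: Ck_const. Qed.

Lemma CK_RtoC n u : Ck n u -> CK n (fun g => RtoC (u g)).
Proof. move=> H; split => //. exact: Ck_const. Qed.

Lemma CK_conj n u : CK n u -> CK n (fun g => Cconj (u g)).
Proof.
  move=> [H1 H2]; split => //=.
  have -> : (fun g : G => - snd (u g)) = (fun g => (-1) * Im (u g)).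
  { apply: functional_extensionality => g; rewrite /Im; ring. }
  apply: Ck_mult => //. exact: Ck_const.
Qed.

(** Successive derivatives of the cosine as phase shifts: index 0 is [cos] and index 3 is [sin], so
    [Ck_comp] serves both. *)
Definition trig_derivs (k : nat) (x : R) : R := cos (x + INR k * (PI / 2)).

Lemma trig_derivs_spec k x : is_derive (trig_derivs k) x (trig_derivs (S k) x).
Proof.
  apply: is_derive_eq. apply: (is_derive_Rcomp cos). apply: is_derive_cos.
  apply: is_derive_Rplus. apply: is_derive_id. apply: is_derive_const.
  rewrite /trig_derivs S_INR.
  have -> : x + (INR k + 1) * (PI / 2) = PI / 2 + (x + INR k * (PI / 2)) by field.
  have := sin_cos (x + INR k * (PI / 2)). rewrite /one /zero /=. lra.
Qed.

Lemma CK_cis n u : Ck n u -> CK n (fun g => cis (u g)).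
Proof.
  move=> H; split => /=.
  - have -> : (fun g : G => cos (u g)) = (fun g => trig_derivs 0 (u g)).
    { apply: functional_extensionality => g. rewrite /trig_derivs /=. f_equal; ring. }
    exact: (Ck_comp _ _ _ trig_derivs_spec).
  - have -> : (fun g : G => sin (u g)) = (fun g => trig_derivs 3 (u g)).
    { apply: functional_extensionality => g. rewrite /trig_derivs sin_cos /=.
      have -> : u g + (1 + 1 + 1) * (PI / 2) = (PI / 2 + u g) + PI by field. rewrite neg_cos. ring. }
    exact: (Ck_comp _ _ _ trig_derivs_spec).
Qed.

Lemma Sm_plus u v : Sm u -> Sm v -> Sm (fun g => u g + v g)%C.
Proof. move=> H1 H2 n; exact: CK_plus. Qed.
Lemma Sm_mult u v : Sm u -> Sm v -> Sm (fun g => u g * v g)%C.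
Proof. move=> H1 H2 n; exact: CK_mult. Qed.
Lemma Sm_const c : Sm (fun _ => c).
Proof. move=> n; exact: CK_const. Qed.
Lemma Sm_conj u : Sm u -> Sm (fun g => Cconj (u g)).
Proof. move=> H n; exact: CK_conj. Qed.
Lemma Sm_scal c u : Sm u -> Sm (fun g => c * u g)%C.
Proof. move=> H; apply: Sm_mult => //. exact: Sm_const. Qed.
Lemma Sm_x : Sm (fun g => RtoC (fst (fst g))).
Proof. move=> n; apply: CK_RtoC. apply Ck_coord. Qed.

Lemma Sm_PX u : Sm u -> Sm (PX u).
Proof. move=> H n. by case: (CK_S _ _ (H (S n))) => [_ [? _]]. Qed.
Lemma Sm_PY u : Sm u -> Sm (PY u).
Proof. move=> H n. by case: (CK_S _ _ (H (S n))) => [_ [_ [? _]]]. Qed.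
Lemma Sm_PZ u : Sm u -> Sm (PZ u).
Proof. move=> H n. by case: (CK_S _ _ (H (S n))) => [_ [_ [_ ?]]]. Qed.
Lemma Sm_partials u : Sm u -> Cpartials u (PX u) (PY u) (PZ u).
Proof. move=> H; exact: (CK_partials 0). Qed.
Lemma Sm_cont u : Sm u -> CcontG u.
Proof. move=> H; exact: (CK_cont 0). Qed.

Lemma Cpartials_plus u ux uy uz v vx vy vz : Cpartials u ux uy uz -> Cpartials v vx vy vz ->
  Cpartials (fun g => u g + v g)%C (fun g => ux g + vx g)%C (fun g => uy g + vy g)%C (fun g => uz g + vz g)%C.
Proof.
  move=> Hu Hv x y z. case: (Hu x y z) => [? [? ?]]. case: (Hv x y z) => [? [? ?]].
  by split; [|split]; apply: CD_plus.
Qed.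
Lemma Cpartials_mult u ux uy uz v vx vy vz : Cpartials u ux uy uz -> Cpartials v vx vy vz ->
  Cpartials (fun g => u g * v g)%C (fun g => ux g * v g + u g * vx g)%C
   (fun g => uy g * v g + u g * vy g)%C (fun g => uz g * v g + u g * vz g)%C.
Proof.
  move=> Hu Hv x y z. case: (Hu x y z) => [? [? ?]]. case: (Hv x y z) => [? [? ?]].
  split; [|split].
  - exact: (CD_mult (fun t => u (t, y, z)) (fun t => v (t, y, z))).
  - exact: (CD_mult (fun t => u (x, t, z)) (fun t => v (x, t, z))).
  - exact: (CD_mult (fun t => u (x, y, t)) (fun t => v (x, y, t))).
Qed.
Lemma Cpartials_scal c u ux uy uz : Cpartials u ux uy uz ->
  Cpartials (fun g => c * u g)%C (fun g => c * ux g)%C (fun g => c * uy g)%C (fun g => c * uz g)%C.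
Proof.
  move=> Hu x y z. case: (Hu x y z) => [? [? ?]]. by split; [|split]; apply: CD_scal.
Qed.
Lemma Cpartials_conj u ux uy uz : Cpartials u ux uy uz ->
  Cpartials (fun g => Cconj (u g)) (fun g => Cconj (ux g)) (fun g => Cconj (uy g)) (fun g => Cconj (uz g)).
Proof.
  move=> Hu x y z. case: (Hu x y z) => [? [? ?]]. by split; [|split]; apply: CD_conj.
Qed.

Lemma contG_comp {U : UniformSpace} (u : G -> R) (f h k : U -> R) p :
  contG u -> continuous f p -> continuous h p -> continuous k p ->
  continuous (fun q => u (f q, h q, k q)) p.
Proof.
  move=> Hu H1 H2 H3. apply: (continuous_comp (fun q => (f q, h q, k q)) (u : R * R * R -> R)).
  cont. exact: Hu.
Qed.

(** A product rule in which one factor is merely continuous; the other one vanishes at the point. It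
    is made for Hadamard's factorisation, where the mean of the derivative is only known to be
    continuous. *)
Lemma is_derive_zero_mult (d A : R -> R) t l : is_derive d t l -> d t = 0 -> continuous A t ->
  is_derive (fun s => d s * A s) t (l * A t).
Proof.
  move=> /is_derive_Reals Hd H0 HA. apply/is_derive_Reals => e He.
  set M := Rabs (A t) + 1. have HM : 0 < M by rewrite /M; have := Rabs_pos (A t); lra.
  set L := Rabs l + 1. have HL : 0 < L by rewrite /L; have := Rabs_pos l; lra.
  case: (Hd (e / (2 * M))) => [|d1 Hd1]. { apply: Rdiv_lt_0_compat; lra. }
  have He2 : 0 < Rmin 1 (e / (2 * L)). { apply: Rmin_pos; first lra. apply: Rdiv_lt_0_compat; lra. }
  move/filterlim_locally: HA => /(_ (mkposreal _ He2)) [d2 Hd2].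
  have Hm : 0 < Rmin d1 d2 by apply: Rmin_pos; apply: cond_pos.
  exists (mkposreal _ Hm) => h Hh0 /= Hh.
  have H1 := Hd1 h Hh0 (Rlt_le_trans _ _ _ Hh (Rmin_l _ _)).
  have H2 : Rabs (A (t + h) - A t) < Rmin 1 (e / (2 * L)).
  { apply: (Hd2 (t + h)). rewrite /ball /= /AbsRing_ball /abs /minus /plus /opp /=.
    have -> : t + h + - t = h by ring. apply: Rlt_le_trans Hh (Rmin_r _ _). }
  rewrite H0 Rmult_0_l Rminus_0_r. rewrite H0 Rminus_0_r in H1.
  have -> : d (t + h) * A (t + h) / h - l * A t = (d (t + h) / h - l) * A (t + h) + l * (A (t + h) - A t) by field.
  apply: Rle_lt_trans (Rabs_triang _ _) _. rewrite !Rabs_mult.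
  have HA1 : Rabs (A (t + h)) <= M.
  { have -> : A (t + h) = A t + (A (t + h) - A t) by ring. apply: Rle_trans (Rabs_triang _ _) _.
    have := Rmin_l 1 (e / (2 * L)). rewrite /M. lra. }
  have HA2 : Rabs (A (t + h) - A t) <= e / (2 * L) by have := Rmin_r 1 (e / (2 * L)); lra.
  have B1 : Rabs (d (t + h) / h - l) * Rabs (A (t + h)) < e / 2.
  { apply: Rle_lt_trans (_ : Rabs (d (t + h) / h - l) * M < _).
    - apply: Rmult_le_compat_l => //. exact: Rabs_pos.
    - have -> : e / 2 = e / (2 * M) * M by field; lra. exact: Rmult_lt_compat_r. }
  have B2 : Rabs l * Rabs (A (t + h) - A t) <= e / 2.
  { have -> : e / 2 = L * (e / (2 * L)) by field; lra.
    apply: Rmult_le_compat => //; try exact: Rabs_pos. rewrite /L; lra. }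
  lra.
Qed.

(* Hadamard's lemma: the increment is the step times a continuous mean of the derivative. *)
Lemma increment_mean (f f' : R -> R) x a : (forall t, is_derive f t (f' t)) -> (forall t, continuous f' t) ->
  f a - f x = (a - x) * RInt (fun s => f' (x + s * (a - x))) 0 1.
Proof.
  move=> Hf Hc.
  have Hcc : forall t, continuous (fun s => f' (x + s * (a - x))) t.
  { move=> t. apply: (continuous_scomp f' (fun s => x + s * (a - x))) => //. cont. }
  rewrite -RInt_Rscal; last by (apply: (@ex_RInt_continuous R_CompleteNormedModule) => t _; exact: Hcc).
  - rewrite (RInt_Derive_eq (fun s => f (x + s * (a - x))) _ 0 1).
    + f_equal; f_equal; ring.
    + move=> s. apply: is_derive_eq. apply: (is_derive_Rcomp f). exact: Hf.
      apply: is_derive_Rplus. apply: is_derive_const. apply: is_derive_Rmult. apply: is_derive_id. apply: is_derive_const.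
      rewrite /one /zero /=. ring.
    + move=> t. apply: continuous_Rmult => //. cont.
Qed.

(** The chain rule for a function with continuous partial derivatives. The increment is split along
    a broken path parallel to the axes, each leg is a coordinate step times a continuous mean, and
    each such product is differentiated where the step vanishes. *)
Lemma partials_path u ux uy uz (p q r : R -> R) t p' q' r' :
  partials u ux uy uz -> contG ux -> contG uy -> contG uz ->
  is_derive p t p' -> is_derive q t q' -> is_derive r t r' ->
  is_derive (fun t => u (p t, q t, r t)) t
   (p' * ux (p t, q t, r t) + q' * uy (p t, q t, r t) + r' * uz (p t, q t, r t)).
Proof.
  move=> Hu Hx Hy Hz Hp Hq Hr.
  have Cp := continuous_of_derive _ _ _ Hp. have Cq := continuous_of_derive _ _ _ Hq.
  have Cr := continuous_of_derive _ _ _ Hr.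
  set x := p t; set y := q t; set z := r t.
  set A := fun w : R * R * R => RInt (fun s => ux (x + s * (fst (fst w) - x), snd (fst w), snd w)) 0 1.
  set B := fun w : R * R * R => RInt (fun s => uy (x, y + s * (snd (fst w) - y), snd w)) 0 1.
  set D := fun w : R * R * R => RInt (fun s => uz (x, y, z + s * (snd w - z))) 0 1.
  have HA : forall w, continuous A w.
  { apply: (continuous_RInt_param (fun (w : R * R * R) s => ux (x + s * (fst (fst w) - x), snd (fst w), snd w))); first lra.
    move=> w s. apply: contG_comp => //; cont. }
  have HB : forall w, continuous B w.
  { apply: (continuous_RInt_param (fun (w : R * R * R) s => uy (x, y + s * (snd (fst w) - y), snd w))); first lra.
    move=> w s. apply: contG_comp => //; cont. }
  have HD : forall w, continuous D w.
  { apply: (continuous_RInt_param (fun (w : R * R * R) s => uz (x, y, z + s * (snd w - z)))); first lra.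
    move=> w s. apply: contG_comp => //; cont. }
  have E : forall s, u (p s, q s, r s) = u (x, y, z) + ((p s - x) * A (p s, q s, r s) + ((q s - y) * B (p s, q s, r s) + (r s - z) * D (p s, q s, r s))).
  { move=> s.
    have E1 := increment_mean (fun a => u (a, q s, r s)) (fun a => ux (a, q s, r s)) x (p s)
      (fun a => proj1 (Hu a (q s) (r s))) ltac:(move=> a; apply: contG_comp => //; cont).
    have E2 := increment_mean (fun a => u (x, a, r s)) (fun a => uy (x, a, r s)) y (q s)
      (fun a => proj1 (proj2 (Hu x a (r s)))) ltac:(move=> a; apply: contG_comp => //; cont).
    have E3 := increment_mean (fun a => u (x, y, a)) (fun a => uz (x, y, a)) z (r s)
      (fun a => proj2 (proj2 (Hu x y a))) ltac:(move=> a; apply: contG_comp => //; cont).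
    rewrite /A /B /D /=. lra. }
  have P : continuous (fun s => (p s, q s, r s)) t by cont.
  have Ax : A (p t, q t, r t) = ux (x, y, z).
  { rewrite /A /= (RInt_ext _ (fun _ => ux (x, y, z))).
    - rewrite RInt_const /scal /= /mult /=; ring.
    - move=> s _. do 3 f_equal; rewrite /x; ring. }
  have By : B (p t, q t, r t) = uy (x, y, z).
  { rewrite /B /= (RInt_ext _ (fun _ => uy (x, y, z))).
    - rewrite RInt_const /scal /= /mult /=; ring.
    - move=> s _. do 3 f_equal; rewrite /y; ring. }
  have Dz : D (p t, q t, r t) = uz (x, y, z).
  { rewrite /D /= (RInt_ext _ (fun _ => uz (x, y, z))).
    - rewrite RInt_const /scal /= /mult /=; ring.
    - move=> s _. do 3 f_equal; rewrite /z; ring. }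
  apply: (is_derive_ext (fun s => u (x, y, z) + ((p s - x) * A (p s, q s, r s) + ((q s - y) * B (p s, q s, r s) + (r s - z) * D (p s, q s, r s))))).
  { move=> s; by rewrite E. }
  apply: is_derive_eq.
  - apply: is_derive_Rplus; first exact: is_derive_const.
    apply: is_derive_Rplus; last apply: is_derive_Rplus.
    + apply: is_derive_zero_mult. apply: is_derive_Rminus. exact: Hp. exact: is_derive_const. rewrite /x; ring.
      apply: (continuous_scomp A) => //.
    + apply: is_derive_zero_mult. apply: is_derive_Rminus. exact: Hq. exact: is_derive_const. rewrite /y; ring.
      apply: (continuous_scomp B) => //.
    + apply: is_derive_zero_mult. apply: is_derive_Rminus. exact: Hr. exact: is_derive_const. rewrite /z; ring.
      apply: (continuous_scomp D) => //.
  - cbv beta. rewrite Ax By Dz /zero /=. ring.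
Qed.

Lemma Sm_path u (p q r : R -> R) t p' q' r' : Sm u ->
  is_derive p t p' -> is_derive q t q' -> is_derive r t r' ->
  CD (fun t => u (p t, q t, r t)) t
   (RtoC p' * PX u (p t, q t, r t) + RtoC q' * PY u (p t, q t, r t) + RtoC r' * PZ u (p t, q t, r t))%C.
Proof.
  move=> Hu Hp Hq Hr. have P := Sm_partials u Hu.
  have [cx1 cx2] := Sm_cont _ (Sm_PX _ Hu). have [cy1 cy2] := Sm_cont _ (Sm_PY _ Hu).
  have [cz1 cz2] := Sm_cont _ (Sm_PZ _ Hu).
  split; apply: is_derive_eq.
  - apply: (partials_path (fun g => Re (u g)) (fun g => Re (PX u g)) (fun g => Re (PY u g)) (fun g => Re (PZ u g)) p q r t p' q' r') => //.
    move=> x y z. case: (P x y z) => [[? ?] [[? ?] [? ?]]]. by split; [|split].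
  - rewrite /=; ring.
  - apply: (partials_path (fun g => Im (u g)) (fun g => Im (PX u g)) (fun g => Im (PY u g)) (fun g => Im (PZ u g)) p q r t p' q' r') => //.
    move=> x y z. case: (P x y z) => [[? ?] [[? ?] [? ?]]]. by split; [|split].
  - rewrite /=; ring.
Qed.

Lemma Ck_schwarz u : Ck 2 u -> part_x (part_y u) = part_y (part_x u) /\ part_x (part_z u) = part_z (part_x u) /\ part_y (part_z u) = part_z (part_y u).
Proof.
  move=> Hu. have P := Ck_partials _ _ Hu.
  have [_ [_ [Hx [Hy Hz]]]] := Hu.
  have Px := Ck_partials 0 _ Hx. have Py := Ck_partials 0 _ Hy. have Pz := Ck_partials 0 _ Hz.
  case: Hx => [_ [_ [_ [cxy cxz]]]]. case: Hy => [_ [_ [cyx [_ cyz]]]]. case: Hz => [_ [_ [czx [czy _]]]].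
  have C2d : forall (w : G -> R) (f h k : R * R -> R), Ck 0 w -> (forall p, continuous f p) -> (forall p, continuous h p) ->
    (forall p, continuous k p) -> forall a b, continuity_2d_pt (fun a b => w (f (a, b), h (a, b), k (a, b))) a b.
  { move=> w f h k Hw Hf Hh Hk a b. apply: (jcont_2d (fun a b => w (f (a, b), h (a, b), k (a, b)))) => p t.
    have E : (fun q : R * R => w (f (fst q, snd q), h (fst q, snd q), k (fst q, snd q))) = (fun q => w (f q, h q, k q)).
    { apply: functional_extensionality; by case. }
    rewrite E. apply: contG_comp => //. exact: (Ck_contG _ _ Hw). }
  split; [|split]; apply: functional_extensionality; move=> [[x y] z].
  - apply: (Schwarz (fun a b => u (a, b, z)) x y).
    + exists (mkposreal 1 Rlt_0_1) => a b _ _. split; [|split; [|split]].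
      * exists (part_x u (a, b, z)); exact: (proj1 (P a b z)). * exists (part_y u (a, b, z)); exact: (proj1 (proj2 (P a b z))).
        * exists (part_x (part_y u) (a, b, z)); exact: (proj1 (Py a b z)). * exists (part_y (part_x u) (a, b, z)); exact: (proj1 (proj2 (Px a b z))).
    + apply: (C2d _ (fun q => fst q) (fun q => snd q) (fun _ => z) cyx); move=> q; cont.
    + apply: (C2d _ (fun q => fst q) (fun q => snd q) (fun _ => z) cxy); move=> q; cont.
  - apply: (Schwarz (fun a b => u (a, y, b)) x z).
    + exists (mkposreal 1 Rlt_0_1) => a b _ _. split; [|split; [|split]].
      * exists (part_x u (a, y, b)); exact: (proj1 (P a y b)). * exists (part_z u (a, y, b)); exact: (proj2 (proj2 (P a y b))).
        * exists (part_x (part_z u) (a, y, b)); exact: (proj1 (Pz a y b)). * exists (part_z (part_x u) (a, y, b)); exact: (proj2 (proj2 (Px a y b))).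
    + apply: (C2d _ (fun q => fst q) (fun _ => y) (fun q => snd q) czx); move=> q; cont.
    + apply: (C2d _ (fun q => fst q) (fun _ => y) (fun q => snd q) cxz); move=> q; cont.
  - apply: (Schwarz (fun a b => u (x, a, b)) y z).
    + exists (mkposreal 1 Rlt_0_1) => a b _ _. split; [|split; [|split]].
      * exists (part_y u (x, a, b)); exact: (proj1 (proj2 (P x a b))). * exists (part_z u (x, a, b)); exact: (proj2 (proj2 (P x a b))).
        * exists (part_y (part_z u) (x, a, b)); exact: (proj1 (proj2 (Pz x a b))). * exists (part_z (part_y u) (x, a, b)); exact: (proj2 (proj2 (Py x a b))).
    + apply: (C2d _ (fun _ => x) (fun q => fst q) (fun q => snd q) czy); move=> q; cont.
    + apply: (C2d _ (fun _ => x) (fun q => fst q) (fun q => snd q) cyz); move=> q; cont.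
Qed.

Lemma Sm_schwarz u : Sm u -> PX (PY u) = PY (PX u) /\ PX (PZ u) = PZ (PX u) /\ PY (PZ u) = PZ (PY u).
Proof.
  move=> Hu. case: (Hu 2%nat) => [H1 H2].
  case: (Ck_schwarz _ H1) => [E1 [E2 E3]]. case: (Ck_schwarz _ H2) => [E4 [E5 E6]].
  rewrite /PX /PY /PZ /=.
  split; [|split]; apply: functional_extensionality => g; congr pair.
  - by have := f_equal (fun f => f g) E1. - by have := f_equal (fun f => f g) E4.
  - by have := f_equal (fun f => f g) E2. - by have := f_equal (fun f => f g) E5.
  - by have := f_equal (fun f => f g) E3. - by have := f_equal (fun f => f g) E6.
Qed.

(** * Integration over the fundamental box *)

Lemma RInt_zero_nonneg (f : R -> R) a b : a < b -> (forall t, continuous f t) ->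
  (forall t, a <= t <= b -> 0 <= f t) -> RInt f a b = 0 -> forall t, a <= t <= b -> f t = 0.
Proof.
  move=> Hab Hc Hp H0 x Hx. apply: NNPP => Hn.
  have Hfx : 0 < f x by case: (Hp x Hx) => // E; exfalso; apply: Hn.
  have He : 0 < f x / 2 by lra.
  have /filterlim_locally /(_ (mkposreal _ He)) [d Hd] := Hc x.
  have Hdp := cond_pos d.
  set u := Rmax a (x - d / 2). set v := Rmin b (x + d / 2).
  have Hu : a <= u <= x /\ x - d < u /\ (u = a \/ u < x) by rewrite /u /Rmax; case: Rle_dec => ?; lra.
  have Hv : x <= v <= b /\ v < x + d /\ (v = b \/ x < v) by rewrite /v /Rmin; case: Rle_dec => ?; lra.
  have Huv : u < v.
  { rewrite /u /v /Rmax /Rmin; do 2 case: Rle_dec => ?; lra. }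
  have E1 := RInt_RChasles f a u b Hc. have E2 := RInt_RChasles f u v b Hc.
  have exf : forall p q, ex_RInt f p q.
  { move=> p q. apply: (@ex_RInt_continuous R_CompleteNormedModule) => t _; exact: Hc. }
  have P1 : 0 <= RInt f a u by apply: RInt_ge_0 => //; [lra | move=> t Ht; apply: Hp; lra].
  have P2 : 0 <= RInt f v b by apply: RInt_ge_0 => //; [lra | move=> t Ht; apply: Hp; lra].
  have P3 : (v - u) * (f x / 2) <= RInt f u v.
  { have -> : (v - u) * (f x / 2) = RInt (fun _ => f x / 2) u v by rewrite RInt_const.
    apply: RInt_le => //; first lra. apply: ex_RInt_const.
    move=> t Ht. have := Hd t. rewrite /ball /= /AbsRing_ball /abs /minus /plus /opp /= => Hb.
    have : Rabs (f t + - f x) < f x / 2. { apply: Hb. apply: Rabs_def1; lra. }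
    move/Rabs_def2. lra. }
  have : 0 < (v - u) * (f x / 2) by apply: Rmult_lt_0_compat; lra. lra.
Qed.

Lemma contG_plus u v : contG u -> contG v -> contG (fun g => u g + v g).
Proof. move=> H1 H2 g. exact: continuous_Rplus. Qed.
Lemma contG_mult u v : contG u -> contG v -> contG (fun g => u g * v g).
Proof. move=> H1 H2 g. exact: continuous_Rmult. Qed.
Lemma contG_const c : contG (fun _ => c).
Proof. move=> g. apply: continuous_const. Qed.
Lemma contG_scal c u : contG u -> contG (fun g => c * u g).
Proof. move=> H; apply: contG_mult => //; exact: contG_const. Qed.
Lemma contG_minus u v : contG u -> contG v -> contG (fun g => u g - v g).
Proof. move=> H1 H2 g. exact: continuous_Rminus. Qed.

Section Box.
Variables (a b w2 r : R).
Hypotheses (Ha : 0 < a) (Hw : 0 < w2) (Hr : 0 < r).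

Definition Iz (h : G -> R) (x y : R) : R := RInt (fun z => h (x, y, z)) 0 r.
Definition Iyz (h : G -> R) (x : R) : R := RInt (fun y => Iz h x y) 0 w2.
Definition I3 (h : G -> R) : R := RInt (fun x => Iyz h x) 0 a.

Lemma cont_z h : contG h -> forall x y z, continuous (fun z => h (x, y, z)) z.
Proof. move=> H x y z. apply: contG_comp => //; cont. Qed.

Lemma jcont_Iz h : contG h -> jcont (fun x y => Iz h x y).
Proof.
  move=> H x y.
  have HH : jcont (fun (q : R * R) z => h (fst q, snd q, z)).
  { move=> q z. apply: contG_comp => //; cont. }
  exact: (continuous_RInt_param _ 0 r (Rlt_le _ _ Hr) HH (x, y)).
Qed.

Lemma cont_Iz h x : contG h -> forall y, continuous (fun y => Iz h x y) y.
Proof. move=> H y. exact: (jcont_slice (fun x y => Iz h x y) x (jcont_Iz h H)). Qed.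

Lemma cont_Iyz h : contG h -> forall x, continuous (fun x => Iyz h x) x.
Proof.
  move=> H x. exact: (continuous_RInt_param (fun x y => Iz h x y) 0 w2 (Rlt_le _ _ Hw) (jcont_Iz h H)).
Qed.

Lemma ex_RInt_c (f : R -> R) p q : (forall t, continuous f t) -> ex_RInt f p q.
Proof. move=> H. apply: (@ex_RInt_continuous R_CompleteNormedModule) => t _. exact: H. Qed.

Lemma I3_plus h k : contG h -> contG k -> I3 (fun g => h g + k g) = I3 h + I3 k.
Proof.
  move=> Hh Hk. rewrite /I3 -RInt_Rplus; try (apply: ex_RInt_c; exact: cont_Iyz).
  apply: RInt_ext => x _. rewrite /Iyz -RInt_Rplus; try (apply: ex_RInt_c; exact: cont_Iz).
  apply: RInt_ext => y _. rewrite /Iz -RInt_Rplus //; apply: ex_RInt_c; exact: cont_z.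
Qed.

Lemma I3_scal c h : contG h -> I3 (fun g => c * h g) = c * I3 h.
Proof.
  move=> Hh. rewrite /I3 -RInt_Rscal; last (apply: ex_RInt_c; exact: cont_Iyz).
  apply: RInt_ext => x _. rewrite /Iyz -RInt_Rscal; last (apply: ex_RInt_c; exact: cont_Iz).
  apply: RInt_ext => y _. rewrite /Iz -RInt_Rscal //; apply: ex_RInt_c; exact: cont_z.
Qed.

Definition in_box (g : G) : Prop :=
  0 <= fst (fst g) <= a /\ 0 <= snd (fst g) <= w2 /\ 0 <= snd g <= r.

Lemma I3_le h k : contG h -> contG k -> (forall g, in_box g -> h g <= k g) -> I3 h <= I3 k.
Proof.
  move=> Hh Hk H. apply: RInt_le; [lra|apply: ex_RInt_c; exact: cont_Iyz|apply: ex_RInt_c; exact: cont_Iyz|].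
  move=> x Hx. apply: RInt_le; [lra|apply: ex_RInt_c; exact: cont_Iz|apply: ex_RInt_c; exact: cont_Iz|].
  move=> y Hy. apply: RInt_le; [lra|apply: ex_RInt_c; exact: cont_z|apply: ex_RInt_c; exact: cont_z|].
  move=> z Hz. apply: H. rewrite /in_box /=. lra.
Qed.

Lemma I3_const c : I3 (fun _ => c) = a * w2 * r * c.
Proof. rewrite /I3 /Iyz /Iz !RInt_const /scal /= /mult /=. ring. Qed.

Lemma I3_ge0 h : contG h -> (forall g, 0 <= h g) -> 0 <= I3 h.
Proof.
  move=> Hh H. have <- : I3 (fun _ => 0) = 0 by rewrite I3_const; ring.
  apply: I3_le => //. exact: contG_const.
Qed.

Lemma I3_zero h : contG h -> (forall g, 0 <= h g) -> I3 h = 0 -> forall g, in_box g -> h g = 0.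
Proof.
  move=> Hh H H0 [[x y] z] [Hx [Hy Hz]]. rewrite /= in Hx Hy Hz.
  have P1 : forall x y, 0 <= Iz h x y.
  { move=> x' y'. apply: RInt_ge_0; [lra|apply: ex_RInt_c; exact: cont_z|by []]. }
  have P2 : forall x, 0 <= Iyz h x.
  { move=> x'. apply: RInt_ge_0; [lra|apply: ex_RInt_c; exact: cont_Iz|by []]. }
  have E1 : Iyz h x = 0 by apply: (RInt_zero_nonneg (fun x => Iyz h x) 0 a) => //; exact: cont_Iyz.
  have E2 : Iz h x y = 0 by apply: (RInt_zero_nonneg (fun y => Iz h x y) 0 w2) => //; exact: cont_Iz.
  exact: (RInt_zero_nonneg (fun z => h (x, y, z)) 0 r Hr (cont_z h Hh x y) (fun t _ => H _) E2).
Qed.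

(* Left invariance under the three generators of the lattice. *)
Definition invar (h : G -> R) : Prop := forall x y z,
  h (x + a, y, z + a * y) = h (x, y, z) /\ h (x + b, y + w2, z + b * y) = h (x, y, z) /\
  h (x, y, z + r) = h (x, y, z).

(** The invariant fields are divergence free and the boundary terms cancel in pairs: opposite faces
    of the box are identified by the lattice, up to a shift in [z] and, for the faces of constant
    [y], a shift in [x]. Both shifts disappear after integration over a full period. *)
Lemma I3_parts h hx hy hz : contG h -> contG hx -> contG hy -> contG hz -> partials h hx hy hz -> invar h ->
  I3 hx = 0 /\ I3 (fun g => hy g + fst (fst g) * hz g) = 0 /\ I3 hz = 0.
Proof.
  move=> Ch Cx Cy Cz P Inv.
  have Ez0 : forall x y, Iz hz x y = 0.
  { move=> x y. rewrite /Iz (RInt_Derive_eq (fun z => h (x, y, z))).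
    - rewrite -{1}(Rplus_0_l r). case: (Inv x y 0) => [_ [_ ->]]. ring.
    - move=> z; apply P.
    - exact: cont_z. }
  (* An integral over a full period in [z] does not see the central shifts [a * y] and [b * y] of
     the lattice action. *)
  have Hshift : forall x y c, Iz h x y = RInt (fun z => h (x, y, z + c)) 0 r.
  { move=> x y c. symmetry. apply: (RInt_period (fun z => h (x, y, z))). exact: cont_z. move=> t; apply Inv. }
  have HHa : forall x y, Iz h (x + a) y = Iz h x y.
  { move=> x y. rewrite (Hshift (x + a) y (a * y)). apply: RInt_ext => z _. apply Inv. }
  have HHb : forall x y, Iz h (x + b) (y + w2) = Iz h x y.
  { move=> x y. rewrite (Hshift (x + b) (y + w2) (b * y)). apply: RInt_ext => z _. apply Inv. }
  have Dx : forall x y, is_derive (fun x => Iz h x y) x (Iz hx x y).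
  { move=> x y. apply: (is_derive_RInt_jcont (fun x z => h (x, y, z)) (fun x z => hx (x, y, z))); first lra.
    - move=> x' t. apply P.
    - move=> p t. apply: contG_comp => //; cont.
    - move=> p t. apply: contG_comp => //; cont. }
  have Dy : forall x y, is_derive (fun y => Iz h x y) y (Iz hy x y).
  { move=> x y. apply: (is_derive_RInt_jcont (fun y z => h (x, y, z)) (fun y z => hy (x, y, z))); first lra.
    - move=> x' t. apply P.
    - move=> p t. apply: contG_comp => //; cont.
    - move=> p t. apply: contG_comp => //; cont. }
  split; [|split].
  - rewrite /I3 (RInt_Derive_eq (fun x => Iyz h x)).
    + rewrite -{1}(Rplus_0_l a). have -> : Iyz h (0 + a) = Iyz h 0. { apply: RInt_ext => y _. exact: HHa. } ring.
    + move=> x. apply: (is_derive_RInt_jcont (fun x y => Iz h x y) (fun x y => Iz hx x y)); first lra.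
      * move=> x' t; exact: Dx. * exact: jcont_Iz. * exact: jcont_Iz.
    + exact: cont_Iyz.
  - rewrite I3_plus //; last first.
    { apply: contG_mult => // g. cont. }
    have -> : I3 (fun g => fst (fst g) * hz g) = 0.
    { rewrite /I3 (RInt_ext _ (fun _ => 0)).
      - rewrite RInt_const /scal /= /mult /=; ring.
      - move=> x _. rewrite /Iyz (RInt_ext _ (fun _ => 0)).
        + rewrite RInt_const /scal /= /mult /=; ring.
        + move=> y _. rewrite /Iz /= RInt_Rscal; last (apply: ex_RInt_c; exact: cont_z).
          move: (Ez0 x y); rewrite /Iz => ->. ring. }
    have -> : I3 hy = 0; last ring.
    rewrite /I3 (RInt_ext _ (fun x => Iz h x w2 - Iz h x 0)).
    + have Cw : forall y x, continuous (fun x => Iz h x y) x.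
      { move=> y x. apply: (continuous_comp (fun x => (x, y)) (fun q : R * R => Iz h (fst q) (snd q))); first by cont.
        exact: (jcont_Iz h Ch). }
      rewrite RInt_Rminus; try (apply: ex_RInt_c; exact: Cw).
      (* The face [y = w2] is the face [y = 0] moved by [b] in the [x] direction, which is harmless
         over the period [a]. *)
      rewrite -(RInt_period (fun x => Iz h x w2) a b).
      * rewrite (RInt_ext _ (fun x => Iz h x 0)). ring.
        move=> x _. rewrite -{1}(Rplus_0_l w2). exact: HHb.
      * exact: Cw.
      * move=> t. exact: HHa.
    + move=> x _. rewrite /Iyz (RInt_Derive_eq (fun y => Iz h x y)) //. exact: cont_Iz.
  - rewrite /I3 (RInt_ext _ (fun _ => 0)).
    + rewrite RInt_const /scal /= /mult /=; ring.
    + move=> x _. rewrite /Iyz (RInt_ext _ (fun _ => 0)).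
      * rewrite RInt_const /scal /= /mult /=; ring.
      * move=> y _. exact: Ez0.
Qed.

Definition CI (u : G -> C) : C := (I3 (fun g => Re (u g)), I3 (fun g => Im (u g))).

Lemma CI_plus u v : CcontG u -> CcontG v -> CI (fun g => u g + v g)%C = (CI u + CI v)%C.
Proof. move=> [? ?] [? ?]. apply: C_ext; rewrite /= -I3_plus //. Qed.

Lemma CI_scal c u : CcontG u -> CI (fun g => c * u g)%C = (c * CI u)%C.
Proof.
  move=> [H1 H2]. apply: C_ext => /=.
  - rewrite -!I3_scal //.
    have -> : I3 (fun g => fst c * fst (u g) - snd c * snd (u g)) = I3 (fun g => fst c * Re (u g) + (-1) * (snd c * Im (u g))).
    { f_equal; apply: functional_extensionality => g; rewrite /Re /Im; ring. }
    rewrite I3_plus; [|exact: contG_scal|do 2 apply: contG_scal; done].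
    rewrite (I3_scal (-1)); last exact: contG_scal. ring.
  - rewrite -!I3_scal // I3_plus //; exact: contG_scal.
Qed.

Lemma CI_conj u : CcontG u -> CI (fun g => Cconj (u g)) = Cconj (CI u).
Proof.
  move=> [H1 H2]. apply: C_ext => //=.
  have -> : (fun g : G => - snd (u g)) = (fun g => (-1) * Im (u g)).
  { apply: functional_extensionality => g; rewrite /Im; ring. }
  rewrite I3_scal //; ring.
Qed.

Definition ip (u v : G -> C) : C := CI (fun g => u g * Cconj (v g))%C.

Lemma CcontG_plus u v : CcontG u -> CcontG v -> CcontG (fun g => u g + v g)%C.
Proof. move=> [? ?] [? ?]; split; exact: contG_plus. Qed.
Lemma CcontG_conj u : CcontG u -> CcontG (fun g => Cconj (u g)).
Proof.
  move=> [? H]; split => //= g. apply: (continuous_opp (fun g => Im (u g))). exact: H.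
Qed.
Lemma CcontG_mult u v : CcontG u -> CcontG v -> CcontG (fun g => u g * v g)%C.
Proof. move=> [? ?] [? ?]; split; [apply: contG_minus|apply: contG_plus]; exact: contG_mult. Qed.
Lemma CcontG_prod u v : CcontG u -> CcontG v -> CcontG (fun g => u g * Cconj (v g))%C.
Proof. move=> Hu Hv. apply: CcontG_mult => //. exact: CcontG_conj. Qed.

Lemma ip_plus_l u v w : CcontG u -> CcontG v -> CcontG w -> ip (fun g => u g + v g)%C w = (ip u w + ip v w)%C.
Proof.
  move=> Hu Hv Hw'. rewrite /ip -CI_plus; try exact: CcontG_prod.
  f_equal; funring.
Qed.

Lemma ip_scal_l c u w : CcontG u -> CcontG w -> ip (fun g => c * u g)%C w = (c * ip u w)%C.
Proof.
  move=> Hu Hw'. rewrite /ip -CI_scal; try exact: CcontG_prod.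
  f_equal; funring.
Qed.

Lemma ip_conj u v : CcontG u -> CcontG v -> ip v u = Cconj (ip u v).
Proof.
  move=> Hu Hv. rewrite /ip -CI_conj; last exact: CcontG_prod.
  f_equal; apply: functional_extensionality => g. Cring.
Qed.

Lemma ip_self u : CcontG u -> ip u u = RtoC (I3 (fun g => Cmod (u g) ^ 2)).
Proof.
  move=> Hu. apply: C_ext => /=.
  - f_equal; apply: functional_extensionality => g. change (Cmod (u g) * (Cmod (u g) * 1)) with (Cmod (u g) ^ 2).
    rewrite Cmod_sq /Re /Im; ring.
  - have -> : (fun g : G => fst (u g) * - snd (u g) + snd (u g) * fst (u g)) = (fun _ => 0).
    { funring. }
    rewrite I3_const; ring.
Qed.

Lemma contG_Cmod2 u : CcontG u -> contG (fun g => Cmod (u g) ^ 2).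
Proof.
  move=> [H1 H2]. have -> : (fun g => Cmod (u g) ^ 2) = (fun g => Re (u g) * Re (u g) + Im (u g) * Im (u g)).
  { apply: functional_extensionality => g. rewrite Cmod_sq; ring. }
  apply: contG_plus; exact: contG_mult.
Qed.
End Box.

(** * Equivariant functions and invariant vector fields *)

Definition inv_by (gam : G) (e : C) (u : G -> C) : Prop := forall g, u (gmul gam g) = (e * u g)%C.

(** The left-invariant field [Y]; in these coordinates [X] and [Z] are the plain partial derivatives
    [PX] and [PZ]. *)
Definition VY (u : G -> C) : G -> C := fun g => (PY u g + RtoC (fst (fst g)) * PZ u g)%C.

Lemma Sm_VY u : Sm u -> Sm (VY u).
Proof.
  move=> H. apply: Sm_plus. exact: Sm_PY. apply: Sm_mult. exact: Sm_x. exact: Sm_PZ.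
Qed.

Lemma CD_unique f t l l' : CD f t l -> CD f t l' -> l = l'.
Proof. by move=> /CD_Cderive <- /CD_Cderive <-. Qed.

(** Left translations commute with left-invariant fields. [PY] alone is not preserved, since the
    translation adds [p * y] to the central coordinate; this produces the extra [p] times [PZ] in
    the assertion [E], which [VY] absorbs. *)
Lemma inv_by_fields gam e u : Sm u -> inv_by gam e u ->
  inv_by gam e (PX u) /\ inv_by gam e (VY u) /\ inv_by gam e (PZ u).
Proof.
  case: gam => [[p q] s] Hu H. have P := Sm_partials u Hu.
  have HZ : inv_by (p, q, s) e (PZ u).
  { move=> [[x y] z]. apply: (CD_unique (fun t => u (p + x, q + y, s + t + p * y)) z).
    - apply: CD_eq. apply: (Sm_path u (fun _ => p + x) (fun _ => q + y) (fun t => s + t + p * y) z 0 0 1) => //.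
      apply: is_derive_const. apply: is_derive_const. auto_derive => //; ring. rewrite /gmul; cbv beta; ring.
    - apply: (CD_ext (fun t => e * u (x, y, t))%C). { move=> t. by rewrite -H. } apply: CD_scal. exact: (proj2 (proj2 (P x y z))). }
  split; [|split] => //.
  - move=> [[x y] z]. apply: (CD_unique (fun t => u (p + t, q + y, s + z + p * y)) x).
    + apply: CD_eq. apply: (Sm_path u (fun t => p + t) (fun _ => q + y) (fun t => s + z + p * y) x 1 0 0) => //.
      auto_derive => //; ring. apply: is_derive_const. apply: is_derive_const. rewrite /gmul; cbv beta; ring.
    + apply: (CD_ext (fun t => e * u (t, y, z))%C). { move=> t. by rewrite -H. } apply: CD_scal. exact: (proj1 (P x y z)).
  - move=> [[x y] z].
    have E : (PY u (gmul (p, q, s) (x, y, z)) + RtoC p * PZ u (gmul (p, q, s) (x, y, z)))%C = (e * PY u (x, y, z))%C.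
    { apply: (CD_unique (fun t => u (p + x, q + t, s + z + p * t)) y).
      + apply: CD_eq. apply: (Sm_path u (fun t => p + x) (fun t => q + t) (fun t => s + z + p * t) y 0 1 p) => //.
        apply: is_derive_const. auto_derive => //; ring. auto_derive => //; ring. rewrite /gmul; cbv beta; ring.
      + apply: (CD_ext (fun t => e * u (x, t, z))%C). { move=> t. by rewrite -H. } apply: CD_scal. exact: (proj1 (proj2 (P x y z))). }
    rewrite /VY. have := HZ (x, y, z). move: E. rewrite /= => E1 E2.
    rewrite RtoC_plus.
    transitivity (e * PY u (x, y, z) + RtoC x * PZ u (p + x, q + y, s + z + p * y)%R)%C; first by rewrite -E1; ring.
    rewrite E2. ring.
Qed.

(** The bracket relations: [[X, Y] = Z] with [Z] central. They reduce to the symmetry of second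
    partial derivatives and the derivative of the coefficient [x] in [VY]. *)
Lemma VY_comm u : Sm u -> PX (VY u) = (fun g => VY (PX u) g + PZ u g)%C /\
  PX (PZ u) = PZ (PX u) /\ VY (PZ u) = PZ (VY u).
Proof.
  move=> Hu. case: (Sm_schwarz u Hu) => [E1 [E2 E3]].
  have Px1 : Cpartials (fun g => RtoC (fst (fst g))) (fun _ => 1%C) (fun _ => 0%C) (fun _ => 0%C).
  { move=> x y z; split; [|split] => /=.
    - apply: (CD_RtoC (fun t => t)). apply: is_derive_id.
    - apply: CD_const. - apply: CD_const. }
  have P := Cpartials_plus _ _ _ _ _ _ _ _ (Sm_partials _ (Sm_PY _ Hu)) (Cpartials_mult _ _ _ _ _ _ _ _ Px1 (Sm_partials _ (Sm_PZ _ Hu))).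
  case: (Cpartials_P _ _ _ _ P) => [EX [EY EZ]].
  split; [|split] => //.
  - rewrite /VY EX. apply: functional_extensionality => g. rewrite E1 E2. ring.
  - rewrite {2}/VY EZ. apply: functional_extensionality => g. rewrite /VY E3. ring.
Qed.

(** The covering argument is run one coordinate at a time: tubes in [z], then slabs in [y], then the
    cube. *)
Lemma contG_bounded h R0 : contG h -> exists M, 0 <= M /\ forall x y z, Rabs x <= R0 -> Rabs y <= R0 -> Rabs z <= R0 -> Rabs (h (x, y, z)) <= M.
Proof.
  move=> H. case: (Rle_lt_dec 0 R0) => HR; last first.
  { exists 0; split; first lra. move=> x y z Hx. have := Rabs_pos x; lra. }
  have L3 : forall x y, exists (d : posreal) M, forall x' y' z, Rabs (x' - x) < d -> Rabs (y' - y) < d -> -R0 <= z <= R0 -> Rabs (h (x', y', z)) <= M.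
  { move=> x y.
    have J : jcont (U := prod_UniformSpace R_UniformSpace R_UniformSpace) (fun q z => h (fst q, snd q, z)).
    { move=> q z. apply: contG_comp => //; cont. }
    case: (loc_bounded_RInt _ (x, y) (-R0) R0 ltac:(lra) J) => d [M HM].
    exists d, M => x' y' z Hx Hy Hz. by apply: (HM (x', y') z). }
  have L2 : forall x, exists (d : posreal) M, forall x' y z, Rabs (x' - x) < d -> -R0 <= y <= R0 -> -R0 <= z <= R0 -> Rabs (h (x', y, z)) <= M.
  { move=> x. apply: (interval_cover (fun p q => exists (d : posreal) M, forall x' y z, Rabs (x' - x) < d -> p <= y <= q -> -R0 <= z <= R0 -> Rabs (h (x', y, z)) <= M)); last lra.
    - move=> p q s Hpq [d1 [M1 H1]] [d2 [M2 H2]].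
      have Hm : 0 < Rmin d1 d2 by apply: Rmin_pos; apply: cond_pos.
      exists (mkposreal _ Hm), (Rmax M1 M2) => x' y z /= Hx Hy Hz.
      case: (Rle_lt_dec y q) => Hq.
      + apply: Rle_trans (Rmax_l _ _). apply: H1 => //; last lra. apply: Rlt_le_trans Hx (Rmin_l _ _).
      + apply: Rle_trans (Rmax_r _ _). apply: H2 => //; last lra. apply: Rlt_le_trans Hx (Rmin_r _ _).
    - move=> y _. case: (L3 x y) => d [M HM]. exists d => u v Hu Huv Hv. exists d, M => x' y' z Hx Hy Hz.
      apply: HM => //. apply: Rabs_def1; lra. }
  have [M HM] : exists M, forall x y z, -R0 <= x <= R0 -> -R0 <= y <= R0 -> -R0 <= z <= R0 -> Rabs (h (x, y, z)) <= M.
  { apply: (interval_cover (fun p q => exists M, forall x y z, p <= x <= q -> -R0 <= y <= R0 -> -R0 <= z <= R0 -> Rabs (h (x, y, z)) <= M)); last lra.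
    - move=> p q s Hpq [M1 H1] [M2 H2]. exists (Rmax M1 M2) => x y z Hx Hy Hz.
      case: (Rle_lt_dec x q) => Hq.
      + apply: Rle_trans (Rmax_l _ _). apply: H1 => //; lra.
      + apply: Rle_trans (Rmax_r _ _). apply: H2 => //; lra.
    - move=> x _. case: (L2 x) => d [M HM]. exists d => u v Hu Huv Hv. exists M => x' y z Hx Hy Hz.
      apply: HM => //. apply: Rabs_def1; lra. }
  exists (Rmax 0 M); split; first exact: Rmax_l.
  move=> x y z Hx Hy Hz. apply: Rle_trans (Rmax_r _ _). by apply: HM; apply/Rabs_le_between.
Qed.

Lemma Rabs_Re_Im (z : C) : Rabs (Re z) <= Cmod z /\ Rabs (Im z) <= Cmod z /\ Cmod z <= Rabs (Re z) + Rabs (Im z).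
Proof.
  have H := Cmod_sq z. have H0 := Cmod_ge_0 z.
  have A1 := Rabs_pos (Re z). have A2 := Rabs_pos (Im z).
  have B1 : Rabs (Re z) ^ 2 = Re z ^ 2 by rewrite pow2_abs.
  have B2 : Rabs (Im z) ^ 2 = Im z ^ 2 by rewrite pow2_abs.
  have S1 := pow2_ge_0 (Re z). have S2 := pow2_ge_0 (Im z).
  split; [|split]; nra.
Qed.

(** * Fourier coefficients and Fejer means *)

Definition CR (f : R -> C) (a b : R) : C := (RInt (fun t => Re (f t)) a b, RInt (fun t => Im (f t)) a b).
Definition ccont (f : R -> C) : Prop := (forall t, continuous (fun t => Re (f t)) t) /\ (forall t, continuous (fun t => Im (f t)) t).

Lemma ccont_plus f g : ccont f -> ccont g -> ccont (fun t => f t + g t)%C.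
Proof. move=> [? ?] [? ?]; split => t; exact: continuous_Rplus. Qed.
Lemma ccont_mult f g : ccont f -> ccont g -> ccont (fun t => f t * g t)%C.
Proof. move=> [? ?] [? ?]; split => t; [apply: continuous_Rminus|apply: continuous_Rplus]; exact: continuous_Rmult. Qed.
Lemma ccont_const c : ccont (fun _ => c).
Proof. split => t; apply: continuous_const. Qed.
Lemma ccont_CD f df : (forall t, CD f t (df t)) -> ccont f.
Proof. move=> H; split => t; case: (H t) => [? ?]; apply: continuous_of_derive; eassumption. Qed.
Lemma ccont_cis c : ccont (fun t => cis (c * t)).
Proof.
  apply: (ccont_CD _ (fun t => Ci * RtoC c * cis (c * t))%C) => t. apply: (CD_cis_comp (fun t => c * t)).
  auto_derive => //; ring.
Qed.
Lemma ccont_scal c f : ccont f -> ccont (fun t => c * f t)%C.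
Proof. move=> H; apply: ccont_mult => //; exact: ccont_const. Qed.
Lemma ccont_shift f c : ccont f -> ccont (fun t => f (t + c)).
Proof.
  move=> [H1 H2]; split => t;
  [apply: (continuous_scomp (fun t => Re (f t)) (fun t => t + c)) | apply: (continuous_scomp (fun t => Im (f t)) (fun t => t + c))] => //; cont.
Qed.

Lemma CR_plus f g a b : ccont f -> ccont g -> CR (fun t => f t + g t)%C a b = (CR f a b + CR g a b)%C.
Proof. move=> [? ?] [? ?]; apply: C_ext => /=; rewrite -RInt_Rplus //; exact: ex_RInt_c. Qed.

Lemma CR_scal c f a b : ccont f -> CR (fun t => c * f t)%C a b = (c * CR f a b)%C.
Proof.
  move=> [H1 H2].
  have E1 := ex_RInt_c _ a b H1. have E2 := ex_RInt_c _ a b H2.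
  have C1 : forall k, ex_RInt (fun t => k * Re (f t)) a b.
  { move=> k. apply: ex_RInt_c => t. apply: continuous_Rmult => //; cont. }
  have C2 : forall k, ex_RInt (fun t => k * Im (f t)) a b.
  { move=> k. apply: ex_RInt_c => t. apply: continuous_Rmult => //; cont. }
  apply: C_ext => /=.
  - rewrite -(RInt_Rscal (fun t => Re (f t)) (fst c)) // -(RInt_Rscal (fun t => Im (f t)) (snd c)) //.
    rewrite -RInt_Rminus //.
  - rewrite -(RInt_Rscal (fun t => Re (f t)) (snd c)) // -(RInt_Rscal (fun t => Im (f t)) (fst c)) //.
    rewrite -RInt_Rplus //.
Qed.

Lemma CR_ext f g a b : (forall t, f t = g t) -> CR f a b = CR g a b.
Proof. by move=> /functional_extensionality ->. Qed.

Lemma CR_period f c : ccont f -> (forall t, f (t + 1) = f t) -> CR (fun t => f (t + c)) 0 1 = CR f 0 1.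
Proof.
  move=> [H1 H2] P; apply: C_ext => /=.
  - apply: (RInt_period (fun t => Re (f t))) => // t. by rewrite P.
  - apply: (RInt_period (fun t => Im (f t))) => // t. by rewrite P.
Qed.

Fixpoint csum (f : nat -> C) (n : nat) : C :=
  match n with O => 0%C | S k => (csum f k + f k)%C end.

Definition zpart (a : Z -> C) (n : nat) : C :=
  (a 0%Z + csum (fun i => a (Z.of_nat (S i)) + a (- Z.of_nat (S i))%Z) n)%C.

(** The sum, not the mean, of the first [N] symmetric partial sums, indices 0 to [N - 1]; the factor
    [1 / N] is supplied where it is used. *)
Definition fejer (a : Z -> C) (N : nat) : C := csum (zpart a) N.

Lemma csum_ext f g n : (forall i, (i < n)%nat -> f i = g i) -> csum f n = csum g n.
Proof.
  elim: n => //= n IH H. rewrite IH; last by (move=> i Hi; apply: H; lia). by rewrite H.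
Qed.

Lemma ccont_csum (f : nat -> R -> C) n : (forall i, ccont (f i)) -> ccont (fun t => csum (fun i => f i t) n).
Proof. move=> H. elim: n => /= [|n IH]; first exact: ccont_const. exact: ccont_plus. Qed.

Lemma CR_csum (f : nat -> R -> C) n a b : (forall i, ccont (f i)) ->
  CR (fun t => csum (fun i => f i t) n) a b = csum (fun i => CR (f i) a b) n.
Proof.
  move=> H. elim: n => /= [|n IH].
  - rewrite /CR /= !RInt_const /scal /= /mult /=. Cring.
  - rewrite CR_plus ?IH //. exact: ccont_csum.
Qed.

Lemma CR_zpart (f : Z -> R -> C) n a b : (forall i, ccont (f i)) ->
  CR (fun t => zpart (fun m => f m t) n) a b = zpart (fun m => CR (f m) a b) n.
Proof.
  move=> H. rewrite /zpart CR_plus //.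
  - rewrite (CR_csum (fun i t => f (Z.of_nat (S i)) t + f (- Z.of_nat (S i))%Z t)%C); last by move=> i; exact: ccont_plus.
    congr Cplus. apply: csum_ext => i _. by rewrite CR_plus.
  - apply: (ccont_csum (fun i t => f (Z.of_nat (S i)) t + f (- Z.of_nat (S i))%Z t)%C) => i. exact: ccont_plus.
Qed.

Lemma ccont_zpart (f : Z -> R -> C) n : (forall i, ccont (f i)) -> ccont (fun t => zpart (fun m => f m t) n).
Proof.
  move=> H. apply: ccont_plus => //.
  apply: (ccont_csum (fun i t => f (Z.of_nat (S i)) t + f (- Z.of_nat (S i))%Z t)%C) => i. exact: ccont_plus.
Qed.

Lemma CR_fejer (f : Z -> R -> C) n a b : (forall i, ccont (f i)) ->
  CR (fun t => fejer (fun m => f m t) n) a b = fejer (fun m => CR (f m) a b) n.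
Proof.
  move=> H. rewrite /fejer (CR_csum (fun i t => zpart (fun m => f m t) i)).
  - apply: csum_ext => i _. exact: CR_zpart.
  - move=> i. exact: ccont_zpart.
Qed.

Fixpoint dirichlet (th : R) (n : nat) : R :=
  match n with O => 1 | S k => dirichlet th k + 2 * cos (INR n * th) end.
Fixpoint fejer_kernel (th : R) (n : nat) : R :=
  match n with O => 0 | S k => fejer_kernel th k + dirichlet th k end.

(** Multiplying by [1 - cos th] makes the sum telescope and avoids half angles and division at
    multiples of the period. Applied a second time, it gives [fejer_kernel_cos] and with it
    positivity of the kernel. *)
Lemma dirichlet_cos th n : (1 - cos th) * dirichlet th n = cos (INR n * th) - cos (INR (S n) * th).
Proof.
  elim: n => [|n IH].
  - rewrite /= Rmult_0_l Rmult_1_l cos_0. ring.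
  - cbn [dirichlet]. rewrite Rmult_plus_distr_l IH.
    have E1 : INR (S (S n)) * th = INR (S n) * th + th by rewrite (S_INR (S n)); ring.
    have E2 : INR n * th = INR (S n) * th - th by rewrite (S_INR n); ring.
    rewrite E1 E2 cos_plus cos_minus. ring.
Qed.

Lemma fejer_kernel_cos th n : (1 - cos th) * fejer_kernel th n = 1 - cos (INR n * th).
Proof.
  elim: n => [|n IH].
  - rewrite /= Rmult_0_l cos_0. ring.
  - cbn [fejer_kernel]. rewrite Rmult_plus_distr_l IH dirichlet_cos. ring.
Qed.

Lemma fejer_kernel_ge0 th n : 0 <= fejer_kernel th n.
Proof.
  have Hc := COS_bound th. case: (Req_dec (cos th) 1) => H.
  - have Hs : sin th = 0. { have := sin2_cos2 th. rewrite /Rsqr H. nra. }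
    have Hk : forall k, cos (INR k * th) = 1.
    { elim => [|k IH]; first by rewrite /= Rmult_0_l cos_0.
      have -> : INR (S k) * th = INR k * th + th by rewrite S_INR; ring. rewrite cos_plus IH H Hs. ring. }
    have Hd : forall k, 0 <= dirichlet th k.
    { elim => [|k IH]; first by rewrite /=; lra. cbn [dirichlet]. rewrite Hk; lra. }
    elim: n => [|n IH] /=; first lra. have := Hd n; lra.
  - have P := fejer_kernel_cos th n. have := COS_bound (INR n * th). nra.
Qed.

Lemma cis_sum_cos (m : nat) th z : (cis (- (IZR (Z.of_nat m)) * th) * z + cis (- (IZR (- Z.of_nat m)) * th) * z)%C = (RtoC (2 * cos (INR m * th)) * z)%C.
Proof.
  rewrite opp_IZR -INR_IZR_INZ.
  have -> : - - INR m * th = INR m * th by ring. have -> : - INR m * th = - (INR m * th) by ring.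
  rewrite cis_opp. Cring.
Qed.

Lemma zpart_dirichlet th z n : zpart (fun m => cis (- IZR m * th) * z)%C n = (RtoC (dirichlet th n) * z)%C.
Proof.
  rewrite /zpart. elim: n => [|n IH].
  - rewrite /= . have -> : - 0 * th = 0 by ring. rewrite cis_0. ring.
  - cbn [csum dirichlet]. rewrite Cplus_assoc IH cis_sum_cos RtoC_plus. ring.
Qed.

Lemma fejer_fejer_kernel th z n : fejer (fun m => cis (- IZR m * th) * z)%C n = (RtoC (fejer_kernel th n) * z)%C.
Proof.
  rewrite /fejer. elim: n => [|n IH] /=; first ring.
  rewrite IH zpart_dirichlet RtoC_plus. ring.
Qed.

Lemma continuous_cos_mult c t : continuous (fun t => cos (c * t)) t.
Proof. exact: (proj1 (ccont_cis c) t). Qed.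

Lemma continuous_fejer_kernel c n t : continuous (fun t => fejer_kernel (c * t) n) t.
Proof.
  have Hd : forall n, continuous (fun t => dirichlet (c * t) n) t.
  { elim => [|k IH]; cbn [dirichlet]; first by cont. apply: continuous_Rplus => //. apply: continuous_Rmult; first by cont.
    apply: (continuous_ext (fun t => cos (INR (S k) * c * t))). { move=> s. f_equal; ring. } exact: continuous_cos_mult. }
  elim: n => [|n IH]; cbn [fejer_kernel]; first by cont. exact: continuous_Rplus.
Qed.

Lemma RInt_cos_period (m : nat) : (0 < m)%nat -> RInt (fun t => cos (INR m * (2 * PI * t))) 0 1 = 0.
Proof.
  move=> Hm. have Hm' : INR m <> 0 by apply: not_0_INR; lia. have HP := PI_RGT_0.
  rewrite (RInt_ext _ (fun t => cos (INR m * (2 * PI) * t))); last by move=> t _; f_equal; ring.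
  rewrite (RInt_Derive_eq (fun t => / (INR m * (2 * PI)) * sin (INR m * (2 * PI) * t)) _ 0 1).
  - rewrite Rmult_0_r sin_0. have -> : INR m * (2 * PI) * 1 = 0 + 2 * INR m * PI by ring. rewrite sin_period sin_0. rring.
  - move=> t. apply: is_derive_eq. apply: (is_derive_scal (fun t => sin (INR m * (2 * PI) * t))).
    apply: (is_derive_Rcomp sin). apply: is_derive_sin. apply: is_derive_Rmult. apply: is_derive_const. apply: is_derive_id.
    rewrite /one /zero /=. field. split; lra.
  - move=> t. exact: continuous_cos_mult.
Qed.

Lemma RInt_fejer_kernel n : RInt (fun t => fejer_kernel (2 * PI * t) n) 0 1 = INR n.
Proof.
  have Cc : forall k t, continuous (fun t => cos (INR k * (2 * PI * t))) t.
  { move=> k t. apply: (continuous_ext (fun t => cos (INR k * (2 * PI) * t))). { move=> s. f_equal; ring. } exact: continuous_cos_mult. }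
  have Cd : forall n t, continuous (fun t => dirichlet (2 * PI * t) n) t.
  { move=> k t. elim: k => [|k IH]; cbn [dirichlet]; first by cont. apply: continuous_Rplus => //. apply: continuous_Rmult => //; first by cont. }
  have Hd : forall k, RInt (fun t => dirichlet (2 * PI * t) k) 0 1 = 1.
  { elim => [|k IH]; cbn [dirichlet]; first by rewrite RInt_const /scal /= /mult /=; rring.
    rewrite RInt_Rplus; [|exact: ex_RInt_c|apply: ex_RInt_c => t; apply: continuous_Rmult => //; by cont].
    rewrite IH (RInt_Rscal (fun t => cos (INR (S k) * (2 * PI * t)))); last by apply: ex_RInt_c. rewrite RInt_cos_period; last lia. rring. }
  elim: n => [|n IH]; cbn [fejer_kernel].
  - rewrite RInt_const /scal /= /mult /=; rring.
  - rewrite RInt_Rplus; [|apply: ex_RInt_c; exact: continuous_fejer_kernel|exact: ex_RInt_c]. rewrite IH Hd S_INR. rring.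
Qed.

(** Since [2 sin^2(pi t) = 1 - cos(2 pi t)], the weight cancels the denominator of the kernel, and
    the second moment is the same for every [n]. *)
Lemma RInt_fejer_sin2 n : (0 < n)%nat -> RInt (fun t => fejer_kernel (2 * PI * t) n * sin (PI * t) ^ 2) 0 1 = / 2.
Proof.
  move=> Hn. rewrite (RInt_ext _ (fun t => / 2 - / 2 * cos (INR n * (2 * PI * t)))).
  - rewrite RInt_Rminus.
    + rewrite RInt_const RInt_Rscal.
      * rewrite RInt_cos_period // /scal /= /mult /=. rring.
      * apply: ex_RInt_c => t. apply: (continuous_ext (fun t => cos (INR n * (2 * PI) * t))). { move=> s. f_equal; ring. } exact: continuous_cos_mult.
    + apply: ex_RInt_const.
    + apply: ex_RInt_c => t. apply: continuous_Rmult; first by cont.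
      apply: (continuous_ext (fun t => cos (INR n * (2 * PI) * t))). { move=> s. f_equal; ring. } exact: continuous_cos_mult.
  - move=> t _. have := fejer_kernel_cos (2 * PI * t) n.
    have -> : 2 * PI * t = 2 * (PI * t) by ring. rewrite cos_2a_sin. lra.
Qed.

(** Makes [sin (PI * t)] an upper bound for the distance to the nearest integer, so that the
    Lipschitz estimate fits the moment bound of the kernel. *)
Lemma sin_lower t : 0 <= t <= / 2 -> t <= sin (PI * t).
Proof.
  move=> Ht. have HP := PI_RGT_0. have HP4 := PI_4. have HP2 := PI2_3_2.
  have [H _] := pre_sin_bound (PI * t) 0 ltac:(nra) ltac:(nra).
  have E : sin_approx (PI * t) (2 * 0 + 1) = PI * t - (PI * t) ^ 3 / 6.
  { rewrite /sin_approx /= /sin_term /=. field. }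
  rewrite E in H. apply: Rle_trans H.
  have Hx : 0 <= PI * t <= 2 by nra.
  have : (PI * t) ^ 3 / 6 <= PI * t * (4 / 6). { have : (PI * t) ^ 2 <= 4 by nra. nra. }
  nra.
Qed.

(* [sin x <= d + sin x ^ 2 / (4 d)] reduces the error of the Fejer mean to the exactly known second moment of the kernel. *)
Lemma fejer_error (psi : R -> R) M (d : R) N : 0 < d -> (0 < N)%nat -> 0 <= M -> (forall t, continuous psi t) ->
  (forall t, 0 <= t <= 1 -> Rabs (psi t) <= M * sin (PI * t)) ->
  Rabs (RInt (fun t => fejer_kernel (2 * PI * t) N * psi t) 0 1) <= M * (d * INR N + / (8 * d)).
Proof.
  move=> Hd HN HM Hc H.
  have Ck := continuous_fejer_kernel (2 * PI) N.
  have Cs : forall t, continuous (fun t => fejer_kernel (2 * PI * t) N * sin (PI * t) ^ 2) t.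
  { move=> t. apply: continuous_Rmult => //. rewrite /=.
    apply: continuous_Rmult; [|apply: continuous_Rmult; last by cont]; exact: (proj2 (ccont_cis PI) t). }
  set bnd := fun t => M * (d * fejer_kernel (2 * PI * t) N + / (4 * d) * (fejer_kernel (2 * PI * t) N * sin (PI * t) ^ 2)).
  have Cb : forall t, continuous bnd t.
  { move=> t. apply: continuous_Rmult; first by cont. apply: continuous_Rplus; apply: continuous_Rmult => //; cont. }
  have E : RInt bnd 0 1 = M * (d * INR N + / (8 * d)).
  { rewrite /bnd RInt_Rscal.
    - rewrite RInt_Rplus.
      + rewrite !RInt_Rscal; [|exact: ex_RInt_c|exact: ex_RInt_c].
        rewrite RInt_fejer_kernel RInt_fejer_sin2 //. rfield. lra.
      + apply: ex_RInt_c => t; apply: continuous_Rmult => //; cont.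
      + apply: ex_RInt_c => t; apply: continuous_Rmult => //; cont.
    - apply: ex_RInt_c => t. apply: continuous_Rplus; apply: continuous_Rmult => //; cont. }
  have Cf : forall t, continuous (fun t => fejer_kernel (2 * PI * t) N * psi t) t by move=> t; exact: continuous_Rmult.
  have P : forall t, 0 < t < 1 -> Rabs (fejer_kernel (2 * PI * t) N * psi t) <= bnd t.
  { move=> t Ht. have K0 := fejer_kernel_ge0 (2 * PI * t) N. rewrite Rabs_mult (Rabs_right _ (Rle_ge _ _ K0)) /bnd.
    have Hs : sin (PI * t) <= d + / (4 * d) * sin (PI * t) ^ 2.
    { have : 0 <= / (4 * d) * (sin (PI * t) - 2 * d) ^ 2.
      { apply: Rmult_le_pos; last exact: pow2_ge_0. apply: Rlt_le; apply: Rinv_0_lt_compat; lra. }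
      have -> : / (4 * d) * (sin (PI * t) - 2 * d) ^ 2 = / (4 * d) * sin (PI * t) ^ 2 - sin (PI * t) + d by field; lra. lra. }
    have Hp : Rabs (psi t) <= M * (d + / (4 * d) * sin (PI * t) ^ 2).
    { apply: Rle_trans (H t ltac:(lra)) _. exact: Rmult_le_compat_l. }
    have := Rmult_le_compat_l _ _ _ K0 Hp. lra. }
  rewrite -E. apply: Rabs_le. split.
  - have <- : RInt (fun t => (-1) * bnd t) 0 1 = - RInt bnd 0 1. { rewrite RInt_Rscal; last exact: ex_RInt_c. rring. }
    apply: RInt_le; [lra|apply: ex_RInt_c => t; apply: continuous_Rmult => //; cont|exact: ex_RInt_c|].
    move=> t /P /Rabs_le_between. lra.
  - apply: RInt_le; [lra|exact: ex_RInt_c|exact: ex_RInt_c|]. move=> t /P /Rabs_le_between. lra.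
Qed.

Definition fcoef (phi : R -> C) (m : Z) : C := CR (fun t => cis (- IZR m * (2 * PI * t)) * phi t)%C 0 1.

Lemma ccont_fcoef phi m : ccont phi -> ccont (fun t => cis (- IZR m * (2 * PI * t)) * phi t)%C.
Proof.
  move=> H. apply: ccont_mult => //.
  have -> : (fun t => cis (- IZR m * (2 * PI * t))) = (fun t => cis (- IZR m * (2 * PI) * t)).
  { apply: functional_extensionality => t; f_equal; ring. }
  exact: ccont_cis.
Qed.

Lemma fejer_mean_error (phi : R -> C) M (d : R) N : 0 < d -> (0 < N)%nat -> 0 <= M -> ccont phi ->
  (forall t, 0 <= t <= 1 -> Cmod (phi t - phi 0)%C <= M * sin (PI * t)) ->
  Cmod (RtoC (INR N) * phi 0%R - fejer (fcoef phi) N)%C <= 2 * (M * (d * INR N + / (8 * d))).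
Proof.
  move=> Hd HN HM Hc H.
  have E : (fejer (fcoef phi) N - RtoC (INR N) * phi 0%R)%C = CR (fun t => RtoC (fejer_kernel (2 * PI * t) N) * (phi t - phi 0%R))%C 0 1.
  { rewrite -(RInt_fejer_kernel N) /fcoef -(CR_fejer (fun m t => cis (- IZR m * (2 * PI * t)) * phi t)%C); last by move=> i; exact: ccont_fcoef.
    have Ck : ccont (fun t => RtoC (fejer_kernel (2 * PI * t) N)).
    { split => t /=; [exact: continuous_fejer_kernel | by cont]. }
    have -> : RtoC (RInt (fun t => fejer_kernel (2 * PI * t) N) 0 1) = CR (fun t => RtoC (fejer_kernel (2 * PI * t) N)) 0 1.
    { rewrite /CR /=. rewrite RInt_const /scal /= /mult /= Rmult_0_r. by []. }
    rewrite (CR_ext _ (fun t => RtoC (fejer_kernel (2 * PI * t) N) * phi t)%C); last by move=> t; rewrite fejer_fejer_kernel.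
    rewrite (CR_ext (fun t => RtoC (fejer_kernel (2 * PI * t) N) * (phi t - phi 0%R))%C (fun t => RtoC (fejer_kernel (2 * PI * t) N) * phi t + (- phi 0%R) * RtoC (fejer_kernel (2 * PI * t) N))%C); last by move=> t; ring.
    rewrite CR_plus; [|exact: ccont_mult|exact: ccont_scal]. rewrite CR_scal //. ring. }
  rewrite -Cmod_opp.
  have -> : (- (RtoC (INR N) * phi 0%R - fejer (fcoef phi) N))%C = (fejer (fcoef phi) N - RtoC (INR N) * phi 0%R)%C by ring.
  rewrite E. apply: Rle_trans (proj2 (proj2 (Rabs_Re_Im _))) _.
  have B : forall f : R -> R, (forall t, continuous f t) -> (forall t, Rabs (f t) <= Cmod (phi t - phi 0%R)%C) ->
    Rabs (RInt (fun t => fejer_kernel (2 * PI * t) N * f t) 0 1) <= M * (d * INR N + / (8 * d)).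
  { move=> f Hf Hb. apply: fejer_error => // t Ht. apply: Rle_trans (Hb t) _. exact: H. }
  have [c1 c2] : ccont (fun t => phi t - phi 0%R)%C. { apply: ccont_plus => //. exact: ccont_const. }
  have -> : Re (CR (fun t => RtoC (fejer_kernel (2 * PI * t) N) * (phi t - phi 0%R))%C 0 1) = RInt (fun t => fejer_kernel (2 * PI * t) N * Re (phi t - phi 0%R)%C) 0 1.
  { apply: RInt_ext => t _. rewrite /=; ring. }
  have -> : Im (CR (fun t => RtoC (fejer_kernel (2 * PI * t) N) * (phi t - phi 0%R))%C 0 1) = RInt (fun t => fejer_kernel (2 * PI * t) N * Im (phi t - phi 0%R)%C) 0 1.
  { apply: RInt_ext => t _. rewrite /=; ring. }
  have := B _ c1 (fun t => proj1 (Rabs_Re_Im _)). have := B _ c2 (fun t => proj1 (proj2 (Rabs_Re_Im _))). lra.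
Qed.

(** By periodicity [phi t] may be compared with [phi 0] or with [phi 1], whichever end is closer.
    The factor 2 comes from treating real and imaginary parts separately. *)
Lemma lipschitz_sin (phi dphi : R -> C) M : (forall t, CD phi t (dphi t)) -> (forall t, phi (t + 1) = phi t) ->
  (forall t, 0 <= t <= 1 -> Cmod (dphi t) <= M) ->
  forall t, 0 <= t <= 1 -> Cmod (phi t - phi 0)%C <= 2 * M * sin (PI * t).
Proof.
  move=> HD HP HM t Ht.
  have HM0 : 0 <= M. { have := HM 0 ltac:(lra). have := Cmod_ge_0 (dphi 0). lra. }
  have L : forall s u, 0 <= s <= 1 -> 0 <= u <= 1 -> Cmod (phi s - phi u)%C <= 2 * M * Rabs (s - u).
  { move=> s u Hs Hu. apply: Rle_trans (proj2 (proj2 (Rabs_Re_Im _))) _.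
    have A : forall f df : R -> R, (forall t, is_derive f t (df t)) -> (forall t, 0 <= t <= 1 -> Rabs (df t) <= M) -> Rabs (f s - f u) <= M * Rabs (s - u).
    { move=> f df Hf Hb. case: (MVT_gen f u s df).
      - move=> x _; exact: Hf.
      - move=> x _. apply: derivable_continuous_pt. exists (df x). apply/is_derive_Reals. exact: Hf.
      - move=> x [Hx ->]. rewrite Rabs_mult. apply: Rmult_le_compat_r; first exact: Rabs_pos. apply: Hb.
        move: Hx; rewrite /Rmin /Rmax. case: Rle_dec => ?; lra. }
    have A1 := A (fun t => Re (phi t)) (fun t => Re (dphi t)) (fun t => proj1 (HD t)) (fun t Ht => Rle_trans _ _ _ (proj1 (Rabs_Re_Im _)) (HM t Ht)).
    have A2 := A (fun t => Im (phi t)) (fun t => Im (dphi t)) (fun t => proj2 (HD t)) (fun t Ht => Rle_trans _ _ _ (proj1 (proj2 (Rabs_Re_Im _))) (HM t Ht)).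
    rewrite /= in A1 A2 *. rewrite /Re /Im in A1 A2 *. rewrite /Rminus in A1 A2 *. lra. }
  case: (Rle_lt_dec t (/ 2)) => Hh.
  - have := L t 0 ltac:(lra) ltac:(lra). rewrite Rminus_0_r Rabs_right; last lra.
    have := sin_lower t ltac:(lra). nra.
  - have := L t 1 ltac:(lra) ltac:(lra). have -> : phi 1 = phi 0 by rewrite -(HP 0) Rplus_0_l.
    rewrite Rabs_left1; last lra. have := sin_lower (1 - t) ltac:(lra).
    have -> : PI * (1 - t) = PI - PI * t by ring. rewrite -(sin_PI_x (PI * t)). nra.
Qed.

(** The threshold depends only on the derivative bound, not on the function. It therefore serves at
    once for the restrictions of a function on the group to all translation lines starting in a
    compact box. *)
Lemma fejer_uniform M e : 0 <= M -> 0 < e -> exists N0, forall N, (N0 <= N)%nat -> (0 < N)%nat /\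
  forall phi dphi, (forall t, CD phi t (dphi t)) -> (forall t, phi (t + 1) = phi t) ->
  (forall t, 0 <= t <= 1 -> Cmod (dphi t) <= M) ->
  Cmod (phi 0%R - RtoC (/ INR N) * fejer (fcoef phi) N)%C <= e.
Proof.
  (* [d] makes the part of the error proportional to [N] at most [N e / 2]; the other part does not
     grow with [N], which is then taken large. *)
  move=> HM He. set d := e / (8 * (M + 1)). have Hd : 0 < d by apply: Rdiv_lt_0_compat; lra.
  have [N HN] := INR_unbounded (4 * M * / (8 * d) / (e / 2)).
  exists (S N). case => [|n] Hn; first lia. split; first lia. move=> phi dphi HD HP Hb.
  have Hc := ccont_CD _ _ HD. have HNn : INR N <= INR n by apply: le_INR; lia.
  clear Hn. move: HN => HN0'. have {HN0' HNn} HN : INR n > 4 * M * / (8 * d) / (e / 2) by lra.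
  have HN0 : 0 < INR (S n) by apply: lt_0_INR; lia.
  have B := fejer_mean_error phi (2 * M) d (S n) Hd ltac:(lia) ltac:(lra) Hc (lipschitz_sin _ _ _ HD HP Hb).
  have -> : (phi 0%R - RtoC (/ INR (S n)) * fejer (fcoef phi) (S n))%C = (RtoC (/ INR (S n)) * (RtoC (INR (S n)) * phi 0%R - fejer (fcoef phi) (S n)))%C.
  { have E : (RtoC (/ INR (S n)) * RtoC (INR (S n)) = 1)%C by rewrite -RtoC_mult Rinv_l //; lra.
    transitivity ((RtoC (/ INR (S n)) * RtoC (INR (S n))) * phi 0%R - RtoC (/ INR (S n)) * fejer (fcoef phi) (S n))%C; first by rewrite E; ring. ring. }
  rewrite Cmod_mult Cmod_R Rabs_right; last by apply: Rle_ge; apply: Rlt_le; exact: Rinv_0_lt_compat.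
  apply: (Rmult_le_reg_l (INR (S n))) => //. rewrite -Rmult_assoc Rinv_r ?Rmult_1_l; last lra.
  apply: Rle_trans B _.
  have E1 : 4 * M * d <= e / 2. { rewrite /d. have -> : 4 * M * (e / (8 * (M + 1))) = e / 2 * (M / (M + 1)) by field; lra.
    have : M / (M + 1) <= 1. { apply: (Rmult_le_reg_r (M + 1)); first lra. have -> : M / (M + 1) * (M + 1) = M by field; lra. lra. } nra. }
  have E2 : 4 * M * / (8 * d) <= INR (S n) * (e / 2).
  { have -> : 4 * M * / (8 * d) = 4 * M * / (8 * d) / (e / 2) * (e / 2) by field; lra.
    apply: Rmult_le_compat_r; first lra. rewrite S_INR. lra. }
  nra.
Qed.

(** * Projections onto characters of a translation *)

(** Translation in coordinates, not in the group. The two agree for central [s]; for the other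
    directions [gsh] is applied to functions independent of [z]. *)
Definition gsh (s : G) (t : R) (g : G) : G :=
  let '(s1, s2, s3) := s in let '(x, y, z) := g in (x + t * s1, y + t * s2, z + t * s3).

Lemma triple_eq (x y z x' y' z' : R) : x = x' -> y = y' -> z = z' -> (x, y, z) = (x', y', z').
Proof. by move=> -> -> ->. Qed.

Lemma gsh_plus s t t' g : gsh s t (gsh s t' g) = gsh s (t + t') g.
Proof. case: s => [[? ?] ?]; case: g => [[? ?] ?] /=. apply: triple_eq; ring. Qed.

Lemma gsh_0 s g : gsh s 0 g = g.
Proof. case: s => [[? ?] ?]; case: g => [[? ?] ?] /=. apply: triple_eq; ring. Qed.

Lemma Ck_avg n s (w : R -> R) u : (forall t, continuous w t) -> Ck n u ->
  Ck n (fun g => RInt (fun t => w t * u (gsh s t g)) 0 1).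
Proof.
  case: s => [[s1 s2] s3] Hw.
  have J : forall v, contG v -> jcont (U := prod_UniformSpace (prod_UniformSpace R_UniformSpace R_UniformSpace) R_UniformSpace) (fun g t => w t * v (gsh (s1, s2, s3) t g)).
  { move=> v Hv p t. apply: continuous_Rmult.
    - apply: (continuous_scomp w) => //; cont.
    - apply: (continuous_ext (fun q : R * R * R * R => v (fst (fst (fst q)) + snd q * s1, snd (fst (fst q)) + snd q * s2, snd (fst q) + snd q * s3))).
      + by move=> [[[? ?] ?] ?].
      + apply: contG_comp => //; cont. }
  have C : forall v, contG v -> contG (fun g => RInt (fun t => w t * v (gsh (s1, s2, s3) t g)) 0 1).
  { move=> v Hv g. apply: (continuous_RInt_param (U := prod_UniformSpace (prod_UniformSpace R_UniformSpace R_UniformSpace) R_UniformSpace) (fun g t => w t * v (gsh (s1, s2, s3) t g))); first lra. exact: J. }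
  elim: n u => [|n IH] u Hu.
  - split => //. apply: C. exact: (Ck_contG _ _ Hu).
  - have P := Ck_partials _ _ Hu. case: (Hu) => [_ [_ [Hx [Hy Hz]]]].
    apply: (Ck_intro n _ _ _ _ _ _ (IH _ Hx) (IH _ Hy) (IH _ Hz)).
    + apply: C. exact: (Ck_contG _ _ Hu).
    + have J1 : forall v, contG v -> forall (f h k : R -> R), (forall x, continuous f x) -> (forall x, continuous h x) -> (forall x, continuous k x) ->
        jcont (U := R_UniformSpace) (fun x t => w t * v (f x + t * s1, h x + t * s2, k x + t * s3)).
      { move=> v Hv f h k Hf Hh Hk p t. apply: continuous_Rmult; first by apply: (continuous_scomp w) => //; cont.
        apply: contG_comp => //; apply: continuous_Rplus; try (by cont).
        - apply: (continuous_scomp f) => //; cont.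
        - apply: (continuous_scomp h) => //; cont.
        - apply: (continuous_scomp k) => //; cont. }
      have Cu := Ck_contG _ _ Hu. have Cx := Ck_contG _ _ Hx. have Cy := Ck_contG _ _ Hy. have Cz := Ck_contG _ _ Hz.
      have Cid : forall x, continuous (fun x : R => x) x by move=> x; cont.
      have Cc : forall c x, continuous (fun _ : R => c : R) x by move=> c x; cont.
      have Dsh : forall c x, is_derive (fun x => x + c) x 1 by move=> c x; auto_derive => //; ring.
      move=> x y z; split; [|split].
      * apply: (is_derive_RInt_jcont (fun x t => w t * u (x + t * s1, y + t * s2, z + t * s3)) (fun x t => w t * part_x u (x + t * s1, y + t * s2, z + t * s3))); first lra.
        -- move=> x' t. apply: is_derive_eq. apply: (is_derive_scal (fun x => u (x + t * s1, y + t * s2, z + t * s3))).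
           apply: (is_derive_Rcomp (fun x => u (x, y + t * s2, z + t * s3)) (fun x => x + t * s1)). exact: (proj1 (P _ _ _)). exact: Dsh. by rewrite Rmult_1_r.
        -- exact: (J1 u Cu (fun x => x) (fun _ => y) (fun _ => z)).
        -- exact: (J1 _ Cx (fun x => x) (fun _ => y) (fun _ => z)).
      * apply: (is_derive_RInt_jcont (fun y t => w t * u (x + t * s1, y + t * s2, z + t * s3)) (fun y t => w t * part_y u (x + t * s1, y + t * s2, z + t * s3))); first lra.
        -- move=> x' t. apply: is_derive_eq. apply: (is_derive_scal (fun y => u (x + t * s1, y + t * s2, z + t * s3))).
           apply: (is_derive_Rcomp (fun y => u (x + t * s1, y, z + t * s3)) (fun x => x + t * s2)). exact: (proj1 (proj2 (P _ _ _))). exact: Dsh. by rewrite Rmult_1_r.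
        -- exact: (J1 u Cu (fun _ => x) (fun y => y) (fun _ => z)).
        -- exact: (J1 _ Cy (fun _ => x) (fun y => y) (fun _ => z)).
      * apply: (is_derive_RInt_jcont (fun z t => w t * u (x + t * s1, y + t * s2, z + t * s3)) (fun z t => w t * part_z u (x + t * s1, y + t * s2, z + t * s3))); first lra.
        -- move=> x' t. apply: is_derive_eq. apply: (is_derive_scal (fun z => u (x + t * s1, y + t * s2, z + t * s3))).
           apply: (is_derive_Rcomp (fun z => u (x + t * s1, y + t * s2, z)) (fun x => x + t * s3)). exact: (proj2 (proj2 (P _ _ _))). exact: Dsh. by rewrite Rmult_1_r.
        -- exact: (J1 u Cu (fun _ => x) (fun _ => y) (fun z => z)).
        -- exact: (J1 _ Cz (fun _ => x) (fun _ => y) (fun z => z)).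
Qed.

(** The component of [u] on which translation by [tau s] acts as [exp(2 pi i (m + rho) tau)]. The
    factor with [rho] turns a function that is periodic up to the phase [exp(2 pi i rho)] into a
    periodic one. *)
Definition tproj (s : G) (rho : R) (u : G -> C) (m : Z) (g : G) : C :=
  fcoef (fun t => cis (- rho * (2 * PI * t)) * u (gsh s t g))%C m.

Lemma CD_gsh s u g t : Sm u ->
  CD (fun t => u (gsh s t g)) t (RtoC (fst (fst s)) * PX u (gsh s t g) + RtoC (snd (fst s)) * PY u (gsh s t g) + RtoC (snd s) * PZ u (gsh s t g))%C.
Proof.
  case: s => [[s1 s2] s3]; case: g => [[x y] z] Hu /=.
  apply: (Sm_path u (fun t => x + t * s1) (fun t => y + t * s2) (fun t => z + t * s3)) => //; auto_derive => //; ring.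
Qed.

Lemma ccont_gsh s u g : Sm u -> ccont (fun t => u (gsh s t g)).
Proof. move=> Hu. apply: (ccont_CD _ _ (fun t => CD_gsh s u g t Hu)). Qed.

Lemma ccont_cis2 c : ccont (fun t => cis (c * (2 * PI * t))).
Proof.
  have -> : (fun t => cis (c * (2 * PI * t))) = (fun t => cis (c * (2 * PI) * t)).
  { apply: functional_extensionality => t; f_equal; ring. }
  exact: ccont_cis.
Qed.

Lemma tproj_E s rho u m g : tproj s rho u m g = CR (fun t => cis (- (IZR m + rho) * (2 * PI * t)) * u (gsh s t g))%C 0 1.
Proof.
  apply: CR_ext => t. rewrite Cmult_assoc -cis_plus. do 2 f_equal; ring.
Qed.

Lemma Sm_tproj s rho u m : Sm u -> Sm (tproj s rho u m).
Proof.
  move=> Hu n. case: (Hu n) => [H1 H2]. have [c1 c2] := ccont_cis2 (- (IZR m + rho)). rewrite /= in c1 c2.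
  have c3 : forall t, continuous (fun t => - sin (- (IZR m + rho) * (2 * PI * t))) t.
  { move=> t. apply: (continuous_opp (fun t => sin (- (IZR m + rho) * (2 * PI * t)))). exact: c2. }
  have e1 : forall v, Ck n v -> forall g (w : R -> R), (forall t, continuous w t) -> ex_RInt (fun t => w t * v (gsh s t g)) 0 1.
  { move=> v Hv g w Hw. apply: ex_RInt_c => t. apply: continuous_Rmult => //.
    case: (s) (g) => [[s1 s2] s3] [[x y] z] /=. apply: contG_comp; [exact: (Ck_contG _ _ Hv)|by cont|by cont|by cont]. }
  split.
  - have -> : (fun g => Re (tproj s rho u m g)) = (fun g => RInt (fun t => cos (- (IZR m + rho) * (2 * PI * t)) * Re (u (gsh s t g))) 0 1
      + RInt (fun t => - sin (- (IZR m + rho) * (2 * PI * t)) * Im (u (gsh s t g))) 0 1).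
    { apply: functional_extensionality => g. rewrite tproj_E -RInt_Rplus; [|exact: (e1 _ H1 g (fun t => cos _) c1)|exact: (e1 _ H2 g _ c3)].
      apply: RInt_ext => t _. rewrite /= /Re /Im. rring. }
    apply: Ck_plus; [exact: (Ck_avg _ _ (fun t => cos _) _ c1 H1)|exact: (Ck_avg _ _ _ _ c3 H2)].
  - have -> : (fun g => Im (tproj s rho u m g)) = (fun g => RInt (fun t => cos (- (IZR m + rho) * (2 * PI * t)) * Im (u (gsh s t g))) 0 1
      + RInt (fun t => sin (- (IZR m + rho) * (2 * PI * t)) * Re (u (gsh s t g))) 0 1).
    { apply: functional_extensionality => g. rewrite tproj_E -RInt_Rplus; [|exact: (e1 _ H2 g (fun t => cos _) c1)|exact: (e1 _ H1 g _ c2)].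
      apply: RInt_ext => t _. rewrite /= /Re /Im. rring. }
    apply: Ck_plus; [exact: (Ck_avg _ _ (fun t => cos _) _ c1 H2)|exact: (Ck_avg _ _ _ _ c2 H1)].
Qed.

Lemma tproj_periodic s rho u g : (forall g, u (gsh s 1 g) = cis (2 * PI * rho) * u g)%C ->
  forall t, (cis (- rho * (2 * PI * (t + 1))) * u (gsh s (t + 1) g) = cis (- rho * (2 * PI * t)) * u (gsh s t g))%C.
Proof.
  move=> H t. rewrite (Rplus_comm t 1) -gsh_plus H Cmult_assoc -cis_plus. do 2 f_equal; ring.
Qed.

Lemma tproj_shift s rho u m : Sm u -> (forall g, u (gsh s 1 g) = cis (2 * PI * rho) * u g)%C ->
  forall tau g, tproj s rho u m (gsh s tau g) = (cis ((IZR m + rho) * (2 * PI * tau)) * tproj s rho u m g)%C.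
Proof.
  move=> Hu H tau g. rewrite !tproj_E.
  set f := fun t => (cis (- (IZR m + rho) * (2 * PI * t)) * u (gsh s t g))%C.
  have Hf : ccont f by apply: ccont_mult; [exact: ccont_cis2 | exact: ccont_gsh].
  have Pf : forall t, f (t + 1) = f t.
  { move=> t. rewrite /f (Rplus_comm t 1) -gsh_plus H Cmult_assoc -cis_plus.
    have -> : - (IZR m + rho) * (2 * PI * (1 + t)) + 2 * PI * rho = - (IZR m + rho) * (2 * PI * t) + 2 * PI * IZR (- m) by rewrite opp_IZR; ring.
    by rewrite cis_period. }
  rewrite -(CR_period f tau Hf Pf) -CR_scal; last exact: ccont_shift.
  apply: CR_ext => t. rewrite /f gsh_plus Cmult_assoc -cis_plus. do 2 f_equal; ring.
Qed.

Lemma tproj_equiv s rho u m (B : G -> G) e : Sm u -> (forall g, u (B g) = e * u g)%C ->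
  (forall t g, u (gsh s t (B g)) = u (B (gsh s t g))) ->
  forall g, tproj s rho u m (B g) = (e * tproj s rho u m g)%C.
Proof.
  move=> Hu H1 H2 g. rewrite !tproj_E -CR_scal; last by apply: ccont_mult; [exact: ccont_cis2 | exact: ccont_gsh].
  apply: CR_ext => t. rewrite H2 H1. ring.
Qed.

Lemma CcontG_bounded u R0 : CcontG u -> exists M, 0 <= M /\ forall x y z, Rabs x <= R0 -> Rabs y <= R0 -> Rabs z <= R0 -> Cmod (u (x, y, z)) <= M.
Proof.
  move=> [H1 H2]. case: (contG_bounded _ R0 H1) => M1 [P1 B1]. case: (contG_bounded _ R0 H2) => M2 [P2 B2].
  exists (M1 + M2); split; first lra. move=> x y z Hx Hy Hz. apply: Rle_trans (proj2 (proj2 (Rabs_Re_Im _))) _.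
  have := B1 x y z Hx Hy Hz; have := B2 x y z Hx Hy Hz. lra.
Qed.

Lemma tproj_approx a w2 r s rho u : Sm u -> (forall g, u (gsh s 1 g) = cis (2 * PI * rho) * u g)%C ->
  forall e, 0 < e -> exists N, (0 < N)%nat /\
  forall g, in_box a w2 r g -> Cmod (u g - RtoC (/ INR N) * fejer (fun m => tproj s rho u m g) N)%C <= e.
Proof.
  move=> Hu H e He.
  set d := fun g => (RtoC (fst (fst s)) * PX u g + RtoC (snd (fst s)) * PY u g + RtoC (snd s) * PZ u g)%C.
  have Hd : Sm d by apply: Sm_plus; [apply: Sm_plus|]; apply: Sm_scal; [exact: Sm_PX|exact: Sm_PY|exact: Sm_PZ].
  (* A cube of this size contains every point [gsh s t g] with [g] in the box and [t] between 0 and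
     1, so one derivative bound serves for all of them. *)
  set R0 := Rabs a + Rabs w2 + Rabs r + Rabs (fst (fst s)) + Rabs (snd (fst s)) + Rabs (snd s).
  case: (CcontG_bounded u R0 (Sm_cont _ Hu)) => M1 [P1 B1]. case: (CcontG_bounded d R0 (Sm_cont _ Hd)) => M2 [P2 B2].
  set M := Rabs (rho * (2 * PI)) * M1 + M2.
  have HM : 0 <= M. { have := Rabs_pos (rho * (2 * PI)). rewrite /M; nra. }
  case: (fejer_uniform M e HM He) => N HN'. case: (HN' N (le_n N)) => HN HF. exists N; split => // g Hg.
  set phi := fun t => (cis (- rho * (2 * PI * t)) * u (gsh s t g))%C.
  set dphi := fun t => (Ci * RtoC (- rho * (2 * PI)) * cis (- rho * (2 * PI * t)) * u (gsh s t g) + cis (- rho * (2 * PI * t)) * d (gsh s t g))%C.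
  have E0 : phi 0 = u g. { rewrite /phi gsh_0. have -> : - rho * (2 * PI * 0) = 0 by ring. rewrite cis_0. ring. }
  rewrite -E0. apply: (HF phi dphi).
  - move=> t. apply: CD_mult; last exact: CD_gsh. apply: (CD_cis_comp (fun t => - rho * (2 * PI * t))). auto_derive => //; ring.
  - move=> t. exact: tproj_periodic.
  - move=> t Ht. rewrite /dphi.
    have In : Cmod (u (gsh s t g)) <= M1 /\ Cmod (d (gsh s t g)) <= M2.
    { have Q : forall p q l, 0 <= p <= l -> Rabs (p + t * q) <= Rabs l + Rabs q.
      { move=> p q l Hp. apply: Rle_trans (Rabs_triang _ _) _. rewrite Rabs_mult (Rabs_right t); last lra.
        rewrite (Rabs_right p) ?(Rabs_right l); try lra. have := Rabs_pos q. nra. }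
      move: Hg. rewrite /in_box. case E : (g) => [[x y] z] /= [Hx [Hy Hz]].
      have E1 : R0 = R0 by []. move: E1 B1 B2. rewrite {1}/R0. case: (s) => [[s1 s2] s3] /= E1 B1 B2.
      have := Rabs_pos a; have := Rabs_pos w2; have := Rabs_pos r; have := Rabs_pos s1; have := Rabs_pos s2; have := Rabs_pos s3.
      have := Q x s1 a Hx. have := Q y s2 w2 Hy. have := Q z s3 r Hz => *.
      split; [apply: B1|apply: B2]; lra. }
    case: In => I1 I2.
    apply: Rle_trans (Cmod_triangle _ _) _. rewrite !Cmod_mult !Cmod_cis Cmod_R.
    have -> : Cmod Ci = 1. { have := Cmod_sq Ci. have := Cmod_ge_0 Ci. rewrite /=. nra. }
    have -> : - rho * (2 * PI) = - (rho * (2 * PI)) by ring. rewrite Rabs_Ropp.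
    have := Rabs_pos (rho * (2 * PI)). rewrite /M. have := Cmod_ge_0 (u (gsh s t g)). nra.
Qed.

(** * Rapidly decreasing functions on the line *)

Definition rapid (f : R -> C) : Prop := forall p : nat, exists M, forall t, Rabs t ^ p * Cmod (f t) <= M.
Definition dC (f : R -> C) : R -> C := fun t => Cderive f t.
(** Rapid decay of all derivatives, encoded coinductively: [f] belongs to some class of
    differentiable rapidly decreasing functions that is stable under derivation. Exhibiting the
    class replaces an induction on the order of the derivative. *)
Definition Schw (f : R -> C) : Prop := exists P : (R -> C) -> Prop, P f /\
  forall h, P h -> rapid h /\ (forall t, CD h t (dC h t)) /\ P (dC h).

Lemma Schw_rapid f : Schw f -> rapid f.
Proof. by move=> [P [Pf H]]; case: (H f Pf). Qed.
Lemma Schw_CD f : Schw f -> forall t, CD f t (dC f t).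
Proof. by move=> [P [Pf H]]; case: (H f Pf) => [_ []]. Qed.
Lemma Schw_d f : Schw f -> Schw (dC f).
Proof. move=> [P [Pf H]]; exists P; split => //. by case: (H f Pf) => [_ []]. Qed.

Lemma dC_eq f df : (forall t, CD f t (df t)) -> dC f = df.
Proof. move=> H; apply: functional_extensionality => t. exact: CD_Cderive. Qed.

Lemma rapid_plus f g : rapid f -> rapid g -> rapid (fun t => f t + g t)%C.
Proof.
  move=> Hf Hg p. case: (Hf p) => M1 H1. case: (Hg p) => M2 H2. exists (M1 + M2) => t.
  have := H1 t; have := H2 t; have := Cmod_triangle (f t) (g t). have := pow_le _ p (Rabs_pos t). nra.
Qed.

Lemma rapid_scal c f : rapid f -> rapid (fun t => c * f t)%C.
Proof.
  move=> Hf p. case: (Hf p) => M1 H1. exists (Cmod c * M1) => t.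
  rewrite Cmod_mult. have := H1 t. have := Cmod_ge_0 c. nra.
Qed.

Lemma rapid_t f : rapid f -> rapid (fun t => RtoC t * f t)%C.
Proof.
  move=> Hf p. case: (Hf (S p)) => M1 H1. exists M1 => t.
  rewrite Cmod_mult Cmod_R. have := H1 t. rewrite /=. lra.
Qed.

(* The closure of a class of functions under the Weyl algebra operations that do not differentiate. *)
Inductive clo (B : (R -> C) -> Prop) : (R -> C) -> Prop :=
| clo_b h : B h -> clo B h
| clo_plus f g : clo B f -> clo B g -> clo B (fun t => f t + g t)%C
| clo_scal c f : clo B f -> clo B (fun t => c * f t)%C
| clo_t f : clo B f -> clo B (fun t => RtoC t * f t)%C.

(** The closure itself is the class that witnesses [Schw]: the Leibniz rule for multiplication by
    [t] keeps derivatives inside it once this holds for the generators. *)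
Lemma clo_Schw B : (forall h, B h -> rapid h /\ exists dh, (forall t, CD h t (dh t)) /\ clo B dh) ->
  forall h, clo B h -> Schw h.
Proof.
  move=> HB h Hh. exists (clo B); split => //; clear h Hh => h Hh.
  have : rapid h /\ exists dh, (forall t, CD h t (dh t)) /\ clo B dh.
  { elim: Hh => {h}.
    - exact: HB.
    - move=> f g _ [R1 [df [D1 C1]]] _ [R2 [dg [D2 C2]]]. split; first exact: rapid_plus.
      exists (fun t => df t + dg t)%C. split; last exact: clo_plus. move=> t. exact: CD_plus.
    - move=> c f _ [R1 [df [D1 C1]]]. split; first exact: rapid_scal.
      exists (fun t => c * df t)%C. split; last exact: clo_scal. move=> t. exact: CD_scal.
    - move=> f Cf [R1 [df [D1 C1]]]. split; first exact: rapid_t.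
      exists (fun t => f t + RtoC t * df t)%C. split; last by apply: clo_plus => //; exact: clo_t.
      move=> t. apply: CD_eq. apply: CD_mult (D1 t). apply: (CD_RtoC (fun t => t)). apply: is_derive_id. rewrite /one /=. cbv beta; ring. }
  move=> [R1 [dh [D1 C1]]]. have E := dC_eq _ _ D1. rewrite E. by split; [|split].
Qed.

Lemma Schw_clo f : clo Schw f -> Schw f.
Proof.
  apply: clo_Schw => h Hh. split; first exact: Schw_rapid. exists (dC h). split; first exact: Schw_CD.
  apply: clo_b. exact: Schw_d.
Qed.

Lemma Schw_plus f g : Schw f -> Schw g -> Schw (fun t => f t + g t)%C.
Proof. move=> Hf Hg. apply: Schw_clo. apply: clo_plus; exact: clo_b. Qed.
Lemma Schw_scal c f : Schw f -> Schw (fun t => c * f t)%C.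
Proof. move=> Hf. apply: Schw_clo. apply: clo_scal; exact: clo_b. Qed.
Lemma Schw_t f : Schw f -> Schw (fun t => RtoC t * f t)%C.
Proof. move=> Hf. apply: Schw_clo. apply: clo_t; exact: clo_b. Qed.

(** Decay of [g] alone is enough, because the equation expresses its derivative through [g], [t g]
    and a function already known to be Schwartz. *)
Lemma Schw_ode (tau : C) g f : rapid g -> Schw f ->
  (forall t, CD g t (tau * (RtoC t * g t) + f t)%C) -> Schw g.
Proof.
  move=> Hg Hf Hd. apply: (clo_Schw (fun h => h = g \/ Schw h)); last by apply: clo_b; left.
  move=> h [-> | Hh].
  - split => //. eexists; split; first exact: Hd. apply: clo_plus; last by apply: clo_b; right.
    apply: clo_scal. apply: clo_t. apply: clo_b. by left.
  - split; first exact: Schw_rapid. exists (dC h). split; first exact: Schw_CD. apply: clo_b. right. exact: Schw_d.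
Qed.

(** The complex Gaussian [exp(- tau t^2 / 2)], with modulus and phase separated. *)
Definition Gs (tau : C) (t : R) : C := (RtoC (exp (- Re tau * t ^ 2 / 2)) * cis (- Im tau * t ^ 2 / 2))%C.

Lemma CD_Gs tau t : CD (Gs tau) t (- tau * (RtoC t * Gs tau t))%C.
Proof.
  apply: CD_eq.
  - apply: CD_mult.
    + apply: CD_RtoC. apply: (is_derive_Rcomp exp). apply: is_derive_exp.
      instantiate (1 := - Re tau * t). auto_derive => //. field.
    + apply: (CD_cis_comp (fun t => - Im tau * t ^ 2 / 2)).
      instantiate (1 := - Im tau * t). auto_derive => //. field.
  - rewrite /Gs. cbv beta. apply: C_ext => /=; rewrite /Re /Im; ring.
Qed.

Lemma Gs_inv tau t : (Gs (- tau)%C t * Gs tau t)%C = 1%C.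
Proof.
  rewrite /Gs.
  transitivity ((RtoC (exp (- Re (- tau)%C * t ^ 2 / 2)) * RtoC (exp (- Re tau * t ^ 2 / 2))) * (cis (- Im (- tau)%C * t ^ 2 / 2) * cis (- Im tau * t ^ 2 / 2)))%C; first ring.
  rewrite -cis_plus -RtoC_mult -exp_plus.
  have -> : - Re (- tau)%C * t ^ 2 / 2 + - Re tau * t ^ 2 / 2 = 0 by rewrite /= /Re /Im; field.
  have -> : - Im (- tau)%C * t ^ 2 / 2 + - Im tau * t ^ 2 / 2 = 0 by rewrite /= /Re /Im; field.
  rewrite exp_0 cis_0. ring.
Qed.

Lemma Cmod_Gs tau t : Cmod (Gs tau t) = exp (- Re tau * t ^ 2 / 2).
Proof.
  rewrite /Gs Cmod_mult Cmod_cis Cmod_R Rabs_right ?Rmult_1_r //. apply: Rle_ge. apply: Rlt_le. exact: exp_pos.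
Qed.

Lemma exp_lower (y : R) (p : nat) : 0 <= y -> (y / INR (S p)) ^ (S p) <= exp y.
Proof.
  move=> Hy. have Hp : 0 < INR (S p) by apply: lt_0_INR; lia.
  have -> : exp y = exp (y / INR (S p)) ^ (S p).
  { rewrite -Rpower_pow; last exact: exp_pos. rewrite /Rpower ln_exp. f_equal. field. lra. }
  apply: pow_incr. split. apply: Rdiv_le_0_compat => //.
  have := exp_ineq1_le (y / INR (S p)). lra.
Qed.

Lemma gauss_rapid k p : 0 < k -> exists M, forall t, Rabs t ^ p * exp (- k * t ^ 2 / 2) <= M.
Proof.
  move=> Hk. set q := (2 * INR (S p) / k). exists (1 + q ^ (S p)) => t.
  have Hp : 0 < INR (S p) by apply: lt_0_INR; lia.
  have Hq : 0 < q by apply: Rdiv_lt_0_compat; lra.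
  set y := k * t ^ 2 / 2. have Hy : 0 <= y by rewrite /y; have := pow2_ge_0 t; nra.
  have -> : - k * t ^ 2 / 2 = - y by rewrite /y; field. rewrite exp_Ropp.
  have E0 := exp_pos y. have E1 : 1 <= exp y by have := exp_ineq1_le y; lra.
  have EL := exp_lower y p Hy.
  have Ht : t ^ 2 = q * (y / INR (S p)) by rewrite /q /y; field; lra.
  have B : Rabs t ^ p <= 1 + (t ^ 2) ^ (S p).
  { case: (Rle_lt_dec (Rabs t) 1) => H1.
    - have : Rabs t ^ p <= 1 by rewrite -(pow1 p); apply: pow_incr; split => //; exact: Rabs_pos.
      have : 0 <= (t ^ 2) ^ (S p) by apply: pow_le; exact: pow2_ge_0. lra.
    - have : Rabs t ^ p <= (t ^ 2) ^ (S p). { rewrite -pow2_abs -pow_mult. apply: Rle_pow; [lra|lia]. } lra. }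
  apply: (Rmult_le_reg_r (exp y)) => //. rewrite Rmult_assoc Rinv_l; last lra. rewrite Rmult_1_r.
  apply: Rle_trans B _. rewrite Ht Rpow_mult_distr.
  have : 0 <= q ^ (S p) by apply: pow_le; lra. nra.
Qed.

Lemma Gs_rapid tau : 0 < Re tau -> rapid (Gs tau).
Proof. move=> H p. case: (gauss_rapid (Re tau) p H) => M HM. exists M => t. rewrite Cmod_Gs. exact: HM. Qed.

Lemma Schw_zero : Schw (fun _ => 0%C).
Proof.
  apply: (clo_Schw (fun h => h = fun _ => 0%C)); last by apply: clo_b.
  move=> h ->. split. { move=> p. exists 0 => t. rewrite Cmod_0. lra. }
  exists (fun _ => 0%C). split; last by apply: clo_b. move=> t. exact: CD_const.
Qed.

Lemma Schw_Gs tau : 0 < Re tau -> Schw (Gs tau).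
Proof.
  move=> H. apply: (Schw_ode (- tau)%C _ (fun _ => 0%C)).
  - exact: Gs_rapid. - exact: Schw_zero. - move=> t. apply: CD_eq. exact: CD_Gs. ring.
Qed.

(** * Solving the first order equation on the line *)

Lemma ccont_bounded f : ccont f -> exists M, forall t, -1 <= t <= 1 -> Cmod (f t) <= M.
Proof.
  move=> [H1 H2].
  have B : forall h : R -> R, (forall t, continuous h t) -> exists M, forall t, -1 <= t <= 1 -> Rabs (h t) <= M.
  { move=> h Hh. case: (loc_bounded_RInt (U := R_UniformSpace) (fun _ t => h t) 0 (-1) 1 ltac:(lra)).
    - move=> p t. apply: (continuous_scomp h) => //; cont.
    - move=> d [M HM]. exists M => t Ht. apply: (HM 0) => //. exact: ball_center. }
  case: (B _ H1) => M1 B1. case: (B _ H2) => M2 B2. exists (M1 + M2) => t Ht.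
  apply: Rle_trans (proj2 (proj2 (Rabs_Re_Im _))) _. have := B1 t Ht; have := B2 t Ht; lra.
Qed.

Lemma CD_CR f x : ccont f -> CD (fun t => CR f 0 t) x (f x).
Proof. move=> [H1 H2]; split => /=; exact: is_derive_RInt_upper. Qed.

Lemma is_derive_gauss k s : is_derive (fun s => exp (- k * s ^ 2 / 2)) s (- k * s * exp (- k * s ^ 2 / 2)).
Proof.
  apply: is_derive_eq. apply: (is_derive_Rcomp exp). apply: is_derive_exp.
  instantiate (1 := - k * s). auto_derive => //. field. ring.
Qed.

Section Tail.
Variables (k : R) (psi : R -> C).
Hypotheses (Hk : 0 < k) (Hc : ccont psi).

(** For [s >= 1] the Gaussian is at most [s] times itself, which has an explicit primitive. The
    bound on the tail thus keeps the full Gaussian factor, as is needed against the growing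
    homogeneous solution. *)
Lemma tail_component (h : R -> R) M p t T : (forall t, continuous h t) ->
  (forall s, Rabs s ^ p * Rabs (h s) <= M * exp (- k * s ^ 2 / 2)) -> 1 <= t <= T ->
  t ^ p * Rabs (RInt h 0 T - RInt h 0 t) <= M / k * exp (- k * t ^ 2 / 2).
Proof.
  move=> Hh HM Ht.
  have HM0 : 0 <= M.
  { have := HM 0. have := exp_pos (- k * 0 ^ 2 / 2). have := Rabs_pos (h 0). have := pow_le _ p (Rabs_pos 0). nra. }
  have -> : RInt h 0 T - RInt h 0 t = RInt h t T. { rewrite -(RInt_RChasles h 0 t T Hh). rring. }
  have Hp : 0 < t ^ p by apply: pow_lt; lra.
  set bnd := fun s => M / t ^ p * (s * exp (- k * s ^ 2 / 2)).
  have De : forall s, is_derive (fun s => - (M / t ^ p / k) * exp (- k * s ^ 2 / 2)) s (bnd s).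
  { move=> s. rewrite /bnd. apply: is_derive_eq. apply: (is_derive_scal (fun s => exp (- k * s ^ 2 / 2))). exact: is_derive_gauss. field. lra. }
  have Cb : forall s, continuous bnd s.
  { move=> s. rewrite /bnd. apply: continuous_Rmult; first by cont. apply: continuous_Rmult; first by cont.
    apply: (continuous_of_derive (fun s => exp (- k * s ^ 2 / 2)) s (- k * s * exp (- k * s ^ 2 / 2))). exact: is_derive_gauss. }
  have E : RInt bnd t T = M / t ^ p / k * exp (- k * t ^ 2 / 2) - M / t ^ p / k * exp (- k * T ^ 2 / 2).
  { rewrite (RInt_Derive_eq _ _ t T De Cb). rring. }
  have P : forall s, t < s < T -> Rabs (h s) <= bnd s.
  { move=> s Hs. have Hs0 : 0 < t ^ p <= s ^ p by split => //; apply: pow_incr; lra.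
    have B := HM s. rewrite (Rabs_right s) in B; last lra.
    have Ex := exp_pos (- k * s ^ 2 / 2). have A := Rabs_pos (h s).
    apply: (Rmult_le_reg_l (t ^ p)) => //.
    have -> : t ^ p * bnd s = M * (s * exp (- k * s ^ 2 / 2)) by rewrite /bnd; field; lra.
    apply: Rle_trans (_ : s ^ p * Rabs (h s) <= _); first nra. apply: Rle_trans B _.
    apply: Rmult_le_compat_l => //. nra. }
  have Q : Rabs (RInt h t T) <= RInt bnd t T.
  { apply: Rabs_le; split.
    - have <- : RInt (fun t => (-1) * bnd t) t T = - RInt bnd t T. { rewrite RInt_Rscal; last exact: ex_RInt_c. rring. }
      apply: RInt_le; [lra|apply: ex_RInt_c => s; apply: continuous_Rmult => //; cont|exact: ex_RInt_c|].
      move=> s /P /Rabs_le_between. lra.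
    - apply: RInt_le; [lra|exact: ex_RInt_c|exact: ex_RInt_c|]. move=> s /P /Rabs_le_between. lra. }
  have Q2 : RInt bnd t T <= M / t ^ p / k * exp (- k * t ^ 2 / 2).
  { rewrite E. have := exp_pos (- k * T ^ 2 / 2).
    have : 0 <= M / t ^ p / k. { apply: Rdiv_le_0_compat => //. exact: Rdiv_le_0_compat. } nra. }
  have -> : M / k * exp (- k * t ^ 2 / 2) = t ^ p * (M / t ^ p / k * exp (- k * t ^ 2 / 2)) by field; lra.
  apply: Rmult_le_compat_l; lra.
Qed.

Hypothesis Hr : forall p : nat, exists M, forall s, Rabs s ^ p * Cmod (psi s) <= M * exp (- k * s ^ 2 / 2).

Lemma exp_neg_le t : exp (- k * t ^ 2 / 2) <= 1.
Proof.
  rewrite -exp_0. have : - k * t ^ 2 / 2 <= 0 by have := pow2_ge_0 t; nra.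
  case => [H | ->]; last lra. apply: Rlt_le. exact: exp_increasing.
Qed.

Lemma tail_limit_component (h : R -> R) : (forall t, continuous h t) -> (forall t, Rabs (h t) <= Cmod (psi t)) ->
  exists L, forall p : nat, exists M, forall t, 1 <= t -> t ^ p * Rabs (L - RInt h 0 t) <= M * exp (- k * t ^ 2 / 2).
Proof.
  move=> Hh Hle.
  have Hr' : forall p : nat, exists M, 0 <= M /\ forall s, Rabs s ^ p * Rabs (h s) <= M * exp (- k * s ^ 2 / 2).
  { move=> p. case: (Hr p) => M HM. exists M. split.
    - have := HM 0. have := exp_pos (- k * 0 ^ 2 / 2). have := Cmod_ge_0 (psi 0). have := pow_le _ p (Rabs_pos 0). nra.
    - move=> s. have := HM s. have := Hle s. have := pow_le _ p (Rabs_pos s). nra. }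
  set u := fun n => RInt h 0 (INR n).
  have [L HL] : exists L, is_lim_seq u (Finite L).
  { case: (Hr' 1%nat) => M [HM0 HM].
    have : ex_finite_lim_seq u; last by case=> L; exists L.
    apply/ex_lim_seq_cauchy_corr => e.
    have [N HN] := INR_unbounded (M / k / e + 1). exists N => n m Hn Hm.
    have He := cond_pos e.
    have W : forall n m, (N <= n)%nat -> (n <= m)%nat -> Rabs (u m - u n) < e.
    { move=> n' m' Hn' Hm'. have Hn1 : INR N <= INR n' by apply: le_INR.
      have Hq : 0 <= M / k / e by apply: Rdiv_le_0_compat => //; apply: Rdiv_le_0_compat.
      have := tail_component h M 1 (INR n') (INR m') Hh HM ltac:(split; [lra|exact: le_INR]).
      rewrite -/(u m') -/(u n') pow_1. have Ex := exp_neg_le (INR n').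
      have Hmk : 0 <= M / k by apply: Rdiv_le_0_compat.
      move=> B. apply: (Rmult_lt_reg_l (INR n')); first lra.
      apply: Rle_lt_trans B _. apply: Rle_lt_trans (_ : M / k * 1 < _); first by apply: Rmult_le_compat_l.
      have E3 : M / k * 1 = M / k / e * e by field; lra. rewrite E3. apply: Rmult_lt_compat_r; lra. }
    case: (Nat.le_ge_cases n m) => Hnm.
    - rewrite Rabs_minus_sym. exact: W. - exact: W. }
  exists L => p. case: (Hr' p) => M [HM0 HM]. exists (M / k) => t Ht.
  have Hl : is_lim_seq (fun n => t ^ p * Rabs (u n - RInt h 0 t)) (t ^ p * Rabs (L - RInt h 0 t)).
  { apply: (is_lim_seq_scal_l (fun n => Rabs (u n - RInt h 0 t)) (t ^ p) (Finite _)).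
    apply: (is_lim_seq_abs (fun n => u n - RInt h 0 t) (Finite _)).
    apply: is_lim_seq_minus'; first exact: HL. apply: is_lim_seq_const. }
  have [N HN] := INR_unbounded t.
  apply: (is_lim_seq_le_loc _ (fun _ => M / k * exp (- k * t ^ 2 / 2)) (Finite _) (Finite _) _ Hl (is_lim_seq_const _)).
  exists N => n Hn. apply: tail_component => //. have : INR N <= INR n by apply: le_INR. lra.
Qed.

Lemma tail_limit : exists L : C, forall p : nat, exists M, forall t, 1 <= t ->
  t ^ p * Cmod (L - CR psi 0 t)%C <= M * exp (- k * t ^ 2 / 2).
Proof.
  case: Hc => [H1 H2].
  case: (tail_limit_component _ H1 (fun t => proj1 (Rabs_Re_Im _))) => L1 B1.
  case: (tail_limit_component _ H2 (fun t => proj1 (proj2 (Rabs_Re_Im _)))) => L2 B2.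
  exists (L1, L2) => p. case: (B1 p) => M1 C1. case: (B2 p) => M2 C2. exists (M1 + M2) => t Ht.

  have D1 : t ^ p * Rabs (L1 - RInt (fun t => Re (psi t)) 0 t) <= M1 * exp (- k * t ^ 2 / 2) := C1 t Ht.
  have D2 : t ^ p * Rabs (L2 - RInt (fun t => Im (psi t)) 0 t) <= M2 * exp (- k * t ^ 2 / 2) := C2 t Ht.
  have D3 : Cmod ((L1, L2) - CR psi 0 t)%C <= Rabs (L1 - RInt (fun t => Re (psi t)) 0 t) + Rabs (L2 - RInt (fun t => Im (psi t)) 0 t).
  { exact: (proj2 (proj2 (Rabs_Re_Im ((L1, L2) - CR psi 0 t)%C))). }
  have Hp : 0 <= t ^ p by apply: pow_le; lra.
  apply: Rle_trans (Rmult_le_compat_l _ _ _ Hp D3) _. lra.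
Qed.
End Tail.

Lemma CR_reflect f t : ccont f -> CR (fun s => f (- s)) 0 t = (- CR f 0 (- t))%C.
Proof.
  move=> [H1 H2].
  have B : forall h : R -> R, (forall t, continuous h t) -> RInt (fun s => h (- s)) 0 t = - RInt h 0 (- t).
  { move=> h Hh. rewrite (RInt_Derive_eq (fun s => - RInt h 0 (- s))).
    - rewrite Ropp_0 RInt_Rpoint. rring.
    - move=> s. apply: is_derive_eq. apply: (is_derive_opp (fun s => RInt h 0 (- s))).
      apply: (is_derive_Rcomp (fun x => RInt h 0 x) (fun s => - s)). exact: is_derive_RInt_upper.
      apply: (is_derive_opp (fun s => s)). apply: is_derive_id. rewrite /opp /one /=. ring.
    - move=> s. apply: (continuous_scomp h (fun s => - s)) => //. apply: (continuous_opp (fun s : R => s)). cont. }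
  apply: C_ext => /=; exact: B.
Qed.

Lemma RInt_upper_le (f : R -> R) a b c : (forall t, continuous f t) -> (forall t, 0 <= f t) -> b <= c ->
  RInt f a b <= RInt f a c.
Proof.
  move=> Hc Hp Hbc. have H1 : 0 <= RInt f b c by apply: RInt_ge_0 => //; exact: ex_RInt_c.
  have H2 := RInt_RChasles f a b c Hc. lra.
Qed.

(** Variation of constants. The homogeneous solution [Gs (- tau)] grows at both ends, so decay
    forces the primitive of the source times [Gs tau] to have the same limit at both infinities.
    This is one linear condition on the source, and a multiple of [Gs (Cconj tau)] achieves it
    because its pairing with [Gs tau] is a positive integral. *)
Lemma solve_line tau f : 0 < Re tau -> Schw f -> exists (c : C) g, Schw g /\
  forall t, CD g t (tau * (RtoC t * g t) - f t + c * Gs (Cconj tau) t)%C.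
Proof.
  move=> Ht Sf. set k := Re tau in Ht *.
  have Sg : Schw (Gs (Cconj tau)) by apply: Schw_Gs.
  have CGs : forall x, ccont (Gs x) by move=> x; apply: (ccont_CD _ _ (CD_Gs x)).
  have CS : forall h, Schw h -> ccont (fun s => h s * Gs tau s)%C.
  { move=> h Hh. apply: ccont_mult => //. exact: (ccont_CD _ _ (Schw_CD _ Hh)). }
  have CSn : forall h, Schw h -> ccont (fun s => h (- s)%R * Gs tau (- s)%R)%C.
  { move=> h Hh. case: (CS h Hh) => [c1 c2]. split => t.
    - apply: (continuous_scomp (fun s => Re (h s * Gs tau s)%C) (fun s => - s)) => //. apply: (continuous_opp (fun s : R => s)). cont.
    - apply: (continuous_scomp (fun s => Im (h s * Gs tau s)%C) (fun s => - s)) => //. apply: (continuous_opp (fun s : R => s)). cont. }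
  have RS : forall h, Schw h -> forall p : nat, exists M, forall s, Rabs s ^ p * Cmod (h s * Gs tau s)%C <= M * exp (- k * s ^ 2 / 2).
  { move=> h Hh p. case: (Schw_rapid _ Hh p) => M HM. exists M => s. rewrite Cmod_mult Cmod_Gs -/k -Rmult_assoc.
    apply: Rmult_le_compat_r => //. apply: Rlt_le; exact: exp_pos. }
  have TL : forall h, Schw h -> exists Lp Lm : C,
    (forall p : nat, exists M, forall t, 1 <= t -> t ^ p * Cmod (Lp - CR (fun s => h s * Gs tau s)%C 0 t)%C <= M * exp (- k * t ^ 2 / 2)) /\
    (forall p : nat, exists M, forall t, 1 <= t -> t ^ p * Cmod (Lm - CR (fun s => h s * Gs tau s)%C 0 (- t))%C <= M * exp (- k * t ^ 2 / 2)).
  { move=> h Hh. case: (tail_limit k _ Ht (CS h Hh) (RS h Hh)) => Lp HLp.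
    case: (tail_limit k (fun s => h (- s)%R * Gs tau (- s)%R)%C Ht (CSn h Hh)) => [|Lm HLm].
    { move=> p. case: (RS h Hh p) => M HM. exists M => s. have := HM (- s). rewrite Rabs_Ropp.
      by have -> : (- s) ^ 2 = s ^ 2 by ring. }
    exists Lp, (- Lm)%C. split => // p. case: (HLm p) => M HM. exists M => t H1. have := HM t H1.
    rewrite (CR_reflect (fun s => h s * Gs tau s)%C t (CS h Hh)).
    have -> : (- Lm - CR (fun s => h s * Gs tau s) 0 (- t))%C = (- (Lm - - CR (fun s => h s * Gs tau s) 0 (- t)))%C by ring.
    by rewrite Cmod_opp. }
  (* Limits at plus and minus infinity of the primitives from 0: [Fp], [Fm] for the source [f], and
     [Gp], [Gm] for the Gaussian used to correct it. *)
  case: (TL _ Sf) => Fp [Fm [HFp HFm]]. case: (TL _ Sg) => Gp [Gm [HGp HGm]].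
  have Edens : forall s, (Gs (Cconj tau) s * Gs tau s)%C = RtoC (exp (- k * s ^ 2)).
  { move=> s. rewrite /Gs.
    transitivity ((RtoC (exp (- Re (Cconj tau) * s ^ 2 / 2)) * RtoC (exp (- Re tau * s ^ 2 / 2))) * (cis (- Im (Cconj tau) * s ^ 2 / 2) * cis (- Im tau * s ^ 2 / 2)))%C; first ring.
    rewrite -cis_plus -RtoC_mult -exp_plus.
    have -> : - Re (Cconj tau) * s ^ 2 / 2 + - Re tau * s ^ 2 / 2 = - k * s ^ 2 by rewrite /k /= /Re /Im; field.
    have -> : - Im (Cconj tau) * s ^ 2 / 2 + - Im tau * s ^ 2 / 2 = 0 by rewrite /= /Re /Im; field.
    rewrite cis_0. ring. }
  have Cd : forall s, continuous (fun s => exp (- k * s ^ 2)) s.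
  { move=> s. apply: (continuous_of_derive _ s (- k * (2 * s) * exp (- k * s ^ 2))). apply: is_derive_eq.
    apply: (is_derive_Rcomp exp). apply: is_derive_exp. instantiate (1 := - k * (2 * s)). auto_derive => //. ring. ring. }
  have EG : forall t, CR (fun s => Gs (Cconj tau) s * Gs tau s)%C 0 t = RtoC (RInt (fun s => exp (- k * s ^ 2)) 0 t).
  { move=> t. rewrite (CR_ext _ (fun s => RtoC (exp (- k * s ^ 2)))) // /CR /= RInt_const /scal /= /mult /= Rmult_0_r. by []. }
  set m := RInt (fun s => exp (- k * s ^ 2)) 0 1.
  have Hm : 0 < m by apply: RInt_gt_0; [lra|move=> s _; exact: exp_pos|move=> s _; exact: Cd].
  (* With [EGm] this gives [Gp - Gm] a positive real part, hence a nonzero total integral. Otherwise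
     the primitive would stay away from its limit, against the decay of the tail. *)
  have EGp : m <= Re Gp.
  { apply: Rnot_lt_le => Hlt. case: (HGp 1%nat) => M HM.
    have [N HN] := INR_unbounded (Rmax 1 (M / (m - Re Gp))).
    have N1 : 1 <= INR N by have := Rmax_l 1 (M / (m - Re Gp)); lra.
    have N2 : M / (m - Re Gp) < INR N by have := Rmax_r 1 (M / (m - Re Gp)); lra.
    have := HM (INR N) N1. rewrite EG pow_1. have R1 := proj1 (Rabs_Re_Im (Gp - RtoC (RInt (fun s => exp (- k * s ^ 2)) 0 (INR N)))%C).
    have Rm : m <= RInt (fun s => exp (- k * s ^ 2)) 0 (INR N).
    { apply: RInt_upper_le => // s. apply: Rlt_le; exact: exp_pos. }
    have R2 : m - Re Gp <= Rabs (Re (Gp - RtoC (RInt (fun s => exp (- k * s ^ 2)) 0 (INR N)))%C).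
    { change (m - Re Gp <= Rabs (Re Gp + - RInt (fun s => exp (- k * s ^ 2)) 0 (INR N))). rewrite Rabs_left1; lra. }
    have Ex := exp_neg_le k Ht (INR N). have Ep := exp_pos (- k * INR N ^ 2 / 2).
    have A : M < INR N * (m - Re Gp).
    { have -> : M = M / (m - Re Gp) * (m - Re Gp) by field; lra. apply: Rmult_lt_compat_r; lra. }
    have B : INR N * (m - Re Gp) <= INR N * Cmod (Gp - RtoC (RInt (fun s => exp (- k * s ^ 2)) 0 (INR N)))%C by apply: Rmult_le_compat_l; lra.
    have Z : 0 < INR N * (m - Re Gp) by apply: Rmult_lt_0_compat; lra.
    nra. }
  have EGm : Re Gm <= 0.
  { apply: Rnot_lt_le => Hlt. case: (HGm 1%nat) => M HM.
    have [N HN] := INR_unbounded (Rmax 1 (M / Re Gm)).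
    have N1 : 1 <= INR N by have := Rmax_l 1 (M / Re Gm); lra.
    have N2 : M / Re Gm < INR N by have := Rmax_r 1 (M / Re Gm); lra.
    have := HM (INR N) N1. rewrite EG pow_1. have R1 := proj1 (Rabs_Re_Im (Gm - RtoC (RInt (fun s => exp (- k * s ^ 2)) 0 (- INR N)))%C).
    have Rm : RInt (fun s => exp (- k * s ^ 2)) 0 (- INR N) <= 0.
    { apply: Rle_trans (Req_le _ _ (RInt_Rpoint (fun s => exp (- k * s ^ 2)) 0)). apply: RInt_upper_le => //; last lra. move=> s. apply: Rlt_le; exact: exp_pos. }
    have R2 : Re Gm <= Rabs (Re (Gm - RtoC (RInt (fun s => exp (- k * s ^ 2)) 0 (- INR N)))%C).
    { change (Re Gm <= Rabs (Re Gm + - RInt (fun s => exp (- k * s ^ 2)) 0 (- INR N))). rewrite Rabs_right; lra. }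
    have Ex := exp_neg_le k Ht (INR N). have Ep := exp_pos (- k * INR N ^ 2 / 2).
    have A : M < INR N * Re Gm.
    { have -> : M = M / Re Gm * Re Gm by field; lra. apply: Rmult_lt_compat_r; lra. }
    have B : INR N * Re Gm <= INR N * Cmod (Gm - RtoC (RInt (fun s => exp (- k * s ^ 2)) 0 (- INR N)))%C by apply: Rmult_le_compat_l; lra.
    have Z : 0 < INR N * Re Gm by apply: Rmult_lt_0_compat; lra.
    nra. }
  have Gne : (Gp - Gm)%C <> 0%C. { move=> E. have := f_equal Re E. rewrite /= -/(Re Gp) -/(Re Gm). lra. }
  (* The quotient of the two total integrals, so that the corrected source pairs to zero with
     [Gs tau]. *)
  set c := ((Fp - Fm) / (Gp - Gm))%C.
  have Ec : (Fp - c * Gp = Fm - c * Gm)%C by rewrite /c; field.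
  set phi := (fun t => f t - c * Gs (Cconj tau) t)%C.
  have Sphi : Schw phi.
  { have -> : phi = (fun t => f t + (- c) * Gs (Cconj tau) t)%C by apply: functional_extensionality => t; rewrite /phi; ring.
    apply: Schw_plus => //. exact: Schw_scal. }
  set L := (Fp - c * Gp)%C.
  set J := fun t => CR (fun s => phi s * Gs tau s)%C 0 t.
  have EJ : forall t, J t = (CR (fun s => f s * Gs tau s)%C 0 t - c * CR (fun s => Gs (Cconj tau) s * Gs tau s)%C 0 t)%C.
  { move=> t. rewrite /J (CR_ext _ (fun s => f s * Gs tau s + (- c) * (Gs (Cconj tau) s * Gs tau s))%C); last by move=> s; rewrite /phi; ring.
    rewrite CR_plus; [|exact: (CS f)|by apply: ccont_scal; exact: CS]. rewrite CR_scal; last exact: CS. ring. }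
  (* [L] is the common limit of [J] at both ends, so [L - J t] is a tail on either side. *)
  set g := fun t => (Gs (- tau) t * (L - J t))%C.
  have Dg : forall t, CD g t (tau * (RtoC t * g t) - f t + c * Gs (Cconj tau) t)%C.
  { move=> t. apply: CD_eq.
    - apply: CD_mult; first exact: CD_Gs. apply: CD_plus; first exact: CD_const.
      apply: (CD_ext (fun t => (-1) * J t)%C); first by move=> s; ring. apply: CD_scal. apply: CD_CR. exact: CS.
    - cbv beta.
      transitivity (tau * (RtoC t * g t) - (Gs (- tau) t * Gs tau t) * phi t)%C; first by rewrite /g; ring.
      rewrite Gs_inv /phi. ring. }
  exists c, g. split => //.
  apply: (Schw_ode tau g (fun t => (-1) * phi t)%C); last first.
  - move=> t. apply: CD_eq (Dg t) _. rewrite /phi. ring.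
  - exact: Schw_scal.
  (* Outside a compact interval the Gaussian factor in the tail bound cancels the growth of
     [Gs (- tau)] exactly, leaving the power of [t]; inside, continuity suffices. *)
  - have Cg := ccont_CD _ _ Dg. case: (ccont_bounded g Cg) => M0 HM0 p.
    case: (HFp p) => M1 HM1. case: (HGp p) => M2 HM2. case: (HFm p) => M3 HM3. case: (HGm p) => M4 HM4.
    have Eg : forall t, Cmod (g t) = exp (k * t ^ 2 / 2) * Cmod (L - J t)%C.
    { move=> t. rewrite /g Cmod_mult Cmod_Gs. do 2 f_equal. rewrite /k /= /Re. field. }
    have Ee : forall t, exp (k * t ^ 2 / 2) * exp (- k * t ^ 2 / 2) = 1.
    { move=> t. rewrite -exp_plus. have -> : k * t ^ 2 / 2 + - k * t ^ 2 / 2 = 0 by field. exact: exp_0. }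
    have Tri : forall x y : C, Cmod (x - c * y)%C <= Cmod x + Cmod c * Cmod y.
    { move=> x y. have := Cmod_triangle x (- (c * y))%C. rewrite Cmod_opp Cmod_mult => H; exact: H. }
    exists (Rabs M0 + (Rabs (M1 + Cmod c * M2)) + (Rabs (M3 + Cmod c * M4))) => t.
    have A0 := Rabs_pos M0. have A1 := Rabs_pos (M1 + Cmod c * M2). have A2 := Rabs_pos (M3 + Cmod c * M4).
    have B0 := Rle_abs M0. have B1 := Rle_abs (M1 + Cmod c * M2). have B2 := Rle_abs (M3 + Cmod c * M4).
    have Kc := Cmod_ge_0 c.
    case: (Rle_lt_dec 1 t) => H1; [|case: (Rle_lt_dec t (-1)) => H2].
    + rewrite Eg Rabs_right; last lra. have Hp : 0 <= t ^ p by apply: pow_le; lra.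
      have -> : (L - J t)%C = ((Fp - CR (fun s => f s * Gs tau s)%C 0 t) - c * (Gp - CR (fun s => Gs (Cconj tau) s * Gs tau s)%C 0 t))%C by rewrite EJ /L; ring.
      have T := Tri (Fp - CR (fun s => f s * Gs tau s)%C 0 t)%C (Gp - CR (fun s => Gs (Cconj tau) s * Gs tau s)%C 0 t)%C.
      have D1 := HM1 t H1. have D2 := Rmult_le_compat_l _ _ _ Kc (HM2 t H1). have Te := Rmult_le_compat_l _ _ _ Hp T.
      have X := exp_pos (k * t ^ 2 / 2). have E := Ee t.
      apply: Rle_trans (_ : exp (k * t ^ 2 / 2) * ((M1 + Cmod c * M2) * exp (- k * t ^ 2 / 2)) <= _).
      * rewrite -Rmult_assoc (Rmult_comm (t ^ p) (exp _)) Rmult_assoc. apply: Rmult_le_compat_l; first lra. apply: Rle_trans Te _. lra.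
      * have -> : exp (k * t ^ 2 / 2) * ((M1 + Cmod c * M2) * exp (- k * t ^ 2 / 2)) = (M1 + Cmod c * M2) * (exp (k * t ^ 2 / 2) * exp (- k * t ^ 2 / 2)) by ring.
        rewrite E. lra.
    + have [u Hu] : exists u, t = - u by exists (- t); ring. subst t.
      have H1' : 1 <= u by lra. rewrite Eg Rabs_Ropp Rabs_right; last lra. have Hp : 0 <= u ^ p by apply: pow_le; lra.
      have -> : (L - J (- u)%R)%C = ((Fm - CR (fun s => f s * Gs tau s)%C 0 (- u)) - c * (Gm - CR (fun s => Gs (Cconj tau) s * Gs tau s)%C 0 (- u)))%C by rewrite EJ /L Ec; ring.
      have -> : (- u) ^ 2 = u ^ 2 by ring.
      have T := Tri (Fm - CR (fun s => f s * Gs tau s)%C 0 (- u))%C (Gm - CR (fun s => Gs (Cconj tau) s * Gs tau s)%C 0 (- u))%C.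
      have D1 := HM3 u H1'. have D2 := Rmult_le_compat_l _ _ _ Kc (HM4 u H1'). have Te := Rmult_le_compat_l _ _ _ Hp T.
      have X := exp_pos (k * u ^ 2 / 2). have E := Ee u.
      apply: Rle_trans (_ : exp (k * u ^ 2 / 2) * ((M3 + Cmod c * M4) * exp (- k * u ^ 2 / 2)) <= _).
      * rewrite -Rmult_assoc (Rmult_comm (u ^ p) (exp _)) Rmult_assoc. apply: Rmult_le_compat_l; first lra. apply: Rle_trans Te _. lra.
      * have -> : exp (k * u ^ 2 / 2) * ((M3 + Cmod c * M4) * exp (- k * u ^ 2 / 2)) = (M3 + Cmod c * M4) * (exp (k * u ^ 2 / 2) * exp (- k * u ^ 2 / 2)) by ring.
        rewrite E. lra.
    + have Hg := HM0 t ltac:(lra). have : Rabs t ^ p <= 1.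
      { rewrite -(pow1 p). apply: pow_incr. split; first exact: Rabs_pos. apply: Rabs_le; lra. }
      have := pow_le _ p (Rabs_pos t). have := Cmod_ge_0 (g t). nra.
Qed.

(** * Absolutely convergent bilateral series *)

Definition zlim (a : Z -> C) (l : C) : Prop :=
  forall e, 0 < e -> exists N, forall n, (N <= n)%nat -> Cmod (zpart a n - l)%C < e.

Definition dominated (a : Z -> C) (M : R) : Prop := forall m, Cmod (a m) <= M / (1 + IZR m ^ 2).

Lemma dom_den m : 0 < 1 + IZR m ^ 2.
Proof. have := pow2_ge_0 (IZR m). lra. Qed.

Lemma dominated_ge0 a M : dominated a M -> 0 <= M.
Proof.
  move=> H. have := H 0%Z. have := Cmod_ge_0 (a 0%Z). have -> : M / (1 + IZR 0 ^ 2) = M by field. lra.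
Qed.

Lemma zpart_S a n : zpart a (S n) = (zpart a n + (a (Z.of_nat (S n)) + a (- Z.of_nat (S n))%Z))%C.
Proof. rewrite /zpart. cbn [csum]. ring. Qed.

(** The terms of index [p + 1] and [-(p + 1)] are together at most [2 M (1/p - 1/(p + 1))], which
    telescopes. The subtracted term is kept for the induction. *)
Lemma zpart_tail a M n p : dominated a M -> (1 <= n)%nat -> (n <= p)%nat ->
  Cmod (zpart a p - zpart a n)%C <= 2 * M / INR n - 2 * M / INR p.
Proof.
  move=> H Hn. have HM := dominated_ge0 _ _ H. elim: p => [|p IH] Hp; first lia.
  case: (Nat.eq_dec n (S p)) => [<-|Hne].
  - have -> : (zpart a n - zpart a n)%C = 0%C by ring. rewrite Cmod_0. lra.
  - have {}IH := IH ltac:(lia). rewrite zpart_S.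
    have -> : (zpart a p + (a (Z.of_nat (S p)) + a (- Z.of_nat (S p))%Z) - zpart a n)%C = ((zpart a p - zpart a n) + (a (Z.of_nat (S p)) + a (- Z.of_nat (S p))%Z))%C by ring.
    have T1 := Cmod_triangle (zpart a p - zpart a n)%C (a (Z.of_nat (S p)) + a (- Z.of_nat (S p))%Z)%C.
    have T2 := Cmod_triangle (a (Z.of_nat (S p))) (a (- Z.of_nat (S p))%Z).
    have H1 := H (Z.of_nat (S p)). have H2 := H (- Z.of_nat (S p))%Z.
    have Hp0 : 0 < INR p by apply: lt_0_INR; lia.
    rewrite opp_IZR -INR_IZR_INZ S_INR in H2. rewrite -INR_IZR_INZ S_INR in H1.
    have E : (- (INR p + 1)) ^ 2 = (INR p + 1) ^ 2 by ring. rewrite E in H2.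
    have B : M / (1 + (INR p + 1) ^ 2) <= M / INR p - M / INR (S p).
    { rewrite S_INR. have -> : M / INR p - M / (INR p + 1) = M / (INR p * (INR p + 1)) by field; lra.
      apply: Rmult_le_compat_l => //. apply: Rinv_le_contravar; nra. }
    rewrite /Rdiv in B *. lra.
Qed.

Lemma zlim_unique a l l' : zlim a l -> zlim a l' -> l = l'.
Proof.
  move=> H H'. apply: NNPP => Hne.
  have Hd : 0 < Cmod (l - l')%C.
  { apply/Cmod_gt_0 => E. apply: Hne. have -> : l = (l - l' + l')%C by ring. rewrite E. ring. }
  case: (H (Cmod (l - l')%C / 2) ltac:(lra)) => N HN. case: (H' (Cmod (l - l')%C / 2) ltac:(lra)) => N' HN'.
  have A := HN (N + N')%nat ltac:(lia). have B := HN' (N + N')%nat ltac:(lia).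
  have T := Cmod_triangle (zpart a (N + N') - l')%C (- (zpart a (N + N') - l))%C. rewrite Cmod_opp in T.
  have E : ((zpart a (N + N') - l') + - (zpart a (N + N') - l))%C = (l - l')%C by ring. rewrite E in T. lra.
Qed.

Lemma dominated_zlim a M : dominated a M -> exists l, zlim a l.
Proof.
  move=> H. have HM := dominated_ge0 _ _ H.
  have B : forall f : C -> R, (forall x y, Rabs (f x - f y) <= Cmod (x - y)%C) -> exists l, is_lim_seq (fun n => f (zpart a n)) (Finite l).
  { move=> f Hf. have : ex_finite_lim_seq (fun n => f (zpart a n)); last by case=> l; exists l.
    apply/ex_lim_seq_cauchy_corr => e. have He := cond_pos e.
    have [N HN] := INR_unbounded (2 * M / e). exists (S N) => n m Hn Hm.
    have W : forall n m, (S N <= n)%nat -> (n <= m)%nat -> Rabs (f (zpart a m) - f (zpart a n)) < e.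
    { move=> n' m' Hn' Hm'. apply: Rle_lt_trans (Hf _ _) _.
      have T := zpart_tail a M n' m' H ltac:(lia) Hm'.
      have Hn0 : 0 < INR n' by apply: lt_0_INR; lia. have Hm0 : 0 < INR m' by apply: lt_0_INR; lia.
      have P : 0 <= 2 * M / INR m' by apply: Rdiv_le_0_compat; lra.
      have : 2 * M / INR n' < e; last lra.
      apply: (Rmult_lt_reg_r (INR n')) => //. have -> : 2 * M / INR n' * INR n' = 2 * M by field; lra.
      have -> : 2 * M = e * (2 * M / e) by field; lra. apply: Rmult_lt_compat_l => //.
      have : INR N <= INR n' by apply: le_INR; lia. lra. }
    case: (Nat.le_ge_cases n m) => Hnm.
    - rewrite Rabs_minus_sym. exact: W. - exact: W. }
  have [l1 H1] := B Re ltac:(move=> x y; exact: (proj1 (Rabs_Re_Im (x - y)%C))).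
  have [l2 H2] := B Im ltac:(move=> x y; exact: (proj1 (proj2 (Rabs_Re_Im (x - y)%C)))).
  exists (l1, l2) => e He. have He2 : 0 < e / 2 by lra.
  move/is_lim_seq_spec: H1 => /(_ (mkposreal _ He2)) [N1 HN1]. move/is_lim_seq_spec: H2 => /(_ (mkposreal _ He2)) [N2 HN2].
  exists (N1 + N2)%nat => n Hn. have A1 : Rabs (Re (zpart a n) - l1) < e / 2 := HN1 n ltac:(lia).
  have A2 : Rabs (Im (zpart a n) - l2) < e / 2 := HN2 n ltac:(lia).
  apply: Rle_lt_trans (proj2 (proj2 (Rabs_Re_Im _))) _.
  change (Rabs (Re (zpart a n) - l1) + Rabs (Im (zpart a n) - l2) < e). lra.
Qed.

(** A total function, so that sums can be rewritten without carrying proofs of convergence; it has a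
    meaning only where a limit exists, in practice for [dominated] families. *)
Definition zser (a : Z -> C) : C := epsilon (inhabits (RtoC 0)) (zlim a).

Lemma zser_lim a M : dominated a M -> zlim a (zser a).
Proof. move=> H. exact: (epsilon_spec (inhabits (RtoC 0)) (zlim a) (dominated_zlim _ _ H)). Qed.

Lemma zser_eq a l : zlim a l -> zser a = l.
Proof. move=> H. apply: (zlim_unique a) => //. exact: (epsilon_spec (inhabits (RtoC 0)) (zlim a) (ex_intro _ l H)). Qed.

Lemma zser_tail a M n : dominated a M -> (1 <= n)%nat -> Cmod (zser a - zpart a n)%C <= 2 * M / INR n.
Proof.
  move=> H Hn. apply: le_epsilon => e He. case: (zser_lim _ _ H e He) => N HN.
  have A := HN (N + n)%nat ltac:(lia). have B := zpart_tail a M n (N + n) H Hn ltac:(lia).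
  have HM := dominated_ge0 _ _ H. have Hp : 0 < INR (N + n) by apply: lt_0_INR; lia.
  have P : 0 <= 2 * M / INR (N + n) by apply: Rdiv_le_0_compat; lra.
  have T := Cmod_triangle (zpart a (N + n) - zpart a n)%C (- (zpart a (N + n) - zser a))%C. rewrite Cmod_opp in T.
  have E : ((zpart a (N + n) - zpart a n) + - (zpart a (N + n) - zser a))%C = (zser a - zpart a n)%C by ring. rewrite E in T. lra.
Qed.

(** The constant 5 is 3 for the terms of index -1, 0 and 1, plus 2 for the tail. *)
Lemma zser_bound a M : dominated a M -> Cmod (zser a) <= 5 * M.
Proof.
  move=> H. have HM := dominated_ge0 _ _ H. have := zser_tail a M 1 H (le_n 1). rewrite Rdiv_1_r => T.
  have T1 := Cmod_triangle (zser a - zpart a 1)%C (zpart a 1).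
  have E : ((zser a - zpart a 1) + zpart a 1)%C = zser a by ring. rewrite E in T1.
  have B : Cmod (zpart a 1) <= 3 * M.
  { have D : forall m, Cmod (a m) <= M.
    { move=> m. apply: Rle_trans (H m) _. have := dom_den m. have := pow2_ge_0 (IZR m) => P Q.
      apply: (Rmult_le_reg_r (1 + IZR m ^ 2)) => //. have -> : M / (1 + IZR m ^ 2) * (1 + IZR m ^ 2) = M by field; lra. nra. }
    rewrite zpart_S. have -> : zpart a 0 = a 0%Z by rewrite /zpart /=; ring.
    apply: Rle_trans (Cmod_triangle _ _) _.
    have := Cmod_triangle (a (Z.of_nat 1)) (a (- Z.of_nat 1)%Z). have := D 0%Z; have := D (Z.of_nat 1); have := D (- Z.of_nat 1)%Z. lra. }
  lra.
Qed.

Lemma zpart_plus a b n : zpart (fun m => a m + b m)%C n = (zpart a n + zpart b n)%C.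
Proof. elim: n => [|n IH]; first by rewrite /zpart /=; ring. rewrite !zpart_S IH. ring. Qed.

Lemma zpart_scal c a n : zpart (fun m => c * a m)%C n = (c * zpart a n)%C.
Proof. elim: n => [|n IH]; first by rewrite /zpart /=; ring. rewrite !zpart_S IH. ring. Qed.

Lemma dominated_plus a b M N : dominated a M -> dominated b N -> dominated (fun m => a m + b m)%C (M + N).
Proof.
  move=> H1 H2 m. apply: Rle_trans (Cmod_triangle _ _) _. have := H1 m; have := H2 m. rewrite /Rdiv. lra.
Qed.

Lemma dominated_scal c a M : dominated a M -> dominated (fun m => c * a m)%C (Cmod c * M).
Proof.
  move=> H1 m. rewrite Cmod_mult /Rdiv Rmult_assoc. apply: Rmult_le_compat_l; [exact: Cmod_ge_0|exact: H1].
Qed.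

Lemma zser_plus a b M N : dominated a M -> dominated b N -> zser (fun m => a m + b m)%C = (zser a + zser b)%C.
Proof.
  move=> H1 H2. apply: zser_eq => e He.
  case: (zser_lim _ _ H1 (e / 2) ltac:(lra)) => N1 B1. case: (zser_lim _ _ H2 (e / 2) ltac:(lra)) => N2 B2.
  exists (N1 + N2)%nat => n Hn. rewrite zpart_plus.
  have -> : (zpart a n + zpart b n - (zser a + zser b))%C = ((zpart a n - zser a) + (zpart b n - zser b))%C by ring.
  apply: Rle_lt_trans (Cmod_triangle _ _) _. have := B1 n ltac:(lia); have := B2 n ltac:(lia). lra.
Qed.

Lemma zser_scal c a M : dominated a M -> zser (fun m => c * a m)%C = (c * zser a)%C.
Proof.
  move=> H1. apply: zser_eq => e He. have Hc := Cmod_ge_0 c.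
  case: (zser_lim _ _ H1 (e / (Cmod c + 1)) ltac:(apply: Rdiv_lt_0_compat; lra)) => N1 B1.
  exists N1 => n Hn. rewrite zpart_scal.
  have -> : (c * zpart a n - c * zser a)%C = (c * (zpart a n - zser a))%C by ring.
  rewrite Cmod_mult. have B := B1 n Hn.
  have -> : e = (Cmod c + 1) * (e / (Cmod c + 1)) by field; lra.
  have P : 0 < e / (Cmod c + 1) by apply: Rdiv_lt_0_compat; lra. have := Cmod_ge_0 (zpart a n - zser a)%C. nra.
Qed.

Lemma zpart_shift a n : zpart (fun m => a (m + 1)%Z) n = (zpart a n + a (Z.of_nat (S n)) - a (- Z.of_nat n)%Z)%C.
Proof.
  elim: n => [|n IH].
  - rewrite /zpart /=. ring.
  - rewrite !zpart_S IH.
    have -> : (Z.of_nat (S n) + 1)%Z = Z.of_nat (S (S n)) by lia. have -> : (- Z.of_nat (S n) + 1)%Z = (- Z.of_nat n)%Z by lia. ring.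
Qed.

Lemma dominated_small a M e : dominated a M -> 0 < e -> exists N, forall m, (Z.of_nat N <= Z.abs m)%Z -> Cmod (a m) < e.
Proof.
  move=> H He. have HM := dominated_ge0 _ _ H. have [N HN] := INR_unbounded (M / e). exists (S N) => m Hm.
  apply: Rle_lt_trans (H m) _. have D := dom_den m.
  apply: (Rmult_lt_reg_r (1 + IZR m ^ 2)) => //. have -> : M / (1 + IZR m ^ 2) * (1 + IZR m ^ 2) = M by field; lra.
  have -> : M = e * (M / e) by field; lra. apply: Rmult_lt_compat_l => //.
  have : INR (S N) <= Rabs (IZR m). { rewrite -abs_IZR INR_IZR_INZ. exact: IZR_le. }
  rewrite S_INR => K. rewrite -pow2_abs. have := pos_INR N. nra.
Qed.

(** The symmetric partial sums of the two families differ by two boundary terms, which tend to 0. *)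
Lemma zser_shift1 a M : dominated a M -> zser (fun m => a (m + 1)%Z) = zser a.
Proof.
  move=> H. apply: zser_eq => e He.
  case: (zser_lim _ _ H (e / 3) ltac:(lra)) => N1 B1. case: (dominated_small _ _ (e / 3) H ltac:(lra)) => N2 B2.
  exists (N1 + N2)%nat => n Hn. rewrite zpart_shift.
  have -> : (zpart a n + a (Z.of_nat (S n)) - a (- Z.of_nat n)%Z - zser a)%C = ((zpart a n - zser a) + (a (Z.of_nat (S n)) + - a (- Z.of_nat n)%Z))%C by ring.
  apply: Rle_lt_trans (Cmod_triangle _ _) _. have := Cmod_triangle (a (Z.of_nat (S n))) (- a (- Z.of_nat n)%Z)%C.
  rewrite Cmod_opp. have := B1 n ltac:(lia). have := B2 (Z.of_nat (S n)) ltac:(lia). have := B2 (- Z.of_nat n)%Z ltac:(lia). lra.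
Qed.

(* The shifted family is again dominated, so that [zser_shift1] iterates. *)
Lemma dominated_shift1 a M : dominated a M -> dominated (fun m => a (m + 1)%Z) (3 * M).
Proof.
  move=> H m. apply: Rle_trans (H _) _. have HM := dominated_ge0 _ _ H.
  have -> : 3 * M / (1 + IZR m ^ 2) = M * (/ (1 + IZR m ^ 2) * 3) by field; have := dom_den m; lra.
  apply: Rmult_le_compat_l => //.
  rewrite plus_IZR. have D := dom_den m.
  have D' : 0 < 1 + (IZR m + 1) ^ 2 by have := pow2_ge_0 (IZR m + 1); lra.
  apply: (Rmult_le_reg_r (1 + (IZR m + 1) ^ 2)) => //. rewrite Rinv_l; last lra.
  apply: (Rmult_le_reg_l (1 + IZR m ^ 2)) => //.
  have -> : (1 + IZR m ^ 2) * (/ (1 + IZR m ^ 2) * 3 * (1 + (IZR m + 1) ^ 2)) = 3 * (1 + (IZR m + 1) ^ 2) by field; lra.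
  have := pow2_ge_0 (IZR m + 3 / 2). nra.
Qed.

Lemma zser_shift a M (d : nat) : dominated a M -> zser (fun m => a (m + Z.of_nat d)%Z) = zser a.
Proof.
  move=> H. have : exists M', dominated (fun m => a (m + Z.of_nat d)%Z) M' /\ zser (fun m => a (m + Z.of_nat d)%Z) = zser a; last by move=> [? []].
  elim: d => [|d [M' [D E]]].
  - exists M. have -> : (fun m => a (m + Z.of_nat 0)%Z) = a by apply functional_extensionality; intro m; cbv beta; f_equal; lia. done.
  - exists (3 * M').
    have -> : (fun m => a (m + Z.of_nat (S d))%Z) = (fun m => (fun m => a (m + Z.of_nat d)%Z) (m + 1)%Z).
    { apply functional_extensionality; intro m; cbv beta; f_equal; lia. }
    split; first exact: (dominated_shift1 (fun m => a (m + Z.of_nat d)%Z) M' D). by rewrite (zser_shift1 (fun m => a (m + Z.of_nat d)%Z) M').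
Qed.

Lemma is_derive_quadratic (F : R -> R) t L K :
  (forall h, Rabs h <= 1 -> Rabs (F (t + h) - F t - h * L) <= K * h ^ 2) -> is_derive F t L.
Proof.
  move=> H. apply/is_derive_Reals => e He.
  have HK : 0 <= K.
  { have X := Rle_trans _ _ _ (Rabs_pos _) (H 1 ltac:(rewrite Rabs_R1; lra)). rewrite pow1 Rmult_1_r in X. exact: X. }
  have Hd : 0 < Rmin 1 (e / (K + 1)). { apply: Rmin_pos; first lra. apply: Rdiv_lt_0_compat; lra. }
  exists (mkposreal _ Hd) => h Hh0 /= Hh.
  have H1 := Rlt_le_trans _ _ _ Hh (Rmin_l _ _). have H2 := Rlt_le_trans _ _ _ Hh (Rmin_r _ _).
  have -> : (F (t + h) - F t) / h - L = (F (t + h) - F t - h * L) * / h by field.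
  have Ha : 0 < Rabs h by apply: Rabs_pos_lt.
  rewrite Rabs_mult Rabs_inv. apply: (Rmult_lt_reg_r (Rabs h)) => //. rewrite Rmult_assoc Rinv_l; last lra. rewrite Rmult_1_r.
  apply: Rle_lt_trans (H h ltac:(lra)) _. rewrite -pow2_abs.
  have -> : e = (K + 1) * (e / (K + 1)) by field; lra.
  have P1 : 0 <= K * Rabs h * (e / (K + 1) - Rabs h) by apply: Rmult_le_pos; nra.
  have P2 : 0 < e / (K + 1) * Rabs h by apply: Rmult_lt_0_compat; lra.
  lra.
Qed.

Lemma taylor2 (f f1 f2 : R -> R) t h B : (forall s, is_derive f s (f1 s)) -> (forall s, is_derive f1 s (f2 s)) ->
  (forall s, Rabs (s - t) <= Rabs h -> Rabs (f2 s) <= B) -> Rabs (f (t + h) - f t - h * f1 t) <= B * h ^ 2.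
Proof.
  move=> D1 D2 HB.
  have mvt : forall (p dp : R -> R) x y, (forall s, is_derive p s (dp s)) -> exists c, Rmin x y <= c <= Rmax x y /\ p y - p x = dp c * (y - x).
  { move=> p dp x y Hp. apply: MVT_gen; first by move=> s _. move=> s _. apply: derivable_continuous_pt. exists (dp s). by apply/is_derive_Reals. }
  case: (mvt f f1 t (t + h) D1) => c [Hc Ec]. case: (mvt f1 f2 t c D2) => x [Hx Ex].
  have btw : forall x y c, Rmin x y <= c <= Rmax x y -> Rabs (c - x) <= Rabs (y - x).
  { move=> x' y' c'. rewrite /Rmin /Rmax /Rabs. case: Rle_dec => ?; case: Rcase_abs => ?; case: Rcase_abs => ?; lra. }
  have Hct : Rabs (c - t) <= Rabs h. { have := btw _ _ _ Hc. by have -> : t + h - t = h by ring. }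
  have Hxt : Rabs (x - t) <= Rabs h. { have := btw _ _ _ Hx. lra. }
  have -> : f (t + h) - f t - h * f1 t = f2 x * ((c - t) * h). { rewrite Ec. have -> : f1 c = f1 t + f2 x * (c - t) by lra. ring. }
  rewrite !Rabs_mult. have := HB x Hxt. have := Rabs_pos (f2 x). have := Rabs_pos (c - t). rewrite -(pow2_abs h). have := Rabs_pos h.
  move: (Rabs (f2 x)) (Rabs (c - t)) (Rabs h) Hct => p q s Hqs Hs Hq Hp HpB.
  have A1 : q * s <= s ^ 2 by nra. have A2 : 0 <= q * s by nra. nra.
Qed.

(** Termwise differentiation through a Taylor remainder: domination of the second derivatives makes
    the error of the difference quotient quadratic, uniformly in the index. The constant 10 is the 5
    of [zser_bound] times 2 for real and imaginary parts. *)
Lemma zser_CD (f f1 f2 : Z -> R -> C) t M : (forall m s, CD (f m) s (f1 m s)) -> (forall m s, CD (f1 m) s (f2 m s)) ->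
  (forall s, Rabs (s - t) <= 1 -> dominated (fun m => f m s) M /\ dominated (fun m => f2 m s) M) ->
  dominated (fun m => f1 m t) M ->
  CD (fun s => zser (fun m => f m s)) t (zser (fun m => f1 m t)).
Proof.
  move=> D1 D2 HM HM1.
  have Q : forall h, Rabs h <= 1 -> Cmod (zser (fun m => f m (t + h)%R) - zser (fun m => f m t) - RtoC h * zser (fun m => f1 m t))%C <= (10 * M) * h ^ 2.
  { move=> h Hh.
    have Eh : t + h - t = h by ring. have Hh' := Hh. rewrite -Eh in Hh'. have A1 := proj1 (HM (t + h) Hh').
    have A0 := proj1 (HM t ltac:(rewrite Rminus_diag Rabs_R0; lra)).
    have -> : (zser (fun m => f m (t + h)%R) - zser (fun m => f m t) - RtoC h * zser (fun m => f1 m t))%C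
      = zser (fun m => (f m (t + h)%R + ((- 1) * f m t + (- RtoC h) * f1 m t)))%C.
    { rewrite (zser_plus _ _ _ _ A1 (dominated_plus _ _ _ _ (dominated_scal (-1)%C _ _ A0) (dominated_scal (- RtoC h)%C _ _ HM1))).
      rewrite (zser_plus _ _ _ _ (dominated_scal (-1)%C _ _ A0) (dominated_scal (- RtoC h)%C _ _ HM1)).
      rewrite (zser_scal _ _ _ A0) (zser_scal _ _ _ HM1). ring. }
    have -> : 10 * M * h ^ 2 = 5 * (2 * (M * h ^ 2)) by ring.
    apply: zser_bound => m.
    have B : forall s, Rabs (s - t) <= Rabs h -> Cmod (f2 m s) <= M / (1 + IZR m ^ 2).
    { move=> s Hs. apply: (proj2 (HM s _)). lra. }
    have T1 := taylor2 (fun s => Re (f m s)) (fun s => Re (f1 m s)) (fun s => Re (f2 m s)) t h _ (fun s => proj1 (D1 m s)) (fun s => proj1 (D2 m s))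
      (fun s Hs => Rle_trans _ _ _ (proj1 (Rabs_Re_Im _)) (B s Hs)).
    have T2 := taylor2 (fun s => Im (f m s)) (fun s => Im (f1 m s)) (fun s => Im (f2 m s)) t h _ (fun s => proj2 (D1 m s)) (fun s => proj2 (D2 m s))
      (fun s Hs => Rle_trans _ _ _ (proj1 (proj2 (Rabs_Re_Im _))) (B s Hs)).
    apply: Rle_trans (proj2 (proj2 (Rabs_Re_Im _))) _.
    have -> : Re (f m (t + h)%R + (-1 * f m t + - RtoC h * f1 m t))%C = Re (f m (t + h)) - Re (f m t) - h * Re (f1 m t) by rewrite /= /Re /Im; ring.
    have -> : Im (f m (t + h)%R + (-1 * f m t + - RtoC h * f1 m t))%C = Im (f m (t + h)) - Im (f m t) - h * Im (f1 m t) by rewrite /= /Re /Im; ring.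
    have E : 2 * (M * h ^ 2) / (1 + IZR m ^ 2) = 2 * (M / (1 + IZR m ^ 2) * h ^ 2) by field; have := dom_den m; lra.
    rewrite E. lra. }
  split; apply: (is_derive_quadratic _ _ _ (10 * M)) => h Hh; apply: Rle_trans (Q h Hh).
  - apply: Rle_trans (proj1 (Rabs_Re_Im _)). apply: Req_le; f_equal. rewrite /= /Re /Im; ring.
  - apply: Rle_trans (proj1 (proj2 (Rabs_Re_Im _))). apply: Req_le; f_equal. rewrite /= /Re /Im; ring.
Qed.

Lemma cesaro a l : zlim a l -> forall e, 0 < e -> exists N0, forall N, (N0 <= N)%nat -> Cmod (RtoC (/ INR N) * fejer a N - l)%C < e.
Proof.
  move=> H e He.
  have B : forall f : C -> R, (forall x y, Rabs (f x - f y) <= Cmod (x - y)%C) -> f 0%C = 0 -> (forall x y, f (x + y)%C = f x + f y) ->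
    (forall k x, f (RtoC k * x)%C = k * f x) ->
    exists N0, forall N, (N0 <= N)%nat -> Rabs (f (RtoC (/ INR N) * fejer a N)%C - f l) < e / 2.
  { move=> f Hf H0 Hp Hs.
    have U : Un_cv (fun n => f (zpart a n)) (f l).
    { move=> e' He'. case: (H e' He') => N HN. exists N => n Hn. apply: Rle_lt_trans (Hf _ _) (HN n Hn). }
    have [N0 HN0] := Cesaro_1 _ _ U (e / 2) ltac:(lra).
    exists (S N0). case => [|N] HN; first lia.
    have -> : f (RtoC (/ INR (S N)) * fejer a (S N))%C = sum_f_R0 (fun n => f (zpart a n)) (Nat.pred (S N)) / INR (S N).
    { rewrite Hs /Rdiv Rmult_comm. f_equal. rewrite /fejer [Nat.pred _]/=. elim: N {HN} => [|N IH].
      - cbn [csum sum_f_R0]. rewrite Hp H0. ring.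
      - cbn [sum_f_R0]. rewrite -IH -Hp. by []. }
    apply: HN0. lia. }
  have [N1 B1] := B Re ltac:(move=> x y; exact: (proj1 (Rabs_Re_Im (x - y)%C))) ltac:(by []) ltac:(by []) ltac:(move=> k x /=; rewrite /Re; ring).
  have [N2 B2] := B Im ltac:(move=> x y; exact: (proj1 (proj2 (Rabs_Re_Im (x - y)%C)))) ltac:(by []) ltac:(by []) ltac:(move=> k x /=; rewrite /Im; ring).
  exists (N1 + N2)%nat => N HN. apply: Rle_lt_trans (proj2 (proj2 (Rabs_Re_Im _))) _.
  have A1 := B1 N ltac:(lia). have A2 := B2 N ltac:(lia).
  change (Rabs (Re (RtoC (/ INR N) * fejer a N)%C - Re l) + Rabs (Im (RtoC (/ INR N) * fejer a N)%C - Im l) < e). lra.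
Qed.

(* The Fejer means converge to [phi 0], and also to the sum of the coefficients since these are summable. *)
Lemma fourier_inversion phi dphi B M : (forall t, CD phi t (dphi t)) -> (forall t, phi (t + 1) = phi t) ->
  (forall t, 0 <= t <= 1 -> Cmod (dphi t) <= B) -> dominated (fcoef phi) M -> phi 0 = zser (fcoef phi).
Proof.
  move=> HD HP HB HM. symmetry. apply: NNPP => Hne.
  have Hd : 0 < Cmod (zser (fcoef phi) - phi 0%R)%C.
  { apply/Cmod_gt_0 => E. apply: Hne. have -> : zser (fcoef phi) = (zser (fcoef phi) - phi 0%R + phi 0%R)%C by ring. rewrite E. ring. }
  set e := Cmod _ in Hd.
  have HB0 : 0 <= B. { have := HB 0 ltac:(lra). have := Cmod_ge_0 (dphi 0). lra. }
  case: (fejer_uniform B (e / 2) HB0 ltac:(lra)) => N1 H1. case: (cesaro _ _ (zser_lim _ _ HM) (e / 2) ltac:(lra)) => N2 H2.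
  case: (H1 (N1 + N2)%nat ltac:(lia)) => _ F. have A := F _ _ HD HP HB. have A2 := H2 (N1 + N2)%nat ltac:(lia).
  move: A A2. set s := (RtoC _ * _)%C => A A2.
  have T := Cmod_triangle (- (phi 0%R - s))%C (- (s - zser (fcoef phi)))%C. rewrite !Cmod_opp in T.
  have E : (- (phi 0%R - s) + - (s - zser (fcoef phi)))%C = (zser (fcoef phi) - phi 0%R)%C by ring. rewrite E -/e in T. lra.
Qed.

Lemma CR_cis_int (n : Z) : CR (fun t => cis (IZR n * (2 * PI * t))) 0 1 = if (n =? 0)%Z then 1%C else 0%C.
Proof.
  have HP := PI_RGT_0.
  case: Z.eqb_spec => [->|Hn].
  - rewrite (CR_ext _ (fun _ => RtoC 1)); last by (move=> t; have -> : 0 * (2 * PI * t) = 0 by ring); rewrite cis_0.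
    rewrite /CR /= !RInt_const /scal /= /mult /=. apply: C_ext => /=; rring.
  - have Hn' : IZR n <> 0 by apply: not_0_IZR.
    set c := IZR n * (2 * PI). have Hc : c <> 0. { rewrite /c. apply: Rmult_integral_contrapositive_currified; lra. }
    have P := cis_2PI n. have Pc : cis c = 1%C by rewrite /c -P; f_equal; ring.
    have C1 : cos c = 1 by exact: (f_equal Re Pc). have S1 : sin c = 0 by exact: (f_equal Im Pc).
    rewrite (CR_ext _ (fun t => cis (c * t))); last by move=> t; rewrite /c; f_equal; ring.
    rewrite /CR. apply: C_ext => /=.
    + rewrite (RInt_Derive_eq (fun t => / c * sin (c * t)) (fun t => cos (c * t)) 0 1).
      * rewrite Rmult_1_r S1 !Rmult_0_r sin_0. rring.
      * move=> t. auto_derive => //. field. exact: Hc.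
      * exact: (proj1 (ccont_cis c)).
    + rewrite (RInt_Derive_eq (fun t => - / c * cos (c * t)) (fun t => sin (c * t)) 0 1).
      * rewrite Rmult_1_r C1 !Rmult_0_r cos_0. rring.
      * move=> t. auto_derive => //. field. exact: Hc.
      * exact: (proj2 (ccont_cis c)).
Qed.

Lemma CR_bound f B : ccont f -> (forall t, 0 <= t <= 1 -> Cmod (f t) <= B) -> Cmod (CR f 0 1) <= 2 * B.
Proof.
  move=> [H1 H2] HB. apply: Rle_trans (proj2 (proj2 (Rabs_Re_Im _))) _.
  have A : forall h : R -> R, (forall t, continuous h t) -> (forall t, Rabs (h t) <= Cmod (f t)) -> Rabs (RInt h 0 1) <= B.
  { move=> h Hh Hb. have := abs_RInt_le_const h 0 1 B ltac:(lra) (ex_RInt_c _ _ _ Hh). rewrite Rminus_0_r Rmult_1_l. apply.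
    move=> t Ht. apply: Rle_trans (Hb t) _. exact: HB. }
  have := A _ H1 (fun t => proj1 (Rabs_Re_Im _)). have := A _ H2 (fun t => proj1 (proj2 (Rabs_Re_Im _))).
  rewrite /=. lra.
Qed.

(** The [n]-th Fourier coefficient of a partial sum of order at least [|n|] is [a n], while the
    partial sums are uniformly of order [1 / N] because the full sum vanishes. *)
Lemma fourier_unique (a : Z -> C) M : dominated a M -> (forall t, zser (fun m => cis (IZR m * (2 * PI * t)) * a m)%C = 0%C) ->
  forall n, a n = 0%C.
Proof.
  move=> H H0 n. have HM := dominated_ge0 _ _ H.
  have D : forall t, dominated (fun m => cis (IZR m * (2 * PI * t)) * a m)%C M.
  { move=> t m. rewrite Cmod_mult Cmod_cis Rmult_1_l. exact: H. }
  have key : forall N, (Z.abs_nat n <= N)%nat -> (1 <= N)%nat -> Cmod (a n) <= 4 * M / INR N.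
  { move=> N HN HN1.
    have E : a n = CR (fun t => cis (- IZR n * (2 * PI * t)) * zpart (fun m => cis (IZR m * (2 * PI * t)) * a m) N)%C 0 1.
    { rewrite (CR_ext _ (fun t => zpart (fun m => a m * cis (IZR (m - n) * (2 * PI * t))) N)%C).
      2: { move=> t. rewrite -zpart_scal. f_equal. apply: functional_extensionality => m.
           have -> : IZR (m - n) * (2 * PI * t) = - IZR n * (2 * PI * t) + IZR m * (2 * PI * t) by rewrite minus_IZR; ring.
           rewrite cis_plus. ring. }
      rewrite (CR_zpart (fun m t => a m * cis (IZR (m - n) * (2 * PI * t)))%C); last by move=> i; apply: ccont_scal; exact: ccont_cis2.
      have -> : (fun m => CR (fun t => a m * cis (IZR (m - n) * (2 * PI * t)))%C 0 1) = (fun m => if (m =? n)%Z then a m else 0%C).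
      { apply: functional_extensionality => m. rewrite CR_scal; last exact: ccont_cis2. rewrite CR_cis_int.
        case: Z.eqb_spec => E1; case: Z.eqb_spec => E2; try lia; ring. }
      have Z0 : forall q, (q < Z.abs_nat n)%nat -> zpart (fun m => if (m =? n)%Z then a m else 0%C) q = 0%C.
      { elim => [|q IH] Hq.
        - rewrite /zpart; cbn [csum]; case: Z.eqb_spec => E; [lia|ring].
        - rewrite zpart_S IH; last lia. case: Z.eqb_spec => E1; first lia. case: Z.eqb_spec => E2; first lia. ring. }
      have Z1 : forall q, (Z.abs_nat n <= q)%nat -> zpart (fun m => if (m =? n)%Z then a m else 0%C) q = a n.
      { elim => [|q IH] Hq.
        - rewrite /zpart; cbn [csum]; case: Z.eqb_spec => E; [rewrite -E; ring|lia].
        - rewrite zpart_S. case: (Nat.eq_dec (Z.abs_nat n) (S q)) => Eq.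
          + rewrite Z0; last lia. case: Z.eqb_spec => E1; case: Z.eqb_spec => E2; try lia; rewrite ?E1 ?E2; ring.
          + rewrite IH; last lia. case: Z.eqb_spec => E1; first lia. case: Z.eqb_spec => E2; first lia. ring. }
      by rewrite Z1. }
    rewrite E. have -> : 4 * M / INR N = 2 * (2 * M / INR N) by rewrite /Rdiv; ring. apply: CR_bound.
    - apply: ccont_mult; first exact: ccont_cis2.
      apply: (ccont_zpart (fun m t => cis (IZR m * (2 * PI * t)) * a m)%C) => i. apply: ccont_mult; [exact: ccont_cis2|exact: ccont_const].
    - move=> t _. rewrite Cmod_mult Cmod_cis Rmult_1_l. have := zser_tail _ M N (D t) HN1. rewrite H0.
      have -> : (0 - zpart (fun m => cis (IZR m * (2 * PI * t)) * a m) N)%C = (- zpart (fun m => cis (IZR m * (2 * PI * t)) * a m) N)%C by ring.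
      by rewrite Cmod_opp. }
  apply: NNPP => Hne. have Hp : 0 < Cmod (a n) by apply/Cmod_gt_0.
  have [N HN] := INR_unbounded (4 * M / Cmod (a n)).
  have K := key (S (N + Z.abs_nat n)) ltac:(lia) ltac:(lia).
  have P : 0 < INR (S (N + Z.abs_nat n)) by apply: lt_0_INR; lia.
  have Q : INR N <= INR (S (N + Z.abs_nat n)) by apply: le_INR; lia.
  have : Cmod (a n) * INR (S (N + Z.abs_nat n)) <= 4 * M.
  { have -> : 4 * M = 4 * M / INR (S (N + Z.abs_nat n)) * INR (S (N + Z.abs_nat n)) by field; lra. apply: Rmult_le_compat_r; lra. }
  have : 4 * M < Cmod (a n) * INR (S (N + Z.abs_nat n)).
  { have -> : 4 * M = Cmod (a n) * (4 * M / Cmod (a n)) by field; lra. apply: Rmult_lt_compat_l; lra. }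
  lra.
Qed.

(** Locally bounded partial derivatives make the function locally Lipschitz. For a series,
    continuity thus follows from bounds on the differentiated series. *)
Lemma contG_of_partials u ux uy uz : partials u ux uy uz ->
  (forall R0, exists M, forall x y z, Rabs x <= R0 -> Rabs y <= R0 -> Rabs z <= R0 ->
    Rabs (ux (x, y, z)) <= M /\ Rabs (uy (x, y, z)) <= M /\ Rabs (uz (x, y, z)) <= M) -> contG u.
Proof.
  move=> P HB [[x y] z]. set R0 := Rabs x + Rabs y + Rabs z + 1. case: (HB R0) => M HM.
  have Px := Rabs_pos x; have Py := Rabs_pos y; have Pz := Rabs_pos z.
  have HM0 : 0 <= M. { have := proj1 (HM x y z ltac:(rewrite /R0; lra) ltac:(rewrite /R0; lra) ltac:(rewrite /R0; lra)). have := Rabs_pos (ux (x, y, z)). lra. }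
  have mvt : forall (p dp : R -> R) s t, (forall q, is_derive p q (dp q)) -> (forall q, Rmin s t <= q <= Rmax s t -> Rabs (dp q) <= M) -> Rabs (p t - p s) <= M * Rabs (t - s).
  { move=> p dp s t Hp Hb. case: (MVT_gen p s t dp) => [q _|q _|q [Hq ->]].
    - exact: Hp.
    - apply: derivable_continuous_pt. exists (dp q). by apply/is_derive_Reals.
    - rewrite Rabs_mult. apply: Rmult_le_compat_r; first exact: Rabs_pos. exact: Hb. }
  apply/filterlim_locally => e.
  have Hd : 0 < Rmin 1 (e / (3 * M + 1)). { apply: Rmin_pos; first lra. apply: Rdiv_lt_0_compat; first exact: cond_pos. lra. }
  exists (mkposreal _ Hd). move=> [[x' y'] z'] [[Hx Hy] Hz].
  rewrite /= /ball /= /AbsRing_ball /abs /minus /plus /opp /= in Hx Hy Hz.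
  change (Rabs (u (x', y', z') - u (x, y, z)) < e).
  have M1 := Rmin_l 1 (e / (3 * M + 1)). have M2 := Rmin_r 1 (e / (3 * M + 1)).
  set dl := Rmin 1 _ in Hd Hx Hy Hz M1 M2.
  have near : forall s t, Rabs (t + - s) < dl -> forall q, Rmin s t <= q <= Rmax s t -> Rabs q <= Rabs s + 1.
  { move=> s t /Rabs_def2 [H1 H2] q. rewrite /Rmin /Rmax /Rabs. case: Rle_dec => ?; case: Rcase_abs => ?; case: Rcase_abs => ?; lra. }
  have nt : forall s t, Rabs (t + - s) < dl -> Rabs t <= Rabs s + 1.
  { move=> s t H. apply: (near s t H). rewrite /Rmin /Rmax; case: Rle_dec => ?; lra. }
  have D1 := mvt (fun t => u (t, y', z')) (fun t => ux (t, y', z')) x x' (fun q => proj1 (P q y' z'))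
    (fun q Hq => proj1 (HM q y' z' ltac:(have := near _ _ Hx q Hq; rewrite /R0; lra) ltac:(have := nt _ _ Hy; rewrite /R0; lra) ltac:(have := nt _ _ Hz; rewrite /R0; lra))).
  have D2 := mvt (fun t => u (x, t, z')) (fun t => uy (x, t, z')) y y' (fun q => proj1 (proj2 (P x q z')))
    (fun q Hq => proj1 (proj2 (HM x q z' ltac:(rewrite /R0; lra) ltac:(have := near _ _ Hy q Hq; rewrite /R0; lra) ltac:(have := nt _ _ Hz; rewrite /R0; lra)))).
  have D3 := mvt (fun t => u (x, y, t)) (fun t => uz (x, y, t)) z z' (fun q => proj2 (proj2 (P x y q)))
    (fun q Hq => proj2 (proj2 (HM x y q ltac:(rewrite /R0; lra) ltac:(rewrite /R0; lra) ltac:(have := near _ _ Hz q Hq; rewrite /R0; lra)))).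
  have -> : u (x', y', z') - u (x, y, z) = (u (x', y', z') - u (x, y', z')) + ((u (x, y', z') - u (x, y, z')) + (u (x, y, z') - u (x, y, z))) by ring.
  apply: Rle_lt_trans (Rabs_triang _ _) _. have := Rabs_triang (u (x, y', z') - u (x, y, z')) (u (x, y, z') - u (x, y, z)).
  cbv beta in D1, D2, D3. rewrite /Rminus in D1 D2 D3 *.
  have B : forall v, v < dl -> M * v <= M * dl by move=> v Hv; apply: Rmult_le_compat_l; lra.
  have B1 := B _ Hx. have B2 := B _ Hy. have B3 := B _ Hz.
  have Q : 3 * (M * dl) < e.
  { have E : e = (3 * M + 1) * (e / (3 * M + 1)) :> R by field; lra.
    have : 0 < e / (3 * M + 1) by lra. have : M * dl <= M * (e / (3 * M + 1)) by apply: Rmult_le_compat_l. lra. }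
  move=> T.
  have S1 := Rle_trans _ _ _ D1 B1. have S2 := Rle_trans _ _ _ D2 B2. have S3 := Rle_trans _ _ _ D3 B3.
  apply: Rle_lt_trans (Rplus_le_compat_l _ _ _ T) _.
  apply: Rle_lt_trans (Rplus_le_compat _ _ _ _ S1 (Rplus_le_compat _ _ _ _ S2 S3)) _. lra.
Qed.

Lemma nat_uniform_bound (P : nat -> R -> Prop) (d : nat) : (forall i M M', P i M -> M <= M' -> P i M') ->
  (forall i, exists M, P i M) -> exists M, forall i, (i < d)%nat -> P i M.
Proof.
  move=> Hm H. elim: d => [|d [M IH]]; first by exists 0; lia.
  case: (H d) => M' HM'. exists (Rmax M M') => i Hi. case: (Nat.eq_dec i d) => [->|Hne].
  - apply: Hm HM' _. exact: Rmax_r. - apply: Hm (IH i ltac:(lia)) _. exact: Rmax_l.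
Qed.

Lemma floor_exists (w y : R) : 0 < w -> exists n : Z, 0 <= y + IZR n * w <= w.
Proof.
  move=> Hw. exists (- (up (y / w) - 1))%Z. have [H1 H2] := archimed (y / w).
  rewrite opp_IZR minus_IZR. have E : y = (y / w) * w by field; lra.
  have : 0 <= (y / w - (IZR (up (y / w)) - 1)) * w <= w; last by lra.
  split; nra.
Qed.

(** The order matters: moving [y] into range by the second generator disturbs [x] and [z], moving
    [x] by the first disturbs only [z], and the centre moves [z] alone. *)
Lemma box_reduce (a b w2 r : R) (h : G -> R) : 0 < a -> 0 < w2 -> 0 < r -> invar a b w2 r h ->
  forall g, exists g', in_box a w2 r g' /\ h g' = h g.
Proof.
  move=> Ha Hw Hr Inv [[x y] z].
  have Iz1 : forall (n : Z) x y z, h (x, y, z + IZR n * r) = h (x, y, z).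
  { have N : forall (n : nat) x y z, h (x, y, z + INR n * r) = h (x, y, z).
    { elim => [|n IH] x' y' z'; first by rewrite /= Rmult_0_l Rplus_0_r.
      have -> : z' + INR (S n) * r = (z' + INR n * r) + r by rewrite S_INR; ring.
      rewrite (proj2 (proj2 (Inv x' y' _))). exact: IH. }
    move=> n x' y' z'. case: (Z_le_gt_dec 0 n) => Hn.
    - rewrite -(Z2Nat.id n) // -INR_IZR_INZ. exact: N.
    - rewrite -(N (Z.to_nat (- n))). do 2 f_equal. rewrite INR_IZR_INZ Z2Nat.id; last lia. rewrite opp_IZR; ring. }
  have Iw : forall (n : Z) x y z, exists x' z', h (x', y + IZR n * w2, z') = h (x, y, z).
  { have N : forall (n : nat) x y z, (exists x' z', h (x', y + INR n * w2, z') = h (x, y, z)) /\ (exists x' z', h (x', y - INR n * w2, z') = h (x, y, z)).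
    { elim => [|n IH] x' y' z'; first by split; exists x', z'; rewrite /= Rmult_0_l ?Rplus_0_r ?Rminus_0_r.
      case: (IH x' y' z') => [[x1 [z1 E1]] [x2 [z2 E2]]]. split.
      - exists (x1 + b), (z1 + b * (y' + INR n * w2)). rewrite -E1 -(proj1 (proj2 (Inv x1 (y' + INR n * w2) z1))). f_equal. apply: triple_eq => //. rewrite S_INR; ring.
      - exists (x2 - b), (z2 - b * (y' - INR (S n) * w2)). rewrite -E2 -(proj1 (proj2 (Inv (x2 - b) (y' - INR (S n) * w2) _))). f_equal. apply: triple_eq; rewrite ?S_INR; ring. }
    move=> n x' y' z'. case: (Z_le_gt_dec 0 n) => Hn.
    - rewrite -(Z2Nat.id n) // -INR_IZR_INZ. exact: (proj1 (N _ _ _ _)).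
    - case: (proj2 (N (Z.to_nat (- n)) x' y' z')) => x1 [z1 E]. exists x1, z1. rewrite -E. f_equal. apply: triple_eq => //. rewrite INR_IZR_INZ Z2Nat.id; last lia. rewrite opp_IZR; ring. }
  have Iv : forall (n : Z) x y z, exists z', h (x + IZR n * a, y, z') = h (x, y, z).
  { have N : forall (n : nat) x y z, (exists z', h (x + INR n * a, y, z') = h (x, y, z)) /\ (exists z', h (x - INR n * a, y, z') = h (x, y, z)).
    { elim => [|n IH] x' y' z'; first by split; exists z'; rewrite /= Rmult_0_l ?Rplus_0_r ?Rminus_0_r.
      case: (IH x' y' z') => [[z1 E1] [z2 E2]]. split.
      - exists (z1 + a * y'). rewrite -E1 -(proj1 (Inv (x' + INR n * a) y' z1)). f_equal. apply: triple_eq => //. rewrite S_INR; ring.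
      - exists (z2 - a * y'). rewrite -E2 -(proj1 (Inv (x' - INR (S n) * a) y' _)). f_equal. apply: triple_eq; rewrite ?S_INR; ring. }
    move=> n x' y' z'. case: (Z_le_gt_dec 0 n) => Hn.
    - rewrite -(Z2Nat.id n) // -INR_IZR_INZ. exact: (proj1 (N _ _ _ _)).
    - case: (proj2 (N (Z.to_nat (- n)) x' y' z')) => z1 E. exists z1. rewrite -E. f_equal. apply: triple_eq => //. rewrite INR_IZR_INZ Z2Nat.id; last lia. rewrite opp_IZR; ring. }
  case: (floor_exists w2 y Hw) => n Hn. case: (Iw n x y z) => x1 [z1 E1].
  case: (floor_exists a x1 Ha) => n2 Hn2. case: (Iv n2 x1 (y + IZR n * w2) z1) => z2 E2.
  case: (floor_exists r z2 Hr) => n3 Hn3.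
  exists (x1 + IZR n2 * a, y + IZR n * w2, z2 + IZR n3 * r). split; first by rewrite /in_box /=.
  by rewrite Iz1 E2.
Qed.

Lemma CR_derive f f' : (forall t, CD f t (f' t)) -> ccont f' -> CR f' 0 1 = (f 1%R - f 0%R)%C.
Proof.
  move=> H [c1 c2]. apply: C_ext => /=.
  - exact: (RInt_Derive_eq (fun t => Re (f t)) (fun t => Re (f' t)) 0 1 (fun t => proj1 (H t)) c1).
  - exact: (RInt_Derive_eq (fun t => Im (f t)) (fun t => Im (f' t)) 0 1 (fun t => proj2 (H t)) c2).
Qed.

Lemma cis_eq_1 (n : Z) (d : nat) : (0 < d)%nat -> (Z.abs n < Z.of_nat d)%Z -> cis (2 * PI * IZR n / INR d) = 1%C -> n = 0%Z.
Proof.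
  move=> Hd Hn E. have D0 : 0 < INR d by apply: lt_0_INR. have HP := PI_RGT_0.
  have E1 : cos (2 * (PI * IZR n / INR d)) = 1. { have := f_equal Re E. rewrite /=. by have -> : 2 * PI * IZR n / INR d = 2 * (PI * IZR n / INR d) by field; lra. }
  rewrite cos_2a_sin in E1. have S0 : sin (PI * IZR n / INR d) = 0 by nra.
  case: (sin_eq_0_0 _ S0) => q Hq.
  have E2 : IZR n = IZR q * INR d. { apply: (Rmult_eq_reg_l (PI / INR d)); last by apply: Rgt_not_eq; apply: Rdiv_lt_0_compat. have -> : PI / INR d * IZR n = PI * IZR n / INR d by field; lra. rewrite Hq. field. lra. }
  rewrite INR_IZR_INZ -mult_IZR in E2. apply eq_IZR in E2. case: (Z.eq_dec q 0) => Hq0; first by subst. exfalso. have A1 : (1 <= Z.abs q)%Z by lia. have A2 : (Z.abs n = Z.abs q * Z.of_nat d)%Z by rewrite E2 Z.abs_mul; lia. nia.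
Qed.

(** * The lowest Landau level *)

Section Landau.
(** [(a, 0)] and [(b, w2)] generate the base lattice, and [c] is the slope for which [x - c * y] is
    unchanged by the second generator. [k] is the frequency along the centre; the hypothesis on
    [k * a * w2] says that [d] flux quanta pass through the base torus. [nu] is the quasi-period
    along [(b, w2)]: it accounts for the sign [e2] and for the central phase of half the
    parallelogram. *)
Variables (a w2 r k c b nu e1 e2 e3 : R) (d : nat).
Hypotheses (Ha : 0 < a) (Hw : 0 < w2) (Hr : 0 < r) (Hk : 0 < k) (Hd : (0 < d)%nat).
Hypotheses (Hb : b = c * w2) (Hka : k * a * w2 = 2 * PI * INR d).
Hypotheses (He1 : e1 * e1 = 1) (He2 : e2 * e2 = 1) (Hnu : cis (2 * PI * nu - k * c * w2 ^ 2 / 2) = RtoC e2) (Hkr : cis (k * r) = RtoC e3).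

Definition mode (u : G -> C) : Prop := forall x y z, u (x, y, z) = (cis (k * z) * u (x, y, 0%R))%C.

Definition lambda_k (u : G -> C) : Prop :=
  Sm u /\ inv_by (a, 0, 0) (RtoC e1) u /\ inv_by (b, w2, 0) (RtoC e2) u /\ mode u.

Definition delta (m : Z) : R := a * (IZR m + nu) / INR d.
Definition pterm (f : Z -> R -> C) (m : Z) (g : G) : C :=
  let '(x, y, z) := g in
  (f m (x - c * y + delta m)%R * cis (2 * PI * (IZR m + nu) * y / w2 + k * (z - c * y ^ 2 / 2)))%C.
(* The Weil-Brezin transform of a family indexed by [Z/d], with inverse [Tc]; [delta] and the Gaussian phase make [X] act
   as [d/dt] and [c X + Y] as multiplication by [Ci k t]. *)
Definition Per (f : Z -> R -> C) (g : G) : C := zser (fun m => pterm f m g).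

(** The form that equivariance under [(a, 0, 0)] takes on families: this translation carries
    [delta m] to [delta (m + d)]. Only [d] members are independent. *)
Definition twisted (f : Z -> R -> C) : Prop := forall m t, f (m + Z.of_nat d)%Z t = (RtoC e1 * f m t)%C.
Definition fam (f : Z -> R -> C) : Prop := twisted f /\ forall m, Schw (f m).

Lemma Hd0 : 0 < INR d. Proof. exact: lt_0_INR. Qed.

Lemma e1_abs : Rabs e1 = 1.
Proof. have : (e1 - 1) * (e1 + 1) = 0 by lra. move/Rmult_integral => [H|H]; [have -> : e1 = 1 by lra|have -> : e1 = -1 by lra]; rewrite ?Rabs_R1 // Rabs_left; lra. Qed.

Lemma twisted_shift f m (q : nat) t : twisted f -> f (m + Z.of_nat d * Z.of_nat q)%Z t = (RtoC (e1 ^ q) * f m t)%C.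
Proof.
  move=> H. elim: q => [|q IH]; first by (have -> : (m + Z.of_nat d * Z.of_nat 0 = m)%Z by lia); rewrite /=; ring.
  have -> : (m + Z.of_nat d * Z.of_nat (S q) = m + Z.of_nat d * Z.of_nat q + Z.of_nat d)%Z by lia.
  rewrite H IH /= RtoC_mult. ring.
Qed.

Lemma e1_pow_sq q : (RtoC (e1 ^ q) * RtoC (e1 ^ q))%C = 1%C.
Proof. rewrite -RtoC_mult -Rpow_mult_distr He1 pow1. by []. Qed.

Definition residue (m : Z) : nat := Z.to_nat (m mod Z.of_nat d).
(** The absolute value does no harm: the quotient serves as an exponent of [e1], whose square is 1,
    so only its parity counts. *)
Definition quot (m : Z) : nat := Z.abs_nat (m / Z.of_nat d).

Lemma residue_lt m : (residue m < d)%nat.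
Proof. rewrite /residue. have := Z.mod_pos_bound m (Z.of_nat d) ltac:(lia). lia. Qed.

Lemma twisted_residue f m t : twisted f -> f m t = (RtoC (e1 ^ quot m) * f (Z.of_nat (residue m)) t)%C.
Proof.
  move=> H. rewrite /quot /residue. have B := Z.mod_pos_bound m (Z.of_nat d) ltac:(lia).
  rewrite Z2Nat.id; last lia. have E := Z.div_mod m (Z.of_nat d) ltac:(lia).
  set q := (m / Z.of_nat d)%Z in E *. set s := (m mod Z.of_nat d)%Z in E B *.
  case: (Z_le_gt_dec 0 q) => Hq.
  - rewrite -(twisted_shift f s (Z.abs_nat q)) //. f_equal. nia.
  - have E2 : s = (m + Z.of_nat d * Z.of_nat (Z.abs_nat q))%Z by nia. rewrite E2 twisted_shift //.
    rewrite Cmult_assoc e1_pow_sq. ring.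
Qed.

Definition extend (h : nat -> R -> C) (m : Z) (t : R) : C := (RtoC (e1 ^ quot m) * h (residue m) t)%C.

Lemma twisted_extend h : twisted (extend h).
Proof.
  move=> m t. rewrite /extend /residue /quot.
  have -> : ((m + Z.of_nat d) mod Z.of_nat d = m mod Z.of_nat d)%Z.
  { have -> : (m + Z.of_nat d = m + 1 * Z.of_nat d)%Z by lia. apply: Z.mod_add. lia. }
  have -> : ((m + Z.of_nat d) / Z.of_nat d = m / Z.of_nat d + 1)%Z.
  { have -> : (m + Z.of_nat d = m + 1 * Z.of_nat d)%Z by lia. apply: Z.div_add. lia. }
  set q := (m / Z.of_nat d)%Z. rewrite Cmult_assoc -RtoC_mult. f_equal. f_equal.
  case: (Z_le_gt_dec 0 q) => Hq.
  - have -> : Z.abs_nat (q + 1) = S (Z.abs_nat q) by lia. by [].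
  - have -> : Z.abs_nat q = S (Z.abs_nat (q + 1)) by lia. rewrite /= -Rmult_assoc He1. ring.
Qed.

Lemma fam_extend h : (forall i, Schw (h i)) -> fam (extend h).
Proof. move=> H; split; first exact: twisted_extend. move=> m. exact: Schw_scal. Qed.

Lemma fam_uniform f p : fam f -> exists M, 0 <= M /\ forall m t, Rabs t ^ p * Cmod (f m t) <= M.
Proof.
  move=> [Ht Hs].
  case: (nat_uniform_bound (fun i M => forall t, Rabs t ^ p * Cmod (f (Z.of_nat i) t) <= M) d) => [i M M' H HM t|i|M HM].
  - have := H t; lra.
  - exact: (Schw_rapid _ (Hs _)).
  - have HM0 : 0 <= M. { have := HM 0%nat Hd 0. have := Cmod_ge_0 (f (Z.of_nat 0) 0). have := pow_le _ p (Rabs_pos 0). nra. }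
    exists M; split => // m t. rewrite (twisted_residue f m t Ht) Cmod_mult Cmod_R -RPow_abs e1_abs pow1 Rmult_1_l.
    apply: HM. exact: residue_lt.
Qed.

(** The [m]-th term is evaluated at a point which is affine in [m] with slope [a / d], so quadratic
    decay of the family becomes summability in [m], uniformly while [x - c * y] stays bounded. *)
Lemma pterm_dominated f R0 : fam f -> exists M, 0 <= M /\ forall x y z, Rabs (x - c * y) <= R0 -> dominated (fun m => pterm f m (x, y, z)) M.
Proof.
  move=> Hf. case: (fam_uniform f 0 Hf) => M1 [P1 H1]. case: (fam_uniform f 2 Hf) => M2 [P2 H2].
  have D0 := Hd0. set A := INR d / a. have HA : 0 < A by apply: Rdiv_lt_0_compat.
  set B := Rabs R0 * A + Rabs nu. have HB : 0 <= B. { rewrite /B. have := Rabs_pos R0; have := Rabs_pos nu. nra. }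
  exists ((1 + 2 * A ^ 2 + 2 * B ^ 2) * (M1 + M2)). split.
  { apply: Rmult_le_pos; last lra. have := pow2_ge_0 A; have := pow2_ge_0 B. lra. }
  move=> x y z Hx m. rewrite /pterm Cmod_mult Cmod_cis Rmult_1_r.
  set t := x - c * y + delta m. have Dm := dom_den m.
  have Em : IZR m = A * t - ((x - c * y) * A + nu) by rewrite /t /delta /A; field; lra.
  have F1 := H1 m t. have F2 := H2 m t. rewrite /= Rmult_1_l in F1. rewrite pow2_abs in F2.
  have Bm : IZR m ^ 2 <= 2 * A ^ 2 * t ^ 2 + 2 * B ^ 2.
  { have Q : ((x - c * y) * A + nu) ^ 2 <= B ^ 2.
    { rewrite -(pow2_abs ((x - c * y) * A + nu)). apply: pow_incr. split; first exact: Rabs_pos.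
      apply: Rle_trans (Rabs_triang _ _) _. rewrite Rabs_mult (Rabs_right A); last lra. rewrite /B.
      have := Rle_abs R0. nra. }
    rewrite Em. have := pow2_ge_0 (A * t + ((x - c * y) * A + nu)). nra. }
  have Cf := Cmod_ge_0 (f m t).
  apply: (Rmult_le_reg_r (1 + IZR m ^ 2)) => //.
  have -> : (1 + 2 * A ^ 2 + 2 * B ^ 2) * (M1 + M2) / (1 + IZR m ^ 2) * (1 + IZR m ^ 2) = (1 + 2 * A ^ 2 + 2 * B ^ 2) * (M1 + M2) by field; lra.
  apply: Rle_trans (_ : Cmod (f m t) * ((1 + 2 * A ^ 2 + 2 * B ^ 2) * (1 + t ^ 2)) <= _).
  { apply: Rmult_le_compat_l => //. have := pow2_ge_0 t; have := pow2_ge_0 A; have := pow2_ge_0 B. nra. }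
  have : Cmod (f m t) * (1 + t ^ 2) <= M1 + M2 by lra. have : 0 <= 1 + 2 * A ^ 2 + 2 * B ^ 2 by have := pow2_ge_0 A; have := pow2_ge_0 B; lra.
  nra.
Qed.

Definition fd (f : Z -> R -> C) : Z -> R -> C := fun m => dC (f m).
Definition fmul (f : Z -> R -> C) : Z -> R -> C := fun m t => (RtoC t * f m t)%C.
Definition fy (f : Z -> R -> C) : Z -> R -> C := fun m t => (RtoC (- c) * fd f m t + (Ci * RtoC k) * fmul f m t)%C.

Lemma fam_plus f h : fam f -> fam h -> fam (fun m t => f m t + h m t)%C.
Proof. move=> [T1 S1] [T2 S2]; split; [move=> m t; rewrite T1 T2; ring | move=> m; exact: Schw_plus]. Qed.
Lemma fam_scal q f : fam f -> fam (fun m t => q * f m t)%C.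
Proof. move=> [T1 S1]; split; [move=> m t; rewrite T1; ring | move=> m; exact: Schw_scal]. Qed.
Lemma fam_fd f : fam f -> fam (fd f).
Proof.
  move=> [T1 S1]; split; last by move=> m; exact: Schw_d. move=> m t. rewrite /fd /dC. apply: CD_Cderive.
  apply: (CD_ext (fun t => RtoC e1 * f m t)%C); first by move=> s; rewrite T1. apply: CD_scal. exact: Schw_CD.
Qed.
Lemma fam_fmul f : fam f -> fam (fmul f).
Proof. move=> [T1 S1]; split; [move=> m t; rewrite /fmul T1; ring | move=> m; exact: Schw_t]. Qed.
Lemma fam_fy f : fam f -> fam (fy f).
Proof. move=> H. apply: fam_plus; apply: fam_scal; [exact: fam_fd|exact: fam_fmul]. Qed.

Lemma Per_plus f h : fam f -> fam h -> forall g, Per (fun m t => f m t + h m t)%C g = (Per f g + Per h g)%C.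
Proof.
  move=> Hf Hh [[x y] z]. case: (pterm_dominated f (Rabs (x - c * y)) Hf) => M1 [_ D1]. case: (pterm_dominated h (Rabs (x - c * y)) Hh) => M2 [_ D2].
  rewrite /Per -(zser_plus _ _ _ _ (D1 x y z (Rle_refl _)) (D2 x y z (Rle_refl _))). f_equal.
  apply: functional_extensionality => m. rewrite /pterm. ring.
Qed.
Lemma Per_scal q f : fam f -> forall g, Per (fun m t => q * f m t)%C g = (q * Per f g)%C.
Proof.
  move=> Hf [[x y] z]. case: (pterm_dominated f (Rabs (x - c * y)) Hf) => M1 [_ D1].
  rewrite /Per -(zser_scal _ _ _ (D1 x y z (Rle_refl _))). f_equal.
  apply: functional_extensionality => m. rewrite /pterm. ring.
Qed.

(** The relation between the translation [delta m] and the frequency in [y] of the [m]-th term that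
    turns the derivative in [y] into multiplication by the argument [t]. *)
Lemma kdelta m : k * delta m = 2 * PI * (IZR m + nu) / w2.
Proof.
  rewrite /delta. have D0 := Hd0. apply: (Rmult_eq_reg_r (w2 * INR d)); last by apply: Rmult_integral_contrapositive_currified; lra.
  have -> : k * (a * (IZR m + nu) / INR d) * (w2 * INR d) = (k * a * w2) * (IZR m + nu) by field; lra.
  rewrite Hka. field. lra.
Qed.

Lemma pterm_CDx f m x y z : fam f -> CD (fun x => pterm f m (x, y, z)) x (pterm (fd f) m (x, y, z)).
Proof.
  move=> [_ S1]. rewrite /pterm. apply: CD_eq.
  - apply: CD_mult; last exact: CD_const. apply: (CD_comp (f m) (fun x => x - c * y + delta m)). exact: (Schw_CD _ (S1 m)).
    instantiate (1 := 1). auto_derive => //; ring.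
  - cbv beta. rewrite /fd. ring.
Qed.

Lemma pterm_CDy f m x y z : fam f -> CD (fun y => pterm f m (x, y, z)) y (pterm (fy f) m (x, y, z) + - (Ci * RtoC k * RtoC x) * pterm f m (x, y, z))%C.
Proof.
  move=> [_ S1]. have K := kdelta m. rewrite /pterm. apply: CD_eq.
  - apply: CD_mult.
    + apply: (CD_comp (f m) (fun y => x - c * y + delta m)). exact: (Schw_CD _ (S1 m)).
      instantiate (1 := - c). auto_derive => //; ring.
    + apply: (CD_cis_comp (fun y => 2 * PI * (IZR m + nu) * y / w2 + k * (z - c * y ^ 2 / 2))).
      (* The derivative of the phase, arranged as [k t - k x] with [t] the argument of [f m]; the
         term [- k x] is what [VY] compensates. *)
      instantiate (1 := k * (x - c * y) + k * delta m - k * x). rewrite K. auto_derive => //. field. lra.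
  - cbv beta. rewrite /fy /fd /fmul.
    have -> : RtoC (k * (x - c * y) + k * delta m - k * x) = (RtoC k * RtoC (x - c * y + delta m) - RtoC k * RtoC x)%C.
    { rewrite -!RtoC_mult -RtoC_minus. f_equal; ring. }
    ring.
Qed.

Lemma Per_CDx f x y z : fam f -> CD (fun x => Per f (x, y, z)) x (Per (fd f) (x, y, z)).
Proof.
  move=> Hf. have Hf1 := fam_fd _ Hf. have Hf2 := fam_fd _ Hf1.
  case: (pterm_dominated f (Rabs (x - c * y) + 1) Hf) => M0 [P0 D0]. case: (pterm_dominated _ (Rabs (x - c * y) + 1) Hf1) => M1 [P1 D1].
  case: (pterm_dominated _ (Rabs (x - c * y) + 1) Hf2) => M2 [P2 D2].
  have W : forall al M M', dominated al M -> M <= M' -> dominated al M'.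
  { move=> al M M' H HM m. apply: Rle_trans (H m) _. apply: Rmult_le_compat_r => //. apply: Rlt_le. apply: Rinv_0_lt_compat. exact: dom_den. }
  apply: (zser_CD (fun m x => pterm f m (x, y, z)) (fun m x => pterm (fd f) m (x, y, z)) (fun m x => pterm (fd (fd f)) m (x, y, z)) x (M0 + M1 + M2)).
  - move=> m s; exact: pterm_CDx.
  - move=> m s; exact: pterm_CDx.
  - move=> s Hs. have Hb' : Rabs (s - c * y) <= Rabs (x - c * y) + 1.
    { have -> : s - c * y = (x - c * y) + (s - x) by ring. apply: Rle_trans (Rabs_triang _ _) _. lra. }
    split; [apply: (W _ M0); [exact: D0|lra] | apply: (W _ M2); [exact: D2|lra]].
  - apply: (W _ M1); last lra. apply: D1. lra.
Qed.

Lemma Per_CDz f x y z : fam f -> CD (fun z => Per f (x, y, z)) z (Ci * RtoC k * Per f (x, y, z))%C.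
Proof.
  move=> Hf. case: (pterm_dominated f (Rabs (x - c * y)) Hf) => M0 [P0 D0].
  have E : forall z, Per f (x, y, z) = (cis (k * z) * Per f (x, y, 0%R))%C.
  { move=> s. rewrite /Per -(zser_scal _ _ _ (D0 x y 0 (Rle_refl _))). f_equal. apply: functional_extensionality => m.
    rewrite /pterm. have -> : 2 * PI * (IZR m + nu) * y / w2 + k * (s - c * y ^ 2 / 2) = k * s + (2 * PI * (IZR m + nu) * y / w2 + k * (0 - c * y ^ 2 / 2)) by ring.
    rewrite cis_plus. ring. }
  apply: (CD_ext (fun z => Per f (x, y, 0%R) * cis (k * z))%C). { move=> s. rewrite (E s). ring. }
  apply: CD_eq. apply: CD_scal. apply: CD_cis_comp. instantiate (1 := k). auto_derive => //; ring.
  rewrite (E z). cbv beta; ring.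
Qed.

Lemma Per_CDy f x y z : fam f -> CD (fun y => Per f (x, y, z)) y (Per (fy f) (x, y, z) + - (Ci * RtoC k * RtoC x) * Per f (x, y, z))%C.
Proof.
  move=> Hf. have Hf1 := fam_fy _ Hf. have Hf2 := fam_fy _ Hf1. set q := (- (Ci * RtoC k * RtoC x))%C.
  set R0 := Rabs (x - c * y) + Rabs c.
  case: (pterm_dominated f R0 Hf) => M0 [P0 D0]. case: (pterm_dominated _ R0 Hf1) => M1 [P1 D1].
  case: (pterm_dominated _ R0 Hf2) => M2 [P2 D2].
  have W : forall al M M', dominated al M -> M <= M' -> dominated al M'.
  { move=> al M M' H HM m. apply: Rle_trans (H m) _. apply: Rmult_le_compat_r => //. apply: Rlt_le. apply: Rinv_0_lt_compat. exact: dom_den. }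
  have Bs : forall s, Rabs (s - y) <= 1 -> Rabs (x - c * s) <= R0.
  { move=> s Hs. have -> : x - c * s = (x - c * y) + (- c) * (s - y) by ring. apply: Rle_trans (Rabs_triang _ _) _.
    rewrite Rabs_mult Rabs_Ropp /R0. have := Rabs_pos c. nra. }
  have By := Bs y ltac:(rewrite Rminus_diag Rabs_R0; lra).
  have Q0 := Cmod_ge_0 q.
  have Dom1 : forall s, Rabs (s - y) <= 1 -> dominated (fun m => pterm (fy f) m (x, s, z) + q * pterm f m (x, s, z))%C (M1 + Cmod q * M0).
  { move=> s Hs. apply: dominated_plus; first by apply: D1; exact: Bs. apply: dominated_scal. apply: D0. exact: Bs. }
  set M := M0 + (M1 + Cmod q * M0) + ((M2 + Cmod q * M1) + Cmod q * (M1 + Cmod q * M0)).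
  have N1 : 0 <= Cmod q * M0 by apply: Rmult_le_pos. have N2 : 0 <= Cmod q * M1 by apply: Rmult_le_pos.
  have N3 : 0 <= Cmod q * (M1 + Cmod q * M0) by apply: Rmult_le_pos; lra.
  apply: CD_eq.
  - apply: (zser_CD (fun m y => pterm f m (x, y, z)) (fun m y => pterm (fy f) m (x, y, z) + q * pterm f m (x, y, z))%C
      (fun m y => (pterm (fy (fy f)) m (x, y, z) + q * pterm (fy f) m (x, y, z)) + q * (pterm (fy f) m (x, y, z) + q * pterm f m (x, y, z)))%C y M).
    + move=> m s; exact: pterm_CDy.
    + move=> m s. apply: CD_plus; first exact: pterm_CDy. apply: CD_scal. exact: pterm_CDy.
    + move=> s Hs. split; first by apply: (W _ M0); [apply: D0; exact: Bs | rewrite /M; lra].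
      apply: (W _ ((M2 + Cmod q * M1) + Cmod q * (M1 + Cmod q * M0))); last by rewrite /M; lra.
      apply: dominated_plus; last by apply: dominated_scal; exact: Dom1.
      apply: dominated_plus; first by apply: D2; exact: Bs. apply: dominated_scal. apply: D1. exact: Bs.
    + apply: (W _ (M1 + Cmod q * M0)); last by rewrite /M; lra. apply: Dom1. rewrite Rminus_diag Rabs_R0; lra.
  - rewrite (zser_plus _ _ _ _ (D1 x y z By) (dominated_scal q _ _ (D0 x y z By))) (zser_scal _ _ _ (D0 x y z By)). by [].
Qed.

Lemma Per_partials f : fam f -> Cpartials (Per f) (Per (fd f))
  (fun g => Per (fy f) g + - (Ci * RtoC k) * (RtoC (fst (fst g)) * Per f g))%C (fun g => Ci * RtoC k * Per f g)%C.
Proof.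
  move=> Hf x y z. split; [exact: Per_CDx | split; [|exact: Per_CDz]].
  apply: CD_eq (Per_CDy f x y z Hf) _. rewrite /=. ring.
Qed.

Lemma Per_bounded f R0 : fam f -> exists M, 0 <= M /\ forall x y z, Rabs x <= R0 -> Rabs y <= R0 -> Cmod (Per f (x, y, z)) <= M.
Proof.
  move=> Hf. case: (pterm_dominated f (R0 + Rabs c * R0) Hf) => M [P D]. exists (5 * M). split; first lra.
  move=> x y z Hx Hy. apply: zser_bound. apply: D. apply: Rle_trans (Rabs_triang _ _) _. rewrite Rabs_Ropp Rabs_mult.
  have := Rabs_pos c. nra.
Qed.

Lemma Per_cont f : fam f -> CcontG (Per f).
Proof.
  move=> Hf. have P := Per_partials f Hf.
  have HB : forall R0, exists M, forall x y z, Rabs x <= R0 -> Rabs y <= R0 -> Rabs z <= R0 ->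
    Cmod (Per (fd f) (x, y, z)) <= M /\ Cmod (Per (fy f) (x, y, z) + - (Ci * RtoC k) * (RtoC x * Per f (x, y, z)))%C <= M /\
    Cmod (Ci * RtoC k * Per f (x, y, z))%C <= M.
  { move=> R0. case: (Per_bounded f R0 Hf) => M0 [P0 B0]. case: (Per_bounded _ R0 (fam_fd _ Hf)) => M1 [P1 B1].
    case: (Per_bounded _ R0 (fam_fy _ Hf)) => M2 [P2 B2].
    set q := Cmod (Ci * RtoC k)%C. have Hq : 0 <= q by exact: Cmod_ge_0.
    exists (M1 + (M2 + q * (Rabs R0 * M0)) + q * M0) => x y z Hx Hy Hz.
    have A0 := B0 x y z Hx Hy. have A1 := B1 x y z Hx Hy. have A2 := B2 x y z Hx Hy.
    have R0p : 0 <= Rabs R0 by exact: Rabs_pos.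
    have Xp : Rabs x <= Rabs R0 by have := Rle_abs R0; lra.
    have N1 : 0 <= q * M0 by apply: Rmult_le_pos. have N2 : 0 <= q * (Rabs R0 * M0) by apply: Rmult_le_pos => //; apply: Rmult_le_pos.
    split; [lra|split].
    - apply: Rle_trans (Cmod_triangle _ _) _. rewrite Cmod_mult Cmod_opp -/q Cmod_mult Cmod_R.
      have : q * (Rabs x * Cmod (Per f (x, y, z))) <= q * (Rabs R0 * M0); last lra.
      apply: Rmult_le_compat_l => //. apply: Rmult_le_compat => //. exact: Rabs_pos. exact: Cmod_ge_0.
    - rewrite Cmod_mult -/q. have : q * Cmod (Per f (x, y, z)) <= q * M0; last lra. exact: Rmult_le_compat_l. }
  split.
  - apply: (contG_of_partials _ (fun g => Re (Per (fd f) g)) (fun g => Re (Per (fy f) g + - (Ci * RtoC k) * (RtoC (fst (fst g)) * Per f g))%C) (fun g => Re (Ci * RtoC k * Per f g)%C)).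
    + move=> x y z. case: (P x y z) => [[? ?] [[? ?] [? ?]]]. by split; [|split].
    + move=> R0. case: (HB R0) => M HM. exists M => x y z Hx Hy Hz. case: (HM x y z Hx Hy Hz) => [A1 [A2 A3]].
      split; [|split]; (apply: Rle_trans (proj1 (Rabs_Re_Im _)) _) => //.
  - apply: (contG_of_partials _ (fun g => Im (Per (fd f) g)) (fun g => Im (Per (fy f) g + - (Ci * RtoC k) * (RtoC (fst (fst g)) * Per f g))%C) (fun g => Im (Ci * RtoC k * Per f g)%C)).
    + move=> x y z. case: (P x y z) => [[? ?] [[? ?] [? ?]]]. by split; [|split].
    + move=> R0. case: (HB R0) => M HM. exists M => x y z Hx Hy Hz. case: (HM x y z Hx Hy Hz) => [A1 [A2 A3]].
      split; [|split]; (apply: Rle_trans (proj1 (proj2 (Rabs_Re_Im _))) _) => //.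
Qed.

Lemma Per_Sm f : fam f -> Sm (Per f).
Proof.
  move=> Hf n. elim: n f Hf => [|n IH] f Hf.
  - case: (Per_cont f Hf) => [? ?]. by split.
  - apply: (CK_intro n _ _ _ _ (Per_cont f Hf) (Per_partials f Hf)).
    + apply: IH. exact: fam_fd.
    + apply: CK_plus; first by apply: IH; exact: fam_fy. apply: CK_mult; first exact: CK_const.
      apply: CK_mult; first exact: Sm_x. exact: IH.
    + apply: CK_mult; [exact: CK_const|exact: IH].
Qed.

Lemma Per_fields f : fam f -> PX (Per f) = Per (fd f) /\ VY (Per f) = Per (fy f) /\ PZ (Per f) = (fun g => Ci * RtoC k * Per f g)%C.
Proof.
  move=> Hf. case: (Cpartials_P _ _ _ _ (Per_partials f Hf)) => [E1 [E2 E3]]. split => //. split => //.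
  rewrite /VY E2 E3. funring.
Qed.

(** Translation by [(a, 0, 0)] reindexes the sum by [d], the central phase [k a y] being exactly the
    change of frequency. Translation by [(b, w2, 0)] acts term by term, since it fixes [x - c * y]
    and multiplies each phase by the same constant. *)
Lemma Per_lambda_k f : fam f -> lambda_k (Per f).
Proof.
  move=> Hf. have HD0 := Hd0. have HP := PI_RGT_0. split; [exact: Per_Sm | split; [|split]].
  - move=> [[x y] z]. rewrite /= .
    case: (pterm_dominated f (Rabs (x - c * y)) Hf) => M [P D].
    rewrite /Per -(zser_shift _ M d (D x y z (Rle_refl _))) -(zser_scal _ _ (3 ^ d * M)).
    + f_equal. apply: functional_extensionality => m. rewrite /pterm. case: (Hf) => [T1 _]. rewrite T1.
      have E1 : a + x - c * (0 + y) + delta m = x - c * y + delta (m + Z.of_nat d).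
      { rewrite /delta plus_IZR -INR_IZR_INZ. field. lra. }
      have E2 : 2 * PI * (IZR (m + Z.of_nat d) + nu) * y / w2 + k * (z - c * y ^ 2 / 2) = 2 * PI * (IZR m + nu) * (0 + y) / w2 + k * (0 + z + a * y - c * (0 + y) ^ 2 / 2).
      { rewrite plus_IZR -INR_IZR_INZ.
        have -> : 2 * PI * (IZR m + INR d + nu) * y / w2 = 2 * PI * (IZR m + nu) * y / w2 + (2 * PI * INR d) * y / w2 by field; lra.
        rewrite -Hka. field. lra. }
      rewrite E1 E2. rewrite Cmult_assoc Cmult_assoc -RtoC_mult He1. ring.
    + have : forall q, dominated (fun m => pterm f (m + Z.of_nat q)%Z (x, y, z)) (3 ^ q * M); last exact.
      elim => [|q IH].
      * move=> m. rewrite Z.add_0_r /= Rmult_1_l. exact: D (Rle_refl _) m.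
      * have Eq : 3 ^ S q * M = 3 * (3 ^ q * M) by rewrite /=; ring. rewrite Eq => m.
        have E3 : (m + Z.of_nat (S q) = m + 1 + Z.of_nat q)%Z by lia. rewrite E3. exact: (dominated_shift1 _ _ IH m).
  - move=> [[x y] z]. rewrite /= . case: (pterm_dominated f (Rabs (x - c * y)) Hf) => M [P D].
    rewrite /Per -(zser_scal _ _ _ (D x y z (Rle_refl _))). f_equal. apply: functional_extensionality => m. rewrite /pterm -Hnu.
    have -> : b + x - c * (w2 + y) + delta m = x - c * y + delta m by rewrite Hb; ring.
    have -> : 2 * PI * (IZR m + nu) * (w2 + y) / w2 + k * (0 + z + b * y - c * (w2 + y) ^ 2 / 2) =
      (2 * PI * nu - k * c * w2 ^ 2 / 2) + (2 * PI * (IZR m + nu) * y / w2 + k * (z - c * y ^ 2 / 2)) + 2 * PI * IZR m.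
    { rewrite Hb. field. lra. }
    rewrite cis_period cis_plus. ring.
  - move=> x y z. case: (pterm_dominated f (Rabs (x - c * y)) Hf) => M [P D].
    rewrite /Per -(zser_scal _ _ _ (D x y 0 (Rle_refl _))). f_equal. apply: functional_extensionality => m.
    rewrite /pterm. have -> : 2 * PI * (IZR m + nu) * y / w2 + k * (z - c * y ^ 2 / 2) = k * z + (2 * PI * (IZR m + nu) * y / w2 + k * (0 - c * y ^ 2 / 2)) by ring.
    rewrite cis_plus. ring.
Qed.

(** [X - i Y]; together with [Lp], which is its adjoint by [Lo_adj], it is an annihilation and
    creation pair at positive central frequency. The factor [1 / sqrt A] is put in by [Los] and
    [Lps]. *)
Definition Lo (u : G -> C) : G -> C := fun g => (PX u g - Ci * VY u g)%C.
Definition Lp (u : G -> C) : G -> C := fun g => (- (PX u g + Ci * VY u g))%C.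

Lemma mode_inv u : mode u <-> forall h, inv_by (0, 0, h) (cis (k * h)) u.
Proof.
  split.
  - move=> H h [[x y] z] /=. rewrite H (H x y z) Cmult_assoc -cis_plus. f_equal.
    + f_equal; ring. + f_equal. apply: triple_eq; ring.
  - move=> H x y z. rewrite -(H z (x, y, 0)) /=. f_equal. apply: triple_eq; ring.
Qed.

Lemma lambda_k_fields u : lambda_k u -> lambda_k (PX u) /\ lambda_k (VY u).
Proof.
  move=> [S1 [I1 [I2 /mode_inv M]]].
  case: (inv_by_fields _ _ _ S1 I1) => [? [? _]]. case: (inv_by_fields _ _ _ S1 I2) => [? [? _]].
  split; (split; [by apply: Sm_PX || apply: Sm_VY | split => //; split => //; apply/mode_inv => h; case: (inv_by_fields _ _ _ S1 (M h)) => [? [? _]] //]).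
Qed.

Lemma mode_plus u v : mode u -> mode v -> mode (fun g => u g + v g)%C.
Proof. move=> H1 H2 x y z. rewrite H1 H2. ring. Qed.
Lemma inv_by_plus g e u v : inv_by g e u -> inv_by g e v -> inv_by g e (fun g => u g + v g)%C.
Proof. move=> H1 H2 h. rewrite H1 H2. ring. Qed.
Lemma inv_by_scal g e q u : inv_by g e u -> inv_by g e (fun g => q * u g)%C.
Proof. move=> H1 h. rewrite H1. ring. Qed.
Lemma lambda_k_plus u v : lambda_k u -> lambda_k v -> lambda_k (fun g => u g + v g)%C.
Proof.
  move=> [S1 [I1 [J1 M1]]] [S2 [I2 [J2 M2]]]. split; [exact: Sm_plus|split; [exact: inv_by_plus|split; [exact: inv_by_plus|exact: mode_plus]]].
Qed.
Lemma lambda_k_scal q u : lambda_k u -> lambda_k (fun g => q * u g)%C.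
Proof.
  move=> [S1 [I1 [J1 M1]]]. split; [exact: Sm_scal|split; [exact: inv_by_scal|split; [exact: inv_by_scal|]]].
  move=> x y z. rewrite M1. ring.
Qed.

Lemma lambda_k_Lo u : lambda_k u -> lambda_k (Lo u).
Proof.
  move=> H. case: (lambda_k_fields u H) => [H1 H2].
  have -> : Lo u = (fun g => PX u g + (- Ci) * VY u g)%C by apply: functional_extensionality => g; rewrite /Lo; ring.
  apply: lambda_k_plus => //. exact: lambda_k_scal.
Qed.
Lemma lambda_k_Lp u : lambda_k u -> lambda_k (Lp u).
Proof.
  move=> H. case: (lambda_k_fields u H) => [H1 H2].
  have -> : Lp u = (fun g => (-1) * PX u g + (- Ci) * VY u g)%C by apply: functional_extensionality => g; rewrite /Lp; ring.
  apply: lambda_k_plus; exact: lambda_k_scal.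
Qed.

Lemma mode_PZ u : lambda_k u -> PZ u = (fun g => Ci * RtoC k * u g)%C.
Proof.
  move=> [S1 [_ [_ M]]]. apply: functional_extensionality; move=> [[x y] z].
  apply: (CD_unique (fun z => u (x, y, z)) z). { exact: (proj2 (proj2 (Sm_partials u S1 x y z))). }
  apply: (CD_ext (fun z => u (x, y, 0%R) * cis (k * z))%C). { move=> s. rewrite (M x y s). ring. }
  apply: CD_eq. apply: CD_scal. apply: CD_cis_comp. instantiate (1 := k). auto_derive => //; ring.
  rewrite (M x y z). cbv beta; ring.
Qed.

(** * Inversion of the Weil-Brezin transform *)

Lemma lambda_k_bounded u : lambda_k u -> exists M, 0 <= M /\ forall g, Cmod (u g) <= M.
Proof.
  move=> [S1 [I1 [I2 M]]].
  have Inv : invar a b w2 r (fun g => Cmod (u g)).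
  { move=> x y z; split; [|split].
    - have := I1 (x, y, z). rewrite /= => E. have := f_equal Cmod E. rewrite Cmod_mult Cmod_R e1_abs Rmult_1_l => <-. do 2 f_equal. apply: triple_eq; ring.
    - have := I2 (x, y, z). rewrite /= => E. have := f_equal Cmod E. rewrite Cmod_mult -Hnu Cmod_cis Rmult_1_l => <-. do 2 f_equal. apply: triple_eq; ring.
    - rewrite (M x y (z + r)) (M x y z) !Cmod_mult !Cmod_cis. by []. }
  case: (CcontG_bounded u (a + w2 + r) (Sm_cont _ S1)) => M0 [P0 B0]. exists M0; split => // g.
  case: (box_reduce _ _ _ _ _ Ha Hw Hr Inv g) => [[[x y] z] [[Hx [Hy Hz]] <-]]. rewrite /= in Hx Hy Hz.
  apply: B0; rewrite Rabs_right; lra.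
Qed.

(** [u] along the orbit of [(s, 0, 0)] under left multiplication by [exp(t w2 (c X + Y))]. At
    [t = 1] this group element is the lattice vector [(b, w2, 0)] up to the centre, so [u] is
    periodic along the orbit up to a phase. *)
Definition upath (u : G -> C) (s t : R) : C := u (s + c * (w2 * t), w2 * t, c * (w2 * t) ^ 2 / 2).
Definition cm (u : G -> C) (m : Z) (s : R) : C := fcoef (fun t => cis (- (nu * (2 * PI * t))) * upath u s t)%C m.
Definition Tc (u : G -> C) (m : Z) (t : R) : C := cm u m (t - delta m).

Lemma cm_E u m s : cm u m s = CR (fun t => cis (- (IZR m + nu) * (2 * PI * t)) * upath u s t)%C 0 1.
Proof. apply: CR_ext => t. rewrite Cmult_assoc -cis_plus. do 2 f_equal. ring. Qed.

Definition VYc (u : G -> C) : G -> C := fun g => (RtoC c * PX u g + VY u g)%C.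

Lemma upath_CD u s t : lambda_k u -> CD (upath u s) t (RtoC w2 * (upath (VYc u) s t - Ci * RtoC k * RtoC s * upath u s t))%C.
Proof.
  move=> H. have E := mode_PZ u H. case: H => [S1 _]. apply: CD_eq.
  - apply: (Sm_path u (fun t => s + c * (w2 * t)) (fun t => w2 * t) (fun t => c * (w2 * t) ^ 2 / 2) t (c * w2) w2 (c * w2 * (w2 * t))) => //.
    + auto_derive => //; ring. + auto_derive => //; ring. + auto_derive => //; field.
  - rewrite /upath /VYc /VY E /=.
    rewrite !RtoC_mult RtoC_plus !RtoC_mult. ring.
Qed.

Lemma ccont_upath u s : lambda_k u -> ccont (upath u s).
Proof. move=> H. exact: (ccont_CD _ _ (fun t => upath_CD u s t H)). Qed.

Lemma upath_period u s t : lambda_k u -> upath u s (t + 1) = (RtoC e2 * cis (k * c * w2 ^ 2 / 2) * upath u s t)%C.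
Proof.
  move=> [_ [_ [I2 /mode_inv M]]]. rewrite /upath -Cmult_assoc (Cmult_comm (cis _)) Cmult_assoc -I2 Cmult_comm.
  have -> : k * c * w2 ^ 2 / 2 = k * (c * w2 ^ 2 / 2) by field. rewrite -M /=. f_equal. rewrite Hb. apply: triple_eq; field.
Qed.

Lemma e2_conj : (RtoC e2 * cis (k * c * w2 ^ 2 / 2) * cis (- (2 * PI * nu)) = 1)%C.
Proof.
  rewrite -Cmult_assoc -cis_plus.
  have -> : k * c * w2 ^ 2 / 2 + - (2 * PI * nu) = - (2 * PI * nu - k * c * w2 ^ 2 / 2) by ring.
  rewrite cis_opp Hnu. rewrite -(cis_conj_mult (2 * PI * nu - k * c * w2 ^ 2 / 2)) Hnu. by [].
Qed.

Lemma phi_period u s t : lambda_k u ->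
  (cis (- (nu * (2 * PI * (t + 1)))) * upath u s (t + 1) = cis (- (nu * (2 * PI * t))) * upath u s t)%C.
Proof.
  move=> H. rewrite (upath_period u s t H).
  have -> : - (nu * (2 * PI * (t + 1))) = - (nu * (2 * PI * t)) + - (2 * PI * nu) by ring. rewrite cis_plus.
  transitivity (cis (- (nu * (2 * PI * t))) * upath u s t * (RtoC e2 * cis (k * c * w2 ^ 2 / 2) * cis (- (2 * PI * nu))))%C; first ring.
  rewrite e2_conj. ring.
Qed.

(** Moving the starting point of the orbit by the lattice vector [(a, 0)] costs a central phase
    linear in [t], of frequency [k a w2 = 2 pi d]. It shifts the Fourier index by [d]. *)
Lemma cm_shift u m s : lambda_k u -> cm u (m + Z.of_nat d)%Z (s - a) = (RtoC e1 * cm u m s)%C.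
Proof.
  move=> H. rewrite !cm_E -CR_scal; last by apply: ccont_mult; [exact: ccont_cis2|exact: ccont_upath].
  apply: CR_ext => t. case: H => [_ [I1 [_ /mode_inv M]]].
  have E : upath u s t = (RtoC e1 * (cis (k * (- a * (w2 * t))) * upath u (s - a) t))%C.
  { rewrite /upath -M -I1 /=. f_equal. apply: triple_eq; field. }
  rewrite E.
  have -> : k * (- a * (w2 * t)) = - (k * a * w2) * t by ring. rewrite Hka plus_IZR -INR_IZR_INZ.
  have -> : - (IZR m + INR d + nu) * (2 * PI * t) = - (IZR m + nu) * (2 * PI * t) + - (2 * PI * INR d) * t by ring.
  rewrite cis_plus.
  transitivity ((RtoC e1 * RtoC e1) * (cis (- (IZR m + nu) * (2 * PI * t)) * cis (- (2 * PI * INR d) * t) * upath u (s - a) t))%C; last ring.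
  rewrite -RtoC_mult He1. ring.
Qed.

Lemma twisted_Tc u : lambda_k u -> twisted (Tc u).
Proof.
  move=> H m t. rewrite /Tc -cm_shift //. f_equal. rewrite /delta plus_IZR -INR_IZR_INZ. field. have := Hd0; lra.
Qed.

Lemma Tc_bounded u m : lambda_k u -> exists M, forall t, Cmod (Tc u m t) <= M.
Proof.
  move=> H. case: (lambda_k_bounded u H) => M [P B]. exists (2 * M) => t. rewrite /Tc cm_E. apply: CR_bound.
  - apply: ccont_mult; [exact: ccont_cis2|exact: ccont_upath].
  - move=> x _. rewrite Cmod_mult Cmod_cis Rmult_1_l. exact: B.
Qed.

Lemma cm_CD u m s : lambda_k u -> CD (cm u m) s (cm (PX u) m s).
Proof.
  move=> [S1 _].
  have Sx := Sm_PX _ S1. have P := Sm_partials u S1.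
  set th := fun t => - (IZR m + nu) * (2 * PI * t).
  have Cc : forall t, continuous (fun t => cos (th t)) t := proj1 (ccont_cis2 (- (IZR m + nu))).
  have Cs : forall t, continuous (fun t => sin (th t)) t := proj2 (ccont_cis2 (- (IZR m + nu))).
  have Cmul : forall q p (t : R), continuous (fun z : R * R => q * snd z) (p, t) by move=> *; cont.
  have Csq : forall p (t : R), continuous (fun z : R * R => c * (w2 * snd z) ^ 2 / 2) (p, t).
  { move=> p t. rewrite /=. apply: continuous_Rmult; cont. }
  have J : forall (f h : G -> R), contG f -> contG h -> forall (e : R),
    jcont (U := R_UniformSpace) (fun s t => cos (th t) * f (s + c * (w2 * t), w2 * t, c * (w2 * t) ^ 2 / 2) + e * (sin (th t) * h (s + c * (w2 * t), w2 * t, c * (w2 * t) ^ 2 / 2))).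
  { move=> f h Hf Hh e p t. apply: continuous_Rplus; apply: continuous_Rmult.
    - apply: (continuous_scomp (fun t => cos (th t))) => //. cont.
    - apply: contG_comp => //; cont.
    - cont.
    - apply: continuous_Rmult. apply: (continuous_scomp (fun t => sin (th t))) => //. cont.
      apply: contG_comp => //; cont. }
  have Re1 : forall v s, Re (cm v m s) = RInt (fun t => cos (th t) * Re (upath v s t) + (-1) * (sin (th t) * Im (upath v s t))) 0 1.
  { move=> v s'. rewrite cm_E. apply: RInt_ext => t _. rewrite /= /Re /Im /th. rring. }
  have Im1 : forall v s, Im (cm v m s) = RInt (fun t => cos (th t) * Im (upath v s t) + 1 * (sin (th t) * Re (upath v s t))) 0 1.
  { move=> v s'. rewrite cm_E. apply: RInt_ext => t _. rewrite /= /Re /Im /th. rring. }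
  case: (Sm_cont _ S1) => [c1 c2]. case: (Sm_cont _ Sx) => [c3 c4].
  have D : forall x y z, is_derive (fun x => Re (u (x, y, z))) x (Re (PX u (x, y, z))) /\ is_derive (fun x => Im (u (x, y, z))) x (Im (PX u (x, y, z))).
  { move=> x y z. exact: (proj1 (P x y z)). }
  have Dsh : forall q x, is_derive (fun x => x + q) x 1 by move=> q x; auto_derive => //; ring.
  split.
  - apply: (is_derive_ext (fun s => RInt (fun t => cos (th t) * Re (upath u s t) + (-1) * (sin (th t) * Im (upath u s t))) 0 1)); first by move=> s'; rewrite Re1.
    rewrite Re1. apply: (is_derive_RInt_jcont (fun s t => cos (th t) * Re (upath u s t) + (-1) * (sin (th t) * Im (upath u s t))) (fun s t => cos (th t) * Re (upath (PX u) s t) + (-1) * (sin (th t) * Im (upath (PX u) s t)))); first lra.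
    + move=> x t. apply: is_derive_Rplus; apply: is_derive_scal; last apply: is_derive_scal.
      * apply: is_derive_eq. apply: (is_derive_Rcomp (fun x => Re (u (x, w2 * t, c * (w2 * t) ^ 2 / 2))) (fun x => x + c * (w2 * t))). exact: (proj1 (D _ _ _)). exact: Dsh. by rewrite Rmult_1_r.
      * apply: is_derive_eq. apply: (is_derive_Rcomp (fun x => Im (u (x, w2 * t, c * (w2 * t) ^ 2 / 2))) (fun x => x + c * (w2 * t))). exact: (proj2 (D _ _ _)). exact: Dsh. by rewrite Rmult_1_r.
    + exact: (J (fun g => Re (u g)) (fun g => Im (u g)) c1 c2).
    + exact: (J (fun g => Re (PX u g)) (fun g => Im (PX u g)) c3 c4).
  - apply: (is_derive_ext (fun s => RInt (fun t => cos (th t) * Im (upath u s t) + 1 * (sin (th t) * Re (upath u s t))) 0 1)); first by move=> s'; rewrite Im1.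
    rewrite Im1. apply: (is_derive_RInt_jcont (fun s t => cos (th t) * Im (upath u s t) + 1 * (sin (th t) * Re (upath u s t))) (fun s t => cos (th t) * Im (upath (PX u) s t) + 1 * (sin (th t) * Re (upath (PX u) s t)))); first lra.
    + move=> x t. apply: is_derive_Rplus; apply: is_derive_scal; last apply: is_derive_scal.
      * apply: is_derive_eq. apply: (is_derive_Rcomp (fun x => Im (u (x, w2 * t, c * (w2 * t) ^ 2 / 2))) (fun x => x + c * (w2 * t))). exact: (proj2 (D _ _ _)). exact: Dsh. by rewrite Rmult_1_r.
      * apply: is_derive_eq. apply: (is_derive_Rcomp (fun x => Re (u (x, w2 * t, c * (w2 * t) ^ 2 / 2))) (fun x => x + c * (w2 * t))). exact: (proj1 (D _ _ _)). exact: Dsh. by rewrite Rmult_1_r.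
    + exact: (J (fun g => Im (u g)) (fun g => Re (u g)) c2 c1).
    + exact: (J (fun g => Im (PX u g)) (fun g => Re (PX u g)) c4 c3).
Qed.

Lemma Tc_CD u m t : lambda_k u -> CD (Tc u m) t (Tc (PX u) m t).
Proof.
  move=> H. apply: CD_eq. apply: (CD_comp (cm u m) (fun t => t - delta m)). exact: cm_CD.
  instantiate (1 := 1). auto_derive => //; ring. rewrite /Tc. ring.
Qed.

Lemma lambda_k_VYc u : lambda_k u -> lambda_k (VYc u).
Proof. move=> H. case: (lambda_k_fields u H) => [H1 H2]. apply: lambda_k_plus => //. exact: lambda_k_scal. Qed.

(* [w2 VYc] differentiates along the curve [upath], up to the factor [Ci k s] from the central character; integrate by parts. *)
Lemma Tc_VYc u m t : lambda_k u -> Tc (VYc u) m t = (Ci * RtoC k * RtoC t * Tc u m t)%C.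
Proof.
  move=> H. have HP := PI_RGT_0. rewrite /Tc. set s := t - delta m.
  have C0 := ccont_cis2 (- (IZR m + nu)).
  have Cu := ccont_upath u s H. have Cv := ccont_upath _ s (lambda_k_VYc u H).
  set psi := fun t => (cis (- (IZR m + nu) * (2 * PI * t)) * upath u s t)%C.
  have D : forall x, CD psi x (RtoC w2 * (cis (- (IZR m + nu) * (2 * PI * x)) * upath (VYc u) s x) + (- (Ci * RtoC k * RtoC w2) * RtoC t) * psi x)%C.
  { move=> x. apply: CD_eq.
    - apply: CD_mult; last exact: upath_CD. apply: (CD_cis_comp (fun t => - (IZR m + nu) * (2 * PI * t))).
      instantiate (1 := - (k * w2) * delta m). have K := kdelta m.
      have -> : - (k * w2) * delta m = - w2 * (k * delta m) by ring. rewrite K. auto_derive => //. field. lra.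
    - rewrite /psi. cbv beta. rewrite /s RtoC_minus !RtoC_mult RtoC_opp RtoC_mult. ring. }
  have Cp : ccont psi by exact: ccont_mult.
  have E := CR_derive _ _ D ltac:(apply: ccont_plus; apply: ccont_scal => //; exact: ccont_mult).
  have P1 : psi 1 = psi 0.
  { rewrite /psi. have Pp := phi_period u s 0 H. rewrite Rplus_0_l in Pp.
    have -> : - (IZR m + nu) * (2 * PI * 1) = - (nu * (2 * PI * 1)) + 2 * PI * IZR (- m) by rewrite opp_IZR; ring.
    rewrite cis_period Pp. do 2 f_equal. ring. }
  rewrite P1 CR_plus in E; [|by apply: ccont_scal; exact: ccont_mult|by apply: ccont_scal].
  rewrite !CR_scal in E; [|by []|exact: ccont_mult].
  rewrite !cm_E -/psi. set Iv := CR _ 0 1 in E *. set Iu := CR psi 0 1 in E *.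
  have Hw0 : RtoC w2 <> 0%C by move/RtoC_inj; lra.
  have E2 : (RtoC w2 * (Iv - Ci * RtoC k * RtoC t * Iu) = 0)%C.
  { transitivity (psi 0%R - psi 0%R)%C; last ring. rewrite -E. ring. }
  apply: NNPP => Hne. have Hn : (Iv - Ci * RtoC k * RtoC t * Iu)%C <> 0%C.
  { move=> E3. apply: Hne. transitivity ((Iv - Ci * RtoC k * RtoC t * Iu) + Ci * RtoC k * RtoC t * Iu)%C; first ring. rewrite E3. ring. }
  exact: (Cmult_neq_0 _ _ Hw0 Hn E2).
Qed.

(** The transforms of all functions in [lambda_k] form the witnessing class: derivation is [PX], and
    multiplication by [k t] is [VYc] up to the factor [Ci]. Hence mere boundedness of every
    transform already yields decay of every order. *)
Lemma Schw_Tc u m : lambda_k u -> Schw (Tc u m).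
Proof.
  move=> H. exists (fun h => exists v, lambda_k v /\ h = Tc v m). split; first by exists u.
  move=> h {u H} [u [H ->]].
  have D : forall t, CD (Tc u m) t (Tc (PX u) m t) by move=> t; exact: Tc_CD.
  rewrite (dC_eq _ _ D). split; [|split].
  - move=> p. elim: p u H {D} => [|p IH] u H.
    + case: (Tc_bounded u m H) => M HM. exists M => t. rewrite /= Rmult_1_l. exact: HM.
    + case: (IH (VYc u) (lambda_k_VYc u H)) => M HM. exists (M / k) => t. have := HM t. rewrite Tc_VYc // !Cmod_mult !Cmod_R.
      have -> : Cmod Ci = 1. { have := Cmod_sq Ci. have := Cmod_ge_0 Ci. rewrite /=. nra. }
      rewrite (Rabs_right k); last lra. rewrite /= => B. apply: (Rmult_le_reg_l k) => //.
      have -> : k * (M / k) = M by field; lra. lra.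
  - exact: D.
  - exists (PX u). split => //. exact: (proj1 (lambda_k_fields u H)).
Qed.

Lemma fam_Tc u : lambda_k u -> fam (Tc u).
Proof. move=> H; split; [exact: twisted_Tc|move=> m; exact: Schw_Tc]. Qed.

Lemma Per_Tc u : lambda_k u -> forall g, u g = Per (Tc u) g.
Proof.
  (* Up to the centre, [(x, y, z)] lies on the orbit that starts at [s = x - c * y], at time
     [t0 = y / w2]. Fourier inversion is applied there after shifting time by [t0]. *)
  move=> H [[x y] z]. have HP := PI_RGT_0. set s := x - c * y. set t0 := y / w2.
  case: (pterm_dominated (Tc u) (Rabs s) (fam_Tc u H)) => M [_ Dm].
  set phi := fun t => (cis (- (nu * (2 * PI * t))) * upath u s t)%C.
  have Pp : forall t, phi (t + 1) = phi t by move=> t; exact: phi_period.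
  set dphi := fun t => (Ci * RtoC (- (nu * (2 * PI))) * cis (- (nu * (2 * PI * t))) * upath u s t + cis (- (nu * (2 * PI * t))) * (RtoC w2 * (upath (VYc u) s t - Ci * RtoC k * RtoC s * upath u s t)))%C.
  have D : forall t, CD phi t (dphi t).
  { move=> t. apply: CD_mult; last exact: upath_CD. apply: (CD_cis_comp (fun t => - (nu * (2 * PI * t)))). auto_derive => //; ring. }
  have Cphi := ccont_CD _ _ D.
  have Fc : forall m, fcoef (fun t => phi (t + t0)) m = (cis (IZR m * (2 * PI * t0)) * cm u m s)%C.
  { move=> m. rewrite /cm -/phi /fcoef.
    rewrite -(CR_period (fun t => cis (- IZR m * (2 * PI * t)) * phi t)%C t0); [|exact: ccont_fcoef|].
    - rewrite -CR_scal; last first.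
      { apply: (ccont_shift (fun t => cis (- IZR m * (2 * PI * t)) * phi t)%C). exact: ccont_fcoef. }
      apply: CR_ext => t. rewrite Cmult_assoc -cis_plus. do 2 f_equal. ring.
    - move=> t. rewrite Pp. have -> : - IZR m * (2 * PI * (t + 1)) = - IZR m * (2 * PI * t) + 2 * PI * IZR (- m) by rewrite opp_IZR; ring. by rewrite cis_period. }
  have Ecm : forall m, Tc u m (x - c * y + delta m) = cm u m s.
  { move=> m. rewrite /Tc. f_equal. rewrite /s; ring. }
  have Dc : dominated (fcoef (fun t => phi (t + t0))) M.
  { move=> m. rewrite Fc Cmod_mult Cmod_cis Rmult_1_l -Ecm. have := Dm x y z (Rle_refl _) m. by rewrite /pterm Cmod_mult Cmod_cis Rmult_1_r. }
  have [B HB] : exists B, forall t, Cmod (dphi t) <= B.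
  { case: (lambda_k_bounded u H) => M1 [P1 B1]. case: (lambda_k_bounded _ (lambda_k_VYc u H)) => M2 [P2 B2].
    exists (Cmod (Ci * RtoC (- (nu * (2 * PI))))%C * M1 + Cmod (RtoC w2) * (M2 + Cmod (Ci * RtoC k * RtoC s)%C * M1)) => t.
    apply: Rle_trans (Cmod_triangle _ _) _. apply: Rplus_le_compat.
    - rewrite Cmod_mult (Cmod_mult _ (cis _)) Cmod_cis Rmult_1_r. apply: Rmult_le_compat_l; [exact: Cmod_ge_0|exact: B1].
    - rewrite Cmod_mult Cmod_cis Rmult_1_l Cmod_mult. apply: Rmult_le_compat_l; first exact: Cmod_ge_0.
      apply: Rle_trans (Cmod_triangle _ _) _. rewrite Cmod_opp. apply: Rplus_le_compat; first exact: B2.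
      rewrite Cmod_mult. apply: Rmult_le_compat_l; [exact: Cmod_ge_0|exact: B1]. }
  have F := fourier_inversion (fun t => phi (t + t0)) (fun t => dphi (t + t0)) B M.
  rewrite Rplus_0_l in F. have {}F : phi t0 = zser (fcoef (fun t => phi (t + t0))).
  { apply: F => //.
    - move=> t. apply: CD_eq. apply: (CD_comp phi (fun t => t + t0)). exact: D. instantiate (1 := 1). auto_derive => //; ring. ring.
    - move=> t. have -> : t + 1 + t0 = (t + t0) + 1 by ring. exact: Pp. }
  have Ey : w2 * t0 = y by rewrite /t0; field; lra.
  have E1 : phi t0 = (cis (- (nu * (2 * PI * t0))) * u (x, y, c * y ^ 2 / 2)%R)%C.
  { rewrite /phi /upath Ey. do 2 f_equal. apply: triple_eq => //. rewrite /s; ring. }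
  have E2 : Per (Tc u) (x, y, z) = (cis (nu * (2 * PI * t0) + k * (z - c * y ^ 2 / 2)) * phi t0)%C.
  { rewrite F -(zser_scal _ _ _ Dc) /Per. f_equal. apply: functional_extensionality => m. rewrite /pterm Ecm Fc Cmult_assoc -cis_plus Cmult_comm. do 2 f_equal.
    rewrite /t0. field. lra. }
  rewrite E2 E1 Cmult_assoc -cis_plus.
  have -> : nu * (2 * PI * t0) + k * (z - c * y ^ 2 / 2) + - (nu * (2 * PI * t0)) = k * (z - c * y ^ 2 / 2) by ring.
  case: H => [_ [_ [_ /mode_inv Mi]]]. rewrite -Mi /=. f_equal. apply: triple_eq; ring.
Qed.

(** * Gaussians, theta functions and the range of the creation operator *)

Definition tau : C := (RtoC k / (1 - Ci * RtoC c))%C.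
(** Under the transform [Lp] is [-(1 - i c) (d/dt - tau t)] and [Lo] is
    [(1 + i c) (d/dt + conj(tau) t)], so this Gaussian is killed by [Lo]. The complex parameter
    reflects the shear of the lattice. *)
Definition gam : R -> C := Gs (Cconj tau).

Lemma one_ic_neq : (1 - Ci * RtoC c)%C <> 0%C.
Proof. move=> E. have := f_equal Re E. rewrite /=. lra. Qed.

Lemma tau_mult : (tau * (1 - Ci * RtoC c) = RtoC k)%C.
Proof. rewrite /tau. field. exact: one_ic_neq. Qed.

Lemma tau_conj_mult : (Cconj tau * (1 + Ci * RtoC c) = RtoC k)%C.
Proof.
  have := f_equal Cconj tau_mult. rewrite Cmult_conj => E.
  have E1 : Cconj (RtoC k) = RtoC k by Cring. rewrite E1 in E. rewrite -E. f_equal. Cring.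
Qed.

Lemma tau_Re : 0 < Re tau.
Proof.
  have := tau_mult. case: tau => p q E. have E1 := f_equal Im E. have E2 := f_equal Re E. rewrite /= in E1 E2 *.
  have E3 : q = c * p by lra. rewrite E3 in E2. have := pow2_ge_0 c. nra.
Qed.

Lemma Schw_gam : Schw gam.
Proof. apply: Schw_Gs. exact: tau_Re. Qed.

Definition theta_f (j : nat) : Z -> R -> C := extend (fun i t => RtoC (if (i =? j)%nat then 1 else 0) * gam t)%C.
Definition theta (j : nat) : G -> C := Per (theta_f j).

Lemma fam_theta j : fam (theta_f j).
Proof. apply: fam_extend => i. apply: Schw_scal. exact: Schw_gam. Qed.

Lemma theta_lambda_k j : lambda_k (theta j).
Proof. apply: Per_lambda_k. exact: fam_theta. Qed.

Lemma fd_extend h m : (forall i, Schw (h i)) -> fd (extend h) m = (fun t => RtoC (e1 ^ quot m) * dC (h (residue m)) t)%C.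
Proof. move=> Hh. rewrite /fd. apply: dC_eq => t. apply: CD_scal. exact: Schw_CD. Qed.

Lemma Per_zero g : Per (fun _ _ => 0%C) g = 0%C.
Proof.
  have F : fam (fun _ _ => 0%C). { split; [move=> m t; ring|move=> m; exact: Schw_zero]. }
  have E := Per_scal 0%C _ F g.
  have E1 : (fun (_ : Z) (_ : R) => 0 * 0)%C = (fun _ _ => 0%C) by apply: functional_extensionality => m; funring.
  rewrite E1 in E. rewrite E. ring.
Qed.

Lemma Lo_Per f g : fam f -> Lo (Per f) g = Per (fun m t => (1 + Ci * RtoC c) * fd f m t + RtoC k * fmul f m t)%C g.
Proof.
  move=> Hf. case: (Per_fields f Hf) => [E1 [E2 _]]. rewrite /Lo E1 E2.
  have F1 := fam_fd _ Hf. have F2 := fam_fmul _ Hf.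
  rewrite /fy !Per_plus ?Per_scal //; try exact: fam_scal.
  rewrite RtoC_opp. transitivity ((1 + Ci * RtoC c) * Per (fd f) g - (Ci * Ci) * RtoC k * Per (fmul f) g)%C; first ring.
  have -> : (Ci * Ci = - 1)%C by Cring. ring.
Qed.

Lemma Lp_Per f g : fam f -> Lp (Per f) g = Per (fun m t => - (1 - Ci * RtoC c) * fd f m t + RtoC k * fmul f m t)%C g.
Proof.
  move=> Hf. case: (Per_fields f Hf) => [E1 [E2 _]]. rewrite /Lp E1 E2.
  have F1 := fam_fd _ Hf. have F2 := fam_fmul _ Hf.
  rewrite /fy !Per_plus ?Per_scal //; try exact: fam_scal.
  rewrite RtoC_opp. transitivity (- (1 - Ci * RtoC c) * Per (fd f) g - (Ci * Ci) * RtoC k * Per (fmul f) g)%C; first ring.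
  have -> : (Ci * Ci = - 1)%C by Cring. ring.
Qed.

Lemma Lo_theta j : Lo (theta j) = fun _ => 0%C.
Proof.
  apply: functional_extensionality => g. rewrite /theta Lo_Per; last exact: fam_theta. rewrite -(Per_zero g). f_equal.
  apply: functional_extensionality => m; apply: functional_extensionality => t. rewrite /theta_f fd_extend; last by move=> i; apply: Schw_scal; exact: Schw_gam.
  rewrite /fmul /extend. set q := RtoC (if _ then _ else _).
  have -> : dC (fun t => q * gam t)%C t = (q * (- Cconj tau * (RtoC t * gam t)))%C.
  { rewrite (dC_eq _ (fun t => q * (- Cconj tau * (RtoC t * gam t)))%C) // => s. apply: CD_scal. exact: CD_Gs. }
  transitivity (RtoC (e1 ^ quot m) * q * RtoC t * gam t * (RtoC k - Cconj tau * (1 + Ci * RtoC c)))%C; first ring.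
  rewrite tau_conj_mult. ring.
Qed.

Lemma Gs_nonzero x t : Gs x t <> 0%C.
Proof. move=> E. have := Cmod_Gs x t. rewrite E Cmod_0. have := exp_pos (- Re x * t ^ 2 / 2). lra. Qed.

Lemma residue_small j : (j < d)%nat -> residue (Z.of_nat j) = j /\ quot (Z.of_nat j) = 0%nat.
Proof. move=> Hj. rewrite /residue /quot Z.mod_small ?Z.div_small; lia. Qed.

(** Along an orbit the theta function is, up to a phase, a Fourier series whose coefficients are
    values of the family. If it vanished, all coefficients would, including a value of the
    Gaussian. *)
Lemma theta_nonzero j : (j < d)%nat -> theta j <> fun _ => 0%C.
Proof.
  move=> Hj E. have HP := PI_RGT_0. set s := - delta (Z.of_nat j).
  case: (pterm_dominated (theta_f j) (Rabs s) (fam_theta j)) => M [_ Dm].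
  have D : dominated (fun m => theta_f j m (s + delta m)) M.
  { move=> m. have := Dm s 0 0 ltac:(rewrite Rmult_0_r Rminus_0_r; apply: Rle_refl) m. rewrite /pterm Cmod_mult Cmod_cis Rmult_1_r.
    by rewrite Rmult_0_r Rminus_0_r. }
  have U := fourier_unique _ M D. have A : theta_f j (Z.of_nat j) (s + delta (Z.of_nat j)) = 0%C; last first.
  { move: A. rewrite /theta_f /extend. case: (residue_small j Hj) => -> ->. rewrite Nat.eqb_refl.
    move=> A. apply: (Gs_nonzero (Cconj tau) (s + delta (Z.of_nat j))). rewrite -/gam -A /=. ring. }
  apply: U => t. have := f_equal (fun h => h (s + c * (w2 * t), w2 * t, c * (w2 * t) ^ 2 / 2)) E. rewrite /theta /Per => E2.
  have D2 : dominated (fun m => cis (IZR m * (2 * PI * t)) * theta_f j m (s + delta m)%R)%C M.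
  { move=> m. rewrite Cmod_mult Cmod_cis Rmult_1_l. exact: D. }
  have E3 : (cis (2 * PI * nu * t) * zser (fun m => cis (IZR m * (2 * PI * t)) * theta_f j m (s + delta m)%R) = 0)%C.
  { rewrite -(zser_scal _ _ _ D2) -E2. f_equal. apply: functional_extensionality => m. rewrite /pterm Cmult_assoc -cis_plus Cmult_comm. f_equal.
    - f_equal; ring. - f_equal; field; lra. }
  apply: NNPP => Hn. have Hc : cis (2 * PI * nu * t) <> 0%C. { move=> E4. have := Cmod_cis (2 * PI * nu * t). rewrite E4 Cmod_0. lra. }
  exact: (Cmult_neq_0 _ _ Hc Hn E3).
Qed.

Lemma Per_csum (F : nat -> Z -> R -> C) cs n g : (forall j, fam (F j)) ->
  fam (fun m t => csum (fun j => cs j * F j m t)%C n) /\ Per (fun m t => csum (fun j => cs j * F j m t)%C n) g = csum (fun j => cs j * Per (F j) g)%C n.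
Proof.
  move=> HF. elim: n => [|n [IH1 IH2]] /=.
  - split; last exact: Per_zero. split; [move=> m t; ring|move=> m; exact: Schw_zero].
  - split; first by apply: fam_plus => //; exact: fam_scal. rewrite Per_plus //; last exact: fam_scal. by rewrite IH2 Per_scal.
Qed.

Lemma csum_delta (f : nat -> C) i n : (i < n)%nat -> csum (fun j => f j * RtoC (if (i =? j)%nat then 1 else 0))%C n = f i.
Proof.
  have Z0 : forall q, (q <= i)%nat -> csum (fun j => f j * RtoC (if (i =? j)%nat then 1 else 0))%C q = 0%C.
  { elim => [|q IH] Hq //=. rewrite IH; last lia. case: Nat.eqb_spec => E; first lia. ring. }
  elim: n => [|n IH] Hn; first lia. cbn [csum]. case: Nat.eqb_spec => E.
  - subst n. rewrite Z0 //. ring.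
  - rewrite IH; last lia. ring.
Qed.

(** The transform reduces the claim to [d] equations on the line, one per residue; the multiples of
    the Gaussian which [solve_line] cannot avoid become the coefficients of the theta functions. *)
Lemma solve u : lambda_k u -> exists cs GG, lambda_k GG /\ u = (fun g => csum (fun j => cs j * theta j g) d + Lp GG g)%C.
Proof.
  move=> Hu. have S := fun i => solve_line tau (Tc u (Z.of_nat i)) tau_Re (Schw_Tc u (Z.of_nat i) Hu).
  set cs := fun i => proj1_sig (constructive_indefinite_description _ (S i)).
  have S' : forall i, exists g, Schw g /\ forall t, CD g t (tau * (RtoC t * g t) - Tc u (Z.of_nat i) t + cs i * gam t)%C.
  { move=> i. exact: (proj2_sig (constructive_indefinite_description _ (S i))). }
  set gs := fun i => proj1_sig (constructive_indefinite_description _ (S' i)).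
  have Hgs : forall i, Schw (gs i) /\ forall t, CD (gs i) t (tau * (RtoC t * gs i t) - Tc u (Z.of_nat i) t + cs i * gam t)%C.
  { move=> i. exact: (proj2_sig (constructive_indefinite_description _ (S' i))). }
  (* On [q g] the transformed [Lp] is [- g' + tau t g], the equation that [solve_line] solves. *)
  set q := (/ (1 - Ci * RtoC c))%C. have Hq : (q * (1 - Ci * RtoC c) = 1)%C by rewrite /q; field; exact: one_ic_neq.
  set F := extend gs. have FF : fam F by apply: fam_extend => i; case: (Hgs i).
  have FH : fam (fun m t => q * F m t)%C by exact: fam_scal.
  exists cs, (Per (fun m t => q * F m t)%C). split; first exact: Per_lambda_k.
  apply: functional_extensionality => g. rewrite (Per_Tc u Hu) Lp_Per //.
  case: (Per_csum theta_f cs d g fam_theta) => [FC EC]. rewrite -EC -Per_plus //; last first.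
  { apply: fam_plus; apply: fam_scal; [exact: fam_fd|exact: fam_fmul]. }
  f_equal. apply: functional_extensionality => m; apply: functional_extensionality => t.
  have Ed : fd (fun m t => q * F m t)%C m t = (q * fd F m t)%C.
  { rewrite /fd (dC_eq _ (fun t => q * dC (F m) t)%C) // => s. apply: CD_scal. apply: Schw_CD. exact: (proj2 FF). }
  rewrite Ed /fmul.
  have -> : csum (fun j => cs j * theta_f j m t)%C d = (RtoC (e1 ^ quot m) * (cs (residue m) * gam t))%C.
  { rewrite (csum_ext _ (fun j => (cs j * RtoC (e1 ^ quot m) * gam t) * RtoC (if (residue m =? j)%nat then 1 else 0))%C); last by move=> i _; rewrite /theta_f /extend; ring.
    rewrite (csum_delta (fun j => cs j * RtoC (e1 ^ quot m) * gam t)%C); last exact: residue_lt. ring. }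
  have -> : fd F m t = (RtoC (e1 ^ quot m) * (tau * (RtoC t * gs (residue m) t) - Tc u (Z.of_nat (residue m)) t + cs (residue m) * gam t))%C.
  { rewrite /F fd_extend; last by move=> i; case: (Hgs i). rewrite (dC_eq _ _ (proj2 (Hgs (residue m)))). by []. }
  rewrite (twisted_residue (Tc u) m t (twisted_Tc u Hu)) /F /extend.
  set e := RtoC (e1 ^ quot m). set gr := gs (residue m) t. set fr := Tc u _ t. set cr := cs (residue m).
  transitivity (e * (cr * gam t) - (q * (1 - Ci * RtoC c)) * (e * (tau * (RtoC t * gr) - fr + cr * gam t)) + RtoC t * e * gr * q * RtoC k)%C; last ring.
  rewrite -tau_mult. transitivity (e * (cr * gam t) - (q * (1 - Ci * RtoC c)) * (e * (tau * (RtoC t * gr) - fr + cr * gam t)) + (q * (1 - Ci * RtoC c)) * (RtoC t * e * gr * tau))%C; last ring.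
  rewrite Hq. ring.
Qed.

(** Only indices congruent to [j] modulo [d] occur in the series, so a [d]-th part of the second
    lattice vector multiplies all its terms by the same phase. The dependence of this phase on [j]
    separates the theta functions. *)
Lemma theta_shift j x y z : theta j (x + c * (w2 / INR d), y + w2 / INR d, z) =
  (cis (2 * PI * (INR j + nu) / INR d - k * c * (y * (w2 / INR d) + (w2 / INR d) ^ 2 / 2)) * theta j (x, y, z))%C.
Proof.
  have D0 := Hd0. have HP := PI_RGT_0.
  case: (pterm_dominated (theta_f j) (Rabs (x - c * y)) (fam_theta j)) => M [_ Dm].
  rewrite /theta /Per -(zser_scal _ _ _ (Dm x y z (Rle_refl _))). f_equal. apply: functional_extensionality => m. rewrite /pterm.
  have -> : x + c * (w2 / INR d) - c * (y + w2 / INR d) + delta m = x - c * y + delta m by ring.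
  case: (Nat.eq_dec (residue m) j) => E.
  - have Em : IZR m = INR j + INR d * IZR (m / Z.of_nat d).
    { rewrite !INR_IZR_INZ -mult_IZR -plus_IZR. f_equal. rewrite -E /residue Z2Nat.id; last by have := Z.mod_pos_bound m (Z.of_nat d) ltac:(lia); lia.
      have := Z.div_mod m (Z.of_nat d) ltac:(lia). lia. }
    set A := cis (2 * PI * (IZR m + nu) * (y + w2 / INR d) / w2 + _). set B := cis _. set D := cis (2 * PI * (IZR m + nu) * y / w2 + _).
    have -> : A = (B * D)%C; last ring.
    symmetry. rewrite /A /B /D -cis_plus -(cis_period (_ + _) (m / Z.of_nat d)). f_equal. rewrite Em. field. lra.
  - have -> : theta_f j m (x - c * y + delta m) = 0%C; last ring.
    rewrite /theta_f /extend. case: Nat.eqb_spec => E2; [by []|ring].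
Qed.

(** The product of one theta function with the conjugate of the other descends to the base torus.
    Translation by a [d]-th part of [(b, w2)] multiplies it by a [d]-th root of unity other than 1
    but preserves its integral. *)
Lemma theta_orth i j : (i < d)%nat -> (j < d)%nat -> i <> j -> ip a w2 r (theta i) (theta j) = 0%C.
Proof.
  move=> Hi Hj Hne. have D0 := Hd0. have HP := PI_RGT_0.
  case: (theta_lambda_k i) => [Si [I1 [I2 Mi]]]. case: (theta_lambda_k j) => [Sj [J1 [J2 Mj]]].
  set h := fun g => (theta i g * Cconj (theta j g))%C.
  have Sh : Sm h by apply: Sm_mult => //; exact: Sm_conj. have [Ch1 Ch2] := Sm_cont _ Sh.
  have Hz : forall x y z, h (x, y, z) = h (x, y, 0).
  { move=> x y z. rewrite /h Mi Mj Cmult_conj.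
    transitivity ((cis (k * z) * Cconj (cis (k * z))) * (theta i (x, y, 0%R) * Cconj (theta j (x, y, 0%R))))%C; first ring. rewrite cis_conj_mult. ring. }
  set HH := fun x y => h (x, y, 0).
  have Hx : forall x y, HH (x + a) y = HH x y.
  { move=> x y. rewrite /HH -(Hz (x + a) y (a * y)) /h. have A1 := I1 (x, y, 0). have A2 := J1 (x, y, 0). rewrite /= in A1 A2.
    have E : (a + x, 0 + y, 0 + 0 + a * y) = (x + a, y, a * y) by apply: triple_eq; ring. rewrite E in A1 A2. rewrite A1 A2 Cmult_conj.
    have -> : Cconj (RtoC e1) = RtoC e1 by Cring.
    transitivity ((RtoC e1 * RtoC e1) * (theta i (x, y, 0%R) * Cconj (theta j (x, y, 0%R))))%C; first ring. rewrite -RtoC_mult He1. ring. }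
  have Hy : forall x y, HH (x + b) (y + w2) = HH x y.
  { move=> x y. rewrite /HH -(Hz (x + b) (y + w2) (b * y)) /h. have A1 := I2 (x, y, 0). have A2 := J2 (x, y, 0). rewrite /= in A1 A2.
    have E : (b + x, w2 + y, 0 + 0 + b * y) = (x + b, y + w2, b * y) by apply: triple_eq; ring. rewrite E in A1 A2. rewrite A1 A2 Cmult_conj.
    rewrite -Hnu. transitivity ((cis (2 * PI * nu - k * c * w2 ^ 2 / 2) * Cconj (cis (2 * PI * nu - k * c * w2 ^ 2 / 2))) * (theta i (x, y, 0%R) * Cconj (theta j (x, y, 0%R))))%C; first ring. rewrite cis_conj_mult. ring. }
  set zeta := cis (2 * PI * IZR (Z.of_nat i - Z.of_nat j) / INR d).
  have Hs : forall x y, HH (x + c * (w2 / INR d)) (y + w2 / INR d) = (zeta * HH x y)%C.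
  { move=> x y. rewrite /HH /h !theta_shift Cmult_conj -cis_opp.
    set p := k * c * _.
    transitivity ((cis (2 * PI * (INR i + nu) / INR d - p) * cis (- (2 * PI * (INR j + nu) / INR d - p))) * (theta i (x, y, 0%R) * Cconj (theta j (x, y, 0%R))))%C; first ring.
    rewrite -cis_plus. f_equal. rewrite /zeta. f_equal. rewrite minus_IZR -!INR_IZR_INZ. field. lra. }
  have JH : forall f : C -> R, (f = Re \/ f = Im) -> jcont (U := R_UniformSpace) (fun x y => f (HH x y)).
  { move=> f [->|->] p t; [apply: (contG_comp (fun g => Re (h g)))|apply: (contG_comp (fun g => Im (h g)))] => //; cont. }
  have JH' : forall f : C -> R, (f = Re \/ f = Im) -> jcont (U := R_UniformSpace) (fun y x => f (HH x y)).
  { move=> f [->|->] p t; [apply: (contG_comp (fun g => Re (h g)))|apply: (contG_comp (fun g => Im (h g)))] => //; cont. }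
  have Rl : Re = Re \/ Re = Im by left. have Ril : Im = Re \/ Im = Im by right.
  set Iy := fun y => CR (fun x => HH x y) 0 a.
  have CIy : ccont Iy.
  { split => y /=; apply: (continuous_RInt_param (U := R_UniformSpace)); first lra; [exact: (JH' Re)|lra|exact: (JH' Im)]. }
  have CHx : forall y, ccont (fun x => HH x y) by move=> y; split; [exact: (jcont_slice _ y (JH' Re Rl))|exact: (jcont_slice _ y (JH' Im Ril))].
  have CRper : forall (f : R -> C) T q, ccont f -> (forall t, f (t + T) = f t) -> CR (fun t => f (t + q)) 0 T = CR f 0 T.
  { move=> f T q [c1 c2] Pf. apply: C_ext => /=; [apply: (RInt_period (fun t => Re (f t)))|apply: (RInt_period (fun t => Im (f t)))] => // t; by rewrite Pf. }
  have Is : forall y, Iy (y + w2 / INR d) = (zeta * Iy y)%C.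
  { move=> y. rewrite /Iy -(CRper (fun x => HH x (y + w2 / INR d)) a (c * (w2 / INR d))) // -CR_scal //. exact: CR_ext. }
  have Ip : forall y, Iy (y + w2) = Iy y.
  { move=> y. rewrite /Iy -(CRper (fun x => HH x (y + w2)) a b) //. exact: CR_ext. }
  have Itot : CR Iy 0 w2 = 0%C.
  { have E1 : CR Iy 0 w2 = (zeta * CR Iy 0 w2)%C. { rewrite -CR_scal // -{1}(CRper Iy w2 (w2 / INR d)) //. exact: CR_ext. }
    apply: NNPP => Hn. have Hz1 : (1 - zeta)%C <> 0%C.
    { move=> E. apply: Hne. have Ez : zeta = 1%C. { transitivity (1 - (1 - zeta))%C; [ring|rewrite E; ring]. }
      have := cis_eq_1 _ _ Hd _ Ez. lia. }
    apply: (Cmult_neq_0 _ _ Hz1 Hn). transitivity (CR Iy 0 w2 - zeta * CR Iy 0 w2)%C; first ring. rewrite -E1. ring. }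
  have Fin : forall f : C -> R, (f = Re \/ f = Im) -> I3 a w2 r (fun g => f (h g)) = r * RInt (fun y => RInt (fun x => f (HH x y)) 0 a) 0 w2.
  { move=> f Hf. rewrite -(RInt_fubini (fun x y => f (HH x y)) 0 a 0 w2); [|lra|lra|exact: JH].
    have CxI : forall x, continuous (fun x => RInt (fun y => f (HH x y)) 0 w2) x.
    { apply: (continuous_RInt_param (U := R_UniformSpace) (fun x y => f (HH x y))); first lra. exact: JH. }
    rewrite -RInt_Rscal; last exact: ex_RInt_c. apply: RInt_ext => x _. rewrite /Iyz -RInt_Rscal.
    2: { apply: ex_RInt_c. exact: (jcont_slice _ x (JH f Hf)). }
    apply: RInt_ext => y _. rewrite /Iz (RInt_ext _ (fun _ => f (HH x y))); last by move=> z _; rewrite Hz.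
    rewrite RInt_const /scal /= /mult /=. rring. }
  rewrite /ip /CI -/h. apply: C_ext => /=.
  - rewrite (Fin Re) //. have := f_equal Re Itot. rewrite /= => ->. ring.
  - rewrite (Fin Im) //. have := f_equal Im Itot. rewrite /= => ->. ring.
Qed.
End Landau.

(** * Inner product spaces of functions *)

(** No completeness is asked, and definiteness is equality of functions, without a quotient. Pairs
    of scalars are covered by letting [X] be two copies of the group. *)
Record prehilbert {X : Type} (V : (X -> C) -> Prop) (ip : (X -> C) -> (X -> C) -> C) : Prop := {
  ph_plus : forall u v, V u -> V v -> V (fun x => u x + v x)%C;
  ph_scal : forall c u, V u -> V (fun x => c * u x)%C;
  ph_zero : V (fun _ => 0%C);
  ph_ip_plus : forall u v w, V u -> V v -> V w -> ip (fun x => u x + v x)%C w = (ip u w + ip v w)%C;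
  ph_ip_scal : forall c u w, V u -> V w -> ip (fun x => c * u x)%C w = (c * ip u w)%C;
  ph_conj : forall u v, V u -> V v -> ip v u = Cconj (ip u v);
  ph_pos : forall u, V u -> 0 <= Re (ip u u);
  ph_def : forall u, V u -> Re (ip u u) = 0 -> u = fun _ => 0%C }.

Inductive span {X : Type} (B : (X -> C) -> Prop) : (X -> C) -> Prop :=
| span_zero : span B (fun _ => 0%C)
| span_add c b w : B b -> span B w -> span B (fun x => c * b x + w x)%C.

Lemma span_base {X} (B : (X -> C) -> Prop) b : B b -> span B b.
Proof.
  move=> Hb. have -> : b = (fun x => 1 * b x + (fun _ => 0%C) x)%C by funring.
  apply: span_add => //. exact: span_zero.
Qed.

Lemma span_plus {X} (B : (X -> C) -> Prop) u v : span B u -> span B v -> span B (fun x => u x + v x)%C.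
Proof.
  move=> Hu Hv. elim: Hu => {u} [|c b w Hb _ IH].
  - have -> : (fun x => 0 + v x)%C = v by funring. done.
  - have -> : (fun x => c * b x + w x + v x)%C = (fun x => c * b x + (fun x => w x + v x) x)%C by funring.
    exact: span_add.
Qed.

Lemma span_scal {X} (B : (X -> C) -> Prop) q u : span B u -> span B (fun x => q * u x)%C.
Proof.
  elim => {u} [|c b w Hb _ IH].
  - have -> : (fun x : X => q * 0)%C = (fun _ => 0%C) by funring. exact: span_zero.
  - have -> : (fun x => q * (c * b x + w x))%C = (fun x => (q * c) * b x + (fun x => q * w x) x)%C by funring.
    exact: span_add.
Qed.

Lemma span_sub {X} (B B' : (X -> C) -> Prop) u : (forall b, B b -> span B' b) -> span B u -> span B' u.
Proof.
  move=> H. elim => {u} [|c b w Hb _ IH]; first exact: span_zero. apply: span_plus => //. apply: span_scal. exact: H.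
Qed.

Section PreHilbert.
Context {X : Type} (V : (X -> C) -> Prop) (ip : (X -> C) -> (X -> C) -> C) (H : prehilbert V ip).
Let Vp := ph_plus V ip H.
Let Vs := ph_scal V ip H.

Definition n2 (u : X -> C) : R := Re (ip u u).

Lemma ip_plus_r u v w : V u -> V v -> V w -> ip w (fun x => u x + v x)%C = (ip w u + ip w v)%C.
Proof.
  move=> Hu Hv Hw. rewrite (ph_conj _ _ H (fun x => u x + v x)%C w) ?(ph_ip_plus _ _ H) //; last exact: Vp.
  rewrite (ph_conj _ _ H u w) // (ph_conj _ _ H v w) //. Cring.
Qed.
Lemma ip_scal_r c u w : V u -> V w -> ip w (fun x => c * u x)%C = (Cconj c * ip w u)%C.
Proof.
  move=> Hu Hw. rewrite (ph_conj _ _ H (fun x => c * u x)%C w) ?(ph_ip_scal _ _ H) //; last exact: Vs.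
  rewrite (ph_conj _ _ H u w) //. Cring.
Qed.
Lemma ip_self_real u : V u -> ip u u = RtoC (n2 u).
Proof.
  move=> Hu. apply: C_ext => //=. have := f_equal Im (ph_conj _ _ H u u Hu Hu). rewrite /Im /=. lra.
Qed.
Lemma ip_zero_l w : V w -> ip (fun _ => 0%C) w = 0%C.
Proof.
  move=> Hw. have := ph_ip_scal _ _ H 0%C (fun _ => 0%C) w (ph_zero _ _ H) Hw.
  have -> : (fun _ : X => 0 * 0)%C = (fun _ => 0%C) by funring. move=> ->. ring.
Qed.
Lemma ip_zero_sym u v : V u -> V v -> ip u v = 0%C -> ip v u = 0%C.
Proof. move=> Hu Hv E. rewrite (ph_conj _ _ H u v) // E. Cring. Qed.

Lemma n2_plus u v : V u -> V v -> n2 (fun x => u x + v x)%C = n2 u + 2 * Re (ip u v) + n2 v.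
Proof.
  move=> Hu Hv. rewrite /n2 (ph_ip_plus _ _ H) //; last exact: Vp. rewrite !ip_plus_r // (ph_conj _ _ H u v) //=. rewrite /Re. ring.
Qed.
Lemma n2_orth u v : V u -> V v -> ip u v = 0%C -> n2 (fun x => u x + v x)%C = n2 u + n2 v.
Proof. move=> Hu Hv E. rewrite n2_plus // E /=. ring. Qed.
Lemma n2_scal c u : V u -> n2 (fun x => c * u x)%C = Cmod c ^ 2 * n2 u.
Proof.
  move=> Hu. rewrite /n2 (ph_ip_scal _ _ H) //; last exact: Vs. rewrite ip_scal_r // ip_self_real // Cmod_sq /= /Re /Im. ring.
Qed.
Lemma n2_pos u : V u -> 0 <= n2 u.
Proof. exact: ph_pos. Qed.

Lemma V_sub u v : V u -> V v -> V (fun x => u x - v x)%C.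
Proof.
  move=> Hu Hv. have -> : (fun x => u x - v x)%C = (fun x => u x + (fun x => (-1) * v x) x)%C by funring.
  apply: Vp => //. exact: Vs.
Qed.

Lemma V_span B w : (forall b, B b -> V b) -> span B w -> V w.
Proof.
  move=> HB. elim => [|c b w' Hb _ IH]; first exact: ph_zero H. apply: Vp => //. apply: Vs. exact: HB.
Qed.

Lemma ip_span_zero B u w : V u -> (forall b, B b -> V b /\ ip u b = 0%C) -> span B w -> ip u w = 0%C.
Proof.
  move=> Hu HB Hw. elim: Hw => {w} [|c b w Hb Hw IH].
  - apply: ip_zero_sym => //; [exact: ph_zero H|exact: ip_zero_l].
  - case: (HB b Hb) => [Vb E]. rewrite ip_plus_r //; [|exact: Vs|by apply: V_span Hw => b' /HB []]. rewrite ip_scal_r // E IH. ring.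
Qed.

Lemma n2_plus_le u v : V u -> V v -> n2 (fun x => u x + v x)%C <= 2 * n2 u + 2 * n2 v.
Proof.
  move=> Hu Hv. have P := n2_pos _ (V_sub u v Hu Hv).
  have E : (fun x => u x - v x)%C = (fun x => u x + (fun x => (-1) * v x) x)%C by funring.
  rewrite E n2_plus // in P; last exact: Vs. rewrite n2_scal // ip_scal_r // in P. rewrite n2_plus //.
  have M : Cmod (-1) = 1 by rewrite Cmod_R Rabs_left; lra. rewrite M /= in P. rewrite /Re in P *. lra.
Qed.

Lemma cauchy_schwarz_real u v : V u -> V v -> Re (ip u v) ^ 2 <= n2 u * n2 v.
Proof.
  move=> Hu Hv. have P1 := n2_pos u Hu. have P2 := n2_pos v Hv.
  have Q : forall t : R, 0 <= n2 u + 2 * t * Re (ip u v) + t ^ 2 * n2 v.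
  { move=> t. have Vt : V (fun x => RtoC t * v x)%C by exact: Vs.
    have := n2_pos _ (Vp u (fun x => RtoC t * v x)%C Hu Vt). rewrite n2_plus // ip_scal_r // n2_scal // Cmod_R pow2_abs /= /Re. lra. }
  case: (Req_dec (n2 v) 0) => E.
  - have E2 : v = fun _ => 0%C by exact: (ph_def _ _ H).
    have -> : ip u v = 0%C by rewrite E2; apply: ip_zero_sym => //; [exact: ph_zero H|exact: ip_zero_l]. rewrite /=. nra.
  - have Pv : 0 < n2 v by lra. have := Q (- Re (ip u v) / n2 v). set s := Re (ip u v). move=> Hs.
    have E3 : n2 u + 2 * (- s / n2 v) * s + (- s / n2 v) ^ 2 * n2 v = n2 u - s ^ 2 / n2 v by field. rewrite E3 in Hs.
    have E4 : s ^ 2 = s ^ 2 / n2 v * n2 v by field. rewrite E4. apply: Rmult_le_compat_r; lra.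
Qed.

(** * Creation and annihilation operators *)

Section Ladder.
Variables (Lo Lp : (X -> C) -> (X -> C)) (s : R) (d : nat) (theta : nat -> X -> C).
Hypotheses (Hs : 0 < s) (VLo : forall u, V u -> V (Lo u)) (VLp : forall u, V u -> V (Lp u)).
Hypotheses (LoL : forall c u v, V u -> V v -> Lo (fun x => c * u x + v x)%C = (fun x => c * Lo u x + Lo v x)%C).
Hypotheses (LpL : forall c u v, V u -> V v -> Lp (fun x => c * u x + v x)%C = (fun x => c * Lp u x + Lp v x)%C).
Hypothesis (Adj : forall u v, V u -> V v -> ip (Lo u) v = ip u (Lp v)).
Hypothesis (Comm : forall u, V u -> Lo (Lp u) = (fun x => Lp (Lo u) x + RtoC s * u x)%C).
Hypotheses (Vth : forall j, (j < d)%nat -> V (theta j)) (Lth : forall j, (j < d)%nat -> Lo (theta j) = fun _ => 0%C).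
Hypothesis (Solve : forall u, V u -> exists cs GG, V GG /\ u = (fun x => csum (fun j => cs j * theta j x) d + Lp GG x)%C).

Definition Lpn (n : nat) (u : X -> C) : X -> C := Nat.iter n Lp u.

Lemma Lpn_S n u : Lpn (S n) u = Lp (Lpn n u). Proof. by []. Qed.

Lemma V_Lpn n u : V u -> V (Lpn n u).
Proof. move=> Hu. elim: n => //= n IH. exact: VLp. Qed.

Lemma Lo_zero : Lo (fun _ => 0%C) = fun _ => 0%C.
Proof.
  have := LoL 0%C _ _ (ph_zero _ _ H) (ph_zero _ _ H).
  have -> : (fun _ : X => 0 * 0 + 0)%C = (fun _ => 0%C) by funring.
  move=> E. have E2 := LoL (-1)%C _ _ (ph_zero _ _ H) (ph_zero _ _ H).
  have E3 : (fun _ : X => (-1) * 0 + 0)%C = (fun _ => 0%C) by funring. rewrite E3 in E2.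
  rewrite E2. funring.
Qed.
Lemma Lp_zero : Lp (fun _ => 0%C) = fun _ => 0%C.
Proof.
  have E2 := LpL (-1)%C _ _ (ph_zero _ _ H) (ph_zero _ _ H).
  have E3 : (fun _ : X => (-1) * 0 + 0)%C = (fun _ => 0%C) by funring. rewrite E3 in E2.
  rewrite E2. funring.
Qed.

Lemma Lp_scal c u : V u -> Lp (fun x => c * u x)%C = (fun x => c * Lp u x)%C.
Proof.
  move=> Hu. have := LpL c u _ Hu (ph_zero _ _ H). rewrite Lp_zero.
  have -> : (fun x => c * u x + 0)%C = (fun x => c * u x)%C by funring. move=> ->.
  funring.
Qed.

Lemma Lo_Lpn j n : (j < d)%nat -> Lo (Lpn (S n) (theta j)) = (fun x => RtoC (INR (S n) * s) * Lpn n (theta j) x)%C.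
Proof.
  move=> Hj. elim: n => [|n IH].
  - rewrite [Lpn 1 _]/= Comm; last exact: Vth. rewrite Lth // Lp_zero. apply: functional_extensionality => x /=. rewrite Rmult_1_l. ring.
  - rewrite Lpn_S Comm; last by apply: V_Lpn; exact: Vth. rewrite IH Lp_scal; last by apply: V_Lpn; exact: Vth.
    apply: functional_extensionality => x. rewrite (S_INR (S n)) Rmult_plus_distr_r RtoC_plus Rmult_1_l /=. ring.
Qed.

Definition rung (n : nat) (b : X -> C) : Prop := exists k j, (k < n)%nat /\ (j < d)%nat /\ b = Lpn k (theta j).

Lemma V_rung n b : rung n b -> V b.
Proof. move=> [k [j [_ [Hj ->]]]]. apply: V_Lpn. exact: Vth. Qed.

Lemma span_Lo n w : span (rung (S n)) w -> span (rung n) (Lo w).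
Proof.
  elim => {w} [|c b w Hb Hw IH].
  - rewrite Lo_zero. exact: span_zero.
  - rewrite LoL; [|exact: V_rung Hb|by apply: V_span Hw; exact: V_rung]. apply: span_plus => //. apply: span_scal.
    case: Hb => [[|k] [j [Hk [Hj ->]]]].
    + rewrite [Lpn 0 _]/= Lth //. exact: span_zero.
    + rewrite Lo_Lpn //. apply: span_scal. apply: span_base. exists k, j. split => //. lia.
Qed.

Lemma span_Lp n w : span (rung n) w -> span (rung (S n)) (Lp w).
Proof.
  elim => {w} [|c b w Hb Hw IH].
  - rewrite Lp_zero. exact: span_zero.
  - rewrite LpL; [|exact: V_rung Hb|by apply: V_span Hw; exact: V_rung]. apply: span_plus => //. apply: span_scal.
    case: Hb => [k [j [Hk [Hj ->]]]]. apply: span_base. exists (S k), j. split; [lia|by split].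
Qed.

(** Each creation operator moved across the inner product becomes an annihilation operator and takes
    the span down one rung, until nothing is left. *)
Lemma Lpn_orth n GG w : V GG -> span (rung n) w -> ip (Lpn n GG) w = 0%C.
Proof.
  move=> HG. elim: n w => [|n IH] w Hw.
  - apply: (ip_span_zero (rung 0)) => //. move=> b [k [j [Hk _]]]. lia.
  - have Vw : V w by apply: V_span Hw; exact: V_rung.
    apply: ip_zero_sym => //; first by apply: V_Lpn. rewrite Lpn_S -Adj //; last exact: V_Lpn.
    apply: ip_zero_sym; [exact: V_Lpn|exact: VLo|]. apply: IH. exact: span_Lo.
Qed.

(** [Solve] is applied again to the preimage under [Lp] that it produced; each round adds one
    rung. *)
Lemma decomposition n u : V u -> exists w GG, span (rung n) w /\ V GG /\ u = (fun x => w x + Lpn n GG x)%C.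
Proof.
  elim: n u => [|n IH] u Hu.
  - exists (fun _ => 0%C), u. split; first exact: span_zero. split => //. apply: functional_extensionality => x /=. ring.
  - case: (Solve u Hu) => cs [G1 [VG1 E1]]. case: (IH G1 VG1) => w [GG [Hw [VGG E2]]].
    exists (fun x => csum (fun j => cs j * theta j x)%C d + Lp w x)%C, GG. split; [|split => //].
    + apply: span_plus; last exact: span_Lp.
      have : forall q, (q <= d)%nat -> span (rung (S n)) (fun x => csum (fun j => cs j * theta j x)%C q); last by apply.
      elim => [|q IHq] Hq /=; first exact: span_zero. apply: span_plus; first by apply: IHq; lia.
      apply: span_scal. apply: span_base. exists 0%nat, q. split; [lia|split; [lia|by []]].
    + have Vw : V w by apply: V_span Hw; exact: V_rung.
      have E3 : Lp G1 = (fun x => Lp w x + Lpn (S n) GG x)%C.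
      { rewrite {1}E2. have -> : (fun x => w x + Lpn n GG x)%C = (fun x => 1 * w x + Lpn n GG x)%C by funring.
        rewrite LpL //; last exact: V_Lpn. apply: functional_extensionality => x /=. ring. }
      rewrite {1}E1 E3. funring.
Qed.

(* On the range of [Lp^n] the number operator [Lp Lo] is at least [n s]. *)
Lemma ladder_gap n GG : V GG -> INR n * s * n2 (Lpn n GG) <= n2 (Lo (Lpn n GG)).
Proof.
  move=> HG. elim: n => [|n IH].
  - rewrite /= !Rmult_0_l. apply: n2_pos. exact: VLo.
  - set h := Lpn n GG in IH. have Vh : V h by exact: V_Lpn. rewrite Lpn_S -/h.
    have VL := VLp h Vh. set w := Lo (Lp h). have Vw : V w by exact: VLo.
    have E1 : n2 (Lp h) = Re (ip h w). { rewrite /n2 -Adj //. have := ph_conj _ _ H h w Vh Vw. rewrite -/w => ->. by []. }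
    have E2 : Re (ip h w) = n2 (Lo h) + s * n2 h.
    { rewrite /w Comm // ip_plus_r //; [|by apply: VLp; exact: VLo|exact: Vs]. rewrite ip_scal_r // ip_self_real // -Adj //; last exact: VLo.
      rewrite ip_self_real //; last exact: VLo. rewrite /= /Re. ring. }
    (* With [t] the squared norm of [Lp h], Cauchy-Schwarz gives [t^2] at most the product of those
       of [h] and [Lo (Lp h)]; the induction hypothesis bounds that of [h] by a multiple of [t], and
       [t] is cancelled. *)
    have P1 := n2_pos _ Vh. have P2 := n2_pos _ Vw. have CS := cauchy_schwarz_real h w Vh Vw.
    have P3 := n2_pos _ (VLo _ Vh).
    rewrite E1. have B : INR (S n) * s * n2 h <= Re (ip h w) by rewrite E2 S_INR; lra.
    set t := Re (ip h w) in CS B E1 E2 *. have Ht : 0 <= t by rewrite E2; nra.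
    have HN : 0 < INR (S n) * s by apply: Rmult_lt_0_compat => //; apply: lt_0_INR; lia.
    case: (Req_dec t 0) => T0; first by rewrite T0 Rmult_0_r.
    apply: (Rmult_le_reg_l t); first lra.
    apply: Rle_trans (_ : INR (S n) * s * (n2 h * n2 w) <= _).
    + have -> : t * (INR (S n) * s * t) = INR (S n) * s * t ^ 2 by ring. apply: Rmult_le_compat_l; lra.
    + have -> : INR (S n) * s * (n2 h * n2 w) = INR (S n) * s * n2 h * n2 w by ring. exact: Rmult_le_compat_r.
Qed.

(** The remainder [Rn] satisfies [||Lo Rn|| <= ||Lo u||], because [Lo w] and [Lo Rn] are orthogonal.
    The gap then makes its squared norm at most [||Lo u||^2 / (n s)]. No explicit eigenfunction
    expansion enters. *)
Lemma ladder_dense u e : V u -> 0 < e -> exists w, span (fun b => exists k j, (j < d)%nat /\ b = Lpn k (theta j)) w /\ n2 (fun x => u x - w x)%C < e.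
Proof.
  move=> Hu He. have [n Hn] := INR_unbounded (n2 (Lo u) / (s * e) + 1).
  case: (decomposition n u Hu) => w [GG [Hw [VGG E]]]. set Rn := Lpn n GG in E. have VR : V Rn by exact: V_Lpn.
  have Vw : V w by apply: V_span Hw; exact: V_rung.
  exists w. split; first by apply: span_sub Hw => b [k [j [_ [Hj ->]]]]; apply: span_base; exists k, j.
  have -> : (fun x => u x - w x)%C = Rn by rewrite E; funring.
  have E2 : Lo u = (fun x => Lo w x + Lo Rn x)%C.
  { rewrite E. have -> : (fun x => w x + Rn x)%C = (fun x => 1 * w x + Rn x)%C by funring.
    rewrite LoL //. funring. }
  have O : ip (Lo w) (Lo Rn) = 0%C.
  { apply: ip_zero_sym; [exact: VLo|exact: VLo|]. rewrite Adj //; last exact: VLo. apply: Lpn_orth => //.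
    case: n {Hn E} Rn VR E2 Hw => [|n] Rn VR E2 Hw.
    - apply: (span_sub (rung 0)); first by move=> b [k [j [Hk _]]]; lia.
      have -> : Lp (Lo w) = fun _ => 0%C; last exact: span_zero.
      have -> : w = fun _ => 0%C; last by rewrite Lo_zero Lp_zero.
      elim: Hw => {Vw E2} // c b w' [k [j [Hk _]]]. lia.
    - apply: span_Lp. exact: span_Lo. }
  have E3 : n2 (Lo u) = n2 (Lo w) + n2 (Lo Rn) by rewrite E2 n2_orth //; exact: VLo.
  have Gp := ladder_gap n GG VGG. rewrite -/Rn in Gp. have P1 := n2_pos _ (VLo _ Vw). have P2 := n2_pos _ VR. have P3 := n2_pos _ (VLo _ Hu).
  have Hq : 0 <= n2 (Lo u) / (s * e) by apply: Rdiv_le_0_compat => //; exact: Rmult_lt_0_compat.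
  apply: (Rmult_lt_reg_l (INR n * s)); first by apply: Rmult_lt_0_compat; lra.
  apply: Rle_lt_trans Gp _. apply: Rle_lt_trans (_ : n2 (Lo u) < _); first lra.
  have -> : n2 (Lo u) = n2 (Lo u) / (s * e) * (s * e) by field; lra.
  have -> : INR n * s * e = INR n * (s * e) by ring. apply: Rmult_lt_compat_r; [exact: Rmult_lt_0_compat|lra].
Qed.

(** Different heights are orthogonal by [Lpn_orth]; at equal height both vectors are lowered
    together, at the cost of a scalar, down to two theta functions. *)
Lemma rung_orth k j k' j' : (forall i i', (i < d)%nat -> (i' < d)%nat -> i <> i' -> ip (theta i) (theta i') = 0%C) ->
  (j < d)%nat -> (j' < d)%nat -> (k <> k' \/ j <> j') -> ip (Lpn k (theta j)) (Lpn k' (theta j')) = 0%C.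
Proof.
  move=> Ho Hj Hj'. have Vj := Vth j Hj. have Vj' := Vth j' Hj'.
  have R1 : forall k k' j j', (j < d)%nat -> (j' < d)%nat -> (k' < k)%nat -> ip (Lpn k (theta j)) (Lpn k' (theta j')) = 0%C.
  { move=> p p' i i' Hi Hi' Hp. apply: Lpn_orth; first exact: Vth. apply: span_base. by exists p', i'. }
  case: (Nat.lt_total k k') => [Hk _|[Hk|Hk _]].
  - apply: ip_zero_sym; [exact: V_Lpn|exact: V_Lpn|exact: R1].
  - subst k'. case=> // Hne. elim: k => [|k IH]; first exact: Ho.
    rewrite (Lpn_S k (theta j')) -Adj; [|exact: V_Lpn|exact: V_Lpn]. rewrite Lo_Lpn // (ph_ip_scal _ _ H) //; [|exact: V_Lpn|exact: V_Lpn].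
    change (RtoC (INR (S k) * s) * ip (Lpn k (theta j)) (Lpn k (theta j')) = 0)%C. rewrite IH. ring.
  - exact: R1.
Qed.

Lemma Lpn_nonzero k j : (j < d)%nat -> theta j <> (fun _ => 0%C) -> Lpn k (theta j) <> (fun _ => 0%C).
Proof.
  move=> Hj H0. elim: k => [|k IH] // E. apply: IH.
  have := Lo_Lpn j k Hj. rewrite E Lo_zero => E2. apply: functional_extensionality => x.
  have E3 : RtoC 0 = (RtoC (INR (S k) * s) * Lpn k (theta j) x)%C by exact: (f_equal (fun f => f x) E2).
  have Hne : RtoC (INR (S k) * s) <> 0%C. { move/RtoC_inj. have : 0 < INR (S k) by apply: lt_0_INR; lia. nra. }
  apply: NNPP => Hn. exact: (Cmult_neq_0 _ _ Hne Hn (eq_sym E3)).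
Qed.
End Ladder.

(** * Symmetric operators with a complete orthogonal family of eigenvectors *)

Section Spectral.
Variables (D : (X -> C) -> (X -> C)) (I : Type) (valid : I -> Prop) (phi : I -> X -> C) (val : I -> R).
Hypotheses (VD : forall u, V u -> V (D u)).
Hypotheses (DL : forall c u v, V u -> V v -> D (fun x => c * u x + v x)%C = (fun x => c * D u x + D v x)%C).
Hypothesis (Sym : forall u v, V u -> V v -> ip (D u) v = ip u (D v)).
Hypotheses (Vphi : forall i, valid i -> V (phi i)) (Dphi : forall i, valid i -> D (phi i) = fun x => (RtoC (val i) * phi i x)%C).
Hypotheses (Nphi : forall i, valid i -> phi i <> fun _ => 0%C).
Hypothesis (Ophi : forall i j, valid i -> valid j -> i <> j -> ip (phi i) (phi j) = 0%C).
Hypothesis (Fin : forall B, exists l : list I, forall i, valid i -> Rabs (val i) <= B -> In i l).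
Hypothesis (Dense : forall u e, V u -> 0 < e -> exists w, span (fun b => exists i, valid i /\ b = phi i) w /\ n2 (fun x => u x - w x)%C < e).

Fixpoint lsum (c : I -> C) (l : list I) : X -> C :=
  match l with nil => fun _ => 0%C | i :: l' => fun x => (c i * phi i x + lsum c l' x)%C end.
Fixpoint rsum (f : I -> R) (l : list I) : R := match l with nil => 0 | i :: l' => f i + rsum f l' end.

Lemma nphi_pos i : valid i -> 0 < n2 (phi i).
Proof.
  move=> Hi. case: (n2_pos _ (Vphi i Hi)) => // E. exfalso. apply: (Nphi i Hi). exact: (ph_def _ _ H _ (Vphi i Hi) (eq_sym E)).
Qed.

Lemma V_lsum c l : (forall i, In i l -> valid i) -> V (lsum c l).
Proof.
  elim: l => [|i l IH] Hl /=; first exact: ph_zero H. apply: Vp; last by apply: IH => j Hj; apply: Hl; right.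
  apply: Vs. apply: Vphi. apply: Hl. by left.
Qed.

Lemma ip_lsum_out c l j : (forall i, In i l -> valid i) -> valid j -> ~ In j l -> ip (lsum c l) (phi j) = 0%C.
Proof.
  elim: l => [|i l IH] Hl Hj Hn /=; first by apply: ip_zero_l; exact: Vphi.
  have Vi : valid i by apply: Hl; left. have Hl' : forall i, In i l -> valid i by move=> q Hq; apply: Hl; right.
  rewrite (ph_ip_plus _ _ H); [|by apply: Vs; exact: Vphi|exact: V_lsum|exact: Vphi]. rewrite (ph_ip_scal _ _ H); try exact: Vphi.
  rewrite IH //; last by (move=> Hq; apply: Hn; right). rewrite Ophi //. ring. move=> E; apply: Hn; by left.
Qed.

Lemma ip_lsum_in c l j : NoDup l -> (forall i, In i l -> valid i) -> In j l -> ip (lsum c l) (phi j) = (c j * RtoC (n2 (phi j)))%C.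
Proof.
  elim: l => [|i l IH] Nd Hl Hj //=.
  have Vi : valid i by apply: Hl; left. have Hl' : forall i, In i l -> valid i by move=> q Hq; apply: Hl; right.
  have Vj : valid j by exact: Hl. inversion Nd; subst.
  rewrite (ph_ip_plus _ _ H); [|by apply: Vs; exact: Vphi|exact: V_lsum|exact: Vphi]. rewrite (ph_ip_scal _ _ H); try exact: Vphi.
  case: (classic (i = j)) => [E|Hne].
  - subst j. rewrite ip_lsum_out // ip_self_real; last exact: Vphi. ring.
  - rewrite IH //; last by case: Hj. rewrite Ophi //. ring.
Qed.

Lemma n2_lsum c l : NoDup l -> (forall i, In i l -> valid i) -> n2 (lsum c l) = rsum (fun i => Cmod (c i) ^ 2 * n2 (phi i)) l.
Proof.
  elim: l => [|i l IH] Nd Hl.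
  - rewrite /n2 /= ip_zero_l //. exact: ph_zero H.
  - have Vi : valid i by apply: Hl; left. have Hl' : forall i, In i l -> valid i by move=> q Hq; apply: Hl; right.
    inversion Nd; subst. cbn [lsum rsum]. rewrite n2_orth; [|by apply: Vs; exact: Vphi|exact: V_lsum|].
    + by rewrite IH // n2_scal //; exact: Vphi.
    + rewrite (ph_ip_scal _ _ H); [|exact: Vphi|exact: V_lsum]. rewrite (ip_zero_sym (lsum c l) (phi i)); [ring|exact: V_lsum|exact: Vphi|exact: ip_lsum_out].
Qed.

Definition coef (f : X -> C) (i : I) : C := (ip f (phi i) / RtoC (n2 (phi i)))%C.
Definition proj (l : list I) (f : X -> C) : X -> C := lsum (coef f) l.

Lemma coef_mult f i : valid i -> (coef f i * RtoC (n2 (phi i)))%C = ip f (phi i).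
Proof.
  move=> Hi. rewrite /coef. field. move/RtoC_inj. have := nphi_pos i Hi. lra.
Qed.

Lemma ip_sub_l u v w : V u -> V v -> V w -> ip (fun x => u x - v x)%C w = (ip u w - ip v w)%C.
Proof.
  move=> Hu Hv Hw. have -> : (fun x => u x - v x)%C = (fun x => u x + (fun x => (-1) * v x) x)%C by funring.
  rewrite (ph_ip_plus _ _ H) //; last exact: Vs. rewrite (ph_ip_scal _ _ H) //. ring.
Qed.

Lemma residual_orth l f c : NoDup l -> (forall i, In i l -> valid i) -> V f -> ip (fun x => f x - proj l f x)%C (lsum c l) = 0%C.
Proof.
  move=> Nd Hl Vf. have VP : V (proj l f) by exact: V_lsum.
  have O : forall i, In i l -> ip (fun x => f x - proj l f x)%C (phi i) = 0%C.
  { move=> i Hi. rewrite ip_sub_l //; last by apply: Vphi; exact: Hl. rewrite ip_lsum_in // coef_mult; last exact: Hl. ring. }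
  have Sp : forall l', (forall i, In i l' -> In i l) -> span (fun b => exists i, In i l /\ b = phi i) (lsum c l').
  { elim => [|i l' IH] Hi /=; first exact: span_zero. apply: span_add; first by exists i; split => //; apply: Hi; left. apply: IH => j Hj; apply: Hi; by right. }
  apply: (ip_span_zero _ _ _ (V_sub _ _ Vf VP) _ (Sp l (fun i Hi => Hi))).
  move=> b [i [Hi ->]]. split; [by apply: Vphi; exact: Hl|exact: O].
Qed.

Lemma lsum_sub c c' l : (fun x => lsum c l x - lsum c' l x)%C = lsum (fun i => c i - c' i)%C l.
Proof.
  elim: l => [|i l IH] /=; apply: functional_extensionality => x; first ring.
  have E := f_equal (fun f => f x) IH. cbv beta in E. rewrite -E. ring.
Qed.

Lemma residual_le l f c : NoDup l -> (forall i, In i l -> valid i) -> V f -> n2 (fun x => f x - proj l f x)%C <= n2 (fun x => f x - lsum c l x)%C.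
Proof.
  move=> Nd Hl Vf. have VP : V (proj l f) by exact: V_lsum.
  have -> : (fun x => f x - lsum c l x)%C = (fun x => (fun x => f x - proj l f x) x + lsum (fun i => coef f i - c i) l x)%C.
  { apply: functional_extensionality => x. have E := f_equal (fun h => h x) (lsum_sub (coef f) c l). cbv beta in E. rewrite -E /proj. ring. }
  have VL : V (lsum (fun i => coef f i - c i)%C l) by exact: V_lsum.
  rewrite n2_orth //; [|exact: V_sub|exact: residual_orth]. have := n2_pos _ VL. lra.
Qed.

Lemma pythagoras l f : NoDup l -> (forall i, In i l -> valid i) -> V f -> n2 f = n2 (fun x => f x - proj l f x)%C + n2 (proj l f).
Proof.
  move=> Nd Hl Vf. have VP : V (proj l f) by exact: V_lsum.
  rewrite -n2_orth //; [|exact: V_sub|exact: residual_orth]. f_equal. funring.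
Qed.

(** Repeated eigenvectors are merged by adding their coefficients: orthogonality yields Pythagoras
    only over a list without duplicates. *)
Lemma span_lsum w : span (fun b => exists i, valid i /\ b = phi i) w -> exists l c, NoDup l /\ (forall i, In i l -> valid i) /\ w = lsum c l.
Proof.
  elim => {w} [|q b w [i [Hi ->]] _ [l [c [Nd [Hl E]]]]].
  - exists nil, (fun _ => 0%C). split; first exact: NoDup_nil. by split.
  - case: (classic (In i l)) => Hin.
    + exists l, (fun j => match excluded_middle_informative (j = i) with left _ => (c j + q)%C | right _ => c j end). split => //. split => //.
      rewrite E. clear E w Hl. elim: l Nd Hin => [|j l IH] Nd Hin //=. inversion Nd; subst.
      apply: functional_extensionality => x. case: excluded_middle_informative => Ej.
      * subst j. have -> : lsum (fun j => match excluded_middle_informative (j = i) with left _ => (c j + q)%C | right _ => c j end) l = lsum c l; last ring.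
        clear - H2. elim: l H2 => [|k l IH] Hn //=. rewrite IH; last by move=> Hk; apply: Hn; right.
        case: excluded_middle_informative => // Ek. exfalso; apply: Hn. by left.
      * have Hin' : In i l by case: Hin. have := f_equal (fun f => f x) (IH H3 Hin'). cbv beta => <-. ring.
    + exists (i :: l), (fun j => match excluded_middle_informative (j = i) with left _ => q | right _ => c j end). split; first exact: NoDup_cons. split; first by move=> j [<-|/Hl].
      rewrite E /=. apply: functional_extensionality => x. case: excluded_middle_informative => // _. f_equal.
      have -> : lsum (fun j => match excluded_middle_informative (j = i) with left _ => q | right _ => c j end) l = lsum c l; last by [].
      clear - Hin. elim: l Hin => [|k l IH] Hn //=. rewrite IH; last by move=> Hk; apply: Hn; right.
      case: excluded_middle_informative => // Ek. exfalso; apply: Hn. by left.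
Qed.

Lemma dense_proj f e : V f -> 0 < e -> exists l, NoDup l /\ (forall i, In i l -> valid i) /\ n2 (fun x => f x - proj l f x)%C < e.
Proof.
  move=> Vf He. case: (Dense f e Vf He) => w [/span_lsum [l [c [Nd [Hl ->]]]] Hw].
  exists l. split => //. split => //. apply: Rle_lt_trans Hw. exact: residual_le.
Qed.

Lemma D_lsum c l : (forall i, In i l -> valid i) -> D (lsum c l) = lsum (fun i => RtoC (val i) * c i)%C l.
Proof.
  elim: l => [|i l IH] Hl /=.
  - have E2 := DL (-1)%C _ _ (ph_zero _ _ H) (ph_zero _ _ H).
    have E3 : (fun _ : X => (-1) * 0 + 0)%C = (fun _ => 0%C) by funring. rewrite E3 in E2.
    rewrite E2. funring.
  - have Vi : valid i by apply: Hl; left. have Hl' : forall i, In i l -> valid i by move=> q Hq; apply: Hl; right.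
    rewrite DL; [|exact: Vphi|exact: V_lsum]. rewrite IH // Dphi //. funring.
Qed.

Lemma list_gap (l : list I) (f : I -> R) : (forall i, In i l -> 0 < f i) -> exists dl, 0 < dl /\ forall i, In i l -> dl <= f i.
Proof.
  elim: l => [|i l IH] Hl; first by exists 1; split => //; lra.
  case: IH => [j Hj|dl [P Q]]; first by apply: Hl; right. exists (Rmin (f i) dl). split.
  - apply: Rmin_pos => //. apply: Hl; by left. - move=> j [<-|Hj]; first exact: Rmin_l. apply: Rle_trans (Rmin_r _ _) _. exact: Q.
Qed.

(** Values of modulus above [|lambda| + 1] are at distance more than 1, and [Fin] leaves finitely
    many others. *)
Lemma value_gap lambda : (forall i, valid i -> lambda <> RtoC (val i)) -> exists dl, 0 < dl /\ forall i, valid i -> dl <= Cmod (RtoC (val i) - lambda)%C.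
Proof.
  move=> Hn. case: (Fin (Cmod lambda + 1)) => l Hl.
  (* The list given by [Fin] may contain labels that are not valid; the default 1 keeps their
     entries positive. *)
  case: (list_gap l (fun i => match excluded_middle_informative (valid i) with left _ => Cmod (RtoC (val i) - lambda)%C | right _ => 1 end)) => [i _|dl [P Q]].
  - case: excluded_middle_informative => [Hi|_]; last lra. apply/Cmod_gt_0 => E. apply: (Hn i Hi).
    transitivity (RtoC (val i) - (RtoC (val i) - lambda))%C; [ring|rewrite E; ring].
  - exists (Rmin dl 1). split; first by apply: Rmin_pos; lra. move=> i Hi.
    case: (Rle_lt_dec (Rabs (val i)) (Cmod lambda + 1)) => Hv.
    + have := Q i (Hl i Hi Hv). case: excluded_middle_informative => // _. have := Rmin_l dl 1. lra.
    + have := Cmod_triangle (RtoC (val i) - lambda)%C lambda. have -> : (RtoC (val i) - lambda + lambda)%C = RtoC (val i) by ring. rewrite Cmod_R.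
      have := Rmin_r dl 1. lra.
Qed.

Definition Dm (lambda : C) (u : X -> C) : X -> C := fun x => (D u x - lambda * u x)%C.

Lemma V_Dm lambda u : V u -> V (Dm lambda u).
Proof. move=> Hu. apply: V_sub; [exact: VD|exact: Vs]. Qed.

Lemma coef_Dm lambda f i : V f -> valid i -> coef (Dm lambda f) i = ((RtoC (val i) - lambda) * coef f i)%C.
Proof.
  move=> Vf Hi. rewrite /coef /Dm ip_sub_l; [|exact: VD|exact: Vs|exact: Vphi]. rewrite Sym //; last exact: Vphi. rewrite Dphi // ip_scal_r //; last exact: Vphi.
  rewrite (ph_ip_scal _ _ H) //; last exact: Vphi. have -> : Cconj (RtoC (val i)) = RtoC (val i) by Cring.
  field. move/RtoC_inj. have := nphi_pos i Hi. lra.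
Qed.

(** On a finite projection the bound holds coefficient by coefficient with the squared gap. The
    residue outside it is arbitrarily small by density, so the inequality passes to [f] up to every
    [e]. *)
Lemma resolvent_bound lambda : (forall i, valid i -> lambda <> RtoC (val i)) -> exists c, 0 < c /\ forall f, V f -> c * n2 f <= n2 (Dm lambda f).
Proof.
  move=> /value_gap [dl [Hdl Hgap]]. exists (dl ^ 2). split; first by apply: pow_lt.
  move=> f Vf. have Vg := V_Dm lambda f Vf. apply: le_epsilon => e He.
  have Hd2 : 0 < dl ^ 2 by apply: pow_lt.
  case: (dense_proj f (e / dl ^ 2) Vf ltac:(exact: Rdiv_lt_0_compat)) => l [Nd [Hl Hr]].
  rewrite (pythagoras l f) //. have Pg := pythagoras l _ Nd Hl Vg.
  have P1 := n2_pos _ (V_sub _ _ Vg (V_lsum (coef (Dm lambda f)) l Hl)).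
  have B : dl ^ 2 * n2 (proj l f) <= n2 (proj l (Dm lambda f)).
  { rewrite /proj !n2_lsum //. clear Nd Hr Pg P1. elim: l Hl => [|i l IH] Hl /=; first lra.
    have Vi : valid i by apply: Hl; left. have Hl' : forall i, In i l -> valid i by move=> q Hq; apply: Hl; right.
    have {}IH := IH Hl'. rewrite coef_Dm // Cmod_mult. have G1 := Hgap i Vi. have Np := nphi_pos i Vi.
    have G2 : dl ^ 2 <= Cmod (RtoC (val i) - lambda)%C ^ 2 by apply: pow_incr; lra.
    have G3 := pow2_ge_0 (Cmod (coef f i)).
    have : dl ^ 2 * (Cmod (coef f i) ^ 2 * n2 (phi i)) <= Cmod (RtoC (val i) - lambda)%C ^ 2 * (Cmod (coef f i) ^ 2 * n2 (phi i)).
    { apply: Rmult_le_compat_r => //. apply: Rmult_le_pos; lra. }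
    rewrite /= in IH *. lra. }
  have : dl ^ 2 * n2 (fun x => f x - proj l f x)%C <= e.
  { have -> : e = dl ^ 2 * (e / dl ^ 2) by field; lra. apply: Rmult_le_compat_l; lra. }
  rewrite /proj in P1 Pg B *. lra.
Qed.

(** On the projection of [h] to finitely many eigenvectors the operator is inverted by dividing each
    coefficient, so the error is only that of the projection. *)
Lemma resolvent_range lambda : (forall i, valid i -> lambda <> RtoC (val i)) -> forall h e, V h -> 0 < e ->
  exists f, V f /\ n2 (fun x => Dm lambda f x - h x)%C < e.
Proof.
  move=> Hn h e Vh He. case: (dense_proj h e Vh He) => l [Nd [Hl Hr]].
  exists (lsum (fun i => coef h i / (RtoC (val i) - lambda))%C l). split; first exact: V_lsum.
  have -> : (fun x => Dm lambda (lsum (fun i => coef h i / (RtoC (val i) - lambda))%C l) x - h x)%C = (fun x => (-1) * (h x - proj l h x))%C.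
  { apply: functional_extensionality => x. rewrite /Dm D_lsum // /proj.
    have : (lsum (fun i => RtoC (val i) * (coef h i / (RtoC (val i) - lambda))) l x - lambda * lsum (fun i => coef h i / (RtoC (val i) - lambda)) l x)%C = lsum (coef h) l x; last by move=> ->; ring.
    elim: l Hl {Nd Hr} => [|i l IH] Hl /=; first ring. rewrite -IH; last by move=> j Hj; apply: Hl; right.
    have Hne : (RtoC (val i) - lambda)%C <> 0%C. { move=> E. apply: (Hn i); first by apply: Hl; left. transitivity (RtoC (val i) - (RtoC (val i) - lambda))%C; [ring|rewrite E; ring]. }
    field. exact: Hne. }
  rewrite n2_scal; last by apply: V_sub => //; exact: V_lsum.
  have -> : Cmod (-1) = 1 by rewrite Cmod_R Rabs_left; lra. rewrite pow1 Rmult_1_l. exact: Hr.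
Qed.

Lemma value_list lambda : exists l : list I, NoDup l /\ forall i, In i l <-> valid i /\ lambda = RtoC (val i).
Proof.
  case: (Fin (Cmod lambda)) => l Hl.
  have [l' [Nd Hl']] : exists l', NoDup l' /\ forall i, In i l' <-> In i l /\ valid i /\ lambda = RtoC (val i).
  { clear Hl. elim: l => [|i l [l' [Nd IH]]].
    - exists nil. split; first exact: NoDup_nil. move=> i; split => //. by case.
    - case: (classic ((valid i /\ lambda = RtoC (val i)) /\ ~ In i l')) => Hc.
      + exists (i :: l'). split; first by apply: NoDup_cons => //; apply Hc. move=> j. split.
        * case=> [<-|/IH [? ?]]; first by split; [left|apply Hc]. split => //; by right.
        * move=> [[<-|Hj] Hv]; first by left. right. by apply/IH.
      + exists l'. split => // j. split.
        * move/IH => [? ?]. split => //; by right.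
        * move=> [[E|Hj] Hv]; last by apply/IH. subst j. apply: NNPP => Hn. apply: Hc. by split. }
  exists l'. split => // i. rewrite Hl'. split; first by case. move=> [Hi E]. split => //. apply: Hl => //. rewrite E Cmod_R. lra.
Qed.

(** By symmetry [f] is orthogonal to every eigenvector of another value. What remains after
    projecting to the listed ones is orthogonal to the whole family and vanishes by density. *)
Lemma eigenvector_expansion lambda f l : (forall i, In i l <-> valid i /\ lambda = RtoC (val i)) -> NoDup l -> V f ->
  D f = (fun x => lambda * f x)%C -> f = lsum (coef f) l.
Proof.
  move=> Hl Nd Vf E. have Hl' : forall i, In i l -> valid i by move=> i /Hl [].
  set g := fun x => (f x - proj l f x)%C. have Vg : V g by apply: V_sub => //; exact: V_lsum.
  have O : forall i, valid i -> ip g (phi i) = 0%C.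
  { move=> i Hi. have Vi := Vphi i Hi. rewrite /g ip_sub_l //; last exact: V_lsum. case: (classic (In i l)) => Hin.
    - rewrite ip_lsum_in // coef_mult //. ring.
    - rewrite ip_lsum_out //. have Hne : lambda <> RtoC (val i) by move=> El; apply: Hin; apply/Hl.
      have E1 : (lambda * ip f (phi i))%C = (RtoC (val i) * ip f (phi i))%C.
      { rewrite -(ph_ip_scal _ _ H) // -E Sym // Dphi // ip_scal_r //. f_equal. Cring. }
      have E2 : ((lambda - RtoC (val i)) * ip f (phi i) = 0)%C. { transitivity (lambda * ip f (phi i) - RtoC (val i) * ip f (phi i))%C; [ring|rewrite E1; ring]. }
      have Hn : (lambda - RtoC (val i))%C <> 0%C. { move=> E3. apply: Hne. transitivity (lambda - RtoC (val i) + RtoC (val i))%C; [ring|rewrite E3; ring]. }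
      have -> : ip f (phi i) = 0%C; last ring. apply: NNPP => Hf. exact: (Cmult_neq_0 _ _ Hn Hf E2). }
  have G0 : n2 g = 0.
  { apply: Rle_antisym; last exact: n2_pos. apply: le_epsilon => e He.
    case: (Dense g e Vg He) => w [Hw Hlt].
    have Vw : V w by apply: V_span Hw => b [i [Hi ->]]; exact: Vphi.
    have Ow : ip g w = 0%C by apply: ip_span_zero Hw => // b [i [Hi ->]]; split; [exact: Vphi|exact: O].
    have E2 : n2 (fun x => g x - w x)%C = n2 g + n2 w.
    { have -> : (fun x => g x - w x)%C = (fun x => g x + (fun x => (-1) * w x) x)%C by funring.
      rewrite n2_orth //; [|exact: Vs|rewrite ip_scal_r // Ow; ring]. rewrite n2_scal //.
      have -> : Cmod (-1) = 1 by rewrite Cmod_R Rabs_left; lra. ring. }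
    have := n2_pos w Vw. lra. }
  have G := ph_def _ _ H g Vg G0. apply: functional_extensionality => x. have := f_equal (fun h => h x) G. rewrite /g /proj => E3.
  transitivity (f x - lsum (coef f) l x + lsum (coef f) l x)%C; [ring|rewrite E3; ring].
Qed.

Lemma lsum_independent c l : NoDup l -> (forall i, In i l -> valid i) -> lsum c l = (fun _ => 0%C) -> forall i, In i l -> c i = 0%C.
Proof.
  move=> Nd Hl E i Hi. have := ip_lsum_in c l i Nd Hl Hi. rewrite E ip_zero_l; last by apply: Vphi; exact: Hl.
  move=> E2. apply: NNPP => Hn. have Hp : RtoC (n2 (phi i)) <> 0%C. { move/RtoC_inj. have := nphi_pos i (Hl i Hi). lra. }
  exact: (Cmult_neq_0 _ _ Hn Hp (eq_sym E2)).
Qed.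
End Spectral.
End PreHilbert.

(** * The scalar equivariant functions *)

Lemma PX_lin c u v : Sm u -> Sm v -> PX (fun g => c * u g + v g)%C = (fun g => c * PX u g + PX v g)%C /\
  PY (fun g => c * u g + v g)%C = (fun g => c * PY u g + PY v g)%C /\ PZ (fun g => c * u g + v g)%C = (fun g => c * PZ u g + PZ v g)%C.
Proof.
  move=> Hu Hv. exact: (Cpartials_P _ _ _ _ (Cpartials_plus _ _ _ _ _ _ _ _ (Cpartials_scal c _ _ _ _ (Sm_partials _ Hu)) (Sm_partials _ Hv))).
Qed.
Lemma VY_lin c u v : Sm u -> Sm v -> VY (fun g => c * u g + v g)%C = (fun g => c * VY u g + VY v g)%C.
Proof.
  move=> Hu Hv. case: (PX_lin c u v Hu Hv) => [_ [E2 E3]]. rewrite /VY E2 E3. funring.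
Qed.
Lemma fields_conj u : Sm u -> PX (fun g => Cconj (u g)) = (fun g => Cconj (PX u g)) /\
  VY (fun g => Cconj (u g)) = (fun g => Cconj (VY u g)) /\ PZ (fun g => Cconj (u g)) = (fun g => Cconj (PZ u g)).
Proof.
  move=> Hu. case: (Cpartials_P _ _ _ _ (Cpartials_conj _ _ _ _ (Sm_partials _ Hu))) => [E1 [E2 E3]].
  split => //. split => //. rewrite /VY E2 E3. apply: functional_extensionality => g. Cring.
Qed.

Lemma Lo_lin c u v : Sm u -> Sm v -> Lo (fun g => c * u g + v g)%C = (fun g => c * Lo u g + Lo v g)%C.
Proof.
  move=> Hu Hv. rewrite /Lo (proj1 (PX_lin c u v Hu Hv)) VY_lin //. funring.
Qed.
Lemma Lp_lin c u v : Sm u -> Sm v -> Lp (fun g => c * u g + v g)%C = (fun g => c * Lp u g + Lp v g)%C.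
Proof.
  move=> Hu Hv. rewrite /Lp (proj1 (PX_lin c u v Hu Hv)) VY_lin //. funring.
Qed.

Lemma Lo_Lp_comm u : Sm u -> Lo (Lp u) = (fun g => Lp (Lo u) g - 2 * Ci * PZ u g)%C.
Proof.
  move=> Hu. have SX := Sm_PX _ Hu. have SY := Sm_VY _ Hu.
  have E1 : Lp u = (fun g => (-1) * PX u g + (fun g => - Ci * VY u g) g)%C by apply: functional_extensionality => g; rewrite /Lp; ring.
  have E2 : Lo u = (fun g => - Ci * VY u g + PX u g)%C by apply: functional_extensionality => g; rewrite /Lo; ring.
  have S0 : Sm (fun _ => 0%C) := Sm_const _.
  have Sc : Sm (fun g => - Ci * VY u g)%C by exact: Sm_scal.
  have Z0 : PX (fun _ => 0%C) = (fun _ => 0%C) /\ VY (fun _ => 0%C) = (fun _ => 0%C).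
  { have P : Cpartials (fun _ => 0%C) (fun _ => 0%C) (fun _ => 0%C) (fun _ => 0%C) by move=> x y z; split; [|split]; exact: CD_const.
    case: (Cpartials_P _ _ _ _ P) => [A1 [A2 A3]]. split => //. rewrite /VY A2 A3. funring. }
  have Xs : forall c v, Sm v -> PX (fun g => c * v g)%C = (fun g => c * PX v g)%C.
  { move=> c v Sv. have := proj1 (PX_lin c v _ Sv S0). rewrite (proj1 Z0).
    have -> : (fun g => c * v g + 0)%C = (fun g => c * v g)%C by funring. move=> ->. funring. }
  have Ys : forall c v, Sm v -> VY (fun g => c * v g)%C = (fun g => c * VY v g)%C.
  { move=> c v Sv. have := VY_lin c v _ Sv S0. rewrite (proj2 Z0).
    have -> : (fun g => c * v g + 0)%C = (fun g => c * v g)%C by funring. move=> ->. funring. }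
  case: (VY_comm u Hu) => [Cm _].
  rewrite E1 E2 Lo_lin // Lp_lin //. rewrite /Lo /Lp Xs // Ys // Cm. apply: functional_extensionality => g.
  have Ci2 : (Ci * Ci = - 1)%C by Cring.
  transitivity (- PX (PX u) g + Ci * VY (PX u) g - Ci * (VY (PX u) g + PZ u g) + (Ci * Ci) * VY (VY u) g)%C; first ring.
  rewrite Ci2.
  transitivity (- PX (PX u) g + Ci * (VY (PX u) g + PZ u g) - Ci * VY (PX u) g + (-1) * VY (VY u) g - 2 * Ci * PZ u g)%C; first ring.
  rewrite -Ci2. ring.
Qed.

Section Scalars.
Variables (a b w2 r e1 e2 e3 : R).
Hypotheses (Ha : 0 < a) (Hw : 0 < w2) (Hr : 0 < r) (He1 : e1 * e1 = 1) (He2 : e2 * e2 = 1) (He3 : e3 * e3 = 1).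

Definition Sp (u : G -> C) : Prop :=
  Sm u /\ inv_by (a, 0, 0) (RtoC e1) u /\ inv_by (b, w2, 0) (RtoC e2) u /\ inv_by (0, 0, r) (RtoC e3) u.

Lemma Sp_plus u v : Sp u -> Sp v -> Sp (fun g => u g + v g)%C.
Proof.
  move=> [S1 [A1 [B1 C1]]] [S2 [A2 [B2 C2']]]. split; [exact: Sm_plus|split; [|split]]; exact: inv_by_plus.
Qed.
Lemma Sp_scal c u : Sp u -> Sp (fun g => c * u g)%C.
Proof.
  move=> [S1 [A1 [B1 C1]]]. split; [exact: Sm_scal|split; [|split]]; exact: inv_by_scal.
Qed.
Lemma Sp_conj u : Sp u -> Sp (fun g => Cconj (u g)).
Proof.
  have Q : forall gm e v, inv_by gm (RtoC e) v -> inv_by gm (RtoC e) (fun g => Cconj (v g)).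
  { move=> gm e v Hv g. rewrite Hv. Cring. }
  move=> [S1 [A1 [B1 C1]]]. split; [exact: Sm_conj|split; [|split]]; exact: Q.
Qed.
Lemma Sp_zero : Sp (fun _ => 0%C).
Proof. split; [exact: Sm_const|split; [|split]] => g; ring. Qed.
Lemma Sp_fields u : Sp u -> Sp (PX u) /\ Sp (VY u) /\ Sp (PZ u).
Proof.
  move=> [S1 [A1 [B1 C1]]].
  case: (inv_by_fields _ _ _ S1 A1) => [? [? ?]]. case: (inv_by_fields _ _ _ S1 B1) => [? [? ?]]. case: (inv_by_fields _ _ _ S1 C1) => [? [? ?]].
  split; [|split]; (split; [|split; [|split]]) => //; [exact: Sm_PX|exact: Sm_VY|exact: Sm_PZ].
Qed.
Lemma Sp_cont u : Sp u -> CcontG u.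
Proof. move=> [S1 _]. exact: Sm_cont. Qed.

(** The signs of the two functions cancel in [u] times the conjugate of [v], which therefore lives
    on the quotient. *)
Lemma Sp_prod_invar u v (f : C -> R) : Sp u -> Sp v -> invar a b w2 r (fun g => f (u g * Cconj (v g))%C).
Proof.
  move=> [S1 [A1 [B1 C1]]] [S2 [A2 [B2 C2']]] x y z.
  have Q : forall e gm g, e * e = 1 -> inv_by gm (RtoC e) u -> inv_by gm (RtoC e) v -> (u (gmul gm g) * Cconj (v (gmul gm g)) = u g * Cconj (v g))%C.
  { move=> e gm g He H1 H2. rewrite H1 H2 Cmult_conj. have -> : Cconj (RtoC e) = RtoC e by Cring.
    transitivity ((RtoC e * RtoC e) * (u g * Cconj (v g)))%C; first ring. rewrite -RtoC_mult He. ring. }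
  split; [|split].
  - rewrite -(Q e1 (a, 0, 0) (x, y, z)) //. have -> : gmul (a, 0, 0) (x, y, z) = (x + a, y, z + a * y) by apply: triple_eq; ring. by [].
  - rewrite -(Q e2 (b, w2, 0) (x, y, z)) //. have -> : gmul (b, w2, 0) (x, y, z) = (x + b, y + w2, z + b * y) by apply: triple_eq; ring. by [].
  - rewrite -(Q e3 (0, 0, r) (x, y, z)) //. have -> : gmul (0, 0, r) (x, y, z) = (x, y, z + r) by apply: triple_eq; ring. by [].
Qed.

Notation ipm := (ip a w2 r).

(** Skew-symmetry of the invariant fields: the integral of a derivative of [u] times the conjugate
    of [v] is zero, and the Leibniz rule splits it. *)
Lemma Sp_parts u v : Sp u -> Sp v -> ipm (PX u) v = (- ipm u (PX v))%C /\ ipm (VY u) v = (- ipm u (VY v))%C /\ ipm (PZ u) v = (- ipm u (PZ v))%C.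
Proof.
  move=> Hu Hv. case: (Sp_fields u Hu) => [Ux [Uy Uz]]. case: (Sp_fields v Hv) => [Vx [Vy Vz]].
  have Su := proj1 Hu. have Sv := proj1 Hv.
  have P := Cpartials_mult _ _ _ _ _ _ _ _ (Sm_partials _ Su) (Cpartials_conj _ _ _ _ (Sm_partials _ Sv)).
  have C0 : CcontG (fun g => u g * Cconj (v g))%C by apply: CcontG_prod; exact: Sp_cont.
  have Cy : forall u v, Sm u -> Sm v -> CcontG (fun g => PY u g * Cconj (v g) + u g * Cconj (PY v g))%C.
  { move=> p q Hp Hq. apply: CcontG_plus; apply: CcontG_prod; apply: Sm_cont => //; exact: Sm_PY. }
  have Cx : CcontG (fun g => PX u g * Cconj (v g) + u g * Cconj (PX v g))%C by apply: CcontG_plus; apply: CcontG_prod; exact: Sp_cont.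
  have Cz : CcontG (fun g => PZ u g * Cconj (v g) + u g * Cconj (PZ v g))%C by apply: CcontG_plus; apply: CcontG_prod; exact: Sp_cont.
  have Cy' := Cy u v Su Sv.
  have HRe := I3_parts a b w2 r Hw Hr _ _ _ _ (proj1 C0) (proj1 Cx) (proj1 Cy') (proj1 Cz)
    ltac:(move=> x y z; case: (P x y z) => [[? ?] [[? ?] [? ?]]]; by split; [|split]) (Sp_prod_invar u v Re Hu Hv).
  have HIm := I3_parts a b w2 r Hw Hr _ _ _ _ (proj2 C0) (proj2 Cx) (proj2 Cy') (proj2 Cz)
    ltac:(move=> x y z; case: (P x y z) => [[? ?] [[? ?] [? ?]]]; by split; [|split]) (Sp_prod_invar u v Im Hu Hv).
  have Fin : forall u1 v1, CcontG (fun g => u1 g * Cconj (v g))%C -> CcontG (fun g => u g * Cconj (v1 g))%C ->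
    CI a w2 r (fun g => u1 g * Cconj (v g) + u g * Cconj (v1 g))%C = 0%C -> ipm u1 v = (- ipm u v1)%C.
  { move=> u1 v1 K1 K2. rewrite CI_plus // => E. rewrite /ip.
    transitivity ((CI a w2 r (fun g => u1 g * Cconj (v g)) + CI a w2 r (fun g => u g * Cconj (v1 g))) - CI a w2 r (fun g => u g * Cconj (v1 g)))%C; [ring|rewrite E; ring]. }
  split; [|split].
  - apply: Fin; [by apply: CcontG_prod; exact: Sp_cont|by apply: CcontG_prod; exact: Sp_cont|]. apply: C_ext; [exact: (proj1 HRe)|exact: (proj1 HIm)].
  - apply: Fin; [by apply: CcontG_prod; exact: Sp_cont|by apply: CcontG_prod; exact: Sp_cont|].
    have E : forall f : C -> R, (f = Re \/ f = Im) -> (fun g => f (VY u g * Cconj (v g) + u g * Cconj (VY v g))%C) =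
      (fun g => f (PY u g * Cconj (v g) + u g * Cconj (PY v g))%C + fst (fst g) * f (PZ u g * Cconj (v g) + u g * Cconj (PZ v g))%C).
    { move=> f Hf. apply: functional_extensionality => g.
      have -> : (VY u g * Cconj (v g) + u g * Cconj (VY v g))%C = ((PY u g * Cconj (v g) + u g * Cconj (PY v g)) + RtoC (fst (fst g)) * (PZ u g * Cconj (v g) + u g * Cconj (PZ v g)))%C.
      { rewrite /VY. Cring. }
      case: Hf => ->; rewrite /=; rewrite /Re /Im /=; ring. }
    apply: C_ext; rewrite /CI /=.
    + rewrite (E Re); last by left. exact: (proj1 (proj2 HRe)).
    + rewrite (E Im); last by right. exact: (proj1 (proj2 HIm)).
  - apply: Fin; [by apply: CcontG_prod; exact: Sp_cont|by apply: CcontG_prod; exact: Sp_cont|]. apply: C_ext; [exact: (proj2 (proj2 HRe))|exact: (proj2 (proj2 HIm))].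
Qed.

Lemma Sp_prehilbert : prehilbert Sp ipm.
Proof.
  split.
  - exact: Sp_plus.
  - exact: Sp_scal.
  - exact: Sp_zero.
  - move=> u v w Hu Hv Hw'. apply: ip_plus_l => //; exact: Sp_cont.
  - move=> c u w Hu Hw'. apply: ip_scal_l => //; exact: Sp_cont.
  - move=> u v Hu Hv. apply: ip_conj => //; exact: Sp_cont.
  - move=> u Hu. rewrite ip_self //; [|exact: Sp_cont]. apply: I3_ge0 => //. apply: contG_Cmod2; exact: Sp_cont. move=> g. exact: pow2_ge_0.
  - move=> u Hu. rewrite ip_self //; [|exact: Sp_cont]. rewrite /= => E0. apply: functional_extensionality => g.
    (* A vanishing norm gives zero on the box only; invariance of the modulus spreads it over the
       group. *)
    have Inv := Sp_prod_invar u u Cmod Hu Hu.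
    case: (box_reduce a b w2 r _ Ha Hw Hr Inv g) => g' [Hg' E].
    have Z := I3_zero a w2 r Ha Hw Hr (fun g => Cmod (u g) ^ 2) (contG_Cmod2 _ (Sp_cont _ Hu)) (fun g => pow2_ge_0 _) E0 g' Hg'.
    cbv beta in E, Z. have Z2 : Cmod (u g') = 0 by nra. rewrite Cmod_mult Z2 Rmult_0_l Cmod_mult in E.
    have Ec : Cmod (Cconj (u g)) = Cmod (u g) by rewrite /Cmod /=; f_equal; ring.
    rewrite Ec in E. apply: Cmod_eq_0. nra.
Qed.

Lemma Sp_Lo u : Sp u -> Sp (Lo u).
Proof.
  move=> H. case: (Sp_fields u H) => [H1 [H2 _]].
  have -> : Lo u = (fun g => PX u g + (- Ci) * VY u g)%C by apply: functional_extensionality => g; rewrite /Lo; ring.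
  apply: Sp_plus => //. exact: Sp_scal.
Qed.
Lemma Sp_Lp u : Sp u -> Sp (Lp u).
Proof.
  move=> H. case: (Sp_fields u H) => [H1 [H2 _]].
  have -> : Lp u = (fun g => (-1) * PX u g + (- Ci) * VY u g)%C by apply: functional_extensionality => g; rewrite /Lp; ring.
  apply: Sp_plus; exact: Sp_scal.
Qed.

Lemma Lo_adj u v : Sp u -> Sp v -> ipm (Lo u) v = ipm u (Lp v).
Proof.
  move=> Hu Hv. case: (Sp_parts u v Hu Hv) => [E1 [E2 _]]. case: (Sp_fields u Hu) => [U1 [U2 _]]. case: (Sp_fields v Hv) => [V1 [V2 _]].
  have Q := Sp_prehilbert.
  have -> : Lo u = (fun g => PX u g + (fun g => (- Ci) * VY u g) g)%C by apply: functional_extensionality => g; rewrite /Lo; ring.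
  have -> : Lp v = (fun g => (fun g => (-1) * PX v g) g + (fun g => (- Ci) * VY v g) g)%C by apply: functional_extensionality => g; rewrite /Lp; ring.
  rewrite (ph_ip_plus _ _ Q _ _ _ U1 (Sp_scal _ _ U2) Hv) (ph_ip_scal _ _ Q _ _ _ U2 Hv) (ip_plus_r _ _ Q _ _ _ (Sp_scal _ _ V1) (Sp_scal _ _ V2) Hu).
  rewrite (ip_scal_r _ _ Q _ _ _ V1 Hu) (ip_scal_r _ _ Q _ _ _ V2 Hu) E1 E2.
  have -> : Cconj (- Ci) = Ci by Cring. have -> : Cconj (-1) = (-1)%C by Cring. ring.
Qed.

(** The fields are skew, so eigenvalues [i ku] and [i kv] with [ku] and [kv] distinct force
    orthogonality. *)
Lemma eigen_orth u v ku kv : Sp u -> Sp v -> ku <> kv ->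
  (PX u = (fun g => Ci * RtoC ku * u g)%C /\ PX v = (fun g => Ci * RtoC kv * v g)%C) \/
  (VY u = (fun g => Ci * RtoC ku * u g)%C /\ VY v = (fun g => Ci * RtoC kv * v g)%C) \/
  (PZ u = (fun g => Ci * RtoC ku * u g)%C /\ PZ v = (fun g => Ci * RtoC kv * v g)%C) -> ipm u v = 0%C.
Proof.
  move=> Hu Hv Hne HE. have Q := Sp_prehilbert. case: (Sp_parts u v Hu Hv) => [E1 [E2 E3]].
  have : (ipm (fun g => Ci * RtoC ku * u g) v = - ipm u (fun g => Ci * RtoC kv * v g))%C.
  { case: HE => [[<- <-] //|[[<- <-] //|[<- <-] //]]. }
  rewrite (ph_ip_scal _ _ Q) // (ip_scal_r _ _ Q) //.
  have -> : Cconj (Ci * RtoC kv) = (- (Ci * RtoC kv))%C by Cring.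
  move=> E. apply: NNPP => Hn. have Hk : (Ci * RtoC (ku - kv))%C <> 0%C.
  { move=> E4. have := f_equal Im E4. rewrite /=. lra. }
  apply: (Cmult_neq_0 _ _ Hk Hn). rewrite RtoC_minus.
  transitivity (Ci * RtoC ku * ipm u v - Ci * RtoC kv * ipm u v)%C; first ring. rewrite E. ring.
Qed.
End Scalars.

(** * Closure of a span inside a space of functions *)

Section Adherence.
Context {X : Type} (V : (X -> C) -> Prop) (ip : (X -> C) -> (X -> C) -> C) (H : prehilbert V ip) (B : (X -> C) -> Prop).
Hypothesis (HB : forall b, B b -> V b).

Definition adherent (f : X -> C) : Prop := V f /\ forall e, 0 < e -> exists w, span B w /\ n2 ip (fun x => f x - w x)%C < e.

Lemma n2_zero : n2 ip (fun _ => 0%C) = 0.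
Proof. rewrite /n2 (ip_zero_l V ip H) //. exact: ph_zero H. Qed.

Lemma adherent_span w : span B w -> adherent w.
Proof.
  move=> Hw. split; first by apply: (V_span V ip H B). move=> e He. exists w. split => //.
  have -> : (fun x => w x - w x)%C = (fun _ => 0%C) by funring. by rewrite n2_zero.
Qed.

Lemma adherent_limit f : V f -> (forall e, 0 < e -> exists g, adherent g /\ n2 ip (fun x => f x - g x)%C < e) -> adherent f.
Proof.
  move=> Vf Hf. split => // e He. case: (Hf (e / 4) ltac:(lra)) => g [[Vg Hg] H1]. case: (Hg (e / 4) ltac:(lra)) => w [Hw H2].
  exists w. split => //. have Vw := V_span V ip H B w HB Hw.
  have -> : (fun x => f x - w x)%C = (fun x => (fun x => f x - g x) x + (fun x => g x - w x) x)%C by funring.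
  have := n2_plus_le V ip H _ _ (V_sub V ip H _ _ Vf Vg) (V_sub V ip H _ _ Vg Vw). lra.
Qed.

Lemma adherent_plus f g : adherent f -> adherent g -> adherent (fun x => f x + g x)%C.
Proof.
  move=> [Vf Hf] [Vg Hg]. split; first exact: (ph_plus _ _ H). move=> e He.
  case: (Hf (e / 4) ltac:(lra)) => w [Hw H1]. case: (Hg (e / 4) ltac:(lra)) => v [Hv H2].
  exists (fun x => w x + v x)%C. split; first exact: span_plus.
  have Vw := V_span V ip H B w HB Hw. have Vv := V_span V ip H B v HB Hv.
  have -> : (fun x => f x + g x - (w x + v x))%C = (fun x => (fun x => f x - w x) x + (fun x => g x - v x) x)%C by funring.
  have := n2_plus_le V ip H _ _ (V_sub V ip H _ _ Vf Vw) (V_sub V ip H _ _ Vg Vv). lra.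
Qed.

Lemma adherent_scal c f : adherent f -> adherent (fun x => c * f x)%C.
Proof.
  move=> [Vf Hf]. split; first exact: (ph_scal _ _ H). move=> e He. have Cp := pow2_ge_0 (Cmod c).
  case: (Hf (e / (Cmod c ^ 2 + 1)) ltac:(apply: Rdiv_lt_0_compat; lra)) => w [Hw H1].
  exists (fun x => c * w x)%C. split; first exact: span_scal. have Vw := V_span V ip H B w HB Hw.
  have -> : (fun x => c * f x - c * w x)%C = (fun x => c * (fun x => f x - w x) x)%C by funring.
  have Vs := V_sub V ip H _ _ Vf Vw.
  rewrite (n2_scal V ip H) //. have P := n2_pos V ip H _ Vs.
  have -> : e = (Cmod c ^ 2 + 1) * (e / (Cmod c ^ 2 + 1)) by field; lra.
  have Q : 0 < e / (Cmod c ^ 2 + 1) by apply: Rdiv_lt_0_compat; lra. nra.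
Qed.
End Adherence.

Lemma prehilbert_sub {X} (V V' : (X -> C) -> Prop) ip : prehilbert V ip -> (forall u, V' u -> V u) ->
  (forall u v, V' u -> V' v -> V' (fun x => u x + v x)%C) -> (forall c u, V' u -> V' (fun x => c * u x)%C) -> V' (fun _ => 0%C) ->
  prehilbert V' ip.
Proof.
  move=> H Hs Hp Hc H0. split => //.
  - move=> u v w Hu Hv Hw. apply: (ph_ip_plus _ _ H); exact: Hs.
  - move=> c u w Hu Hw. apply: (ph_ip_scal _ _ H); exact: Hs.
  - move=> u v Hu Hv. apply: (ph_conj _ _ H); exact: Hs.
  - move=> u Hu. apply: (ph_pos _ _ H); exact: Hs.
  - move=> u Hu. apply: (ph_def _ _ H); exact: Hs.
Qed.

(** * The Dirac operator in coordinates *)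

(** A pair of functions is encoded as one scalar function on two copies of [G], so the results on
    [prehilbert] hold for spinors as for scalars. *)
Definition mkp (p q : G -> C) : bool * G -> C := fun x => match x with (true, g) => p g | (false, g) => q g end.
Definition pc (i : bool) (F : bool * G -> C) : G -> C := fun g => F (i, g).

Lemma mkp_eta F : F = mkp (pc true F) (pc false F).
Proof. by apply: functional_extensionality; case=> [[|] g]. Qed.

Lemma ip_lin3_l {X} (V : (X -> C) -> Prop) ip (H : prehilbert V ip) a1 a2 a3 u1 u2 u3 w : V u1 -> V u2 -> V u3 -> V w ->
  ip (fun x => a1 * u1 x + (a2 * u2 x + a3 * u3 x))%C w = (a1 * ip u1 w + (a2 * ip u2 w + a3 * ip u3 w))%C.
Proof.
  move=> H1 H2 H3 Hw. have S1 := ph_scal _ _ H a1 _ H1. have S2 := ph_scal _ _ H a2 _ H2. have S3 := ph_scal _ _ H a3 _ H3.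
  rewrite (ph_ip_plus _ _ H (fun x => a1 * u1 x)%C (fun x => a2 * u2 x + a3 * u3 x)%C) //; last exact: (ph_plus _ _ H).
  rewrite (ph_ip_plus _ _ H (fun x => a2 * u2 x)%C (fun x => a3 * u3 x)%C) // !(ph_ip_scal _ _ H) //.
Qed.
Lemma ip_lin3_r {X} (V : (X -> C) -> Prop) ip (H : prehilbert V ip) a1 a2 a3 u1 u2 u3 w : V u1 -> V u2 -> V u3 -> V w ->
  ip w (fun x => a1 * u1 x + (a2 * u2 x + a3 * u3 x))%C = (Cconj a1 * ip w u1 + (Cconj a2 * ip w u2 + Cconj a3 * ip w u3))%C.
Proof.
  move=> H1 H2 H3 Hw. have S1 := ph_scal _ _ H a1 _ H1. have S2 := ph_scal _ _ H a2 _ H2. have S3 := ph_scal _ _ H a3 _ H3.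
  rewrite (ip_plus_r _ _ H (fun x => a1 * u1 x)%C (fun x => a2 * u2 x + a3 * u3 x)%C) //; last exact: (ph_plus _ _ H).
  rewrite (ip_plus_r _ _ H (fun x => a2 * u2 x)%C (fun x => a3 * u3 x)%C) // !(ip_scal_r _ _ H) //.
Qed.

Lemma Re_Cplus x y : Re (x + y)%C = Re x + Re y. Proof. by []. Qed.
Lemma Cconj_Cplus x y : Cconj (x + y)%C = (Cconj x + Cconj y)%C. Proof. Cring. Qed.

Section Pairs.
Variables (a b w2 r e1 e2 e3 s q0 : R).
Hypotheses (Ha : 0 < a) (Hw : 0 < w2) (Hr : 0 < r) (Hs : 0 < s) (He1 : e1 * e1 = 1) (He2 : e2 * e2 = 1) (He3 : e3 * e3 = 1).
Notation SpP := (Sp a b w2 r e1 e2 e3).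
Notation ipm := (ip a w2 r).
Let PH := Sp_prehilbert a b w2 r e1 e2 e3 Ha Hw Hr He1 He2 He3.

Definition VP (F : bool * G -> C) : Prop := SpP (pc true F) /\ SpP (pc false F).
Definition ipP (F H : bool * G -> C) : C := (ipm (pc true F) (pc true H) + ipm (pc false F) (pc false H))%C.

Lemma VP_mkp p q : SpP p -> SpP q -> VP (mkp p q).
Proof. by move=> Hp Hq; split. Qed.

Lemma VP_prehilbert : prehilbert VP ipP.
Proof.
  split.
  - move=> u v [U1 U2] [V1 V2]. split; exact: Sp_plus.
  - move=> c u [U1 U2]. split; exact: Sp_scal.
  - split; exact: Sp_zero.
  - move=> u v w [U1 U2] [V1 V2] [W1 W2]. rewrite /ipP.
    have -> : pc true (fun x => u x + v x)%C = (fun g => pc true u g + pc true v g)%C by [].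
    have -> : pc false (fun x => u x + v x)%C = (fun g => pc false u g + pc false v g)%C by [].
    have Q1 := ph_ip_plus _ _ PH (pc true u) (pc true v) (pc true w) U1 V1 W1. have Q2 := ph_ip_plus _ _ PH (pc false u) (pc false v) (pc false w) U2 V2 W2.
    rewrite Q1 Q2. ring.
  - move=> c u w [U1 U2] [W1 W2]. rewrite /ipP.
    have -> : pc true (fun x => c * u x)%C = (fun g => c * pc true u g)%C by [].
    have -> : pc false (fun x => c * u x)%C = (fun g => c * pc false u g)%C by [].
    rewrite (ph_ip_scal _ _ PH c (pc true u) (pc true w) U1 W1) (ph_ip_scal _ _ PH c (pc false u) (pc false w) U2 W2). ring.
  - move=> u v [U1 U2] [V1 V2]. rewrite /ipP (ph_conj _ _ PH (pc true u)) // (ph_conj _ _ PH (pc false u)) // Cconj_Cplus. by [].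
  - move=> u [U1 U2]. rewrite /ipP Re_Cplus. apply: Rplus_le_le_0_compat; exact: (ph_pos _ _ PH).
  - move=> u [U1 U2]. rewrite /ipP Re_Cplus => E0. have P1 := ph_pos _ _ PH _ U1. have P2 := ph_pos _ _ PH _ U2.
    have E1 : Re (ipm (pc true u) (pc true u)) = 0 by lra. have E2 : Re (ipm (pc false u) (pc false u)) = 0 by lra.
    have F1 := ph_def _ _ PH _ U1 E1. have F2 := ph_def _ _ PH _ U2 E2.
    rewrite (mkp_eta u) F1 F2. by apply: functional_extensionality; case=> [[|] g].
Qed.

Definition Los (u : G -> C) : G -> C := fun g => (RtoC s * Lo u g)%C.
Definition Lps (u : G -> C) : G -> C := fun g => (RtoC s * Lp u g)%C.

(* The Dirac operator in the spinor basis of [J_frame], with [s = 1 / sqrt A] and [q0 = 1 / (4 A)]. *)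
Definition DD (F : bool * G -> C) : bool * G -> C :=
  mkp (fun g => Ci * PZ (pc true F) g + Lps (pc false F) g - RtoC q0 * pc true F g)%C
      (fun g => Los (pc true F) g - Ci * PZ (pc false F) g - RtoC q0 * pc false F g)%C.

Lemma VP_DD F : VP F -> VP (DD F).
Proof.
  move=> [H1 H2]. case: (Sp_fields _ _ _ _ _ _ _ _ H1) => [_ [_ Z1]]. case: (Sp_fields _ _ _ _ _ _ _ _ H2) => [_ [_ Z2]].
  have L1 := Sp_Lo _ _ _ _ _ _ _ _ H1. have L2 := Sp_Lp _ _ _ _ _ _ _ _ H2.
  split.
  - have -> : pc true (DD F) = (fun g => (fun g => Ci * PZ (pc true F) g) g + (fun g => (fun g => RtoC s * Lp (pc false F) g) g + (fun g => (- RtoC q0) * pc true F g) g) g)%C.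
    { apply: functional_extensionality => g. rewrite /DD /pc /= /Lps. ring. }
    apply: Sp_plus; [|apply: Sp_plus]; exact: Sp_scal.
  - have -> : pc false (DD F) = (fun g => (fun g => RtoC s * Lo (pc true F) g) g + (fun g => (fun g => (- Ci) * PZ (pc false F) g) g + (fun g => (- RtoC q0) * pc false F g) g) g)%C.
    { apply: functional_extensionality => g. rewrite /DD /pc /= /Los. ring. }
    apply: Sp_plus; [|apply: Sp_plus]; exact: Sp_scal.
Qed.

Lemma DD_lin c F H : VP F -> VP H -> DD (fun x => c * F x + H x)%C = (fun x => c * DD F x + DD H x)%C.
Proof.
  move=> [[F1 _] [F2 _]] [[H1 _] [H2 _]].
  have E1 : pc true (fun x => c * F x + H x)%C = (fun g => c * pc true F g + pc true H g)%C by [].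
  have E2 : pc false (fun x => c * F x + H x)%C = (fun g => c * pc false F g + pc false H g)%C by [].
  rewrite /DD E1 E2 /Los /Lps Lo_lin // Lp_lin // (proj2 (proj2 (PX_lin c _ _ F1 H1))) (proj2 (proj2 (PX_lin c _ _ F2 H2))).
  apply: functional_extensionality; case=> [[|] g] /=; ring.
Qed.

(** The diagonal terms are symmetric, being [Ci] times a skew field up to sign, and the off-diagonal
    ones are adjoint to each other. *)
Lemma DD_sym F H : VP F -> VP H -> ipP (DD F) H = ipP F (DD H).
Proof.
  move=> [F1 F2] [H1 H2].
  case: (Sp_fields _ _ _ _ _ _ _ _ F1) => [_ [_ ZF1]]. case: (Sp_fields _ _ _ _ _ _ _ _ F2) => [_ [_ ZF2]].
  case: (Sp_fields _ _ _ _ _ _ _ _ H1) => [_ [_ ZH1]]. case: (Sp_fields _ _ _ _ _ _ _ _ H2) => [_ [_ ZH2]].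
  have LF1 := Sp_Lo _ _ _ _ _ _ _ _ F1. have LF2 := Sp_Lp _ _ _ _ _ _ _ _ F2.
  have LH1 := Sp_Lo _ _ _ _ _ _ _ _ H1. have LH2 := Sp_Lp _ _ _ _ _ _ _ _ H2.
  have Dt : forall K, pc true (DD K) = (fun g => Ci * PZ (pc true K) g + (RtoC s * Lp (pc false K) g + (- RtoC q0) * pc true K g))%C.
  { move=> K. apply: functional_extensionality => g. change (pc true (DD K) g) with (Ci * PZ (pc true K) g + RtoC s * Lp (pc false K) g - RtoC q0 * pc true K g)%C. ring. }
  have Df : forall K, pc false (DD K) = (fun g => RtoC s * Lo (pc true K) g + ((- Ci) * PZ (pc false K) g + (- RtoC q0) * pc false K g))%C.
  { move=> K. apply: functional_extensionality => g. change (pc false (DD K) g) with (RtoC s * Lo (pc true K) g - Ci * PZ (pc false K) g - RtoC q0 * pc false K g)%C. ring. }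
  rewrite /ipP !Dt !Df.
  rewrite (ip_lin3_l _ _ PH _ _ _ _ _ _ _ ZF1 LF2 F1 H1) (ip_lin3_l _ _ PH _ _ _ _ _ _ _ LF1 ZF2 F2 H2).
  rewrite (ip_lin3_r _ _ PH _ _ _ _ _ _ _ ZH1 LH2 H1 F1) (ip_lin3_r _ _ PH _ _ _ _ _ _ _ LH1 ZH2 H2 F2).
  have Adj := Lo_adj a b w2 r e1 e2 e3 Ha Hw Hr He1 He2 He3.
  rewrite (proj2 (proj2 (Sp_parts a b w2 r e1 e2 e3 Hw Hr He1 He2 He3 _ _ F1 H1))).
  rewrite (proj2 (proj2 (Sp_parts a b w2 r e1 e2 e3 Hw Hr He1 He2 He3 _ _ F2 H2))).
  rewrite -(Adj _ _ F1 H2).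
  have E5 : ipm (Lp (pc false F)) (pc true H) = ipm (pc false F) (Lo (pc true H)).
  { rewrite (ph_conj _ _ PH _ _ H1 LF2) -(Adj _ _ H1 F2) (ph_conj _ _ PH _ _ F2 LH1). exact: Cconj_conj. }
  rewrite E5.
  have C1 : Cconj Ci = (- Ci)%C by Cring.
  have C2' : Cconj (- Ci) = Ci by Cring.
  have C3 : forall x, Cconj (RtoC x) = RtoC x by move=> x; Cring.
  have C4 : Cconj (- RtoC q0) = (- RtoC q0)%C by Cring.
  rewrite C1 C2' !C3 C4. ring.
Qed.

(* The quaternionic structure commuting with the Dirac operator; it exchanges opposite central characters. *)
Definition JJ (F : bool * G -> C) : bool * G -> C := mkp (fun g => - Cconj (pc false F g))%C (fun g => Cconj (pc true F g)).

Lemma VP_JJ F : VP F -> VP (JJ F).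
Proof.
  move=> [H1 H2]. split; last exact: Sp_conj.
  have -> : pc true (JJ F) = (fun g => (-1) * (fun g => Cconj (pc false F g)) g)%C by apply: functional_extensionality => g; rewrite /JJ /pc /=; ring.
  apply: Sp_scal. exact: Sp_conj.
Qed.

Lemma DD_JJ F : VP F -> DD (JJ F) = JJ (DD F).
Proof.
  move=> [[S1 _] [S2 _]].
  case: (fields_conj _ S1) => [A1 [A2 A3]]. case: (fields_conj _ S2) => [B1 [B2 B3]].
  have S2' := Sm_conj _ S2. have S0 := Sm_const 0%C.
  have E : pc true (JJ F) = (fun g => (-1) * (fun g => Cconj (pc false F g)) g + (fun _ => 0%C) g)%C by apply: functional_extensionality => g; rewrite /JJ /pc /=; ring.
  have Z0 : Cpartials (fun _ => 0%C) (fun _ => 0%C) (fun _ => 0%C) (fun _ => 0%C) by move=> x y z; split; [|split]; exact: CD_const.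
  case: (Cpartials_P _ _ _ _ Z0) => [Z1 [Z2 Z3]].
  have Q1 : PX (pc true (JJ F)) = (fun g => - Cconj (PX (pc false F) g))%C.
  { rewrite E (proj1 (PX_lin (-1)%C _ _ S2' S0)) B1 Z1. funring. }
  have Q2 : VY (pc true (JJ F)) = (fun g => - Cconj (VY (pc false F) g))%C.
  { rewrite E (VY_lin (-1)%C _ _ S2' S0) B2. apply: functional_extensionality => g. rewrite {2}/VY Z2 Z3. ring. }
  have Q3 : PZ (pc true (JJ F)) = (fun g => - Cconj (PZ (pc false F) g))%C.
  { rewrite E (proj2 (proj2 (PX_lin (-1)%C _ _ S2' S0))) B3 Z3. funring. }
  apply: functional_extensionality; case=> [[|] g].
  - change (Ci * PZ (pc true (JJ F)) g + RtoC s * - (PX (pc false (JJ F)) g + Ci * VY (pc false (JJ F)) g) - RtoC q0 * - Cconj (pc false F g)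
      = - Cconj (RtoC s * (PX (pc true F) g - Ci * VY (pc true F) g) - Ci * PZ (pc false F) g - RtoC q0 * pc false F g))%C.
    rewrite Q3 A1 A2. Cring.
  - change (RtoC s * (PX (pc true (JJ F)) g - Ci * VY (pc true (JJ F)) g) - Ci * PZ (pc false (JJ F)) g - RtoC q0 * Cconj (pc true F g)
      = Cconj (Ci * PZ (pc true F) g + RtoC s * - (PX (pc false F) g + Ci * VY (pc false F) g) - RtoC q0 * pc true F g))%C.
    rewrite Q1 Q2 A3. Cring.
Qed.

Lemma ipP_JJ F H : VP F -> VP H -> ipP (JJ F) (JJ H) = Cconj (ipP F H).
Proof.
  move=> [F1 F2] [H1 H2]. rewrite /ipP.
  have Q : forall u v, SpP u -> SpP v -> ipm (fun g => Cconj (u g)) (fun g => Cconj (v g)) = Cconj (ipm u v).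
  { move=> u v Hu Hv. rewrite /ip -CI_conj; last by apply: CcontG_prod; exact: (Sp_cont a b w2 r e1 e2 e3).
    - f_equal. apply: functional_extensionality => g. Cring.
    - exact: Hw. - exact: Hr. }
  have E : forall K, pc true (JJ K) = (fun g => (-1) * (fun g => Cconj (pc false K g)) g)%C by move=> K; apply: functional_extensionality => g; rewrite /JJ /pc /=; ring.
  have E' : forall K, pc false (JJ K) = (fun g => Cconj (pc true K g)) by [].
  have SC := Sp_conj a b w2 r e1 e2 e3.
  rewrite !E !E' (ph_ip_scal _ _ PH); [|exact: SC|by apply: Sp_scal; exact: SC]. rewrite (ip_scal_r _ _ PH); [|exact: SC|exact: SC].
  rewrite !Q //. Cring.
Qed.

Lemma JJ_JJ F : JJ (JJ F) = (fun x => (-1) * F x)%C.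
Proof. apply: functional_extensionality; case=> [[|] g]; rewrite /JJ /pc /=; Cring. Qed.

Lemma JJ_lin c F H : JJ (fun x => c * F x + H x)%C = (fun x => Cconj c * JJ F x + JJ H x)%C.
Proof. apply: functional_extensionality; case=> [[|] g]; rewrite /JJ /pc /=; Cring. Qed.
End Pairs.

(** * Eigenspinors with nonzero central character *)

Lemma Ci_Ci : (Ci * Ci = - 1)%C. Proof. Cring. Qed.
Lemma Cconj_RtoC x : Cconj (RtoC x) = RtoC x. Proof. Cring. Qed.
Lemma fun_scal0 {X} (u : X -> C) c : (fun x => c * u x + (fun _ => 0%C) x)%C = (fun x => c * u x)%C.
Proof. funring. Qed.

Lemma Sm_PZ_scal c u : Sm u -> PZ (fun g => c * u g)%C = (fun g => c * PZ u g)%C.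
Proof. move=> Hu. exact: (proj2 (proj2 (Cpartials_P _ _ _ _ (Cpartials_scal c _ _ _ _ (Sm_partials _ Hu))))). Qed.
Lemma PZ_zero : PZ (fun _ => 0%C) = fun _ => 0%C.
Proof.
  have Z0 : Cpartials (fun _ => 0%C) (fun _ => 0%C) (fun _ => 0%C) (fun _ => 0%C) by move=> x y z; split; [|split]; exact: CD_const.
  exact: (proj2 (proj2 (Cpartials_P _ _ _ _ Z0))).
Qed.

Section Level.
Variables (a w2 r k c b nu e1 e2 e3 s q0 : R) (d : nat).
Hypotheses (Ha : 0 < a) (Hw : 0 < w2) (Hr : 0 < r) (Hk : 0 < k) (Hs : 0 < s) (Hd : (0 < d)%nat) (Hb : b = c * w2) (Hka : k * a * w2 = 2 * PI * INR d)
  (He1 : e1 * e1 = 1) (He2 : e2 * e2 = 1) (He3 : e3 * e3 = 1) (Hnu : cis (2 * PI * nu - k * c * w2 ^ 2 / 2) = RtoC e2) (Hkr : cis (k * r) = RtoC e3).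
Notation SpP := (Sp a b w2 r e1 e2 e3).
Notation ipm := (ip a w2 r).
Notation LK := (lambda_k a w2 k b e1 e2).
Notation th := (theta a w2 k c nu e1 d).
Notation Los := (Los s).
Notation Lps := (Lps s).
(** The scalar by which the commutator of [Los] and [Lps] acts at central frequency [k]: it is
    [-2 i s^2 Z] with [Z = i k]. *)
Let sg := 2 * k * s ^ 2.

Lemma LK_Sp u : LK u -> SpP u.
Proof. move=> [H1 [H2 [H3 H4]]]. split => //. split => //. split => //. rewrite -Hkr. exact: (proj1 (mode_inv k u) H4). Qed.

Lemma LK_zero : LK (fun _ => 0%C).
Proof.
  have := lambda_k_scal a w2 k b e1 e2 0%C _ (theta_lambda_k a w2 k c b nu e1 e2 d Ha Hw Hk Hd Hb Hka He1 Hnu 0%nat).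
  congr (lambda_k _ _ _ _ _ _ _). funring.
Qed.

Lemma LK_prehilbert : prehilbert LK ipm.
Proof.
  apply: (prehilbert_sub _ _ _ (Sp_prehilbert a b w2 r e1 e2 e3 Ha Hw Hr He1 He2 He3)); [exact: LK_Sp|exact: lambda_k_plus|exact: lambda_k_scal|exact: LK_zero].
Qed.

Lemma sg_pos : 0 < sg.
Proof. rewrite /sg. have : 0 < s ^ 2 by apply: pow_lt. nra. Qed.

Lemma LK_Los u : LK u -> LK (Los u).
Proof. move=> Hu. apply: lambda_k_scal. exact: lambda_k_Lo. Qed.
Lemma LK_Lps u : LK u -> LK (Lps u).
Proof. move=> Hu. apply: lambda_k_scal. exact: lambda_k_Lp. Qed.
Lemma Los_lin q u v : LK u -> LK v -> Los (fun g => q * u g + v g)%C = (fun g => q * Los u g + Los v g)%C.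
Proof. move=> [Hu _] [Hv _]. rewrite /Los Lo_lin //. funring. Qed.
Lemma Lps_lin q u v : LK u -> LK v -> Lps (fun g => q * u g + v g)%C = (fun g => q * Lps u g + Lps v g)%C.
Proof. move=> [Hu _] [Hv _]. rewrite /Lps Lp_lin //. funring. Qed.
Lemma Los_adj u v : LK u -> LK v -> ipm (Los u) v = ipm u (Lps v).
Proof.
  move=> Hu Hv. have U := lambda_k_Lo _ _ _ _ _ _ _ Hu. have V := lambda_k_Lp _ _ _ _ _ _ _ Hv.
  rewrite /Los /Lps (ph_ip_scal _ _ LK_prehilbert _ _ _ U Hv) (ip_scal_r _ _ LK_prehilbert _ _ _ V Hu) Cconj_RtoC.
  by rewrite (Lo_adj a b w2 r e1 e2 e3 Ha Hw Hr He1 He2 He3 u v (LK_Sp _ Hu) (LK_Sp _ Hv)).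
Qed.
Lemma Los_comm u : LK u -> Los (Lps u) = (fun g => Lps (Los u) g + RtoC sg * u g)%C.
Proof.
  move=> Hu. have Su := proj1 Hu. have U := lambda_k_Lo _ _ _ _ _ _ _ Hu. have V := lambda_k_Lp _ _ _ _ _ _ _ Hu. have S0 := Sm_const 0%C.
  have Lo0 : Lo (fun _ => 0%C) = (fun _ => 0%C) /\ Lp (fun _ => 0%C) = (fun _ => 0%C).
  { split; [have := Lo_lin (-1)%C _ _ S0 S0|have := Lp_lin (-1)%C _ _ S0 S0];
    (have -> : (fun _ : G => (-1) * 0 + 0)%C = (fun _ => 0%C) by funring) => ->;
    funring. }
  have A1 : Los (Lps u) = (fun g => RtoC s * (RtoC s * Lo (Lp u) g))%C.
  { rewrite /Los /Lps. have := Lo_lin (RtoC s) _ _ (proj1 V) S0. rewrite fun_scal0 (proj1 Lo0) => ->. funring. }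
  have A2 : Lps (Los u) = (fun g => RtoC s * (RtoC s * Lp (Lo u) g))%C.
  { rewrite /Los /Lps. have := Lp_lin (RtoC s) _ _ (proj1 U) S0. rewrite fun_scal0 (proj2 Lo0) => ->. funring. }
  rewrite A1 A2 Lo_Lp_comm // (mode_PZ _ _ _ _ _ _ _ Hu). apply: functional_extensionality => g.
  have -> : RtoC sg = (2 * RtoC k * (RtoC s * RtoC s))%C by rewrite /sg /= -!RtoC_mult; congr RtoC; ring.
  transitivity (RtoC s * (RtoC s * Lp (Lo u) g) - 2 * (Ci * Ci) * RtoC k * (RtoC s * RtoC s) * u g)%C; first ring. rewrite Ci_Ci. ring.
Qed.
Lemma LK_th j : LK (th j).
Proof. exact: (theta_lambda_k a w2 k c b nu e1 e2 d Ha Hw Hk Hd Hb Hka He1 Hnu j). Qed.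
Lemma Los_th j : Los (th j) = fun _ => 0%C.
Proof. rewrite /Los (Lo_theta a w2 k c nu e1 d Ha Hw Hk Hd Hka He1 j). funring. Qed.

Definition Rn (n j : nat) : G -> C := Lpn Lps n (th j).

Lemma LK_Rn n j : LK (Rn n j).
Proof. apply: V_Lpn; [exact: LK_Lps|exact: LK_th]. Qed.
Lemma Rn_orth n j n' j' : (j < d)%nat -> (j' < d)%nat -> (n <> n' \/ j <> j') -> ipm (Rn n j) (Rn n' j') = 0%C.
Proof.
  move=> Hj Hj' H. apply: (rung_orth LK ipm LK_prehilbert Los Lps sg d th LK_Los LK_Lps Los_lin Lps_lin Los_adj Los_comm (fun j _ => LK_th j) (fun j _ => Los_th j)) => //.
  exact: (theta_orth a w2 r k c b nu e1 e2 d Ha Hw Hk Hd Hb Hka He1 Hnu).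
Qed.
Lemma Rn_nonzero n j : (j < d)%nat -> Rn n j <> fun _ => 0%C.
Proof.
  move=> Hj. apply: (Lpn_nonzero LK ipm LK_prehilbert Los Lps sg d th sg_pos LK_Lps Los_lin Lps_lin Los_comm (fun j _ => LK_th j) (fun j _ => Los_th j)) => //.
  exact: (theta_nonzero a w2 k c nu e1 d Ha Hw Hk Hd He1 j Hj).
Qed.
Lemma Los_Rn n j : (j < d)%nat -> Los (Rn (S n) j) = (fun g => RtoC (INR (S n) * sg) * Rn n j g)%C.
Proof.
  move=> Hj. exact: (Lo_Lpn LK ipm LK_prehilbert Los Lps sg d th LK_Lps Lps_lin Los_comm (fun j _ => LK_th j) (fun j _ => Los_th j) j n Hj).
Qed.
Lemma Rn_dense u e : LK u -> 0 < e -> exists w, span (fun v => exists n j, (j < d)%nat /\ v = Rn n j) w /\ n2 ipm (fun g => u g - w g)%C < e.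
Proof.
  apply: (ladder_dense LK ipm LK_prehilbert Los Lps sg d th sg_pos LK_Los LK_Lps Los_lin Lps_lin Los_adj Los_comm (fun j _ => LK_th j) (fun j _ => Los_th j)).
  move=> v Hv. case: (solve a w2 r k c b nu e1 e2 d Ha Hw Hr Hk Hd Hb Hka He1 Hnu v Hv) => cs [GG [HG E]].
  (* [solve] concerns [Lp], the ladder uses [Lps = s Lp]. *)
  exists cs, (fun g => RtoC (/ s) * GG g)%C. split; first exact: lambda_k_scal.
  have E0 := Lp_lin (RtoC (/ s)) _ _ (proj1 HG) (Sm_const 0%C). rewrite fun_scal0 in E0.
  have L0 : Lp (fun _ => 0%C) = (fun _ => 0%C).
  { have S0 := Sm_const 0%C. have := Lp_lin (-1)%C _ _ S0 S0. have -> : (fun _ : G => (-1) * 0 + 0)%C = (fun _ => 0%C) by funring.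
    move=> ->. funring. }
  rewrite {1}E /Lps E0 L0. apply: functional_extensionality => g.
  transitivity (csum (fun j => cs j * th j g) d + (RtoC s * RtoC (/ s)) * Lp GG g)%C; last ring.
  rewrite -RtoC_mult Rinv_r; last lra. ring.
Qed.

(* Ground and excited eigenspinors; for [lv], [La] is either square root of [k ^ 2 + (n + 1) * sg]. *)
Definition gv (j : nat) : bool * G -> C := mkp (Rn 0 j) (fun _ => 0%C).
Definition lv (n : nat) (La : R) (j : nat) : bool * G -> C := mkp (Rn (S n) j) (fun g => RtoC (La + k) * Rn n j g)%C.

Notation VPP := (VP a b w2 r e1 e2 e3).
Notation D := (DD s q0).

Lemma VP_gv j : VPP (gv j).
Proof. apply: VP_mkp; [apply: LK_Sp; exact: LK_Rn|exact: Sp_zero]. Qed.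
Lemma VP_lv n La j : VPP (lv n La j).
Proof. apply: VP_mkp; [|apply: Sp_scal]; apply: LK_Sp; exact: LK_Rn. Qed.
Lemma gv_nonzero j : (j < d)%nat -> gv j <> fun _ => 0%C.
Proof. move=> Hj E. apply: (Rn_nonzero 0 j Hj). exact: (f_equal (fun F g => F (true, g)) E). Qed.
Lemma lv_nonzero n La j : (j < d)%nat -> lv n La j <> fun _ => 0%C.
Proof. move=> Hj E. apply: (Rn_nonzero (S n) j Hj). exact: (f_equal (fun F g => F (true, g)) E). Qed.

Lemma gv_PZ j i : PZ (pc i (gv j)) = (fun g => Ci * RtoC k * pc i (gv j) g)%C.
Proof.
  case: i; first exact: (mode_PZ _ _ _ _ _ _ _ (LK_Rn 0 j)).
  change (PZ (fun _ => 0%C) = (fun g => Ci * RtoC k * 0)%C). rewrite PZ_zero. funring.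
Qed.
Lemma lv_PZ n La j i : PZ (pc i (lv n La j)) = (fun g => Ci * RtoC k * pc i (lv n La j) g)%C.
Proof.
  case: i; first exact: (mode_PZ _ _ _ _ _ _ _ (LK_Rn (S n) j)).
  exact: (mode_PZ _ _ _ _ _ _ _ (lambda_k_scal _ _ _ _ _ _ (RtoC (La + k)) _ (LK_Rn n j))).
Qed.

Lemma DD_gv j : D (gv j) = (fun x => RtoC (- k - q0) * gv j x)%C.
Proof.
  apply: functional_extensionality; case=> [[|] g].
  - change (Ci * PZ (Rn 0 j) g + Lps (fun _ => 0%C) g - RtoC q0 * Rn 0 j g = RtoC (- k - q0) * Rn 0 j g)%C.
    have -> : Lps (fun _ => 0%C) = (fun _ => 0%C).
    { have L0 := LK_zero. have := Lps_lin (-1)%C _ _ L0 L0. have -> : (fun _ : G => (-1) * 0 + 0)%C = (fun _ => 0%C) by funring.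
      move=> ->. funring. }
    rewrite (mode_PZ _ _ _ _ _ _ _ (LK_Rn 0 j)) RtoC_minus RtoC_opp.
    transitivity ((Ci * Ci) * RtoC k * Rn 0 j g - RtoC q0 * Rn 0 j g)%C; first ring. rewrite Ci_Ci. ring.
  - change (Los (th j) g - Ci * PZ (fun _ => 0%C) g - RtoC q0 * 0 = RtoC (- k - q0) * 0)%C. rewrite Los_th PZ_zero. ring.
Qed.

(** On combinations of [Rn (S n) j] above and [Rn n j] below, the operator without its constant is
    the matrix with rows [(- k, 1)] and [((n + 1) sg, k)]. Its eigenvectors are [(1, La + k)] for
    the two square roots [La]. *)
Lemma DD_lv n La j : (j < d)%nat -> La ^ 2 = k ^ 2 + INR (S n) * sg -> D (lv n La j) = (fun x => RtoC (La - q0) * lv n La j x)%C.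
Proof.
  move=> Hj HLa. have HR := LK_Rn n j. have HR' := LK_Rn (S n) j.
  apply: functional_extensionality; case=> [[|] g].
  - change (Ci * PZ (Rn (S n) j) g + Lps (fun g => RtoC (La + k) * Rn n j g)%C g - RtoC q0 * Rn (S n) j g = RtoC (La - q0) * Rn (S n) j g)%C.
    have -> : Lps (fun g => RtoC (La + k) * Rn n j g)%C = (fun g => RtoC (La + k) * Rn (S n) j g)%C.
    { have := Lps_lin (RtoC (La + k)) _ _ HR LK_zero. rewrite fun_scal0 => ->.
      have := Lps_lin (-1)%C _ _ LK_zero LK_zero. have -> : (fun _ : G => (-1) * 0 + 0)%C = (fun _ => 0%C) by funring.
      move=> E0. apply: functional_extensionality => h. have E := f_equal (fun f => f h) E0. cbv beta in E. rewrite E. change (Lps (Rn n j) h) with (Rn (S n) j h). ring. }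
    rewrite (mode_PZ _ _ _ _ _ _ _ HR') RtoC_minus RtoC_plus.
    transitivity ((Ci * Ci) * RtoC k * Rn (S n) j g + (RtoC La + RtoC k) * Rn (S n) j g - RtoC q0 * Rn (S n) j g)%C; first ring. rewrite Ci_Ci. ring.
  - change (Los (Rn (S n) j) g - Ci * PZ (fun g => RtoC (La + k) * Rn n j g)%C g - RtoC q0 * (RtoC (La + k) * Rn n j g) = RtoC (La - q0) * (RtoC (La + k) * Rn n j g))%C.
    rewrite Los_Rn // Sm_PZ_scal; last exact: (proj1 HR). rewrite (mode_PZ _ _ _ _ _ _ _ HR).
    transitivity ((RtoC (INR (S n) * sg) - (Ci * Ci) * RtoC k * RtoC (La + k) - RtoC q0 * RtoC (La + k)) * Rn n j g)%C; first ring. rewrite Ci_Ci.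
    have -> : INR (S n) * sg = La ^ 2 - k ^ 2 by lra. rewrite !RtoC_minus !RtoC_plus !RtoC_pow. ring.
Qed.

Lemma gv_orth j j' : (j < d)%nat -> (j' < d)%nat -> j <> j' -> ipP a w2 r (gv j) (gv j') = 0%C.
Proof.
  move=> Hj Hj' H. change (ipm (Rn 0 j) (Rn 0 j') + ipm (fun _ => 0%C) (fun _ => 0%C) = 0)%C.
  rewrite Rn_orth; [|exact: Hj|exact: Hj'|by right]. rewrite (ip_zero_l _ _ LK_prehilbert); last exact: LK_zero. ring.
Qed.
Lemma gv_lv_orth j n La j' : (j < d)%nat -> (j' < d)%nat -> ipP a w2 r (gv j) (lv n La j') = 0%C.
Proof.
  move=> Hj Hj'. change (ipm (Rn 0 j) (Rn (S n) j') + ipm (fun _ => 0%C) (fun g => RtoC (La + k) * Rn n j' g)%C = 0)%C.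
  rewrite Rn_orth; [|exact: Hj|exact: Hj'|by left]. rewrite (ip_zero_l _ _ LK_prehilbert); last by apply: lambda_k_scal; exact: LK_Rn. ring.
Qed.
(** The two eigenspinors with the same [n] and [j] but opposite roots are not covered here; they are
    separated later by their eigenvalues. *)
Lemma lv_orth n La j n' La' j' : (j < d)%nat -> (j' < d)%nat -> (n <> n' \/ j <> j') -> ipP a w2 r (lv n La j) (lv n' La' j') = 0%C.
Proof.
  move=> Hj Hj' H. change (ipm (Rn (S n) j) (Rn (S n') j') + ipm (fun g => RtoC (La + k) * Rn n j g)%C (fun g => RtoC (La' + k) * Rn n' j' g)%C = 0)%C.
  have H1 := LK_Rn n j. have H2 := LK_Rn n' j'.
  rewrite (ph_ip_scal _ _ LK_prehilbert); [|exact: H1|exact: lambda_k_scal]. rewrite (ip_scal_r _ _ LK_prehilbert); [|exact: H2|exact: H1].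
  rewrite !Rn_orth //; last (case: H => H; [left; lia|by right]). ring.
Qed.

(* [lv n La j] and [lv n (- La) j] together span [mkp (Rn (S n) j) 0] and [mkp 0 (Rn n j)]. *)
Lemma LK_adherent (B : (bool * G -> C) -> Prop) (HB : forall v, B v -> VPP v) :
  (forall j, (j < d)%nat -> B (gv j)) ->
  (forall n j, (j < d)%nat -> B (lv n (sqrt (k ^ 2 + INR (S n) * sg)) j) /\ B (lv n (- sqrt (k ^ 2 + INR (S n) * sg)) j)) ->
  forall u, LK u -> adherent VPP (ipP a w2 r) B (mkp u (fun _ => 0%C)) /\ adherent VPP (ipP a w2 r) B (mkp (fun _ => 0%C) u).
Proof.
  move=> Bg Bl. have P := VP_prehilbert a b w2 r e1 e2 e3 Ha Hw Hr He1 He2 He3.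
  have S2 : forall n j, (j < d)%nat -> span B (mkp (fun _ => 0%C) (Rn n j)).
  { move=> n j Hj. case: (Bl n j Hj) => B1 B2. set La := sqrt _ in B1 B2.
    have HLa : 0 < La. { apply: sqrt_lt_R0. have := pow_lt k 2 Hk. have := sg_pos. have := pos_INR (S n). nra. }
    (* The second components of the two eigenspinors are multiples by [La + k] and [- La + k]; their
       difference [2 La] gives the coefficients. *)
    have -> : mkp (fun _ => 0%C) (Rn n j) = (fun x => (fun x => RtoC (/ (2 * La)) * lv n La j x) x + (fun x => RtoC (- / (2 * La)) * lv n (- La) j x) x)%C.
    { apply: functional_extensionality; case=> [[|] g].
      - change (RtoC 0 = RtoC (/ (2 * La)) * Rn (S n) j g + RtoC (- / (2 * La)) * Rn (S n) j g)%C. rewrite RtoC_opp. ring.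
      - change (Rn n j g = RtoC (/ (2 * La)) * (RtoC (La + k) * Rn n j g) + RtoC (- / (2 * La)) * (RtoC (- La + k) * Rn n j g))%C.
        transitivity (RtoC (/ (2 * La) * (La + k) + - / (2 * La) * (- La + k)) * Rn n j g)%C.
        + have -> : / (2 * La) * (La + k) + - / (2 * La) * (- La + k) = 1 by field; lra. ring.
        + rewrite RtoC_plus !RtoC_mult. ring. }
    apply: span_plus; apply: span_scal; exact: span_base. }
  have S1 : forall n j, (j < d)%nat -> span B (mkp (Rn n j) (fun _ => 0%C)).
  { move=> [|n] j Hj; first by apply: span_base; exact: Bg. case: (Bl n j Hj) => B1 _. set La := sqrt _ in B1.
    have -> : mkp (Rn (S n) j) (fun _ => 0%C) = (fun x => lv n La j x + (fun x => RtoC (- (La + k)) * mkp (fun _ => 0%C) (Rn n j) x) x)%C.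
    { apply: functional_extensionality; case=> [[|] g].
      - change (Rn (S n) j g = Rn (S n) j g + RtoC (- (La + k)) * 0)%C. ring.
      - change (RtoC 0 = RtoC (La + k) * Rn n j g + RtoC (- (La + k)) * Rn n j g)%C. rewrite RtoC_opp. ring. }
    apply: span_plus; first exact: span_base. apply: span_scal. exact: S2. }
  have N2 : forall u, LK u -> n2 (ipP a w2 r) (mkp u (fun _ => 0%C)) = n2 ipm u /\ n2 (ipP a w2 r) (mkp (fun _ => 0%C) u) = n2 ipm u.
  { move=> u Hu. have Z : ipm (fun _ => 0%C) (fun _ => 0%C) = 0%C by apply: (ip_zero_l _ _ LK_prehilbert); exact: LK_zero.
    split; rewrite /n2.
    - change (Re (ipm u u + ipm (fun _ => 0%C) (fun _ => 0%C))%C = Re (ipm u u)). rewrite Z Re_Cplus /=. ring.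
    - change (Re (ipm (fun _ => 0%C) (fun _ => 0%C) + ipm u u)%C = Re (ipm u u)). rewrite Z Re_Cplus /=. ring. }
  move=> u Hu. have VS : forall w, span (fun v => exists n j, (j < d)%nat /\ v = Rn n j) w -> LK w.
  { move=> w. apply: (V_span LK ipm LK_prehilbert) => v [n [j [_ ->]]]. exact: LK_Rn. }
  split.
  - split; first by apply: VP_mkp; [exact: LK_Sp|exact: Sp_zero]. move=> e He. case: (Rn_dense u e Hu He) => w [Hw' Hlt].
    exists (mkp w (fun _ => 0%C)). split.
    + elim: Hw' {Hlt} => [|q v w' [n [j [Hj ->]]] _ IH].
      * have -> : mkp (fun _ => 0%C) (fun _ => 0%C) = (fun _ => 0%C) by apply: functional_extensionality; case=> [[|] g]. exact: span_zero.
      * have -> : mkp (fun x => q * Rn n j x + w' x)%C (fun _ => 0%C) = (fun x => (fun x => q * mkp (Rn n j) (fun _ => 0%C) x) x + mkp w' (fun _ => 0%C) x)%C.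
        { apply: functional_extensionality; case=> [[|] g] //=. ring. }
        apply: span_plus => //. apply: span_scal. exact: S1.
    + have -> : (fun x => mkp u (fun _ => 0%C) x - mkp w (fun _ => 0%C) x)%C = mkp (fun g => u g - w g)%C (fun _ => 0%C).
      { apply: functional_extensionality; case=> [[|] g] //=. ring. }
      rewrite (proj1 (N2 _ _)) //. apply: (V_sub LK ipm LK_prehilbert) => //. exact: VS.
  - split; first by apply: VP_mkp; [exact: Sp_zero|exact: LK_Sp]. move=> e He. case: (Rn_dense u e Hu He) => w [Hw' Hlt].
    exists (mkp (fun _ => 0%C) w). split.
    + elim: Hw' {Hlt} => [|q v w' [n [j [Hj ->]]] _ IH].
      * have -> : mkp (fun _ => 0%C) (fun _ => 0%C) = (fun _ => 0%C) by apply: functional_extensionality; case=> [[|] g]. exact: span_zero.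
      * have -> : mkp (fun _ => 0%C) (fun x => q * Rn n j x + w' x)%C = (fun x => (fun x => q * mkp (fun _ => 0%C) (Rn n j) x) x + mkp (fun _ => 0%C) w' x)%C.
        { apply: functional_extensionality; case=> [[|] g] //=. ring. }
        apply: span_plus => //. apply: span_scal. exact: S2.
    + have -> : (fun x => mkp (fun _ => 0%C) u x - mkp (fun _ => 0%C) w x)%C = mkp (fun _ => 0%C) (fun g => u g - w g)%C.
      { apply: functional_extensionality; case=> [[|] g] //=. ring. }
      rewrite (proj2 (N2 _ _)) //. apply: (V_sub LK ipm LK_prehilbert) => //. exact: VS.
Qed.
End Level.

(** * Density of the eigenspinors *)

Definition zinv (u : G -> C) : Prop := forall x y z, u (x, y, z) = u (x, y, 0).

Section Fourier.
Variables (a b w2 r e1 e2 e3 s q0 rho1 rho2 rho3 : R).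
Hypotheses (Ha : 0 < a) (Hw : 0 < w2) (Hr : 0 < r) (Hs : 0 < s)
  (He1 : e1 * e1 = 1) (He2 : e2 * e2 = 1) (He3 : e3 * e3 = 1)
  (Hc1 : cis (2 * PI * rho1) = RtoC e1) (Hc2 : cis (2 * PI * rho2) = RtoC e2) (Hc3 : cis (2 * PI * rho3) = RtoC e3).
Notation SpP := (Sp a b w2 r e1 e2 e3).
Notation ipm := (ip a w2 r).
Notation VPP := (VP a b w2 r e1 e2 e3).
Notation ipPP := (ipP a w2 r).
Let PH := Sp_prehilbert a b w2 r e1 e2 e3 Ha Hw Hr He1 He2 He3.
Let PP := VP_prehilbert a b w2 r e1 e2 e3 Ha Hw Hr He1 He2 He3.

Section Good.
Variables (B : (bool * G -> C) -> Prop).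
Hypothesis (HB : forall v, B v -> VPP v).
Notation Ad := (adherent VPP ipPP B).

(** Density is a statement about pairs, but the Fourier decomposition acts on one scalar at a time;
    this is the scalar form, with [u] placed in either component. *)
Definition good (u : G -> C) : Prop := Ad (mkp u (fun _ => 0%C)) /\ Ad (mkp (fun _ => 0%C) u).

Lemma good_Sp u : good u -> SpP u.
Proof. by move=> [[[H _] _] _]. Qed.

Lemma good_plus u v : good u -> good v -> good (fun g => u g + v g)%C.
Proof.
  move=> [U1 U2] [V1 V2]. split.
  - have -> : mkp (fun g => u g + v g)%C (fun _ => 0%C) = (fun x => mkp u (fun _ => 0%C) x + mkp v (fun _ => 0%C) x)%C.
    { apply: functional_extensionality; case=> [[|] g] //=. ring. } by apply: (adherent_plus VPP ipPP PP B HB).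
  - have -> : mkp (fun _ => 0%C) (fun g => u g + v g)%C = (fun x => mkp (fun _ => 0%C) u x + mkp (fun _ => 0%C) v x)%C.
    { apply: functional_extensionality; case=> [[|] g] //=. ring. } by apply: (adherent_plus VPP ipPP PP B HB).
Qed.

Lemma good_scal c u : good u -> good (fun g => c * u g)%C.
Proof.
  move=> [U1 U2]. split.
  - have -> : mkp (fun g => c * u g)%C (fun _ => 0%C) = (fun x => c * mkp u (fun _ => 0%C) x)%C.
    { apply: functional_extensionality; case=> [[|] g] //=. ring. } by apply: (adherent_scal VPP ipPP PP B HB).
  - have -> : mkp (fun _ => 0%C) (fun g => c * u g)%C = (fun x => c * mkp (fun _ => 0%C) u x)%C.
    { apply: functional_extensionality; case=> [[|] g] //=. ring. } by apply: (adherent_scal VPP ipPP PP B HB).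
Qed.

Lemma good_csum (f : nat -> G -> C) n : good (f 0%nat) -> (forall i, good (f i)) -> good (fun g => csum (fun i => f i g) n).
Proof.
  move=> H0 H. elim: n => [|n IH] /=; last exact: (good_plus _ _ IH (H n)).
  have -> : (fun _ : G => RtoC 0) = (fun g => 0 * f 0%nat g)%C by funring. exact: good_scal.
Qed.

Lemma good_fejer (f : Z -> G -> C) c N : (forall m, good (f m)) -> good (fun g => c * fejer (fun m => f m g) N)%C.
Proof.
  move=> H. apply: good_scal.
  have Q : forall n, good (fun g => zpart (fun m => f m g) n).
  { move=> n. apply: good_plus => //. apply: (good_csum (fun i g => f (Z.of_nat (S i)) g + f (- Z.of_nat (S i))%Z g)%C) => [|i]; exact: good_plus. }
  exact: (good_csum (fun n g => zpart (fun m => f m g) n)).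
Qed.

Lemma n2_mkp u v : n2 ipPP (mkp u v) = n2 ipm u + n2 ipm v.
Proof. by []. Qed.

Lemma good_limit u : SpP u -> (forall e, 0 < e -> exists w, good w /\ forall g, in_box a w2 r g -> Cmod (u g - w g)%C <= e) -> good u.
Proof.
  move=> Hu Hl. have V := a * w2 * r. have V0 : 0 < a * w2 * r by repeat apply: Rmult_lt_0_compat.
  have Q : forall e, 0 < e -> exists w, good w /\ n2 ipm (fun g => u g - w g)%C < e.
  (* A uniform error [e'] has squared norm at most [e'^2] times the volume [a * w2 * r]; since
     [e' <= 1], this is at most [e / 2]. *)
  { move=> e He. set e' := Rmin 1 (e / (2 * (a * w2 * r))).
    have He' : 0 < e'. { apply: Rmin_pos; first lra. apply: Rdiv_lt_0_compat; lra. }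
    case: (Hl e' He') => w [Hg Hb]. exists w. split => //. have Sw := good_Sp _ Hg.
    have Sd := V_sub SpP ipm PH u w Hu Sw.
    rewrite /n2 ip_self; last exact: (Sp_cont a b w2 r e1 e2 e3). change (Re (RtoC ?x)) with x.
    have : I3 a w2 r (fun g => Cmod (u g - w g)%C ^ 2) <= I3 a w2 r (fun _ => e' ^ 2).
    { apply: I3_le => //; [by apply: (contG_Cmod2 (fun g => u g - w g)%C); exact: (Sp_cont a b w2 r e1 e2 e3)|by move=> g; apply: continuous_const|].
      move=> g Hbg. apply: pow_incr. split; [exact: Cmod_ge_0|exact: Hb]. }
    rewrite I3_const.
    have L1 : e' <= 1 by exact: Rmin_l. have L2 : e' <= e / (2 * (a * w2 * r)) by exact: Rmin_r.
    have L3 : a * w2 * r * e' <= e / 2.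
    { apply: Rle_trans (Rmult_le_compat_l _ _ _ (Rlt_le _ _ V0) L2) _. right. field. lra. }
    have L4 : e' ^ 2 <= e' by nra. have := Rmult_le_compat_l _ _ _ (Rlt_le _ _ V0) L4. lra. }
  have Z0 : n2 ipm (fun _ => 0%C) = 0 by exact: (n2_zero SpP ipm PH).
  split.
  - apply: (adherent_limit VPP ipPP PP B HB); first by apply: VP_mkp; [done|exact: Sp_zero]. move=> e He. case: (Q e He) => w [[Hg _] Hlt].
    exists (mkp w (fun _ => 0%C)). split => //.
    have -> : (fun x => mkp u (fun _ => 0%C) x - mkp w (fun _ => 0%C) x)%C = mkp (fun g => u g - w g)%C (fun _ => 0%C).
    { apply: functional_extensionality; case=> [[|] g] //=. ring. } rewrite n2_mkp Z0. lra.
  - apply: (adherent_limit VPP ipPP PP B HB); first by apply: VP_mkp; [exact: Sp_zero|done]. move=> e He. case: (Q e He) => w [[_ Hg] Hlt].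
    exists (mkp (fun _ => 0%C) w). split => //.
    have -> : (fun x => mkp (fun _ => 0%C) u x - mkp (fun _ => 0%C) w x)%C = mkp (fun _ => 0%C) (fun g => u g - w g)%C.
    { apply: functional_extensionality; case=> [[|] g] //=. ring. } rewrite n2_mkp Z0. lra.
Qed.

Lemma good_tproj sh rho u : SpP u -> (forall g, u (gsh sh 1 g) = cis (2 * PI * rho) * u g)%C -> (forall m, good (tproj sh rho u m)) -> good u.
Proof.
  move=> Hu Hsh Hg. apply: good_limit => // e He. case: (tproj_approx a w2 r sh rho u (proj1 Hu) Hsh e He) => N [HN Hb].
  exists (fun g => RtoC (/ INR N) * fejer (fun m => tproj sh rho u m g) N)%C. split => //. exact: (good_fejer (fun m => tproj sh rho u m)).
Qed.
End Good.

Lemma Sp_tproj sh rho u m : SpP u -> (forall gm t g, u (gsh sh t (gmul gm g)) = u (gmul gm (gsh sh t g))) -> SpP (tproj sh rho u m).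
Proof.
  move=> [S1 [A1 [B1 C1]]] H. split; first exact: Sm_tproj. split; [|split] => g; apply: tproj_equiv => //.
Qed.

Lemma Sp_zproj u m : SpP u -> SpP (tproj (0, 0, r) rho3 u m) /\ mode (2 * PI * (IZR m + rho3) / r) (tproj (0, 0, r) rho3 u m).
Proof.
  move=> Hu. split.
  - apply: Sp_tproj => // [[[p q] t']] t [[x y] z]. rewrite /gsh /gmul. congr u. apply: triple_eq; ring.
  - move=> x y z. have := tproj_shift (0, 0, r) rho3 u m (proj1 Hu).
    have Hsh : forall g, u (gsh (0, 0, r) 1 g) = (cis (2 * PI * rho3) * u g)%C.
    { move=> [[x' y'] z']. rewrite Hc3 -(proj2 (proj2 (proj2 Hu))) /gsh /gmul. congr u. apply: triple_eq; ring. }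
    move=> /(_ Hsh (z / r) (x, y, 0)). rewrite /gsh.
    have -> : (x + z / r * 0, y + z / r * 0, 0 + z / r * r) = (x, y, z) :> G by apply: triple_eq; field; lra.
    move=> ->. congr (cis _ * _)%C. field. lra.
Qed.

Definition character (al be : R) : G -> C := fun g => cis (2 * PI * (al * fst (fst g) + be * snd (fst g))).

Lemma character_Sm al be : Sm (character al be).
Proof.
  move=> n. apply: CK_cis. case: (Ck_coord n) => [H1 [H2 _]]. apply: Ck_mult; first exact: Ck_const. apply: Ck_plus; apply: Ck_mult => //; exact: Ck_const.
Qed.
Lemma character_fields al be : PX (character al be) = (fun g => Ci * RtoC (2 * PI * al) * character al be g)%C /\
  VY (character al be) = (fun g => Ci * RtoC (2 * PI * be) * character al be g)%C /\ PZ (character al be) = (fun _ => 0%C).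
Proof.
  have P : Cpartials (character al be) (fun g => Ci * RtoC (2 * PI * al) * character al be g)%C
    (fun g => Ci * RtoC (2 * PI * be) * character al be g)%C (fun _ => 0%C).
  { move=> x y z. split; [|split].
    - apply: (CD_cis_comp (fun t => 2 * PI * (al * t + be * y))). auto_derive => //. ring.
    - apply: (CD_cis_comp (fun t => 2 * PI * (al * x + be * t))). auto_derive => //. ring.
    - exact: (CD_const (cis (2 * PI * (al * x + be * y)))). }
  case: (Cpartials_P _ _ _ _ P) => [E1 [E2 E3]]. split => //. split => //. rewrite /VY E2 E3. funring.
Qed.
Lemma character_conj al be g : (character al be g * Cconj (character al be g) = 1)%C.
Proof. exact: cis_conj_mult. Qed.

(** Together with [tau2], the point of the shifted dual lattice whose pairings with [(a, 0)] and
    [(b, w2)] are [j1 + rho1] and [j2 + rho2]. *)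
Definition tau1 (j1 : Z) : R := (IZR j1 + rho1) / a.
Definition tau2 (j1 j2 : Z) : R := 1 / w2 * ((IZR j2 + rho2) - b / a * (IZR j1 + rho1)).

Lemma character_Sp j1 j2 : e3 = 1 -> SpP (character (tau1 j1) (tau2 j1 j2)).
Proof.
  move=> E3. split; first exact: character_Sm. split; [|split]; move=> [[x y] z]; rewrite /character /gmul /=.
  - rewrite -Hc1 -(cis_period (2 * PI * rho1) j1) -cis_plus. congr cis. rewrite /tau1. field. lra.
  - rewrite -Hc2 -(cis_period (2 * PI * rho2) j2) -cis_plus. congr cis. rewrite /tau1 /tau2. field. lra.
  - rewrite E3 Rplus_0_l Rplus_0_l. ring.
Qed.

(* Joint eigenfunctions of the translations along [(a,0)] and [(b,w2)] are multiples of a character. *)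
Lemma good_zinv B (HB : forall v, B v -> VPP v) u : (forall j1 j2, good B (character (tau1 j1) (tau2 j1 j2))) -> SpP u -> zinv u -> good B u.
Proof.
  move=> Hch Hu Hz.
  (* For functions independent of [z], lattice translations and coordinate translations coincide;
     every shift below uses this to correct the last coordinate. *)
  have Cz : forall v, zinv v -> forall x y z z', v (x, y, z) = v (x, y, z') by move=> v Hv x y z z'; rewrite Hv (Hv x y z').
  have Hsh1 : forall v, SpP v -> zinv v -> forall g, v (gsh (a, 0, 0) 1 g) = (cis (2 * PI * rho1) * v g)%C.
  { move=> v Hv Hvz [[x y] z]. rewrite Hc1 -(proj1 (proj2 Hv)) /gsh /gmul (Cz v Hvz _ _ _ (0 + z + a * y)). congr v. apply: triple_eq; ring. }
  have Hsh2 : forall v, SpP v -> zinv v -> forall g, v (gsh (b, w2, 0) 1 g) = (cis (2 * PI * rho2) * v g)%C.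
  { move=> v Hv Hvz [[x y] z]. rewrite Hc2 -(proj1 (proj2 (proj2 Hv))) /gsh /gmul (Cz v Hvz _ _ _ (0 + z + b * y)). congr v. apply: triple_eq; ring. }
  have Sp' : forall v sh rho m, SpP v -> zinv v -> SpP (tproj sh rho v m) /\ zinv (tproj sh rho v m).
  { move=> v [[s1 s2] s3] rho m Hv Hvz. split.
    - apply: Sp_tproj => // [[[p q] t']] t [[x y] z]. rewrite /gsh /gmul (Cz v Hvz _ _ _ (t' + (z + t * s3) + p * (y + t * s2))). congr v. apply: triple_eq; ring.
    - move=> x y z. have := tproj_equiv (s1, s2, s3) rho v m (fun g => let '(x, y, z) := g in (x, y, 0)) 1%C (proj1 Hv).
      move=> /(_ _ _ (x, y, z)) => E. rewrite E; [ring|by move=> [[x' y'] z']; rewrite (Hvz x' y' z'); ring|].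
      move=> t [[x' y'] z'] /=. exact: (Cz v Hvz). }
  apply: (good_tproj B HB (a, 0, 0) rho1 u Hu (Hsh1 u Hu Hz)) => j1.
  case: (Sp' u (a, 0, 0) rho1 j1 Hu Hz). set v := tproj _ _ _ _ => Hv Hvz.
  apply: (good_tproj B HB (b, w2, 0) rho2 v Hv (Hsh2 v Hv Hvz)) => j2.
  case: (Sp' v (b, w2, 0) rho2 j2 Hv Hvz). set w := tproj _ _ _ _ => Hw' Hwz.
  (* The second projection keeps the character acquired along [(a, 0, 0)], because the two
     coordinate translations commute. *)
  have T1 : forall tau g, w (gsh (a, 0, 0) tau g) = (cis ((IZR j1 + rho1) * (2 * PI * tau)) * w g)%C.
  { move=> tau g. apply: (tproj_equiv (b, w2, 0) rho2 v j2 (gsh (a, 0, 0) tau)); first exact: (proj1 Hv).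
    - move=> h. exact: (tproj_shift (a, 0, 0) rho1 u j1 (proj1 Hu) (Hsh1 u Hu Hz)).
    - move=> t [[x y] z] /=. congr v. apply: triple_eq; ring. }
  have T2 := tproj_shift (b, w2, 0) rho2 v j2 (proj1 Hv) (Hsh2 v Hv Hvz).
  (* Both translations together reach every point of the plane [z = 0] from the origin, so the value
     there determines [w]. *)
  have -> : w = (fun g => w (0, 0, 0) * character (tau1 j1) (tau2 j1 j2) g)%C.
  { apply: functional_extensionality => [[[x y] z]]. rewrite Hwz.
    have -> : (x, y, 0) = gsh (b, w2, 0) (y / w2) (gsh (a, 0, 0) ((x - b * y / w2) / a) (0, 0, 0)) :> G by apply: triple_eq; field; lra.
    rewrite -/w in T2. rewrite T2 T1 Cmult_assoc -cis_plus /character /=. rewrite [X in _ = X]Cmult_comm. congr (cis _ * _)%C. rewrite /tau1 /tau2. field. lra. }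
  exact: good_scal.
Qed.

(** The phase of [l], with value 1 at 0. This convention yields two independent eigenspinors also
    when both frequencies vanish, which is the case of multiplicity two. *)
Definition uphase (l : C) : C := match Req_EM_T (Cmod l) 0 with left _ => 1%C | right _ => (l / RtoC (Cmod l))%C end.

Lemma uphase_spec l : l = (RtoC (Cmod l) * uphase l)%C /\ (uphase l * Cconj (uphase l) = 1)%C.
Proof.
  rewrite /uphase. case: Req_EM_T => H.
  - split; first by rewrite H (Cmod_eq_0 l H); ring. Cring.
  - have Hn : RtoC (Cmod l) <> 0%C by move/RtoC_inj. split; first by field.
    have E : (l * Cconj l = RtoC (Cmod l) * RtoC (Cmod l))%C.
    { rewrite -RtoC_mult. apply: C_ext => /=; last ring. have := Cmod_sq l. rewrite /Re /Im /=. lra. }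
    have -> : Cconj (l / RtoC (Cmod l)) = (Cconj l / RtoC (Cmod l))%C by rewrite /Cdiv -RtoC_inv // Cmult_conj Cconj_RtoC.
    transitivity ((l * Cconj l) / (RtoC (Cmod l) * RtoC (Cmod l)))%C; first by field. rewrite E. by field.
Qed.

(** The scalar by which [Los] acts on the character. On its multiples the operator without its
    constant is the Hermitian matrix with zero diagonal and entry [ell], whence the eigenvectors
    [(1, phase)] and [(1, - phase)] in [tv]. *)
Definition ell (al be : R) : C := (RtoC s * (RtoC (2 * PI * be) + Ci * RtoC (2 * PI * al)))%C.
Definition tv (al be : R) (pl : bool) : bool * G -> C :=
  mkp (character al be) (fun g => RtoC (sgn pl) * uphase (ell al be) * character al be g)%C.

Lemma Cmod_ell al be : Cmod (ell al be) = 2 * PI * sqrt (s ^ 2 * (al ^ 2 + be ^ 2)).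
Proof.
  have PI0 := PI_RGT_0. apply: (Rsqr_inj _ _ (Cmod_ge_0 _)).
  { apply: Rmult_le_pos; [lra|exact: sqrt_pos]. }
  rewrite /Rsqr. have := Cmod_sq (ell al be). rewrite /ell /= => E.
  have H : 0 <= s ^ 2 * (al ^ 2 + be ^ 2) by apply: Rmult_le_pos; nra.
  have HQ := sqrt_sqrt _ H. set q := sqrt _ in HQ *.
  have -> : 2 * PI * q * (2 * PI * q) = 4 * (PI * PI) * (q * q) by ring. rewrite HQ. rewrite /ell. rewrite /Re /Im /= in E *. lra.
Qed.

Lemma DD_tv al be pl : DD s q0 (tv al be pl) = (fun x => RtoC (- q0 + sgn pl * Cmod (ell al be)) * tv al be pl x)%C.
Proof.
  case: (character_fields al be) => [EX [EY EZ]]. have Sc := character_Sm al be.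
  case: (uphase_spec (ell al be)) => [H1 H2]. set ch := character al be in EX EY EZ Sc *. set U := uphase _ in H1 H2 *. set N := Cmod _ in H1 *.
  have Hss : sgn pl * sgn pl = 1 by case: (pl); rewrite /sgn; ring.
  set q := (RtoC (sgn pl) * U)%C.
  have LoE : forall g, Lo ch g = ((RtoC (2 * PI * be) + Ci * RtoC (2 * PI * al)) * ch g)%C.
  { move=> g. rewrite /Lo EX EY. transitivity (Ci * RtoC (2 * PI * al) * ch g - (Ci * Ci) * RtoC (2 * PI * be) * ch g)%C; first ring. rewrite Ci_Ci. ring. }
  have S0 := Sm_const 0%C.
  have LpE : forall g, Lp (fun g => q * ch g)%C g = (q * ((RtoC (2 * PI * be) - Ci * RtoC (2 * PI * al)) * ch g))%C.
  { move=> g. have := Lp_lin q _ _ Sc S0. rewrite fun_scal0 => ->.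
    have -> : Lp (fun _ => 0%C) g = 0%C.
    { have := Lp_lin (-1)%C _ _ S0 S0. have -> : (fun _ : G => (-1) * 0 + 0)%C = (fun _ => 0%C) by funring. move=> ->. ring. }
    rewrite /Lp EX EY. transitivity (q * (- (Ci * RtoC (2 * PI * al)) * ch g - (Ci * Ci) * RtoC (2 * PI * be) * ch g))%C; first ring. rewrite Ci_Ci. ring. }
  have HC : (RtoC s * (RtoC (2 * PI * be) - Ci * RtoC (2 * PI * al)) = RtoC N * Cconj U)%C.
  { transitivity (Cconj (ell al be)); first by rewrite /ell; Cring. rewrite {1}H1. rewrite Cmult_conj Cconj_RtoC. by []. }
  apply: functional_extensionality; case=> [[|] g].
  - change (Ci * PZ ch g + RtoC s * Lp (fun g => q * ch g) g - RtoC q0 * ch g = RtoC (- q0 + sgn pl * N) * ch g)%C.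
    rewrite EZ LpE. transitivity (q * (RtoC s * (RtoC (2 * PI * be) - Ci * RtoC (2 * PI * al))) * ch g - RtoC q0 * ch g)%C; first ring.
    rewrite HC RtoC_plus RtoC_opp RtoC_mult /q. transitivity (RtoC (sgn pl) * RtoC N * (U * Cconj U) * ch g - RtoC q0 * ch g)%C; first ring. rewrite H2. ring.
  - change (RtoC s * Lo ch g - Ci * PZ (fun g => q * ch g) g - RtoC q0 * (q * ch g) = RtoC (- q0 + sgn pl * N) * (q * ch g))%C.
    rewrite Sm_PZ_scal // EZ LoE. transitivity (ell al be * ch g - RtoC q0 * (q * ch g))%C; first by rewrite /ell; ring.
    rewrite H1 RtoC_plus RtoC_opp RtoC_mult /q. transitivity ((RtoC (sgn pl * sgn pl) * (RtoC N * U)) * ch g - RtoC q0 * (RtoC (sgn pl) * U * ch g))%C; first by rewrite Hss; ring.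
    rewrite RtoC_mult. ring.
Qed.

Lemma tv_nonzero al be pl : tv al be pl <> fun _ => 0%C.
Proof.
  move=> E. have := f_equal (fun F => F (true, (0, 0, 0))) E. rewrite /tv /= => E2. have := character_conj al be (0, 0, 0). rewrite E2 => E3.
  have := f_equal Re E3. rewrite /=. lra.
Qed.
Lemma tv_PZ al be pl i : PZ (pc i (tv al be pl)) = (fun g => Ci * RtoC 0 * pc i (tv al be pl) g)%C.
Proof.
  case: (character_fields al be) => [_ [_ EZ]]. have Sc := character_Sm al be. case: i.
  - change (PZ (character al be) = fun g => Ci * RtoC 0 * character al be g)%C. rewrite EZ. funring.
  - set q := (RtoC (sgn pl) * uphase (ell al be))%C. change (PZ (fun g => q * character al be g) = fun g => Ci * RtoC 0 * (q * character al be g))%C.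
    rewrite Sm_PZ_scal // EZ. funring.
Qed.

Section Torus.
Hypothesis (E3 : e3 = 1).
Notation ch := (fun j1 j2 => character (tau1 j1) (tau2 j1 j2)).
Notation tvj := (fun j1 j2 => tv (tau1 j1) (tau2 j1 j2)).

Lemma VP_tv j1 j2 pl : VPP (tvj j1 j2 pl).
Proof. apply: VP_mkp; [|apply: Sp_scal]; exact: character_Sp. Qed.

Lemma character_orth j1 j2 i1 i2 : (j1, j2) <> (i1, i2) -> ipm (ch j1 j2) (ch i1 i2) = 0%C.
Proof.
  move=> H. have PI0 := PI_RGT_0. have S1 := character_Sp j1 j2 E3. have S2 := character_Sp i1 i2 E3.
  case: (character_fields (tau1 j1) (tau2 j1 j2)) => [X1 [Y1 _]]. case: (character_fields (tau1 i1) (tau2 i1 i2)) => [X2 [Y2 _]].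
  case: (Z.eq_dec j1 i1) => H1.
  - apply: (eigen_orth a b w2 r e1 e2 e3 Ha Hw Hr He1 He2 He3 _ _ _ _ S1 S2); [|right; left; split; [exact: Y1|exact: Y2]].
    subst i1. move=> E. apply: H. congr pair. apply: eq_IZR. have E4 : tau2 j1 j2 = tau2 j1 i2 by apply: (Rmult_eq_reg_l (2 * PI)); lra.
    move: E4. rewrite /tau2. set X := b / a * _. move=> E4. have := Rmult_eq_reg_l (1 / w2) _ _ E4.
    have : 1 / w2 <> 0 by apply: Rgt_not_eq; apply: Rdiv_lt_0_compat; lra. move=> HH /(_ HH). lra.
  - apply: (eigen_orth a b w2 r e1 e2 e3 Ha Hw Hr He1 He2 He3 _ _ _ _ S1 S2); [|left; split; [exact: X1|exact: X2]].
    move=> E. apply: H1. apply: eq_IZR. have E4 : tau1 j1 = tau1 i1 by apply: (Rmult_eq_reg_l (2 * PI)); lra.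
    move: E4. rewrite /tau1 => E4. have : (IZR j1 + rho1) = (IZR i1 + rho1) by apply: (Rmult_eq_reg_r (/ a)) => //; apply: Rinv_neq_0_compat; lra. lra.
Qed.

Lemma tv_orth j1 j2 pl i1 i2 pl' : (j1, j2, pl) <> (i1, i2, pl') -> ipPP (tvj j1 j2 pl) (tvj i1 i2 pl') = 0%C.
Proof.
  move=> H. have S1 := character_Sp j1 j2 E3. have S2 := character_Sp i1 i2 E3.
  change (ipm (ch j1 j2) (ch i1 i2) + ipm (fun g => RtoC (sgn pl) * uphase (ell (tau1 j1) (tau2 j1 j2)) * ch j1 j2 g)%C (fun g => RtoC (sgn pl') * uphase (ell (tau1 i1) (tau2 i1 i2)) * ch i1 i2 g)%C = 0)%C.
  rewrite (ph_ip_scal _ _ PH) //; last exact: Sp_scal. rewrite (ip_scal_r _ _ PH) //.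
  case: (classic ((j1, j2) = (i1, i2))) => E; last by rewrite character_orth //; ring.
  (* For the same character the two signs must be opposite, and the contributions of the two
     components cancel because the phase has modulus 1. *)
  case: E => Ea Eb. subst i1 i2. have Hp : sgn pl * sgn pl' = -1. { move: H. case: (pl); case: (pl') => HH; rewrite /sgn; try lra; by case: HH. }
  case: (uphase_spec (ell (tau1 j1) (tau2 j1 j2))) => _. set U := uphase _ => HU. rewrite Cmult_conj Cconj_RtoC.
  set I := ipm _ _. transitivity (I + RtoC (sgn pl * sgn pl') * (U * Cconj U) * I)%C; first by rewrite RtoC_mult; ring. rewrite Hp HU. ring.
Qed.

Lemma good_character B (HB : forall v, B v -> VPP v) j1 j2 : B (tvj j1 j2 true) -> B (tvj j1 j2 false) -> good B (ch j1 j2).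
Proof.
  move=> B1 B2. case: (uphase_spec (ell (tau1 j1) (tau2 j1 j2))) => _ HU. have M1 : RtoC (-1) = (- (1))%C by Cring.
  split; apply: (adherent_span VPP ipPP PP B HB).
  - have -> : mkp (ch j1 j2) (fun _ => 0%C) = (fun x => (fun x => RtoC (1 / 2) * tvj j1 j2 true x) x + (fun x => RtoC (1 / 2) * tvj j1 j2 false x) x)%C.
    { apply: functional_extensionality; case=> [[|] g].
      - change (ch j1 j2 g = RtoC (1 / 2) * ch j1 j2 g + RtoC (1 / 2) * ch j1 j2 g)%C. transitivity (RtoC (1 / 2 + 1 / 2) * ch j1 j2 g)%C; last by rewrite RtoC_plus; ring.
        have -> : 1 / 2 + 1 / 2 = 1 by field. ring.
      - change (RtoC 0 = RtoC (1 / 2) * (RtoC 1 * uphase (ell (tau1 j1) (tau2 j1 j2)) * ch j1 j2 g) + RtoC (1 / 2) * (RtoC (-1) * uphase (ell (tau1 j1) (tau2 j1 j2)) * ch j1 j2 g))%C.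
        rewrite M1. ring. }
    apply: span_plus; apply: span_scal; exact: span_base.
  - move: HU. set U := uphase _ => HU.
    have -> : mkp (fun _ => 0%C) (ch j1 j2) = (fun x => (fun x => (RtoC (1 / 2) * Cconj U) * tvj j1 j2 true x) x + (fun x => - (RtoC (1 / 2) * Cconj U) * tvj j1 j2 false x) x)%C.
    { apply: functional_extensionality; case=> [[|] g].
      - change (RtoC 0 = (RtoC (1 / 2) * Cconj U) * ch j1 j2 g + - (RtoC (1 / 2) * Cconj U) * ch j1 j2 g)%C. ring.
      - change (ch j1 j2 g = RtoC (1 / 2) * Cconj U * (RtoC 1 * U * ch j1 j2 g) + - (RtoC (1 / 2) * Cconj U) * (RtoC (-1) * U * ch j1 j2 g))%C. rewrite M1. transitivity (RtoC (1 / 2 + 1 / 2) * (U * Cconj U) * ch j1 j2 g)%C; last by rewrite RtoC_plus; ring.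
        rewrite HU. have -> : 1 / 2 + 1 / 2 = 1 by field. ring. }
    apply: span_plus; apply: span_scal; exact: span_base.
Qed.
End Torus.
End Fourier.

(** * The labelled eigenspinors *)

(** Recovers a natural number from the real that equals it; [up] exceeds an integer by one, hence
    the [- 1]. *)
Definition natpart (x : R) : nat := Z.to_nat (up x - 1).

Lemma natpart_IZR z : (0 <= z)%Z -> INR (natpart (IZR z)) = IZR z.
Proof.
  move=> Hz. rewrite /natpart. have -> : up (IZR z) = (z + 1)%Z by symmetry; apply: tech_up; rewrite plus_IZR; lra.
  rewrite INR_IZR_INZ Z2Nat.id; [congr IZR; lia|lia].
Qed.

Definition Zrange (K : nat) : list Z := map (fun n => Z.of_nat n - Z.of_nat K)%Z (seq 0 (2 * K + 1)).
Lemma Zrange_In K z : (Z.abs z <= Z.of_nat K)%Z -> In z (Zrange K).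
Proof. move=> H. apply/in_map_iff. exists (Z.to_nat (z + Z.of_nat K)). split; first lia. apply/in_seq. lia. Qed.

Definition label_le (K : nat) (i : label) : Prop :=
  match i with
  | Torus j1 j2 _ => (Z.abs j1 <= Z.of_nat K)%Z /\ (Z.abs j2 <= Z.of_nat K)%Z
  | Ground ka j => (Z.abs ka <= Z.of_nat K)%Z /\ (j <= K)%nat
  | Level ka p _ j => (Z.abs ka <= Z.of_nat K)%Z /\ (p <= K)%nat /\ (j <= K)%nat
  end.

Lemma label_le_list K : exists l, forall i, label_le K i -> In i l.
Proof.
  pose Zr := Zrange K. pose Nr := seq 0 (S K). pose Br := true :: false :: nil.
  exists (flat_map (fun j1 => flat_map (fun j2 => map (Torus j1 j2) Br) Zr) Zr ++
     flat_map (fun ka => map (Ground ka) Nr) Zr ++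
     flat_map (fun ka => flat_map (fun p => flat_map (fun pl => map (Level ka p pl) Nr) Br) Nr) Zr).
  have HB : forall pl, In pl Br by case; [left|right; left].
  have HN : forall n, (n <= K)%nat -> In n Nr by move=> n Hn; apply/in_seq; lia.
  case=> [j1 j2 pl [H1 H2]|ka j [H1 H2]|ka p pl j [H1 [H2 H3]]].
  - apply/in_app_iff; left. apply/in_flat_map. exists j1. split; first exact: Zrange_In. apply/in_flat_map. exists j2. split; first exact: Zrange_In.
    apply/in_map_iff. exists pl. by split.
  - apply/in_app_iff; right. apply/in_app_iff; left. apply/in_flat_map. exists ka. split; first exact: Zrange_In. apply/in_map_iff. exists j. split => //. exact: HN.
  - apply/in_app_iff; right. apply/in_app_iff; right. apply/in_flat_map. exists ka. split; first exact: Zrange_In. apply/in_flat_map. exists p. split; first exact: HN.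
    apply/in_flat_map. exists pl. split => //. apply/in_map_iff. exists j. split => //. exact: HN.
Qed.

Section Labels.
Variables (A r w2 e1 e2 e3 : R) (mv mw : Z).
Hypotheses (HA : 0 < A) (Hr : 0 < r) (Hw : 0 < w2) (Hmv : (0 < mv)%Z)
  (H1 : e1 = 1 \/ e1 = -1) (H2 : e2 = 1 \/ e2 = -1) (H3 : e3 = 1 \/ e3 = -1) (Heven : e3 = -1 -> exists n, mv = (2 * n)%Z).

(* [v = (aa, 0)] and [w = (bb, w2)]; [kk], [dd], [nn] are the central frequency, the multiplicity and the parameter [nu] of
   [Section Landau] attached to [kappa]. *)
Definition aa := r * IZR mv / w2.
Definition bb := r * IZR mw / w2.
Definition ss := / sqrt A.
Definition q4 := 1 / (4 * A).
Definition rho (e : R) := (1 - e) / 4.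
Definition kk (ka : Z) := 2 * PI / r * Rabs (mu e3 ka).
Definition dd (ka : Z) : nat := natpart (IZR mv * Rabs (mu e3 ka)).
Definition cc := bb / w2.
(** The last term cancels the central phase of half the parallelogram, so that the phase left is the
    one of the sign [e2]; see [cis_nn]. *)
Definition nn (ka : Z) := rho e2 + kk ka * cc * w2 ^ 2 / (4 * PI).

Lemma mv_pos : 0 < IZR mv. Proof. exact: IZR_lt. Qed.
Lemma aa_pos : 0 < aa.
Proof. have := mv_pos. move=> ?. rewrite /aa. apply: Rdiv_lt_0_compat => //. exact: Rmult_lt_0_compat. Qed.
Lemma ss_pos : 0 < ss. Proof. apply: Rinv_0_lt_compat. exact: sqrt_lt_R0. Qed.
Lemma ss_sq : ss ^ 2 = / A.
Proof. rewrite /ss pow_inv. congr Rinv. rewrite /= Rmult_1_r. apply: sqrt_sqrt. lra. Qed.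
Lemma sq_one e : e = 1 \/ e = -1 -> e * e = 1. Proof. by case=> ->; ring. Qed.

Lemma cis_PI : cis PI = RtoC (-1).
Proof. apply: C_ext; rewrite /=; [exact: cos_PI|exact: sin_PI]. Qed.

Lemma cis_rho e : e = 1 \/ e = -1 -> cis (2 * PI * rho e) = RtoC e.
Proof.
  case=> ->; rewrite /rho.
  - have -> : 2 * PI * ((1 - 1) / 4) = 0 by field. exact: cis_0.
  - have -> : 2 * PI * ((1 - -1) / 4) = PI by field. exact: cis_PI.
Qed.

Lemma cis_mu ka : cis (2 * PI * mu e3 ka) = RtoC e3.
Proof. rewrite -cis_rho // -(cis_period (2 * PI * rho e3) ka). congr cis. rewrite /mu /rho. ring. Qed.
Lemma cis_abs_mu ka : cis (2 * PI * Rabs (mu e3 ka)) = RtoC e3.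
Proof.
  case: (Rle_dec 0 (mu e3 ka)) => H; first by rewrite Rabs_pos_eq // cis_mu.
  rewrite Rabs_left; last lra. have -> : 2 * PI * - mu e3 ka = - (2 * PI * mu e3 ka) by ring. rewrite cis_opp cis_mu. exact: Cconj_RtoC.
Qed.

(** Integrality comes from the constraint on the spin structure: if [e3 = -1] then [mv] is even and
    absorbs the half in [mu]. *)
Lemma mu_multiplicity ka : INR (dd ka) = IZR mv * Rabs (mu e3 ka).
Proof.
  rewrite /dd. suff [z [Hz ->]] : exists z, (0 <= z)%Z /\ IZR mv * Rabs (mu e3 ka) = IZR z by exact: natpart_IZR.
  have [z E] : exists z, IZR mv * mu e3 ka = IZR z.
  { case: H3 => E3.
    - exists (mv * ka)%Z. rewrite mult_IZR /mu E3. field.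
    - case: (Heven E3) => n En. exists (n * (2 * ka + 1))%Z. rewrite En /mu E3 !mult_IZR plus_IZR mult_IZR. field. }
  exists (Z.abs z). split; first lia. rewrite abs_IZR -E Rabs_mult (Rabs_pos_eq (IZR mv)) //. left. exact: mv_pos.
Qed.

Lemma mu_ge_half ka : mu e3 ka <> 0 -> 1 / 2 <= Rabs (mu e3 ka).
Proof.
  have Q : forall z : Z, z <> 0%Z -> 1 <= Rabs (IZR z). { move=> z Hz. rewrite -abs_IZR. apply: IZR_le. lia. }
  rewrite /mu. case: H3 => ->.
  - have -> : IZR ka + (1 - 1) / 4 = IZR ka by field. move=> Hn. have := Q ka. have : ka <> 0%Z by move=> E; apply: Hn; rewrite E. move=> HH /(_ HH). lra.
  - move=> _. have -> : IZR ka + (1 - -1) / 4 = IZR (2 * ka + 1) / 2 by rewrite plus_IZR mult_IZR; field.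
    rewrite /Rdiv Rabs_mult (Rabs_pos_eq (/ 2)); last lra. have := Q (2 * ka + 1)%Z. have : (2 * ka + 1 <> 0)%Z by lia. move=> HH /(_ HH). lra.
Qed.

Notation SpP := (Sp aa bb w2 r e1 e2 e3).
Notation VPP := (VP aa bb w2 r e1 e2 e3).
Notation ipPP := (ipP aa w2 r).
Notation D := (DD ss q4).
Let PP := VP_prehilbert aa bb w2 r e1 e2 e3 aa_pos Hw Hr (sq_one _ H1) (sq_one _ H2) (sq_one _ H3).

Section OneKappa.
Variable (ka : Z).
Hypothesis (Hka : mu e3 ka <> 0).

Lemma kk_pos : 0 < kk ka.
Proof.
  have PI0 := PI_RGT_0. have := mu_ge_half _ Hka. move=> ?. apply: Rmult_lt_0_compat; last lra. apply: Rdiv_lt_0_compat; lra.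
Qed.
Lemma dd_pos : (0 < dd ka)%nat.
Proof. apply: INR_lt. rewrite mu_multiplicity /=. have := mu_ge_half _ Hka. have := mv_pos. nra. Qed.
Lemma bb_cc : bb = cc * w2. Proof. rewrite /cc. field. lra. Qed.
Lemma kk_aa : kk ka * aa * w2 = 2 * PI * INR (dd ka).
Proof. rewrite mu_multiplicity /kk /aa. field. lra. Qed.
Lemma cis_nn : cis (2 * PI * nn ka - kk ka * cc * w2 ^ 2 / 2) = RtoC e2.
Proof. rewrite -cis_rho // /nn. congr cis. field. have := PI_RGT_0. lra. Qed.
Lemma cis_kk : cis (kk ka * r) = RtoC e3.
Proof. rewrite -(cis_abs_mu ka). congr cis. rewrite /kk. field. lra. Qed.
End OneKappa.

Ltac level_side := first [exact: aa_pos|exact: Hw|exact: Hr|exact: kk_pos|exact: ss_pos|exact: dd_pos|exact: bb_cc|exact: kk_aa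
  |by apply: sq_one|exact: cis_nn|exact: cis_kk|assumption].

(* Eigenspinors with [mu < 0] are the images of those for [- mu] under the quaternionic structure. *)
Definition flip (ka : Z) (F : bool * G -> C) : bool * G -> C := match Rlt_dec 0 (mu e3 ka) with left _ => F | right _ => JJ F end.

Lemma flip_VP ka F : VPP F -> VPP (flip ka F).
Proof. move=> HF. rewrite /flip. case: Rlt_dec => // _. exact: VP_JJ. Qed.
Lemma JJ_scal c F : JJ (fun x => c * F x)%C = (fun x => Cconj c * JJ F x)%C.
Proof. apply: functional_extensionality; case=> [[|] g]; rewrite /JJ /pc /=; Cring. Qed.
Lemma flip_D ka F v : VPP F -> D F = (fun x => RtoC v * F x)%C -> D (flip ka F) = (fun x => RtoC v * flip ka F x)%C.
Proof.
  move=> HF E. rewrite /flip. case: Rlt_dec => // _. rewrite (DD_JJ aa bb w2 r e1 e2 e3) // E JJ_scal Cconj_RtoC. by [].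
Qed.
Lemma flip_orth ka F H : VPP F -> VPP H -> ipPP F H = 0%C -> ipPP (flip ka F) (flip ka H) = 0%C.
Proof.
  move=> HF HH E. rewrite /flip. case: Rlt_dec => _; first exact: E. rewrite (ipP_JJ aa bb w2 r e1 e2 e3 aa_pos Hw Hr (sq_one _ H1) (sq_one _ H2) (sq_one _ H3) _ _ HF HH) E. exact: Cconj_RtoC.
Qed.
Lemma flip_nonzero ka (F : bool * G -> C) : F <> (fun _ => 0%C) -> flip ka F <> (fun _ => 0%C).
Proof.
  rewrite /flip. case: Rlt_dec => // _ HF E. apply: HF. have E2 : (fun x => (-1) * F x)%C = JJ (fun _ => 0%C) by rewrite -JJ_JJ E.
  apply: functional_extensionality => x. have E3 := f_equal (fun f => f x) E2. cbv beta in E3.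
  have -> : F x = (- (-1 * F x))%C by ring. rewrite E3. case: (x) => [[|] g]; rewrite /JJ /pc /=; Cring.
Qed.
(** The construction is made at frequency proportional to [|mu|]; the conjugation in [JJ] reverses
    its sign, so after [flip] the frequency carries the true sign of [mu]. *)
Lemma flip_PZ ka F : mu e3 ka <> 0 -> VPP F -> (forall i, PZ (pc i F) = (fun g => Ci * RtoC (kk ka) * pc i F g)%C) ->
  forall i, PZ (pc i (flip ka F)) = (fun g => Ci * RtoC (2 * PI / r * mu e3 ka) * pc i (flip ka F) g)%C.
Proof.
  move=> Hk [HF1 HF2] HP i. rewrite /flip. case: Rlt_dec => Hm.
  - by rewrite HP /kk Rabs_pos_eq; last lra.
  - have E : kk ka = - (2 * PI / r * mu e3 ka) by rewrite /kk Rabs_left; [ring|lra]. rewrite E in HP.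
    case: (fields_conj _ (proj1 HF1)) => [_ [_ A1]]. case: (fields_conj _ (proj1 HF2)) => [_ [_ A2]].
    case: i.
    + have -> : pc true (JJ F) = (fun g => (-1) * (fun g => Cconj (pc false F g)) g)%C by apply: functional_extensionality => g; rewrite /JJ /pc /=; ring.
      rewrite Sm_PZ_scal; last by apply: Sm_conj; exact: (proj1 HF2). rewrite A2 HP. apply: functional_extensionality => g. Cring.
    + change (PZ (fun g => Cconj (pc true F g)) = (fun g => Ci * RtoC (2 * PI / r * mu e3 ka) * Cconj (pc true F g))%C).
      rewrite A1 HP. apply: functional_extensionality => g. Cring.
Qed.

Definition level_value (ka : Z) (n : nat) : R := sqrt (kk ka ^ 2 + INR (S n) * (2 * kk ka * ss ^ 2)).
Definition gk (ka : Z) (j : nat) : bool * G -> C := gv aa w2 (kk ka) cc (nn ka) e1 ss (dd ka) j.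
Definition lk (ka : Z) (n : nat) (pl : bool) (j : nat) : bool * G -> C :=
  lv aa w2 (kk ka) cc (nn ka) e1 ss (dd ka) n (sgn pl * level_value ka n) j.
Definition tk (j1 j2 : Z) (pl : bool) : bool * G -> C := tv ss (tau1 aa (rho e1) j1) (tau2 aa bb w2 (rho e1) (rho e2) j1 j2) pl.

Definition phi (i : label) : bool * G -> C :=
  match i with
  | Torus j1 j2 pl => tk j1 j2 pl
  | Ground ka j => flip ka (gk ka j)
  (* Levels are numbered from 1 in the labels, whereas [lv n] joins the rungs [n] and [S n]. *)
  | Level ka p pl j => flip ka (lk ka (pred p) pl j)
  end.

Notation valid := (is_label mv e3).
Notation val := (label_value A r w2 mv mw e1 e2 e3).

Lemma level_value_label ka n : mu e3 ka <> 0 ->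
  level_value ka n = 2 * sqrt (PI * INR (S n) / (r * A) * Rabs (mu e3 ka) + PI ^ 2 / r ^ 2 * mu e3 ka ^ 2).
Proof.
  move=> Hk. have PI0 := PI_RGT_0. have -> : 2 = sqrt (2 * 2) by rewrite sqrt_square; lra.
  have M := mu_ge_half _ Hk. have N := pos_INR (S n).
  rewrite -sqrt_mult_alt; last lra. rewrite /level_value ss_sq /kk -(pow2_abs (mu e3 ka)). congr sqrt. field. lra.
Qed.
Lemma level_value_sq ka n : mu e3 ka <> 0 -> 0 < level_value ka n /\ level_value ka n ^ 2 = kk ka ^ 2 + INR (S n) * (2 * kk ka * ss ^ 2).
Proof.
  move=> Hk. have K := kk_pos _ Hk. have N := lt_0_INR (S n) (Nat.lt_0_succ n). have S := pow_lt ss 2 ss_pos.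
  have P : 0 < kk ka ^ 2 + INR (Datatypes.S n) * (2 * kk ka * ss ^ 2).
  { apply: Rplus_lt_0_compat; first exact: pow_lt. repeat apply: Rmult_lt_0_compat => //; lra. }
  split; first exact: sqrt_lt_R0. rewrite /level_value pow2_sqrt //. lra.
Qed.

Lemma copy_lt ka j : INR j < IZR mv * Rabs (mu e3 ka) <-> (j < dd ka)%nat.
Proof. rewrite -mu_multiplicity. split; [exact: INR_lt|exact: lt_INR]. Qed.

Lemma VP_gk ka j : mu e3 ka <> 0 -> VPP (gk ka j).
Proof.
  move=> Hk. apply: VP_gv; try level_side.
Qed.
Lemma VP_lk ka n pl j : mu e3 ka <> 0 -> VPP (lk ka n pl j).
Proof.
  move=> Hk. apply: VP_lv; try level_side.
Qed.
Lemma VP_tk j1 j2 pl : e3 = 1 -> VPP (tk j1 j2 pl).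
Proof. move=> E. apply: VP_tv => //; [exact: aa_pos|exact: cis_rho|exact: cis_rho]. Qed.

Lemma VP_phi i : valid i -> VPP (phi i).
Proof.
  case: i => [j1 j2 pl|ka j|ka p pl j] /=.
  - exact: VP_tk. - move=> [Hk _]. apply: flip_VP. exact: VP_gk. - move=> [Hk _]. apply: flip_VP. exact: VP_lk.
Qed.

Lemma phi_nonzero i : valid i -> phi i <> fun _ => 0%C.
Proof.
  case: i => [j1 j2 pl|ka j|ka p pl j] /=.
  - move=> _. exact: tv_nonzero.
  - move=> [Hk /copy_lt Hj]. apply: flip_nonzero.
    apply: (gv_nonzero aa w2 r (kk ka) cc bb (nn ka) e1 e2 e3); try level_side.
  - move=> [Hk [_ /copy_lt Hj]]. apply: flip_nonzero.
    apply: (lv_nonzero aa w2 r (kk ka) cc bb (nn ka) e1 e2 e3); try level_side.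
Qed.

Lemma tau_alpha j1 j2 : tau1 aa (rho e1) j1 = alpha1 r w2 mv e1 j1 /\ tau2 aa bb w2 (rho e1) (rho e2) j1 j2 = alpha2 w2 mv mw e1 e2 j1 j2.
Proof.
  have M := mv_pos. rewrite /tau1 /tau2 /alpha1 /alpha2 /rho /aa /bb. split; field; lra.
Qed.

Lemma D_phi i : valid i -> D (phi i) = (fun x => RtoC (val i) * phi i x)%C.
Proof.
  case: i => [j1 j2 pl|ka j|ka p pl j]; rewrite /is_label /label_value /phi.
  - move=> _. rewrite /tk DD_tv Cmod_ell. case: (tau_alpha j1 j2) => [-> ->].
    have -> : - q4 + sgn pl * (2 * PI * sqrt (ss ^ 2 * (alpha1 r w2 mv e1 j1 ^ 2 + alpha2 w2 mv mw e1 e2 j1 j2 ^ 2)))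
      = - (1 / (4 * A)) + sgn pl * (2 * PI * sqrt ((alpha1 r w2 mv e1 j1 ^ 2 + alpha2 w2 mv mw e1 e2 j1 j2 ^ 2) / A)).
    { rewrite ss_sq /q4 /Rdiv (Rmult_comm (/ A)) //. } by [].
  - move=> [Hk _]. apply: flip_D; first exact: VP_gk.
    rewrite /gk (DD_gv aa w2 (kk ka) cc bb (nn ka) e1 e2); [|exact: aa_pos|exact: Hw|exact: kk_pos|exact: dd_pos|exact: bb_cc|exact: kk_aa|exact: sq_one|exact: cis_nn].
    have -> : - kk ka - q4 = - (1 / (4 * A)) - 2 * PI / r * Rabs (mu e3 ka) by rewrite /kk /q4; ring. by [].
  - move=> [Hk [Hp /copy_lt Hj]]. apply: flip_D; first exact: VP_lk. case: p Hp => [|n] Hp; first lia.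
    rewrite [pred _]/= /lk (DD_lv aa w2 r (kk ka) cc bb (nn ka) e1 e2 e3); [|exact: aa_pos|exact: Hw|exact: Hr|exact: kk_pos|exact: dd_pos|exact: bb_cc|exact: kk_aa|exact: sq_one|exact: sq_one|exact: sq_one|exact: cis_nn|exact: cis_kk|done|].
    + rewrite level_value_label //. apply: functional_extensionality => x. congr (RtoC _ * _)%C. rewrite /q4. ring.
    + rewrite -(proj2 (level_value_sq ka n Hk)) Rpow_mult_distr. have -> : sgn pl ^ 2 = 1 by case: (pl); rewrite /sgn; lra. ring.
Qed.

Definition zfreq (i : label) : R := match i with Torus _ _ _ => 0 | Ground ka _ | Level ka _ _ _ => 2 * PI / r * mu e3 ka end.

Lemma PZ_phi i : valid i -> forall c, PZ (pc c (phi i)) = (fun g => Ci * RtoC (zfreq i) * pc c (phi i) g)%C.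
Proof.
  case: i => [j1 j2 pl|ka j|ka p pl j] /=.
  - move=> _ c. exact: tv_PZ.
  - move=> [Hk _]. apply: flip_PZ => //; first exact: VP_gk.
    apply: (gv_PZ aa w2 (kk ka) cc bb (nn ka) e1 e2 ss); try level_side.
  - move=> [Hk _]. apply: flip_PZ => //; first exact: VP_lk.
    apply: (lv_PZ aa w2 (kk ka) cc bb (nn ka) e1 e2 ss); try level_side.
Qed.

Lemma D_symmetric F H : VPP F -> VPP H -> ipPP (D F) H = ipPP F (D H).
Proof. move=> HF HH. apply: (DD_sym aa bb w2 r e1 e2 e3) => //; by [exact: aa_pos|exact: sq_one|exact: ss_pos]. Qed.

Lemma phi_orth_value i j : valid i -> valid j -> val i <> val j -> ipPP (phi i) (phi j) = 0%C.
Proof.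
  move=> Hi Hj Hne. have Vi := VP_phi i Hi. have Vj := VP_phi j Hj.
  have := D_symmetric _ _ Vi Vj. rewrite (D_phi i Hi) (D_phi j Hj) (ph_ip_scal _ _ PP _ _ _ Vi Vj) (ip_scal_r _ _ PP _ _ _ Vj Vi) Cconj_RtoC => E.
  apply: NNPP => Hn. have Hk : RtoC (val i - val j) <> 0%C by move/RtoC_inj; lra.
  apply: (Cmult_neq_0 _ _ Hk Hn). rewrite RtoC_minus. transitivity (RtoC (val i) * ipPP (phi i) (phi j) - RtoC (val j) * ipPP (phi i) (phi j))%C; first ring. rewrite E. ring.
Qed.

(** Different central frequencies are separated by the skew field [Z], different eigenvalues by
    symmetry of the operator. What remains has a common frequency and a common eigenvalue; there
    orthogonality comes from the characters, the rungs or the theta functions. *)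
Lemma phi_orth i j : valid i -> valid j -> i <> j -> ipPP (phi i) (phi j) = 0%C.
Proof.
  move=> Hi Hj Hne. have Vi := VP_phi i Hi. have Vj := VP_phi j Hj.
  case: (Req_dec (zfreq i) (zfreq j)) => Hz; last first.
  { have Q : forall c, ip aa w2 r (pc c (phi i)) (pc c (phi j)) = 0%C.
    { move=> c. apply: (eigen_orth aa bb w2 r e1 e2 e3 aa_pos Hw Hr (sq_one _ H1) (sq_one _ H2) (sq_one _ H3) _ _ (zfreq i) (zfreq j)) => //; [by case: c; apply Vi|by case: c; apply Vj|].
      right. right. split; exact: PZ_phi. }
    rewrite /ipP !Q. ring. }
  case: (Req_dec (val i) (val j)) => Hv; last exact: phi_orth_value.
  have PI0 := PI_RGT_0.
  have Zne : forall ka, mu e3 ka <> 0 -> 2 * PI / r * mu e3 ka <> 0.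
  { move=> ka Hk E. apply: Hk. apply: (Rmult_eq_reg_l (2 * PI / r)); first by rewrite E; ring. apply: Rgt_not_eq. apply: Rdiv_lt_0_compat; lra. }
  have Zinj : forall ka ka', 2 * PI / r * mu e3 ka = 2 * PI / r * mu e3 ka' -> ka = ka'.
  { move=> ka ka' E. apply: eq_IZR. have : mu e3 ka = mu e3 ka'. { apply: (Rmult_eq_reg_l (2 * PI / r)) => //. apply: Rgt_not_eq. apply: Rdiv_lt_0_compat; lra. } rewrite /mu. lra. }
  have sym0 : forall F H, VPP F -> VPP H -> ipPP F H = 0%C -> ipPP H F = 0%C.
  { move=> F H HF HH E. rewrite (ph_conj _ _ PP F H) // E. exact: Cconj_RtoC. }
  have GL : forall ka j n pl j', valid (Ground ka j) -> valid (Level ka n pl j') -> ipPP (flip ka (gk ka j)) (flip ka (lk ka (pred n) pl j')) = 0%C.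
  { move=> ka j0 n pl j' [Hk /copy_lt Hj0] [_ [_ /copy_lt Hj']]. apply: flip_orth; [exact: VP_gk|exact: VP_lk|].
    apply: (gv_lv_orth aa w2 r (kk ka) cc bb (nn ka) e1 e2 e3); try level_side. }
  case: i Hi Vi Hne Hz Hv => [j1 j2 pl|ka n|ka p pl n] Hi Vi Hne Hz Hv; case: j Hj Vj Hne Hz Hv => [i1 i2 pl'|ka' n'|ka' p' pl' n'] Hj Vj Hne Hz Hv.
  - apply: (tv_orth aa bb w2 r e1 e2 e3) => //; try exact: aa_pos; try exact: sq_one; try exact: cis_rho. move=> E. apply: Hne. by case: E => -> -> ->.
  - exfalso. exact: (Zne ka' (proj1 Hj) (eq_sym Hz)).
  - exfalso. exact: (Zne ka' (proj1 Hj) (eq_sym Hz)).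
  - exfalso. exact: (Zne ka (proj1 Hi) Hz).
  - have E := Zinj _ _ Hz. subst ka'. case: (Hi) => Hk /copy_lt Hn. case: (Hj) => _ /copy_lt Hn'. apply: flip_orth; try exact: VP_gk.
    apply: (gv_orth aa w2 r (kk ka) cc bb (nn ka) e1 e2 e3); try level_side.
    move=> E. apply: Hne. by rewrite E.
  - have E := Zinj _ _ Hz. subst ka'. exact: GL.
  - exfalso. exact: (Zne ka (proj1 Hi) Hz).
  - have E := Zinj _ _ Hz. subst ka'. apply: sym0 => //. exact: GL.
  - have E := Zinj _ _ Hz. subst ka'. case: (Hi) => Hk [Hp /copy_lt Hn]. case: (Hj) => _ [Hp' /copy_lt Hn'].
    apply: flip_orth; try exact: VP_lk.
    apply: (lv_orth aa w2 r (kk ka) cc bb (nn ka) e1 e2 e3); try level_side.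
    (* Were rung and copy equal, the signs would differ; but then the eigenvalues differ, a case
       already settled. *)
    apply: NNPP => Hnn. have Epn : p = p' by case: (Nat.eq_dec (pred p) (pred p')) => ?; [lia|by exfalso; apply: Hnn; left].
    have Enn : n = n' by apply: NNPP => ?; apply: Hnn; right. subst p' n'.
    have Hpl : pl <> pl' by move=> E; apply: Hne; rewrite E.
    case: (level_value_sq ka (pred p) Hk) => L _. rewrite level_value_label // in L. rewrite (Nat.succ_pred_pos p Hp) in L.
    move: Hv. rewrite /label_value. set X := sqrt _ in L *. case: (pl) Hpl; case: (pl') => //= _; rewrite /sgn; lra.
Qed.
Lemma Zabs_le_INR z K : Rabs (IZR z) <= INR K -> (Z.abs z <= Z.of_nat K)%Z.
Proof. rewrite -abs_IZR INR_IZR_INZ. exact: le_IZR. Qed.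

Lemma mu_near ka : Rabs (IZR ka) <= Rabs (mu e3 ka) + 1.
Proof.
  have -> : IZR ka = mu e3 ka + - rho e3 by rewrite /mu /rho; ring. apply: Rle_trans (Rabs_triang _ _) _. apply: Rplus_le_compat_l.
  rewrite Rabs_Ropp /rho. case: H3 => ->; rewrite Rabs_pos_eq; lra.
Qed.

(** Each family is [- q4] plus or minus a quantity that grows with its indices, so a bound on the
    eigenvalue bounds these; the copies are bounded by the multiplicity. *)
Lemma val_bound Bd : exists K, forall i, valid i -> Rabs (val i) <= Bd -> label_le K i.
Proof.
  have PI0 := PI_RGT_0. have M0 := mv_pos. have Q0 : 0 < q4 by apply: Rdiv_lt_0_compat; lra.
  set M := Rabs Bd + q4 + 1. have HM : 1 <= M. { have := Rabs_pos Bd. rewrite /M. lra. }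
  (* [T], [U], [W] bound [alpha], [mu] and the level *)
  set T := A * M ^ 2 + 1. set U := r * M / (2 * PI). set W := M ^ 2 * (r * A).
  have HT : 0 <= T. { rewrite /T. have := pow2_ge_0 M. nra. }
  have HU : 0 <= U. { rewrite /U. apply: Rdiv_le_0_compat; nra. }
  have HW : 0 <= W. { rewrite /W. apply: Rmult_le_pos; [exact: pow2_ge_0|nra]. }
  case: (INR_unbounded ((aa + w2 + Rabs bb) * T + 1 + U + W + IZR mv * U + 1)) => K HK. exists K.
  have Ha := aa_pos. have Hbb := Rabs_pos bb.
  have P1 : 0 <= (aa + w2 + Rabs bb) * T by nra. have P2 : 0 <= IZR mv * U by nra.
  have Mu : forall ka, 2 * PI / r * Rabs (mu e3 ka) <= M -> Rabs (mu e3 ka) <= U.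
  { move=> ka H. have E : Rabs (mu e3 ka) = r / (2 * PI) * (2 * PI / r * Rabs (mu e3 ka)) by field; lra.
    rewrite E /U. have -> : r * M / (2 * PI) = r / (2 * PI) * M by field; lra. apply: Rmult_le_compat_l => //. apply: Rdiv_le_0_compat; lra. }
  have Ka : forall ka, Rabs (mu e3 ka) <= U -> (Z.abs ka <= Z.of_nat K)%Z.
  { move=> ka H. apply: Zabs_le_INR. have := mu_near ka. lra. }
  have Cp : forall ka j, Rabs (mu e3 ka) <= U -> INR j < IZR mv * Rabs (mu e3 ka) -> (j <= K)%nat.
  { move=> ka j H Hj. apply: INR_le. have := Rmult_le_compat_l _ _ _ (Rlt_le _ _ M0) H. lra. }
  have Sq : forall X pl, Rabs (- (1 / (4 * A)) + sgn pl * X) <= Bd -> 0 <= X -> X <= M.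
  { move=> X pl H HX. have := Rle_abs Bd. move: H. rewrite -/q4 /M => /Rabs_le_between [A1 A2]. move: A1 A2. case: pl; rewrite /sgn; lra. }
  case=> [j1 j2 pl|ka j|ka p pl j]; rewrite /is_label /label_value /label_le.
  - move=> _ HB. set a1 := alpha1 _ _ _ _ _ in HB. set a2 := alpha2 _ _ _ _ _ _ _ in HB.
    have X0 : 0 <= (a1 ^ 2 + a2 ^ 2) / A by apply: Rdiv_le_0_compat => //; have := pow2_ge_0 a1; have := pow2_ge_0 a2; lra.
    have S0 := sqrt_pos ((a1 ^ 2 + a2 ^ 2) / A). have L := Sq _ _ HB ltac:(nra).
    have L2 : sqrt ((a1 ^ 2 + a2 ^ 2) / A) <= M. { have PI1 : 1 < PI by have := PI2_1; lra. nra. }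
    have L3 : (a1 ^ 2 + a2 ^ 2) <= A * M ^ 2.
    { have -> : a1 ^ 2 + a2 ^ 2 = A * (sqrt ((a1 ^ 2 + a2 ^ 2) / A) * sqrt ((a1 ^ 2 + a2 ^ 2) / A)) by rewrite sqrt_sqrt //; field; lra.
      apply: Rmult_le_compat_l; nra. }
    have Ab : forall x, x ^ 2 <= A * M ^ 2 -> Rabs x <= T. { move=> x Hx. rewrite /T. apply: Rabs_le. nra. }
    have B1 : Rabs a1 <= T by apply: Ab; have := pow2_ge_0 a2; lra. have B2 : Rabs a2 <= T by apply: Ab; have := pow2_ge_0 a1; lra.
    case: (tau_alpha j1 j2) => E1 E2. rewrite -/a1 -/a2 in E1 E2.
    have R1 : Rabs (rho e1) <= 1 by rewrite /rho; case: H1 => ->; rewrite Rabs_pos_eq; lra.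
    have R2 : Rabs (rho e2) <= 1 by rewrite /rho; case: H2 => ->; rewrite Rabs_pos_eq; lra.
    split; apply: Zabs_le_INR.
    + have -> : IZR j1 = aa * a1 + - rho e1 by rewrite -E1 /tau1; field; lra. apply: Rle_trans (Rabs_triang _ _) _. rewrite Rabs_Ropp Rabs_mult (Rabs_pos_eq aa); last lra. nra.
    + have -> : IZR j2 = (w2 * a2 + bb * a1) + - rho e2 by rewrite -E1 -E2 /tau1 /tau2; field; lra.
      apply: Rle_trans (Rabs_triang _ _) _. rewrite Rabs_Ropp.
      have := Rabs_triang (w2 * a2) (bb * a1). rewrite (Rabs_mult w2 a2) (Rabs_mult bb a1) (Rabs_pos_eq w2); last lra.
      have := Rmult_le_compat_l _ _ _ Hbb B1. have := Rmult_le_compat_l _ _ _ (Rlt_le _ _ Hw) B2. have := Rmult_le_pos _ _ (Rlt_le _ _ Ha) HT. lra.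
  - move=> [Hk Hj] HB. have X0 : 0 <= 2 * PI / r * Rabs (mu e3 ka) by apply: Rmult_le_pos; [apply: Rdiv_le_0_compat; lra|exact: Rabs_pos].
    have E : - (1 / (4 * A)) - 2 * PI / r * Rabs (mu e3 ka) = - (1 / (4 * A)) + sgn false * (2 * PI / r * Rabs (mu e3 ka)) by rewrite /sgn; ring.
    rewrite E in HB. have L := Mu ka (Sq _ _ HB X0).
    split; [exact: Ka|exact: Cp Hj].
  - move=> [Hk [Hp Hj]] HB. set X := PI * INR p / (r * A) * Rabs (mu e3 ka) in HB. set Y := PI ^ 2 / r ^ 2 * mu e3 ka ^ 2 in HB.
    have N := pos_INR p. have Hm := mu_ge_half _ Hk. have RA : 0 < r * A by nra.
    have Z0 : 0 <= PI * INR p / (r * A) by apply: Rdiv_le_0_compat => //; nra.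
    have X0 : 0 <= X by apply: Rmult_le_pos => //; lra.
    have Y1 : Y = (PI / r * Rabs (mu e3 ka)) ^ 2 by rewrite /Y -(pow2_abs (mu e3 ka)); field; lra.
    have Y0 : 0 <= Y by rewrite Y1; exact: pow2_ge_0.
    have S0 := sqrt_pos (X + Y). have L := Sq _ _ HB ltac:(lra).
    have SS := sqrt_sqrt (X + Y) ltac:(lra).
    have LU : Rabs (mu e3 ka) <= U.
    { apply: Mu. have V0 : 0 <= PI / r * Rabs (mu e3 ka) by apply: Rmult_le_pos; [apply: Rdiv_le_0_compat; lra|lra].
      have -> : 2 * PI / r * Rabs (mu e3 ka) = 2 * (PI / r * Rabs (mu e3 ka)) by field; lra. nra. }
    split; first exact: Ka. split; last exact: Cp Hj. apply: INR_le.
    have XM : X <= M ^ 2 / 4 by nra.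
    have : INR p <= W; last lra.
    have PI1 : 1 < PI by have := PI2_1; lra.
    have X1 : INR p / (r * A) * (1 / 2) <= X.
    { rewrite /X. apply: Rmult_le_compat => //; [apply: Rdiv_le_0_compat => //|lra|]. apply: Rmult_le_compat_r; [left; exact: Rinv_0_lt_compat|nra]. }
    have -> : INR p = (INR p / (r * A) * (1 / 2)) * (2 * (r * A)) by field; lra. rewrite /W.
    have := Rmult_le_compat_r (2 * (r * A)) _ _ ltac:(lra) (Rle_trans _ _ _ X1 XM). nra.
Qed.

Lemma val_finite Bd : exists l, forall i, valid i -> Rabs (val i) <= Bd -> In i l.
Proof.
  case: (val_bound Bd) => K HK. case: (label_le_list K) => l Hl. exists l => i Hi Hb. apply: Hl. exact: HK.
Qed.

Definition basis (b : bool * G -> C) : Prop := exists i, valid i /\ b = phi i.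
Lemma VP_basis b : basis b -> VPP b.
Proof. move=> [i [Hi ->]]. exact: VP_phi. Qed.

Notation Gd := (good aa bb w2 r e1 e2 e3 basis).

(** The family is taken as the preimage of the basis under [flip]: density is known at positive
    frequency, before the quaternionic structure is applied. *)
Lemma LK_good ka : mu e3 ka <> 0 -> forall u, lambda_k aa w2 (kk ka) bb e1 e2 u ->
  adherent VPP ipPP (fun b => exists b', basis b' /\ flip ka b = b' /\ VPP b) (mkp u (fun _ => 0%C)) /\
  adherent VPP ipPP (fun b => exists b', basis b' /\ flip ka b = b' /\ VPP b) (mkp (fun _ => 0%C) u).
Proof.
  move=> Hk u Hu.
  apply: (LK_adherent aa w2 r (kk ka) cc bb (nn ka) e1 e2 e3 ss (dd ka)); try level_side.
  - by move=> v [b' [_ [_ H]]].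
  - move=> j Hj. exists (flip ka (gk ka j)). split; last by split => //; exact: VP_gk. exists (Ground ka j). split => //. split => //. exact/copy_lt.
  - have Q : forall n pl j, (j < dd ka)%nat -> exists b', basis b' /\ flip ka (lk ka n pl j) = b' /\ VPP (lk ka n pl j).
    { move=> n pl j Hj. exists (flip ka (lk ka n pl j)). split; last by split => //; exact: VP_lk. exists (Level ka (S n) pl j). split => //. split => //. split; [lia|exact/copy_lt]. }
    move=> n j Hj. split.
    + have := Q n true j Hj. rewrite /lk /sgn Rmult_1_l. by [].
    + have := Q n false j Hj. rewrite /lk /sgn. have -> : -1 * level_value ka n = - level_value ka n by ring. by [].
Qed.

(** [flip] is either the identity or an antilinear map that conjugates inner products; both preserve
    norms and carry spans to spans. *)
Lemma adherent_flip ka F : adherent VPP ipPP (fun b => exists b', basis b' /\ flip ka b = b' /\ VPP b) F -> adherent VPP ipPP basis (flip ka F).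
Proof.
  move=> [VF HF]. split; first exact: flip_VP. move=> e He. case: (HF e He) => w [Hw' Hlt].
  have VW : VPP w. { apply: (V_span VPP ipPP PP) Hw'. by move=> b [b' [_ [_ H]]]. }
  exists (flip ka w). split.
  - elim: Hw' {Hlt VW} => [|q b w' [b' [Hb' [Eb Vb]]] _ IH].
    + have -> : flip ka (fun _ => 0%C) = (fun _ => 0%C); last exact: span_zero.
      rewrite /flip. case: Rlt_dec => // _. apply: functional_extensionality; case=> [[|] g]; rewrite /JJ /pc /=; Cring.
    (* The coefficient is conjugated exactly when [flip] is antilinear. *)
    + have -> : flip ka (fun x => q * b x + w' x)%C = (fun x => (match Rlt_dec 0 (mu e3 ka) with left _ => q | right _ => Cconj q end) * flip ka b x + flip ka w' x)%C.
      { rewrite /flip. case: Rlt_dec => // _. exact: JJ_lin. }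
      apply: span_add => //. by rewrite Eb.
  - suff -> : n2 ipPP (fun x => flip ka F x - flip ka w x)%C = n2 ipPP (fun x => F x - w x)%C by [].
    rewrite /flip. case: Rlt_dec => [//|_]. have VS := V_sub VPP ipPP PP _ _ VF VW.
    have -> : (fun x => JJ F x - JJ w x)%C = JJ (fun x => F x - w x)%C.
    { have -> : (fun x => F x - w x)%C = (fun x => (-1) * w x + F x)%C by funring.
      rewrite JJ_lin. have -> : Cconj (-1) = (-1)%C by Cring. funring. }
    rewrite /n2 (ipP_JJ aa bb w2 r e1 e2 e3 aa_pos Hw Hr (sq_one _ H1) (sq_one _ H2) (sq_one _ H3) _ _ VS VS). by [].
Qed.

Lemma good_all u : SpP u -> Gd u.
Proof.
  move=> Hu. have K1 := sq_one _ H1. have K2 := sq_one _ H2. have K3 := sq_one _ H3. have Ha := aa_pos.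
  apply: (good_tproj aa bb w2 r e1 e2 e3 Ha Hw Hr K1 K2 K3 basis VP_basis (0, 0, r) (rho e3)) => // [g|ka].
  { rewrite cis_rho //. case: g => [[x y] z]. rewrite -(proj2 (proj2 (proj2 Hu))) /gsh /gmul. congr u. apply: triple_eq; ring. }
  case: (Sp_zproj aa bb w2 r e1 e2 e3 (rho e3) Hr (cis_rho _ H3) u ka Hu). move: (tproj (0, 0, r) (rho e3) u ka) => v Hv Hm.
  have Em : IZR ka + rho e3 = mu e3 ka by []. rewrite Em in Hm.
  case: (Req_dec (mu e3 ka) 0) => Hz.
  (* For [e3 = -1] the parameter [mu] is a half-integer and cannot vanish. *)
  - have E3 : e3 = 1. { case: H3 => // E. exfalso. have := mu_ge_half. move: Hz. rewrite /mu E => Hz _. have : 2 * IZR ka + 1 = 0 by lra. rewrite -mult_IZR -plus_IZR => /eq_IZR. lia. }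
    apply: (good_zinv aa bb w2 r e1 e2 e3 (rho e1) (rho e2)) => //; try exact: cis_rho; try exact: VP_basis.
    + move=> j1 j2. apply: (good_character aa bb w2 r e1 e2 e3 ss (rho e1) (rho e2)) => //; try exact: VP_basis.
      exists (Torus j1 j2 true). by split. exists (Torus j1 j2 false). by split.
    + move=> x y z. rewrite Hm Hz. have -> : 2 * PI * 0 / r * z = 0 by field; lra. rewrite cis_0. ring.
  - case: (Rlt_dec 0 (mu e3 ka)) => Hp.
    + have HL : lambda_k aa w2 (kk ka) bb e1 e2 v.
      { case: Hv => [S0 [A0 [B0 _]]]. split => //. split => //. split => //. rewrite /kk Rabs_pos_eq; last lra. move: Hm. congr mode. field. lra. }
      case: (LK_good ka Hz v HL) => /(adherent_flip ka) G1 /(adherent_flip ka) G2.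
      have F0 : forall F, flip ka F = F by move=> F; rewrite /flip; case: Rlt_dec. rewrite !F0 in G1 G2. by split.
    + have Hv' := Sp_conj _ _ _ _ _ _ _ _ Hv.
      have HL : lambda_k aa w2 (kk ka) bb e1 e2 (fun g => Cconj (v g)).
      { case: Hv' => [S0 [A0 [B0 _]]]. split => //. split => //. split => //. move=> x y z. rewrite Hm Cmult_conj -cis_opp. congr (cis _ * _)%C. rewrite /kk Rabs_left; [field; lra|lra]. }
      have HL' := lambda_k_scal _ _ _ _ _ _ (-1)%C _ HL.
      have F0 : forall F, flip ka F = JJ F by move=> F; rewrite /flip; case: Rlt_dec.
      (* [JJ] exchanges the components: [v] on top comes from minus its conjugate at the bottom, and
         [v] at the bottom from its conjugate on top. *)
      case: (LK_good ka Hz _ HL') => _ /(adherent_flip ka) G2. case: (LK_good ka Hz _ HL) => /(adherent_flip ka) G1 _. rewrite !F0 in G1 G2.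
      split.
      * move: G2. congr (adherent _ _ _ _). apply: functional_extensionality; case=> [[|] g]; rewrite /JJ /pc /=; apply: C_ext; rewrite /= /Re /Im /=; lra.
      * move: G1. congr (adherent _ _ _ _). apply: functional_extensionality; case=> [[|] g]; rewrite /JJ /pc /=; apply: C_ext; rewrite /= /Re /Im /=; lra.
Qed.

Lemma phi_dense F e : VPP F -> 0 < e -> exists w, span basis w /\ n2 ipPP (fun x => F x - w x)%C < e.
Proof.
  move=> [HF1 HF2] He. case: (good_all _ HF1) => A1 _. case: (good_all _ HF2) => _ A2.
  have := adherent_plus VPP ipPP PP basis VP_basis _ _ A1 A2.
  have -> : (fun x => mkp (pc true F) (fun _ => 0%C) x + mkp (fun _ => 0%C) (pc false F) x)%C = F.
  { rewrite {3}(mkp_eta F). apply: functional_extensionality; case=> [[|] g] /=; ring. }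
  move=> [_ H]. exact: H.
Qed.
End Labels.

(** * Clifford multiplication *)

Lemma c2_ext (s t : C2) : fst s = fst t -> snd s = snd t -> s = t.
Proof. case: s => s1 s2; case: t => t1 t2 /= -> ->. by []. Qed.

Ltac c2ring := apply: c2_ext; rewrite /c2add /c2scal /c2zero /=; ring.

Lemma c2_cancel a b c d s : c2add (c2add a b) (c2add c d) = c2scal (RtoC (-2)) s -> a = c2scal (RtoC (-1)) s -> d = c2scal (RtoC (-1)) s -> b = c2scal (RtoC (-1)) c.
Proof.
  move=> E Ea Ed. rewrite Ea Ed in E. have E1 := f_equal fst E. have E2 := f_equal snd E. clear E. rewrite /c2add /c2scal /= in E1 E2.
  have M1 : RtoC (-1) = (- (1))%C by Cring. have M2 : RtoC (-2) = (- (1) - 1)%C by Cring.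
  rewrite M1 M2 in E1 E2. apply: c2_ext; rewrite /c2scal /= M1.
  - transitivity ((- (1) * fst s + fst b + (fst c + - (1) * fst s)) + fst s + fst s - fst c)%C; first ring. rewrite E1. ring.
  - transitivity ((- (1) * snd s + snd b + (snd c + - (1) * snd s)) + snd s + snd s - snd c)%C; first ring. rewrite E2. ring.
Qed.

Definition det2 (s t : C2) : C := (fst s * snd t - snd s * fst t)%C.

Lemma det2_nonzero s t : (forall p q, c2add (c2scal p s) (c2scal q t) = c2zero -> p = 0%C /\ q = 0%C) -> det2 s t <> 0%C.
Proof.
  move=> H E. rewrite /det2 in E.
  have [A1 A2] : snd t = 0%C /\ (- snd s)%C = 0%C.
  { apply: H. apply: c2_ext; rewrite /c2add /c2scal /c2zero /=; last ring. transitivity (fst s * snd t - snd s * fst t)%C; [ring|exact: E]. }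
  have [A3 A4] : fst t = 0%C /\ (- fst s)%C = 0%C.
  { apply: H. apply: c2_ext; rewrite /c2add /c2scal /c2zero /=; first ring. transitivity (- (fst s * snd t - snd s * fst t))%C; [ring|rewrite E; ring]. }
  have := H 1%C 0%C. case; last by move=> E1 _; have := f_equal Re E1; rewrite /=; lra.
  have B1 : fst s = 0%C by transitivity (- - fst s)%C; [ring|rewrite A4; ring]. have B2 : snd s = 0%C by transitivity (- - snd s)%C; [ring|rewrite A2; ring].
  apply: c2_ext; rewrite /c2add /c2scal /c2zero /= ?B1 ?B2; ring.
Qed.

Section Clifford.
Variables (A : R) (cl : lie -> C2 -> C2).
Hypotheses (HA : 0 < A) (Hcl : is_clifford A cl).
Notation J1 := (cl (Defs.E1 A)).
Notation J2 := (cl (E2 A)).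
Notation J3 := (cl E3).
Notation neg s := (c2scal (RtoC (-1)) s).

Lemma cl_add_s u s t : cl u (c2add s t) = c2add (cl u s) (cl u t). Proof. exact: (proj1 (proj2 (proj2 Hcl))). Qed.
Lemma cl_scal_s u c s : cl u (c2scal c s) = c2scal c (cl u s). Proof. exact: (proj1 (proj2 (proj2 (proj2 Hcl)))). Qed.
Lemma cl_sq u s : cl u (cl u s) = c2scal (RtoC (- metric_sq A u)) s. Proof. exact: (proj1 (proj2 (proj2 (proj2 (proj2 Hcl))))). Qed.
Lemma cl_zero u : cl u c2zero = c2zero.
Proof. have -> : c2zero = c2scal 0%C c2zero by c2ring. rewrite cl_scal_s. c2ring. Qed.

Lemma sqrtA_sq : A * (1 / sqrt A) ^ 2 = 1.
Proof.
  have S := sqrt_lt_R0 _ HA. have E := sqrt_sqrt A (Rlt_le _ _ HA). rewrite -{1}E. field. lra.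
Qed.

Lemma J_squares s : J1 (J1 s) = neg s /\ J2 (J2 s) = neg s /\ J3 (J3 s) = neg s.
Proof.
  have Q := sqrtA_sq. rewrite !cl_sq /metric_sq /Defs.E1 /E2 /E3.
  have -> : - (A * (1 / sqrt A) ^ 2 + A * 0 ^ 2 + 0 ^ 2) = -1 by rewrite Q; ring.
  have -> : - (A * 0 ^ 2 + A * (1 / sqrt A) ^ 2 + 0 ^ 2) = -1 by rewrite Q; ring.
  have -> : - (A * 0 ^ 2 + A * 0 ^ 2 + 1 ^ 2) = -1 by ring. by [].
Qed.

(** Polarisation: the squared length of [E1 + E2] is 2, and subtracting the two squares leaves the
    anticommutator. *)
Lemma J12_anti s : J1 (J2 s) = neg (J2 (J1 s)).
Proof.
  case: (J_squares s) => [S1 [S2 _]].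
  have E := cl_sq (lie_add (Defs.E1 A) (E2 A)) s.
  have Em : - metric_sq A (lie_add (Defs.E1 A) (E2 A)) = -2.
  { have Q := sqrtA_sq. rewrite /lie_add /Defs.E1 /E2 /metric_sq. rewrite !Rplus_0_l !Rplus_0_r. lra. }
  rewrite Em !(proj1 Hcl) !cl_add_s in E. exact: (c2_cancel _ _ _ _ s E S1 S2).
Qed.

(** The orientation condition with [E3] applied once more, using that its square is -1. *)
Lemma J12 s : J1 (J2 s) = J3 s.
Proof.
  have E := proj2 (proj2 (proj2 (proj2 (proj2 Hcl)))) s. have E2 := f_equal J3 E. rewrite (proj2 (proj2 (J_squares _))) cl_scal_s in E2.
  have E3 := f_equal (fun t => neg t) E2. cbv beta in E3.
  have NN : forall t, neg (neg t) = t. { move=> t. apply: c2_ext; rewrite /c2scal /= Cmult_assoc -RtoC_mult; have -> : -1 * -1 = 1 by ring. all: ring. }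
  by rewrite !NN in E3.
Qed.

Lemma neg_neg t : neg (neg t) = t.
Proof. apply: c2_ext; rewrite /c2scal /= Cmult_assoc -RtoC_mult; have -> : -1 * -1 = 1 by ring. all: ring. Qed.

Lemma J31 s : J3 (J1 s) = J2 s /\ J1 (J3 s) = neg (J2 s).
Proof.
  have E : J1 (J3 s) = neg (J2 s) by rewrite -J12 (proj1 (J_squares _)). split => //.
  rewrite -J12 J12_anti. have -> : J2 (J1 (J1 s)) = neg (J2 s) by rewrite (proj1 (J_squares _)) cl_scal_s. exact: neg_neg.
Qed.

(** [E1] anticommutes with [E3], hence carries its [i]-eigenspace to the [-i]-eigenspace, and
    eigenvectors of different eigenvalues are independent. All Clifford matrices follow from this
    one vector. *)
Lemma J_frame sp : J3 sp = c2scal Ci sp -> sp <> c2zero ->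
  let sm := J1 sp in det2 sp sm <> 0%C /\ J1 sm = neg sp /\ J2 sp = c2scal (- Ci)%C sm /\ J2 sm = c2scal (- Ci)%C sp /\ J3 sm = c2scal (- Ci)%C sm.
Proof.
  move=> H3 Hn sm. case: (J_squares sp) => [S1 _]. case: (J31 sp) => [A1 A2]. case: (J31 sm) => [B1 B2].
  have J2p : J2 sp = c2scal (- Ci)%C sm.
  { have E : neg (J2 sp) = c2scal Ci sm by rewrite -A2 H3 cl_scal_s. rewrite -(neg_neg (J2 sp)) E.
    apply: c2_ext; rewrite /c2scal /= Cmult_assoc; congr (_ * _)%C; Cring. }
  have J3m : J3 sm = c2scal (- Ci)%C sm by rewrite /sm A1.
  have J2m : J2 sm = c2scal (- Ci)%C sp.
  { rewrite -B1 -/sm. have -> : J1 sm = neg sp by []. rewrite cl_scal_s H3. apply: c2_ext; rewrite /c2scal /= Cmult_assoc; congr (_ * _)%C; Cring. }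
  split; last by [].
  have Hm : sm <> c2zero.
  { move=> E. apply: Hn. rewrite -(neg_neg sp) -S1 -/sm E cl_zero. c2ring. }
  have Z : forall p s, s <> c2zero -> c2scal p s = c2zero -> p = 0%C.
  { move=> p s Hs E. apply: NNPP => Hp. apply: Hs. have F1 := f_equal fst E. have F2 := f_equal snd E. rewrite /c2scal /= in F1 F2.
    apply: c2_ext; rewrite /c2zero /=; apply: NNPP => Hx; [exact: (Cmult_neq_0 _ _ Hp Hx F1)|exact: (Cmult_neq_0 _ _ Hp Hx F2)]. }
  apply: det2_nonzero => p q E.
  have E2 := f_equal J3 E. rewrite cl_add_s !cl_scal_s cl_zero H3 J3m in E2.
  have Ep : c2scal (p * (2 * Ci))%C sp = c2zero.
  { transitivity (c2add (c2scal Ci (c2add (c2scal p sp) (c2scal q sm))) (c2add (c2scal p (c2scal Ci sp)) (c2scal q (c2scal (- Ci)%C sm)))); first by c2ring.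
    rewrite E E2. c2ring. }
  have Eq : c2scal (q * (2 * Ci))%C sm = c2zero.
  { transitivity (c2add (c2scal Ci (c2add (c2scal p sp) (c2scal q sm))) (c2scal (- (1))%C (c2add (c2scal p (c2scal Ci sp)) (c2scal q (c2scal (- Ci)%C sm))))); first by c2ring.
    rewrite E E2. c2ring. }
  have Q : forall x, (x * (2 * Ci))%C = 0%C -> x = 0%C.
  { move=> x Ex. apply: NNPP => Hx. apply: (Cmult_neq_0 _ _ Hx _ Ex). move=> Ei. have := f_equal Im Ei. rewrite /=. lra. }
  split; apply: Q; [exact: (Z _ sp)|exact: (Z _ sm)].
Qed.

(* [e - i E3 e] lies in the i-eigenspace of E3; if it vanishes, [E1 e] does. *)
Lemma clifford_frame : exists sp, J3 sp = c2scal Ci sp /\ sp <> c2zero.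
Proof.
  set e := (RtoC 1, RtoC 0) : C2. have He : e <> c2zero by move=> E; have := f_equal (fun s => Re (fst s)) E; rewrite /=; lra.
  set v := c2add e (c2scal (- Ci)%C (J3 e)).
  case: (classic (v = c2zero)) => Hv.
  - have E : J3 e = c2scal (- Ci)%C e.
    { transitivity (c2add (c2scal (- Ci)%C e) (c2scal Ci v)); last by rewrite Hv; c2ring.
      rewrite /v. apply: c2_ext; rewrite /c2add /c2scal /=; move: (J3 e) => [x y] /=; [transitivity (- (Ci * Ci) * x)%C|transitivity (- (Ci * Ci) * y)%C]; (ring || (rewrite Ci_Ci; ring)). }
    exists (J1 e). case: (J31 e) => [A1 A2]. split.
    + rewrite A1 -(neg_neg (J2 e)) -A2 E cl_scal_s. apply: c2_ext; rewrite /c2scal /= Cmult_assoc; congr (_ * _)%C; Cring.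
    + move=> E0. apply: He. rewrite -(neg_neg e) -(proj1 (J_squares e)) E0 cl_zero. c2ring.
  - exists v. split => //. rewrite /v cl_add_s cl_scal_s (proj2 (proj2 (J_squares e))).
    apply: c2_ext; rewrite /c2add /c2scal /=; move: (J3 e) => [x y] /=.
    + transitivity (Ci * 1 - (Ci * Ci) * x)%C; last ring. rewrite Ci_Ci. Cring.
    + transitivity (Ci * 0 - (Ci * Ci) * y)%C; last ring. rewrite Ci_Ci. Cring.
Qed.
End Clifford.

Definition frame (sp sm : C2) (F : bool * G -> C) : c2fun := fun g => c2add (c2scal (F (true, g)) sp) (c2scal (F (false, g)) sm).
(** Cramer's rule, inverse to [frame]. *)
Definition coord (sp sm : C2) (f : c2fun) : bool * G -> C :=
  mkp (fun g => (snd sm / det2 sp sm) * fst (f g) + (- fst sm / det2 sp sm) * snd (f g))%C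
      (fun g => (- snd sp / det2 sp sm) * fst (f g) + (fst sp / det2 sp sm) * snd (f g))%C.

Section Frame.
Variables (sp sm : C2).
Hypothesis (Hdet : det2 sp sm <> 0%C).
Notation T := (frame sp sm).
Notation S := (coord sp sm).

Lemma frame_coord f : T (S f) = f.
Proof.
  apply: functional_extensionality => g. apply: c2_ext; rewrite /frame /coord /mkp /c2add /c2scal /=; move: Hdet; rewrite /det2 => HH; by field.
Qed.
Lemma coord_frame F : S (T F) = F.
Proof.
  apply: functional_extensionality; case=> [[|] g]; rewrite /frame /coord /mkp /c2add /c2scal /=; move: Hdet; rewrite /det2 => HH; by field.
Qed.

Lemma smooth_Sm f : smooth f <-> Sm (fun g => fst (f g)) /\ Sm (fun g => snd (f g)).
Proof. split; [move=> H; split => n; case: (H n) => [? [? [? ?]]]; by split|move=> [Ha Hb] n; case: (Ha n); case: (Hb n); by split]. Qed.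

Lemma smooth_frame F : smooth (T F) <-> Sm (pc true F) /\ Sm (pc false F).
Proof.
  rewrite smooth_Sm. split.
  - move=> [Ha Hb]. rewrite -(coord_frame F). split; apply: Sm_plus; exact: Sm_scal.
  - move=> [Ha Hb]. split.
    + have -> : (fun g => fst (T F g)) = (fun g => (fst sp * pc true F g) + (fst sm * pc false F g))%C by apply: functional_extensionality => g; rewrite /frame /= /pc; ring.
      apply: Sm_plus; exact: Sm_scal.
    + have -> : (fun g => snd (T F g)) = (fun g => (snd sp * pc true F g) + (snd sm * pc false F g))%C by apply: functional_extensionality => g; rewrite /frame /= /pc; ring.
      apply: Sm_plus; exact: Sm_scal.
Qed.

Lemma inv_frame gm e F : (forall g, T F (gmul gm g) = c2scal e (T F g)) <-> inv_by gm e (pc true F) /\ inv_by gm e (pc false F).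
Proof.
  split.
  - move=> H. rewrite -(coord_frame F). split => g; rewrite /pc /coord /mkp H /c2scal /=; ring.
  - move=> [Ha Hb] g. rewrite /frame. have := Ha g. have := Hb g. rewrite /pc => -> ->. c2ring.
Qed.

Lemma norm_frame_le x1 x2 : Cmod (x1 * fst sp + x2 * fst sm)%C ^ 2 + Cmod (x1 * snd sp + x2 * snd sm)%C ^ 2 <=
  2 * (Cmod (fst sp) + Cmod (snd sp) + Cmod (fst sm) + Cmod (snd sm)) ^ 2 * (Cmod x1 ^ 2 + Cmod x2 ^ 2).
Proof.
  have P := Cmod_ge_0 (fst sp). have Q := Cmod_ge_0 (snd sp). have R1 := Cmod_ge_0 (fst sm). have R2 := Cmod_ge_0 (snd sm).
  have X1 := Cmod_ge_0 x1. have X2 := Cmod_ge_0 x2.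
  have A1 := Cmod_triangle (x1 * fst sp)%C (x2 * fst sm)%C. have A2 := Cmod_triangle (x1 * snd sp)%C (x2 * snd sm)%C.
  rewrite !Cmod_mult in A1 A2. have B1 := Cmod_ge_0 (x1 * fst sp + x2 * fst sm)%C. have B2 := Cmod_ge_0 (x1 * snd sp + x2 * snd sm)%C.
  move: (Cmod (x1 * fst sp + x2 * fst sm)%C) (Cmod (x1 * snd sp + x2 * snd sm)%C) A1 A2 B1 B2 => L1 L2.
  move: (Cmod (fst sp)) (Cmod (snd sp)) (Cmod (fst sm)) (Cmod (snd sm)) (Cmod x1) (Cmod x2) P Q R1 R2 X1 X2 => a b c d p q P Q R1 R2 X1 X2 A1 A2 B1 B2.
  have C1 : L1 ^ 2 <= (p * a + q * c) ^ 2 by apply: pow_incr. have C2' : L2 ^ 2 <= (p * b + q * d) ^ 2 by apply: pow_incr.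
  have D1 : (p * a + q * c) ^ 2 <= (p ^ 2 + q ^ 2) * (a ^ 2 + c ^ 2). { have := pow2_ge_0 (p * c - q * a). nra. }
  have D2 : (p * b + q * d) ^ 2 <= (p ^ 2 + q ^ 2) * (b ^ 2 + d ^ 2). { have := pow2_ge_0 (p * d - q * b). nra. }
  have E : (a ^ 2 + c ^ 2) + (b ^ 2 + d ^ 2) <= (a + b + c + d) ^ 2.
  { have := Rmult_le_pos _ _ P Q. have := Rmult_le_pos _ _ P R1. have := Rmult_le_pos _ _ P R2. have := Rmult_le_pos _ _ Q R1. have := Rmult_le_pos _ _ Q R2. have := Rmult_le_pos _ _ R1 R2. nra. }
  have F0 : 0 <= p ^ 2 + q ^ 2 by have := pow2_ge_0 p; have := pow2_ge_0 q; lra.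
  have := Rmult_le_compat_l _ _ _ F0 E. have := pow2_ge_0 (a + b + c + d). nra.
Qed.
End Frame.

Definition c2norm2 (f : c2fun) : G -> R := fun g => Cmod (fst (f g)) ^ 2 + Cmod (snd (f g)) ^ 2.

(** The frame need not be orthonormal for the standard norm of [C2], so passing to components
    preserves the norm only up to a constant. Equivalent norms define the same resolvent set. *)
Lemma frame_norms sp sm (Hdet : det2 sp sm <> 0%C) : exists K, 0 < K /\ forall F g,
  c2norm2 (frame sp sm F) g <= K * (Cmod (F (true, g)) ^ 2 + Cmod (F (false, g)) ^ 2) /\
  Cmod (F (true, g)) ^ 2 + Cmod (F (false, g)) ^ 2 <= K * c2norm2 (frame sp sm F) g.
Proof.
  set sp' := (snd sm / det2 sp sm, - snd sp / det2 sp sm)%C : C2. set sm' := (- fst sm / det2 sp sm, fst sp / det2 sp sm)%C : C2.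
  set K1 := 2 * (Cmod (fst sp) + Cmod (snd sp) + Cmod (fst sm) + Cmod (snd sm)) ^ 2.
  set K2 := 2 * (Cmod (fst sp') + Cmod (snd sp') + Cmod (fst sm') + Cmod (snd sm')) ^ 2.
  have P1 : 0 <= K1 by rewrite /K1; have := pow2_ge_0 (Cmod (fst sp) + Cmod (snd sp) + Cmod (fst sm) + Cmod (snd sm)); lra.
  have P2 : 0 <= K2 by rewrite /K2; have := pow2_ge_0 (Cmod (fst sp') + Cmod (snd sp') + Cmod (fst sm') + Cmod (snd sm')); lra.
  exists (K1 + K2 + 1). split; first lra. move=> F g.
  have N : forall x y : C, 0 <= Cmod x ^ 2 + Cmod y ^ 2 by move=> x y; have := pow2_ge_0 (Cmod x); have := pow2_ge_0 (Cmod y); lra.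
  split.
  - have E := norm_frame_le sp sm (F (true, g)) (F (false, g)). rewrite -/K1 in E. have := N (F (true, g)) (F (false, g)).
    rewrite /c2norm2 /frame /c2add /c2scal. rewrite /= in E *. nra.
  - have E := norm_frame_le sp' sm' (fst (frame sp sm F g)) (snd (frame sp sm F g)). rewrite -/K2 in E.
    have Ec : forall i, coord sp sm (frame sp sm F) (i, g) = F (i, g) by move=> i; rewrite coord_frame.
    have Et := Ec true. have Ef := Ec false. rewrite /coord /mkp in Et Ef.
    have := N (fst (frame sp sm F g)) (snd (frame sp sm F g)). rewrite -{1}Et -{1}Ef /c2norm2.
    have X1 : (fst (frame sp sm F g) * fst sp' + snd (frame sp sm F g) * fst sm' = snd sm / det2 sp sm * fst (frame sp sm F g) + - fst sm / det2 sp sm * snd (frame sp sm F g))%C by rewrite /sp' /sm' /=; ring.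
    have X2 : (fst (frame sp sm F g) * snd sp' + snd (frame sp sm F g) * snd sm' = - snd sp / det2 sp sm * fst (frame sp sm F g) + fst sp / det2 sp sm * snd (frame sp sm F g))%C by rewrite /sp' /sm' /=; ring.
    rewrite X1 X2 in E. nra.
Qed.

(** * The lattice *)

Section Lattice.
Variables (r w2 : R) (mv mw : Z) (eps : G -> R).
Hypotheses (Hr : 0 < r) (Hw : 0 < w2) (Heps : is_character r w2 mv mw eps).
Notation a := (aa r w2 mv).
Notation b := (bb r w2 mw).

Definition ga (h1 h2 h : Z) : G := (IZR h1 * a + IZR h2 * b, IZR h2 * w2, IZR h * r).

Lemma ga_Gamma h1 h2 h : in_Gamma r w2 mv mw (ga h1 h2 h).
Proof. exists h1, h2, h. rewrite /ga /aa /bb /vec_v /vec_w /=. apply: triple_eq; ring. Qed.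
Lemma Gamma_ga g : in_Gamma r w2 mv mw g -> exists h1 h2 h, g = ga h1 h2 h.
Proof. move=> [h1 [h2 [h ->]]]. exists h1, h2, h. rewrite /ga /aa /bb /vec_v /vec_w /=. apply: triple_eq; ring. Qed.
Lemma ga_mul h1 h2 h k1 k2 k : gmul (ga h1 h2 h) (ga k1 k2 k) = ga (h1 + k1) (h2 + k2) (h + k + h1 * k2 * mv + h2 * k2 * mw).
Proof. rewrite /ga /gmul !plus_IZR !mult_IZR /aa /bb. apply: triple_eq; field; lra. Qed.

Lemma eps_ga h1 h2 h k1 k2 k : eps (ga (h1 + k1) (h2 + k2) (h + k + h1 * k2 * mv + h2 * k2 * mw)) = eps (ga h1 h2 h) * eps (ga k1 k2 k).
Proof. rewrite -ga_mul. apply: (proj2 Heps); exact: ga_Gamma. Qed.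
Lemma eps_sq h1 h2 h : eps (ga h1 h2 h) * eps (ga h1 h2 h) = 1.
Proof. case: (proj1 Heps _ (ga_Gamma h1 h2 h)) => ->; ring. Qed.
Lemma eps_one : eps (ga 0 0 0) = 1.
Proof. rewrite -(eps_sq 0 0 0). rewrite -eps_ga. by []. Qed.

(** The lattice elements over [v] and [w] commute up to the [mv]-th power of the central generator,
    on which a character to a commutative group is trivial; for odd [mv] this excludes the sign
    -1. *)
Lemma eps_mv : eps (ga 0 0 1) = -1 -> exists n, mv = (2 * n)%Z.
Proof.
  move=> E. case: (Z.Even_or_Odd mv) => [[n Hn]|[n Hn]]; first by exists n. exfalso.
  have A1 := eps_ga 1 0 0 0 1 0. have A2 := eps_ga 0 1 0 1 0 0. have A3 := eps_ga 1 1 0 0 0 mv.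
  have A4 := eps_ga 0 0 n 0 0 n. have A5 := eps_ga 0 0 (n + n) 0 0 1.
  have S1 := eps_sq 1 0 0. have S2 := eps_sq 0 1 0. have S3 := eps_sq 0 0 n.
  replace (ga (1 + 0) (0 + 1) (0 + 0 + 1 * 1 * mv + 0 * 1 * mw)) with (ga 1 1 mv) in A1 by (f_equal; ring).
  replace (ga (0 + 1) (1 + 0) (0 + 0 + 0 * 0 * mv + 1 * 0 * mw)) with (ga 1 1 0) in A2 by (f_equal; ring).
  replace (ga (1 + 0) (1 + 0) (0 + mv + 1 * 0 * mv + 1 * 0 * mw)) with (ga 1 1 mv) in A3 by (f_equal; ring).
  replace (ga (0 + 0) (0 + 0) (n + n + 0 * 0 * mv + 0 * 0 * mw)) with (ga 0 0 (n + n)) in A4 by (f_equal; ring).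
  replace (ga (0 + 0) (0 + 0) (n + n + 1 + 0 * 0 * mv + 0 * 0 * mw)) with (ga 0 0 mv) in A5 by (f_equal; lia).
  rewrite A4 S3 E in A5. rewrite A5 A2 A1 in A3. nra.
Qed.

Section Invariance.
Variable (f : c2fun).
Definition eqv (h1 h2 h : Z) : Prop := forall g, f (gmul (ga h1 h2 h) g) = c2scal (RtoC (eps (ga h1 h2 h))) (f g).

Lemma gmul_assoc g h k : gmul (gmul g h) k = gmul g (gmul h k).
Proof. move: g h k => [[x y] z] [[x' y'] z'] [[x'' y''] z'']. rewrite /gmul. apply: triple_eq; ring. Qed.

Lemma eqv_mul h1 h2 h k1 k2 k : eqv h1 h2 h -> eqv k1 k2 k -> eqv (h1 + k1) (h2 + k2) (h + k + h1 * k2 * mv + h2 * k2 * mw).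
Proof.
  move=> Hh Hk g. rewrite eps_ga -ga_mul gmul_assoc Hh Hk RtoC_mult. c2ring.
Qed.
Lemma eqv_opp h1 h2 h : eqv h1 h2 h -> eqv (- h1) (- h2) (- h + h1 * h2 * mv + h2 * h2 * mw).
Proof.
  move=> Hh g. set k := (- h + _ + _)%Z.
  have E : gmul (ga h1 h2 h) (ga (- h1) (- h2) k) = ga 0 0 0 by rewrite ga_mul; congr ga; rewrite /k; ring.
  have Ee : eps (ga h1 h2 h) * eps (ga (- h1) (- h2) k) = 1.
  { rewrite -(proj2 Heps) ?E ?eps_one //; exact: ga_Gamma. }
  have I0 : gmul (ga 0 0 0) g = g. { case: g => [[x y] z]. rewrite /ga /gmul. apply: triple_eq; ring. }
  have := Hh (gmul (ga (- h1) (- h2) k) g). rewrite -gmul_assoc E I0 => ->.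
  transitivity (c2scal (RtoC (eps (ga h1 h2 h) * eps (ga (- h1) (- h2) k))) (f (gmul (ga (- h1) (- h2) k) g))); last by rewrite RtoC_mult; c2ring.
  rewrite Ee. c2ring.
Qed.

(** The elements satisfying the equivariance form a subgroup. The centre is treated before the
    direction of [w], because powers of [w] pick up a central term with [mw] that must be
    removed. *)
Lemma eqv_Gamma : eqv 1 0 0 -> eqv 0 1 0 -> eqv 0 0 1 -> forall h1 h2 h, eqv h1 h2 h.
Proof.
  move=> G1 G2 G3.
  have E0 : eqv 0 0 0.
  { move=> g. have -> : gmul (ga 0 0 0) g = g by case: g => [[x y] z]; rewrite /ga /gmul; apply: triple_eq; ring. rewrite eps_one. c2ring. }
  have Zs : forall P : Z -> Prop, P 0%Z -> (forall n, P n -> P (n + 1)%Z) -> (forall n, P n -> P (- n)%Z) -> forall n, P n.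
  { move=> P P0 PS PN. have Q : forall n : nat, P (Z.of_nat n). { elim=> [|n IH]; first exact: P0. rewrite Nat2Z.inj_succ. exact: PS. }
    move=> n. case: (Z_le_gt_dec 0 n) => Hn; first by rewrite -(Z2Nat.id n) //; exact: Q.
    have -> : n = (- - n)%Z by ring. apply: PN. rewrite -(Z2Nat.id (- n)); [exact: Q|lia]. }
  have F3 : forall h, eqv 0 0 h.
  { apply: Zs => // n Hn.
    - have := eqv_mul _ _ _ _ _ _ Hn G3. by have -> : (n + 1 + 0 * 0 * mv + 0 * 0 * mw = n + 1)%Z by ring.
    - have := eqv_opp _ _ _ Hn. by have -> : (- n + 0 * 0 * mv + 0 * 0 * mw = - n)%Z by ring. }
  have F1 : forall h, eqv h 0 0.
  { apply: Zs => // n Hn.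
    - have := eqv_mul _ _ _ _ _ _ Hn G1. by have -> : (0 + 0 + n * 0 * mv + 0 * 0 * mw = 0)%Z by ring.
    - have := eqv_opp _ _ _ Hn. by have -> : (- 0 + n * 0 * mv + 0 * 0 * mw = 0)%Z by ring. }
  have F2 : forall h, eqv 0 h 0.
  { apply: Zs => // n Hn.
    - have := eqv_mul _ _ _ _ _ _ (eqv_mul _ _ _ _ _ _ Hn G2) (F3 (- (n * mw))%Z).
      have -> : (0 + 0 + 0 * 1 * mv + n * 1 * mw + - (n * mw) + (0 + 0) * 0 * mv + (n + 1) * 0 * mw = 0)%Z by ring. by rewrite !Z.add_0_r.
    - have := eqv_mul _ _ _ _ _ _ (eqv_opp _ _ _ Hn) (F3 (- (n * n * mw))%Z).
      have -> : (- 0 + 0 * n * mv + n * n * mw + - (n * n * mw) + - 0 * 0 * mv + - n * 0 * mw = 0)%Z by ring. by rewrite !Z.add_0_r. }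
  move=> h1 h2 h. have := eqv_mul _ _ _ _ _ _ (eqv_mul _ _ _ _ _ _ (F1 h1) (F2 h2)) (F3 (h - h1 * h2 * mv)%Z).
  have -> : (0 + 0 + h1 * h2 * mv + 0 * h2 * mw + (h - h1 * h2 * mv) + (h1 + 0) * 0 * mv + (0 + h2) * 0 * mw = h)%Z by ring. by rewrite !Z.add_0_r Z.add_0_l.
Qed.
End Invariance.

(** Turns the condition over the whole lattice into the three generator conditions on each
    component. *)
Lemma spinor_frame sp sm (Hdet : det2 sp sm <> 0%C) F :
  is_spinor r w2 mv mw eps (frame sp sm F) <-> VP a b w2 r (eps (ga 1 0 0)) (eps (ga 0 1 0)) (eps (ga 0 0 1)) F.
Proof.
  have B1 : ga 1 0 0 = (a, 0, 0) by rewrite /ga; apply: triple_eq; ring.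
  have B2 : ga 0 1 0 = (b, w2, 0) by rewrite /ga; apply: triple_eq; ring.
  have B3 : ga 0 0 1 = (0, 0, r) by rewrite /ga; apply: triple_eq; ring.
  split.
  - move=> [Hs He]. case: (proj1 (smooth_frame sp sm Hdet F) Hs) => S1 S2.
    have I : forall h1 h2 h, inv_by (ga h1 h2 h) (RtoC (eps (ga h1 h2 h))) (pc true F) /\ inv_by (ga h1 h2 h) (RtoC (eps (ga h1 h2 h))) (pc false F).
    { move=> h1 h2 h. apply/(inv_frame sp sm Hdet) => g. apply: He. exact: ga_Gamma. }
    case: (I 1 0 0)%Z => I1 I1'. case: (I 0 1 0)%Z => I2 I2'. case: (I 0 0 1)%Z => I3 I3'.
    rewrite {1}B1 in I1. rewrite {1}B1 in I1'. rewrite {1}B2 in I2. rewrite {1}B2 in I2'. rewrite {1}B3 in I3. rewrite {1}B3 in I3'. by split.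
  - move=> [[S1 [I1 [I2 I3]]] [S2 [I1' [I2' I3']]]]. split; first exact/(smooth_frame sp sm Hdet).
    move=> gm g /Gamma_ga [h1 [h2 [h ->]]]. move: h1 h2 h g. apply: (eqv_Gamma (frame sp sm F)).
    + apply/(inv_frame sp sm Hdet). by rewrite {1 3}B1.
    + apply/(inv_frame sp sm Hdet). by rewrite {1 3}B2.
    + apply/(inv_frame sp sm Hdet). by rewrite {1 3}B3.
Qed.
End Lattice.

(** * The Dirac operator in a frame *)

Section DiracFrame.
Variables (A : R) (cl : lie -> C2 -> C2) (sp sm : C2).
Hypotheses (HA : 0 < A) (Hcl : is_clifford A cl) (Hsp : cl E3 sp = c2scal Ci sp) (Hnz : sp <> c2zero) (Hsm : cl (Defs.E1 A) sp = sm).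

Lemma lderive_fields u : Sm u -> forall x y z,
  Cderive (fun t => u (gmul (x, y, z) (gexp (lie_scal t (Defs.E1 A))))) 0 = (RtoC (ss A) * PX u (x, y, z))%C /\
  Cderive (fun t => u (gmul (x, y, z) (gexp (lie_scal t (E2 A))))) 0 = (RtoC (ss A) * VY u (x, y, z))%C /\
  Cderive (fun t => u (gmul (x, y, z) (gexp (lie_scal t E3)))) 0 = PZ u (x, y, z).
Proof.
  move=> Hu x y z. have Q : 1 / sqrt A = ss A by rewrite /ss /Rdiv Rmult_1_l.
  split; [|split]; apply: CD_Cderive.
  - apply: (CD_ext (fun t => u (x + t * ss A, y, z))).
    { move=> t. rewrite /Defs.E1 /lie_scal /gexp /gmul Q. congr u. apply: triple_eq; field. }
    apply: CD_eq. apply: (Sm_path u (fun t => x + t * ss A) (fun _ => y) (fun _ => z) 0 (ss A) 0 0) => //.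
    auto_derive => //; ring. apply: is_derive_const. apply: is_derive_const.
    have -> : (x + 0 * ss A, y, z) = (x, y, z) :> G by apply: triple_eq; ring. ring.
  - apply: (CD_ext (fun t => u (x, y + t * ss A, z + t * (x * ss A)))).
    { move=> t. rewrite /E2 /lie_scal /gexp /gmul Q. congr u. apply: triple_eq; field. }
    apply: CD_eq. apply: (Sm_path u (fun t => x) (fun t => y + t * ss A) (fun t => z + t * (x * ss A)) 0 0 (ss A) (x * ss A)) => //.
    apply: is_derive_const. auto_derive => //; ring. auto_derive => //; ring.
    have -> : (x, y + 0 * ss A, z + 0 * (x * ss A)) = (x, y, z) :> G by apply: triple_eq; ring. rewrite /VY RtoC_mult. change (fst (fst (x, y, z))) with x. ring.
  - apply: (CD_ext (fun t => u (x, y, z + t))).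
    { move=> t. rewrite /E3 /lie_scal /gexp /gmul. congr u. apply: triple_eq; field. }
    apply: CD_eq. apply: (Sm_path u (fun t => x) (fun t => y) (fun t => z + t) 0 0 0 1) => //.
    apply: is_derive_const. apply: is_derive_const. auto_derive => //; ring.
    have -> : (x, y, z + 0) = (x, y, z) :> G by apply: triple_eq; ring. ring.
Qed.

Lemma lderive_frame F : Sm (pc true F) -> Sm (pc false F) ->
  lderive (Defs.E1 A) (frame sp sm F) = frame sp sm (mkp (fun g => RtoC (ss A) * PX (pc true F) g)%C (fun g => RtoC (ss A) * PX (pc false F) g)%C) /\
  lderive (E2 A) (frame sp sm F) = frame sp sm (mkp (fun g => RtoC (ss A) * VY (pc true F) g)%C (fun g => RtoC (ss A) * VY (pc false F) g)%C) /\
  lderive E3 (frame sp sm F) = frame sp sm (mkp (fun g => PZ (pc true F) g)%C (fun g => PZ (pc false F) g)%C).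
Proof.
  move=> S1 S2.
  set u := fun s1 s2 g => (s1 * pc true F g + (s2 * pc false F g))%C.
  have Su : forall s1 s2, Sm (u s1 s2) by move=> s1 s2; apply: Sm_plus; exact: Sm_scal.
  have S2' : forall s2, Sm (fun g => s2 * pc false F g)%C by move=> s2; exact: Sm_scal. have S0 := Sm_const 0%C.
  have Z0 : Cpartials (fun _ => 0%C) (fun _ => 0%C) (fun _ => 0%C) (fun _ => 0%C) by move=> x y z; split; [|split]; exact: CD_const.
  case: (Cpartials_P _ _ _ _ Z0) => [Z1 [Z2 Z3]].
  have Vz : VY (fun _ => 0%C) = (fun _ => 0%C) by rewrite /VY Z2 Z3; funring.
  have Fu : forall s1 s2 g, PX (u s1 s2) g = (s1 * PX (pc true F) g + s2 * PX (pc false F) g)%C /\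
     VY (u s1 s2) g = (s1 * VY (pc true F) g + s2 * VY (pc false F) g)%C /\ PZ (u s1 s2) g = (s1 * PZ (pc true F) g + s2 * PZ (pc false F) g)%C.
  { move=> s1 s2 g. have L1 := PX_lin s1 _ _ S1 (S2' s2). have L2 := VY_lin s1 _ _ S1 (S2' s2).
    have M1 := PX_lin s2 _ _ S2 S0. have M2 := VY_lin s2 _ _ S2 S0. rewrite fun_scal0 in M1. rewrite fun_scal0 in M2.
    rewrite /u (proj1 L1) L2 (proj2 (proj2 L1)) (proj1 M1) M2 (proj2 (proj2 M1)) Z1 Z3 Vz. split; [|split]; ring. }
  have Ef : forall h, fst (frame sp sm F h) = u (fst sp) (fst sm) h /\ snd (frame sp sm F h) = u (snd sp) (snd sm) h.
  { move=> h. rewrite /frame /u /pc /c2add /c2scal /=. split; ring. }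
  have L : forall (W : lie) (g : G), lderive W (frame sp sm F) g = (Cderive (fun t => u (fst sp) (fst sm) (gmul g (gexp (lie_scal t W)))) 0, Cderive (fun t => u (snd sp) (snd sm) (gmul g (gexp (lie_scal t W)))) 0).
  { move=> W g. rewrite /lderive. congr pair; congr Cderive; apply: functional_extensionality => t; [exact: (proj1 (Ef _))|exact: (proj2 (Ef _))]. }
  split; [|split]; apply: functional_extensionality => [[[x y] z]]; rewrite L;
   case: (lderive_fields _ (Su (fst sp) (fst sm)) x y z) => [P1 [P2 P3]]; case: (lderive_fields _ (Su (snd sp) (snd sm)) x y z) => [Q1 [Q2 Q3]];
   case: (Fu (fst sp) (fst sm) (x, y, z)) => [U1 [U2 U3]]; case: (Fu (snd sp) (snd sm) (x, y, z)) => [V1 [V2 V3]].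
  - rewrite P1 Q1 U1 V1 /frame /mkp. apply: c2_ext; rewrite /c2add /c2scal /=; ring.
  - rewrite P2 Q2 U2 V2 /frame /mkp. apply: c2_ext; rewrite /c2add /c2scal /=; ring.
  - rewrite P3 Q3 U3 V3 /frame /mkp. apply: c2_ext; rewrite /c2add /c2scal /=; ring.
Qed.

Lemma dirac_frame F : Sm (pc true F) -> Sm (pc false F) -> dirac A cl (frame sp sm F) = frame sp sm (DD (ss A) (q4 A) F).
Proof.
  move=> S1 S2. case: (lderive_frame F S1 S2) => [E1 [E2 E3]].
  have := J_frame A cl HA Hcl sp Hsp Hnz. rewrite Hsm. cbv zeta. move=> [_ [K1 [K2 [K2' K3']]]].
  apply: functional_extensionality => g. rewrite /dirac E1 E2 E3 /frame !(cl_add_s A cl Hcl) !(cl_scal_s A cl Hcl) Hsm K1 K2 K2' Hsp K3'.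
  change (mkp ?p ?q (true, g)) with (p g). change (mkp ?p ?q (false, g)) with (q g).
  change (DD (ss A) (q4 A) F (true, g)) with (Ci * PZ (pc true F) g + RtoC (ss A) * - (PX (pc false F) g + Ci * VY (pc false F) g) - RtoC (q4 A) * pc true F g)%C.
  change (DD (ss A) (q4 A) F (false, g)) with (RtoC (ss A) * (PX (pc true F) g - Ci * VY (pc true F) g) - Ci * PZ (pc false F) g - RtoC (q4 A) * pc false F g)%C.
  change (F (true, g)) with (pc true F g). change (F (false, g)) with (pc false F g).
  have M1 : RtoC (-1) = (- (1))%C by Cring.
  have M4 : RtoC (- (1 / (4 * A))) = (- RtoC (q4 A))%C by rewrite RtoC_opp.
  apply: c2_ext; rewrite /c2add /c2scal /fst /snd -/(fst _) -/(snd _) M1 M4.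
  - move: (PX _ g) (PX _ g). intros. case: sp sm => [s1 s2] [t1 t2] /=; ring.
  - case: sp sm => [s1 s2] [t1 t2] /=; ring.
Qed.
End DiracFrame.

Lemma l2norm_I3 A r w2 mv f : l2norm A r w2 mv f = sqrt (A * I3 (aa r w2 mv) w2 r (c2norm2 f)).
Proof. by []. Qed.

Lemma frame_n2 sp sm (Hdet : det2 sp sm <> 0%C) a b w2 r e1 e2 e3 : 0 < a -> 0 < w2 -> 0 < r ->
  exists K, 0 < K /\ forall F, VP a b w2 r e1 e2 e3 F ->
    0 <= I3 a w2 r (c2norm2 (frame sp sm F)) /\
    I3 a w2 r (c2norm2 (frame sp sm F)) <= K * n2 (ipP a w2 r) F /\ n2 (ipP a w2 r) F <= K * I3 a w2 r (c2norm2 (frame sp sm F)).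
Proof.
  move=> Ha Hw Hr. case: (frame_norms sp sm Hdet) => K [HK Hn]. exists K. split => // F [V1 V2].
  have C1 := Sp_cont _ _ _ _ _ _ _ _ V1. have C2' := Sp_cont _ _ _ _ _ _ _ _ V2.
  have D1 := contG_Cmod2 _ C1. have D2 := contG_Cmod2 _ C2'.
  have E : n2 (ipP a w2 r) F = I3 a w2 r (fun g => Cmod (pc true F g) ^ 2 + Cmod (pc false F g) ^ 2).
  { rewrite (I3_plus a w2 r Hw Hr _ _ D1 D2) /n2 /ipP (ip_self a w2 r _ C1) (ip_self a w2 r _ C2') Re_Cplus. reflexivity. }
  have Dp : contG (fun g => Cmod (pc true F g) ^ 2 + Cmod (pc false F g) ^ 2) by move=> g; apply: continuous_Rplus; [exact: D1|exact: D2].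
  have Dc : contG (c2norm2 (frame sp sm F)).
  { case: (V1) => S1 _. case: (V2) => S2 _. case: (proj1 (smooth_Sm _) (proj2 (smooth_frame sp sm Hdet F) (conj S1 S2))) => U1 U2.
    move=> g. apply: continuous_Rplus; [exact: (contG_Cmod2 _ (Sm_cont _ U1))|exact: (contG_Cmod2 _ (Sm_cont _ U2))]. }
  have Dk : forall h, contG h -> contG (fun g => K * h g) by move=> h Hh g; apply: continuous_Rmult; [apply: continuous_const|exact: Hh].
  split; [|split].
  - apply: I3_ge0 => // g. rewrite /c2norm2. have := pow2_ge_0 (Cmod (fst (frame sp sm F g))). have := pow2_ge_0 (Cmod (snd (frame sp sm F g))). lra.
  - rewrite E -(I3_scal a w2 r Hw Hr) //. apply: I3_le => //; [exact: Dk|]. move=> g _. exact: (proj1 (Hn F g)).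
  - rewrite E -(I3_scal a w2 r Hw Hr) //. apply: I3_le => //; [exact: Dk|]. move=> g _. exact: (proj2 (Hn F g)).
Qed.

Theorem mainTheorem9 :
  forall (A r w2 : R) (mv mw : Z) (eps : G -> R) (eps1 eps2 eps3 : R)
         (cl : lie -> C2 -> C2),
    0 < A -> 0 < r -> 0 < w2 -> (0 < mv)%Z ->
    is_character r w2 mv mw eps ->
    eps (fst (vec_v r w2 mv), snd (vec_v r w2 mv), 0) = eps1 ->
    eps (fst (vec_w r w2 mw), snd (vec_w r w2 mw), 0) = eps2 ->
    eps (0, 0, r) = eps3 ->
    is_clifford A cl ->
    forall lambda : C,
      (spectrum A r w2 mv mw eps cl lambda <->
       exists i : label, is_label mv eps3 i /\
         lambda = RtoC (label_value A r w2 mv mw eps1 eps2 eps3 i)) /\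
      (exists n : nat,
         has_card (fun i : label => is_label mv eps3 i /\
           lambda = RtoC (label_value A r w2 mv mw eps1 eps2 eps3 i)) n /\
         has_dim (eigenspace A r w2 mv mw eps cl lambda) n).
Proof.
  move=> A r w2 mv mw eps eps1 eps2 eps3 cl HA Hr Hw Hmv Heps Hv1 Hv2 Hv3 Hcl lambda.
  have G1 : eps (ga r w2 mv mw 1 0 0) = eps1 by rewrite -Hv1 /ga /aa /bb /vec_v /=; congr eps; apply: triple_eq; ring.
  have G2 : eps (ga r w2 mv mw 0 1 0) = eps2 by rewrite -Hv2 /ga /aa /bb /vec_w /=; congr eps; apply: triple_eq; ring.
  have G3 : eps (ga r w2 mv mw 0 0 1) = eps3 by rewrite -Hv3 /ga /=; congr eps; apply: triple_eq; ring.
  have H1 : eps1 = 1 \/ eps1 = -1 by rewrite -G1; apply: (proj1 Heps); exact: ga_Gamma.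
  have H2 : eps2 = 1 \/ eps2 = -1 by rewrite -G2; apply: (proj1 Heps); exact: ga_Gamma.
  have H3 : eps3 = 1 \/ eps3 = -1 by rewrite -G3; apply: (proj1 Heps); exact: ga_Gamma.
  have Heven : eps3 = -1 -> exists n, mv = (2 * n)%Z by rewrite -G3; exact: (eps_mv r w2 mv mw eps Hw Heps).
  (* Everything is transported to pairs of scalar functions through the frame [sp], [sm], in which
     the operator is [DD]. *)
  case: (clifford_frame A cl HA Hcl) => sp [Hsp Hnz]. set sm := cl (Defs.E1 A) sp. have Hsm : cl (Defs.E1 A) sp = sm by [].
  have Hdet : det2 sp sm <> 0%C := proj1 (J_frame A cl HA Hcl sp Hsp Hnz).
  clearbody sm. pose T := frame sp sm.
  have Ha := aa_pos r w2 mv Hr Hw Hmv.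
  pose V := VP (aa r w2 mv) (bb r w2 mw) w2 r eps1 eps2 eps3. pose ipV := ipP (aa r w2 mv) w2 r.
  have PH : prehilbert V ipV := VP_prehilbert _ (bb r w2 mw) w2 r eps1 eps2 eps3 Ha Hw Hr (sq_one _ H1) (sq_one _ H2) (sq_one _ H3).
  have Spin : forall F, is_spinor r w2 mv mw eps (T F) <-> V F.
  { move=> F. rewrite /V -G1 -G2 -G3. exact: (spinor_frame r w2 mv mw eps Hw Heps sp sm Hdet F). }
  pose D := DD (ss A) (q4 A). pose valid := is_label mv eps3. pose val := label_value A r w2 mv mw eps1 eps2 eps3.
  pose ph := phi A r w2 eps1 eps2 eps3 mv mw.
  have VD : forall F, V F -> V (D F) by move=> F; exact: VP_DD.
  have DL : forall c F H, V F -> V H -> D (fun x => c * F x + H x)%C = (fun x => c * D F x + D H x)%C by move=> c F H; exact: DD_lin.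
  have Sym : forall F H, V F -> V H -> ipV (D F) H = ipV F (D H) := D_symmetric A r w2 eps1 eps2 eps3 mv mw Hr Hw Hmv H1 H2 H3.
  have Vphi : forall i, valid i -> V (ph i) := VP_phi A r w2 eps1 eps2 eps3 mv mw Hr Hw Hmv H1 H2 H3 Heven.
  have Dphi : forall i, valid i -> D (ph i) = (fun x => RtoC (val i) * ph i x)%C := D_phi A r w2 eps1 eps2 eps3 mv mw HA Hr Hw Hmv H1 H2 H3 Heven.
  have Nphi : forall i, valid i -> ph i <> (fun _ => 0%C) := phi_nonzero A r w2 eps1 eps2 eps3 mv mw HA Hr Hw Hmv H1 H2 H3 Heven.
  have Ophi : forall i j, valid i -> valid j -> i <> j -> ipV (ph i) (ph j) = 0%C := phi_orth A r w2 eps1 eps2 eps3 mv mw HA Hr Hw Hmv H1 H2 H3 Heven.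
  have Fin : forall B, exists l, forall i, valid i -> Rabs (val i) <= B -> In i l := val_finite A r w2 eps1 eps2 eps3 mv mw HA Hr Hw Hmv H1 H2 H3.
  have Dense : forall F e, V F -> 0 < e -> exists w, span (fun b => exists i, valid i /\ b = ph i) w /\ n2 ipV (fun x => F x - w x)%C < e :=
    phi_dense A r w2 eps1 eps2 eps3 mv mw HA Hr Hw Hmv H1 H2 H3 Heven.
  have TD : forall F, V F -> dirac A cl (T F) = T (D F).
  { move=> F [[S1 _] [S2 _]]. exact: (dirac_frame A cl sp sm HA Hcl Hsp Hnz Hsm F S1 S2). }
  have TDm : forall F, V F -> dirac_minus A cl lambda (T F) = T (Dm D lambda F).
  { move=> F HF. apply: functional_extensionality => g. rewrite /dirac_minus TD // /T /frame /Dm /c2sub.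
    have M1 : RtoC (-1) = (- (1))%C by Cring. rewrite M1. c2ring. }
  have TS : forall F H, (fun g => c2sub (T F g) (T H g)) = T (fun x => F x - H x)%C.
  { move=> F H. apply: functional_extensionality => g. rewrite /T /frame /c2sub.
    have M1 : RtoC (-1) = (- (1))%C by Cring. rewrite M1. c2ring. }
  case: (frame_n2 sp sm Hdet _ (bb r w2 mw) w2 r eps1 eps2 eps3 Ha Hw Hr) => K [HK HN].
  have VDm : forall F, V F -> V (Dm D lambda F) by move=> F HF; exact: (V_Dm V ipV PH D VD lambda F HF).
  have Surj : forall f, is_spinor r w2 mv mw eps f -> exists F, V F /\ f = T F.
  { move=> f Hf. exists (coord sp sm f). rewrite /T frame_coord //. split => //. apply/Spin. by rewrite /T frame_coord. }
  split; first split.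
  (* If no label has the value [lambda], the gap in the spectrum puts [lambda] into the resolvent
     set. *)
  - move=> Hs. apply: NNPP => Hno. apply: Hs.
    have Hn : forall i, valid i -> lambda <> RtoC (val i) by move=> i Hi E; apply: Hno; exists i.
    split.
    + case: (resolvent_bound V ipV PH D label valid ph val VD Sym Vphi Dphi Nphi Ophi Fin Dense lambda Hn) => c [Hc Hb].
      (* One factor [K] for each of the two passages between the norm of spinors and that of pairs;
         the root because the abstract bound is for squared norms. *)
      exists (sqrt (c / K ^ 2)). split; first by apply: sqrt_lt_R0; apply: Rdiv_lt_0_compat => //; exact: pow_lt.
      move=> f /Surj [F [HF ->]]. rewrite TDm // !l2norm_I3 -sqrt_mult_alt; last by apply: Rdiv_le_0_compat; [lra|exact: pow_lt].
      apply: sqrt_le_1_alt. case: (HN F HF) => [P0 [P1 P2]]. case: (HN _ (VDm F HF)) => [Q0 [Q1 Q2]]. have B := Hb F HF.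
      have L : c * I3 (aa r w2 mv) w2 r (c2norm2 (T F)) <= K ^ 2 * I3 (aa r w2 mv) w2 r (c2norm2 (T (Dm D lambda F))).
      { rewrite -/T -/ipV in P1 Q2. have := Rmult_le_compat_l c _ _ (Rlt_le _ _ Hc) P1. have := Rmult_le_compat_l K _ _ (Rlt_le _ _ HK) Q2.
        have := Rmult_le_compat_l K _ _ (Rlt_le _ _ HK) B. lra. }
      have K2 : 0 < K ^ 2 by exact: pow_lt. apply: (Rmult_le_reg_l (K ^ 2)) => //.
      have -> : K ^ 2 * (c / K ^ 2 * (A * I3 (aa r w2 mv) w2 r (c2norm2 (T F)))) = A * (c * I3 (aa r w2 mv) w2 r (c2norm2 (T F))) by field; lra.
      have := Rmult_le_compat_l A _ _ (Rlt_le _ _ HA) L. lra.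
    + move=> h /Surj [H [HH ->]] e He.
      (* The tolerance for pairs that leaves an [l2norm] below [e] after the constant [K], the
         volume factor [A] and the square root. *)
      have He' : 0 < e ^ 2 / (A * K) by apply: Rdiv_lt_0_compat; [exact: pow_lt|exact: Rmult_lt_0_compat].
      case: (resolvent_range V ipV PH D label valid ph val DL Vphi Dphi Nphi Ophi Dense lambda Hn H _ HH He') => F [HF Hlt].
      exists (T F). split; first exact/Spin. rewrite TDm // TS l2norm_I3.
      have VS := V_sub V ipV PH _ _ (VDm F HF) HH. case: (HN _ VS) => [P0 [P1 _]]. rewrite -/T -/ipV in P0 P1.
      rewrite -(sqrt_pow2 e); last lra. apply: sqrt_lt_1_alt. split; first by apply: Rmult_le_pos => //; lra.
      have := Rmult_le_compat_l A _ _ (Rlt_le _ _ HA) P1. have := Rmult_lt_compat_l (A * K) _ _ (Rmult_lt_0_compat _ _ HA HK) Hlt.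
      have -> : A * K * (e ^ 2 / (A * K)) = e ^ 2 by field; split; lra. lra.
  (* Conversely an eigenspinor violates the lower bound: its image under the shifted operator is
     zero while its norm is positive. *)
  - move=> [i [Hi El]] [[c [Hc Hb]] _]. have := Hb (T (ph i)) (proj2 (Spin _) (Vphi i Hi)). rewrite TDm; last exact: Vphi.
    have -> : Dm D lambda (ph i) = (fun _ => 0%C). { rewrite /Dm (Dphi i Hi) El. apply: functional_extensionality => x. rewrite -/val. ring. }
    rewrite !l2norm_I3. case: (HN _ (ph_zero _ _ PH)) => [Z0 [Z1 _]]. case: (HN _ (Vphi i Hi)) => [P0 [P1 P2]]. rewrite -/T -/ipV in Z0 Z1 P0 P1 P2.
    have N0 := nphi_pos V ipV PH label valid ph Vphi Nphi i Hi.
    have NZ : n2 ipV (fun _ => 0%C) = 0 by exact: (n2_zero V ipV PH). rewrite NZ in Z1.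
    have -> : I3 (aa r w2 mv) w2 r (c2norm2 (T (fun _ => 0%C))) = 0 by lra. rewrite Rmult_0_r sqrt_0.
    have PP : 0 < A * I3 (aa r w2 mv) w2 r (c2norm2 (T (ph i))). { apply: Rmult_lt_0_compat => //. nra. }
    have := sqrt_lt_R0 _ PP. nra.
  (* The finite list of labels with value [lambda] gives the cardinality and indexes a basis of the
     eigenspace. *)
  - case: (value_list label valid val Fin lambda) => l [Nd Hl]. exists (length l). split; first by exists l.
    have Hval : forall i, In i l -> valid i by move=> i /Hl [].
    (* Default entry for [nth]; it is never reached below the length of the list. *)
    pose d := Torus 0 0 true. pose bs := fun k => T (ph (nth k l d)).
    have LC : forall c n, lincomb n c bs = T (fun x => csum (fun k => c k * ph (nth k l d) x) n)%C.
    { move=> c. elim=> [|n IH]; apply: functional_extensionality => g /=; first by rewrite /T /frame; c2ring.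
      rewrite IH /bs /T /frame. c2ring. }
    have LS : forall l' c, lsum label ph c l' = (fun x => csum (fun k => c (nth k l' d) * ph (nth k l' d) x) (length l'))%C.
    { move=> l' c. elim: l' => [|i l' IH] //=. apply: functional_extensionality => x. rewrite IH.
      have Q : forall (h : nat -> C) n, csum h (S n) = (h 0%nat + csum (fun k => h (S k)) n)%C.
      { move=> h. elim=> [|n IHn] /=; first ring. rewrite -/(csum h (S n)) in IHn *. change (csum h (S n) + h (S n) = h 0%nat + (csum (fun k => h (S k)) n + h (S n)))%C. rewrite IHn. ring. }
      have -> : (csum (fun k => c (match k with O => i | S m => nth m l' d end) * ph (match k with O => i | S m => nth m l' d end) x) (length l') + c (match length l' with O => i | S m => nth m l' d end) * ph (match length l' with O => i | S m => nth m l' d end) x)%C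
        = csum (fun k => c (nth k (i :: l') d) * ph (nth k (i :: l') d) x)%C (S (length l')) by [].
      by rewrite Q. }
    exists bs. split; [|split].
    + move=> k Hk. have Hi := proj1 (Hl _) (nth_In l d Hk). split; first by apply/Spin; exact: Vphi (proj1 Hi).
      move=> g. rewrite /bs TD; last exact: Vphi (proj1 Hi). rewrite (Dphi _ (proj1 Hi)) -(proj2 Hi) /T /frame. c2ring.
    (* [idx] is the position of a label in the duplicate-free list; it converts coefficients indexed
       by position into coefficients indexed by label. *)
    + move=> c Hc k Hk. pose idx := fun i => match excluded_middle_informative (exists k, (k < length l)%nat /\ nth k l d = i) with left H => epsilon (inhabits 0%nat) (fun k => (k < length l)%nat /\ nth k l d = i) | right _ => 0%nat end.
      have Hidx : forall k, (k < length l)%nat -> idx (nth k l d) = k.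
      { move=> m Hm. rewrite /idx. case: excluded_middle_informative => [H|H]; last by exfalso; apply: H; exists m.
        have := epsilon_spec (inhabits 0%nat) (fun k => (k < length l)%nat /\ nth k l d = nth m l d) H. move=> [P Q]. exact: (proj1 (NoDup_nth l d) Nd _ _ P Hm Q). }
      have E0 : lsum label ph (fun i => c (idx i)) l = (fun _ => 0%C).
      { rewrite LS. have -> : (fun x => csum (fun k => c (idx (nth k l d)) * ph (nth k l d) x) (length l))%C = coord sp sm (lincomb (length l) c bs).
        { rewrite LC /T coord_frame //. apply: functional_extensionality => x. apply: csum_ext => m Hm. by rewrite Hidx. }
        have -> : lincomb (length l) c bs = T (fun _ => 0%C) by apply: functional_extensionality => g; rewrite Hc /T /frame; c2ring.
        exact: coord_frame. }
      have := lsum_independent V ipV PH label valid ph Vphi Nphi Ophi _ l Nd Hval E0 (nth k l d) (nth_In l d Hk). by rewrite Hidx.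
    + move=> f [/Surj [F [HF ->]] Ef].
      have EF : D F = (fun x => lambda * F x)%C.
      { rewrite -(coord_frame sp sm Hdet (D F)) -(coord_frame sp sm Hdet (fun x => lambda * F x)%C). congr coord. rewrite -/T -TD //. apply: functional_extensionality => g. rewrite Ef /T /frame. c2ring. }
      have E := eigenvector_expansion V ipV PH D label valid ph val Sym Vphi Dphi Nphi Ophi Dense lambda F l Hl Nd HF EF.
      exists (fun k => coef ipV label ph F (nth k l d)) => g. rewrite LC {1}E LS. by [].
Qed.
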